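(* Let $A\subset\mathbb R^n$ coincide with its reduced kernel. If $\alpha=2$, assume moreover that $c_\alpha(A^i)=0$ and that $D:=\mathbb R^n\setminus\overline A$ is a (connected open) domain. Then for every $y\notin A^r$, $$S(\varepsilon_y^A)=\begin{cases}\overline A&\text{if }\alpha<2,\\ \partial D&\text{if }\alpha=2.\end{cases}$$
   Context: Standing assumptions: $n\ge3$, $\alpha\in(0,2]$, and $\kappa_\alpha(x,y)=|x-y|^{\alpha-n}$ is the Riesz kernel on $\mathbb R^n$. $\mathfrak M^+$ denotes the cone of positive Radon measures $\mu$ on $\mathbb R^n$ whose potential $\kappa_\alpha\mu(x)=\int|x-z|^{\alpha-n}d\mu(z)$ is not identically $+\infty$. The energy of $\mu$ is $\|\mu\|_\alpha^2=\iint\kappa_\alpha\,d\mu\,d\mu$; $\mathcal E^+_\alpha(A)$ is the set of positive measures of finite energy concentrated on $A$. The inner capacity of $A\subset\mathbb R^n$ is defined by $1/c_\alpha(A)=\inf\{\|\mu\|_\alpha^2:\ \mu\in\mathcal E^+_\alpha(A),\ \mu(\mathbb R^n)=1\}$. ''n.e. on $A$'' means: for all points of $A$ except a subset of inner capacity zero. The reduced kernel of $A$ is the set of $x\in A$ such that $c_\alpha(A\cap B(x,r))>0$ for every $r>0$. Inner balayage: for $\mu\in\mathfrak M^+$ and arbitrary $A$, $\mu^A$ is the unique measure in $\mathfrak M^+$ with $\kappa_\alpha\mu^A=\inf\{\kappa_\alpha\nu:\ \nu\in\mathfrak M^+,\ \kappa_\alpha\nu\ge\kappa_\alpha\mu \text{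 n.e. on }A\}$ pointwise. $\varepsilon_y$ is the Dirac measure at $y$, $\varepsilon_y^A:=(\varepsilon_y)^A$, $A^r:=\{y:\ \varepsilon_y^A=\varepsilon_y\}$, $A^i:=\overline A\setminus A^r$. $S(\mu)$ denotes the (closed) support of a measure $\mu$. *)

(* Defs.v *)
From HB Require Import structures.
From mathcomp Require Import all_boot all_order all_algebra.
From mathcomp Require Import all_classical all_reals all_analysis.
Set Implicit Arguments. Unset Strict Implicit. Unset Printing Implicit Defensive.
Import Order.TTheory GRing.Theory Num.Theory.
Import numFieldNormedType.Exports.
Local Open Scope classical_set_scope.
Local Open Scope ring_scope.

Definition Rn (R : realType) (n : nat) := 'rV[R]_n.

Definition RnB (R : realType) (n : nat) := g_sigma_algebraType (@open (Rn R n)).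

Definition edist (R : realType) (n : nat) (x z : 'rV[R]_n) : R :=
  Num.sqrt (\sum_(i < n) (x ord0 i - z ord0 i) ^+ 2).

Definition riesz (R : realType) (n : nat) (alpha : R) (x z : 'rV[R]_n) : \bar R :=
  if x == z then +oo%E else ((edist x z) `^ (alpha - n%:R))%:E.

Definition msr (R : realType) (n : nat) := {measure set (RnB R n) -> \bar R}.

Definition radon (R : realType) (n : nat) (mu : msr R n) : Prop :=
  forall K : set (Rn R n), compact K -> (mu K < +oo)%E.

Definition potential (R : realType) (n : nat) (alpha : R) (mu : msr R n)
  (x : Rn R n) : \bar R :=
  (\int[mu]_(z in setT) riesz alpha x z)%E.

Definition Mplus (R : realType) (n : nat) (alpha : R) (mu : msr R n) : Prop :=
  radon mu /\ exists x, (potential alpha mu x < +oo)%E.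

Definition energy (R : realType) (n : nat) (alpha : R) (mu : msr R n) : \bar R :=
  (\int[mu]_(x in setT) \int[mu]_(z in setT) riesz alpha x z)%E.

Definition concentrated (R : realType) (n : nat) (mu : msr R n)
  (A : set (Rn R n)) : Prop :=
  mu.-negligible (~` (A : set (RnB R n))).

Definition Eplus (R : realType) (n : nat) (alpha : R) (A : set (Rn R n))
  (mu : msr R n) : Prop :=
  radon mu /\ (energy alpha mu < +oo)%E /\ concentrated mu A.

Definition inv_cap (R : realType) (n : nat) (alpha : R) (A : set (Rn R n)) : \bar R :=
  ereal_inf [set energy alpha mu | mu in
              [set mu : msr R n | Eplus alpha A mu /\ mu setT = 1%E]].

Definition cap_zero (R : realType) (n : nat) (alpha : R) (A : set (Rn R n)) : Prop :=
  inv_cap alpha A = +oo%E.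

Definition ne_on (R : realType) (n : nat) (alpha : R) (A : set (Rn R n))
  (P : Rn R n -> Prop) : Prop :=
  exists E : set (Rn R n), E `<=` A /\ cap_zero alpha E /\
    forall x, A x -> ~ E x -> P x.

Definition eball (R : realType) (n : nat) (x : Rn R n) (r : R) : set (Rn R n) :=
  [set z | edist x z < r].

Definition reduced_kernel (R : realType) (n : nat) (alpha : R) (A : set (Rn R n))
  : set (Rn R n) :=
  [set x | A x /\ forall r : R, 0 < r -> ~ cap_zero alpha (A `&` eball x r)].

Definition is_balayage (R : realType) (n : nat) (alpha : R) (mu : msr R n)
  (A : set (Rn R n)) (nu : msr R n) : Prop :=
  Mplus alpha nu /\
  forall x, potential alpha nu x =
    ereal_inf [set potential alpha nu' x | nu' in
      [set nu' : msr R n | Mplus alpha nu' /\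
         ne_on alpha A (fun z => (potential alpha mu z <= potential alpha nu' z)%E)]].

Definition dirac_at (R : realType) (n : nat) (y : Rn R n) : msr R n :=
  @dirac _ (RnB R n) (y : RnB R n) R.

Definition regular_pts (R : realType) (n : nat) (alpha : R) (A : set (Rn R n))
  : set (Rn R n) :=
  [set y | is_balayage alpha (dirac_at y) A (dirac_at y)].

Definition irregular_pts (R : realType) (n : nat) (alpha : R) (A : set (Rn R n))
  : set (Rn R n) :=
  closure A `\` regular_pts alpha A.

Definition msupport (R : realType) (n : nat) (mu : msr R n) : set (Rn R n) :=
  [set x | forall U : set (Rn R n), open U -> U x -> (0 < mu U)%E].

Definition boundary (R : realType) (n : nat) (D : set (Rn R n)) : set (Rn R n) :=
  closure D `&` closure (~` D).

(* Main.v *)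
Require Import Defs.
From HB Require Import structures.
From mathcomp Require Import all_boot all_order all_algebra.
From mathcomp Require Import all_classical all_reals all_analysis.
From mathcomp Require Import measurable_realfun ring lra.
(* Imported again because mathcomp-analysis has another [edist]. *)
Require Import Defs.
Set Implicit Arguments. Unset Strict Implicit. Unset Printing Implicit Defensive.
Import Order.TTheory GRing.Theory Num.Theory.
Import numFieldNormedType.Exports.
Local Open Scope classical_set_scope.
Local Open Scope ring_scope.

(** A Gaussian mixture over times represents the Riesz kernel.  Cutting the time
    integral at [s] splits the kernel into a short part, exponentially small in [1/s]
    away from the diagonal, and a bounded long part; a sub-Markovian kernel [kmid s]
    turns the whole kernel into the long part, and so plays the role of the spherical
    means.  A lower semicontinuous function that dominates its [kmid] means and is
    dominated by a potential is a potential (weak compactness applied to the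
    normalized differences).  Hence the measures whose potential dominates that of
    the unit mass at [y] n.e. on [A] are stable under minima of potentials, and the
    balayage [nu] is reached along a sequence [nu_k] in this class with decreasing
    potentials.

    Smearing out the part of [nu_k] far from [A] changes its potential on [A] by an
    exponentially small factor only, so [nu] does not charge the complement of the
    closure of [A].  If [nu] vanishes near a point of the closure of [A], integrating
    the potentials of [nu_k] against a measure of bounded potential carried by a small
    piece of [A] shows that the potentials of [nu] and of the unit mass at [y] agree at
    some points of [A] nearby; there, the [kmid s] means of their difference, the
    defect, are exponentially small in [1/s].

    For [alpha < 2] the kernel [kmid s] is at least [s ^ (alpha / 2)] times a positive
    kernel, so the defect vanishes almost everywhere and [y] would be regular.  For
    [alpha = 2] the kernel is Gaussian and the vanishing of the defect only spreads
    inside regions not charged by [nu], hence over the connected set [D]; the defect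
    also vanishes at the regular points of [A], and the irregular ones are Lebesgue
    null, so again [y] would be regular.  In the interior of the closure of [A] the
    same two facts make the defect vanish almost everywhere, which excludes any charge
    of [nu] there. *)

(** * Densities, product integrals and Euclidean balls *)

(** The weight [t ^ (alpha / 2 - 1)] is, up to a constant, the potential density of the
    [alpha / 2]-stable subordinator, and the times behind [kmid s] follow the law of this
    subordinator at its first passage over [s], a point mass when [alpha = 2]. By the Gaussian
    semigroup, identities between kernels reduce to identities between measures on the time axis,
    and all [alpha] are treated together until the last steps. Long kernels are bounded, so long
    potentials of measures in the cone are finite everywhere and can be subtracted, which Riesz
    potentials cannot. The obstacle is that the balayage is known only as a pointwise infimum, a
    priori neither attained nor lower semicontinuous; information passes from the [nu_k] to [nu]
    through long potentials, which do converge at every point. Local masses are read off from two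
    exponentials: a measure vanishing within distance [q] has a short potential of order
    [exp (- q^2 / (2 s))], whereas mass within distance [q / 4] would contribute at least order
    [exp (- q^2 / (8 s))]. *)

Section density.
Import HBNNSimple.
Local Open Scope ereal_scope.
Context d (T : measurableType d) (R : realType).
Variables (mu : {measure set T -> \bar R}) (f : T -> R).

Definition dens (mf : measurable_fun setT f) (f0 : forall x, (0 <= f x)%R)
  (A : set T) : \bar R := \int[mu]_(x in A) (f x)%:E.

Hypotheses (mf : measurable_fun setT f) (f0 : forall x, (0 <= f x)%R).

Let dens0 : dens mf f0 set0 = 0.
Proof. exact: integral_set0. Qed.

Let dens_ge0 A : 0 <= dens mf f0 A.
Proof. by apply: integral_ge0 => x _; rewrite lee_fin. Qed.

Let dens_sigma : semi_sigma_additive (dens mf f0).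
Proof.
move=> F mF tF mUF; rewrite /dens ge0_integral_bigcup//; last 2 first.
- by apply/measurable_EFinP; exact: measurable_funTS.
- by move=> x _; rewrite lee_fin.
by apply: is_cvg_ereal_nneg_natsum => n _; apply: integral_ge0 => x _; rewrite lee_fin.
Qed.

HB.instance Definition _ := isMeasure.Build _ _ _ (dens mf f0)
  dens0 dens_ge0 dens_sigma.

Definition densm : {measure set T -> \bar R} := dens mf f0.

Lemma densE A : densm A = \int[mu]_(x in A) (f x)%:E. Proof. by []. Qed.

Let integral_dens_indic (A : set T) : measurable A ->
  \int[densm]_x (\1_A x)%:E = \int[mu]_x ((f x)%:E * (\1_A x)%:E).
Proof.
move=> mA; rewrite integral_indic// setIT densE integral_mkcond.
by apply: eq_integral => x _; rewrite epatch_indic.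
Qed.

Let integral_dens_nnsfun (h : {nnsfun T >-> R}) :
  \int[densm]_x (h x)%:E = \int[mu]_x ((f x)%:E * (h x)%:E).
Proof.
under eq_integral do rewrite fimfunE -fsumEFin//.
have mi r : measurable_fun [set: T] (fun x => (\1_(h @^-1` [set r]) x)%:E : \bar R).
  exact/measurable_EFinP/measurable_indic.
rewrite ge0_integral_fsum//; last 2 first.
- by move=> r; under eq_fun do rewrite EFinM; exact: measurable_funeM.
- by move=> r x _; rewrite EFinM nnfun_muleindic_ge0.
under [RHS]eq_integral => x _.
  rewrite fimfunE -fsumEFin// ge0_mule_fsumr//; last first.
    by move=> r; rewrite EFinM nnfun_muleindic_ge0.
  over.
have mF : measurable_fun [set: T] (EFin \o f) by exact/measurable_EFinP.
rewrite ge0_integral_fsum//; last 2 first.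
- move=> r; apply: emeasurable_funM => //.
  by under eq_fun do rewrite EFinM; exact: measurable_funeM.
- by move=> r x _; apply: mule_ge0; [rewrite lee_fin|rewrite EFinM nnfun_muleindic_ge0].
apply: eq_fsbigr => r _.
have [r0|r0] := leP 0%R r; last first.
  by rewrite preimage_nnfun0// !integral0_eq// => x _; rewrite indic0 mulr0 ?mule0.
under eq_integral do rewrite EFinM.
rewrite ge0_integralZl// integral_dens_indic//.
under [in RHS]eq_integral do rewrite EFinM muleCA.
rewrite ge0_integralZl//; first by apply: emeasurable_funM.
by move=> x _; rewrite mule_ge0 ?lee_fin.
Qed.

(** Monotone convergence along simple functions asks for no integrability, so [g] may take the value
    [+oo], as Riesz kernels do. *)
Lemma integral_dens (g : T -> \bar R) : measurable_fun setT g ->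
  (forall x, 0 <= g x) -> \int[densm]_x g x = \int[mu]_x ((f x)%:E * g x).
Proof.
move=> mg g0.
pose h := nnsfun_approx measurableT mg.
have ndh : nondecreasing_seq (h : (T -> R)^nat) := nd_nnsfun_approx measurableT mg.
have hg x : setT x -> EFin \o h^~ x @ \oo --> g x.
  by move=> _; apply: cvg_nnsfun_approx => // y _; exact: g0.
transitivity (\int[densm]_x (limn (fun n => (h n x)%:E))).
  by apply: eq_integral => x _; apply/esym/cvg_lim => //; exact: hg.
rewrite monotone_convergence//; last 3 first.
- by move=> n; exact/measurable_EFinP.
- by move=> n x _; rewrite lee_fin.
- by move=> x _ m n mn; rewrite lee_fin; exact/lefP/ndh.
under eq_fun do rewrite integral_dens_nnsfun.
rewrite -monotone_convergence//.
- apply: eq_integral => x _; apply/cvg_lim => //.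
  by apply: cvgeZl => //; exact: hg.
- by move=> n; apply: emeasurable_funM; exact/measurable_EFinP.
- by move=> n x _; rewrite mule_ge0 ?lee_fin.
- by move=> x _ m n mn; rewrite lee_wpmul2l ?lee_fin//; exact/lefP/ndh.
Qed.

Lemma dens_sigma_finite : sigma_finite setT mu -> sigma_finite setT densm.
Proof.
move=> [F UF mF]; have mG n : measurable [set x | (f x <= n%:R)%R].
  have mf' : measurable_fun setT (EFin \o f) by exact/measurable_EFinP.
  have := emeasurable_fun_infty_c measurableT mf' n%:R%:E.
  by rewrite setTI.
(* Pairs are enumerated by [pickle]; a piece of finite measure, cut to where the density is at most
   an integer, keeps finite mass. *)
pose H (k : nat) := let p := odflt (0, 0)%N (unpickle k) in
  F p.1 `&` [set x | (f x <= p.2%:R)%R].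
exists H.
  apply/esym; rewrite -subTset => x _.
  have [i _ Fi] : (\bigcup_i F i) x by rewrite -UF.
  have [j fj] : exists j : nat, (f x <= j%:R)%R.
    exists (`|Num.ceil (f x)|)%N; rewrite (le_trans (ceil_ge _))// pmulrn ler_int.
    by rewrite lez_abs.
  by exists (pickle (i, j)) => //; rewrite /H pickleK.
move=> k; rewrite /H; set p := odflt _ _; split.
  by apply: measurableI => //; exact: (mF _).1.
rewrite densE (@le_lt_trans _ _ (\int[mu]_(x in F p.1 `&` [set x | (f x <= p.2%:R)%R]) (cst p.2%:R%:E) x))//.
  apply: ge0_le_integral => //.
  - by apply: measurableI => //; exact: (mF _).1.
  - by move=> x _; rewrite lee_fin.
  - by apply/measurable_EFinP; exact: measurable_funTS.
  - by move=> x [_ /=]; rewrite lee_fin.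
rewrite integral_cst//; last by apply: measurableI => //; exact: (mF _).1.
rewrite lte_mul_pinfty ?lee_fin//.
apply: le_lt_trans (mF p.1).2; apply: le_measure; rewrite ?inE//.
- by apply: measurableI => //; exact: (mF _).1.
- exact: (mF _).1.
Qed.

End density.

Section sigma_finite_of_proof.
Local Open Scope ereal_scope.
Context d (T : measurableType d) (R : realType) (m : {measure set T -> \bar R}).

(* Carries a proof of sigma-finiteness, so that it can be inferred as a canonical instance. *)
Definition sfm (s : sigma_finite setT m) : set T -> \bar R := m.

Hypothesis (s : sigma_finite setT m).
HB.instance Definition _ := Measure.on (sfm s).
HB.instance Definition _ := @Measure_isSigmaFinite.Build _ _ _ (sfm s) s.

End sigma_finite_of_proof.

Section tonelli.
Local Open Scope ereal_scope.
Context d1 d2 (T1 : measurableType d1) (T2 : measurableType d2) (R : realType).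
Variables (m1 : {measure set T1 -> \bar R}) (m2 : {measure set T2 -> \bar R}).
Hypotheses (s1 : sigma_finite setT m1) (s2 : sigma_finite setT m2).

Lemma tonelli (f : T1 -> T2 -> \bar R) :
  measurable_fun setT (fun p : T1 * T2 => f p.1 p.2) ->
  (forall x y, 0 <= f x y) ->
  \int[m1]_x \int[m2]_y f x y = \int[m2]_y \int[m1]_x f x y.
Proof.
move=> mf f0.
exact: (@fubini_tonelli _ _ _ _ _ (sfm s1) (sfm s2) (fun p => f p.1 p.2) mf (fun p => f0 p.1 p.2)).
Qed.

Lemma measurable_int2 (f : T1 -> T2 -> \bar R) :
  measurable_fun setT (fun p : T1 * T2 => f p.1 p.2) ->
  (forall x y, 0 <= f x y) ->
  measurable_fun setT (fun x => \int[m2]_y f x y).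
Proof.
move=> mf f0.
exact (@measurable_fun_fubini_tonelli_F _ _ _ _ _ (sfm s2) _ mf (fun p => f0 p.1 p.2)).
Qed.

End tonelli.

(** * Euclidean distance and balls against the sup-norm topology *)

Section euclid.
Context (R : realType) (n : nat).
Implicit Types (x y z : 'rV[R]_n).

Lemma edist_ge0 x z : 0 <= edist x z. Proof. exact: sqrtr_ge0. Qed.

Lemma edistC x z : edist x z = edist z x.
Proof. by rewrite /edist; congr Num.sqrt; apply: eq_bigr => i _; rewrite -sqrrN opprB. Qed.

Lemma sqr_edist x z : edist x z ^+ 2 = \sum_(i < n) (x ord0 i - z ord0 i) ^+ 2.
Proof. by rewrite sqr_sqrtr// sumr_ge0// => i _; rewrite sqr_ge0. Qed.

Lemma coord_le_edist x z i : `|x ord0 i - z ord0 i| <= edist x z.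
Proof.
rewrite -sqrtr_sqr ler_sqrt; last by rewrite sumr_ge0// => j _; rewrite sqr_ge0.
by rewrite (bigD1 i)//= lerDl sumr_ge0// => j _; rewrite sqr_ge0.
Qed.

Lemma edist0P x z : edist x z = 0 -> x = z.
Proof.
move=> xz; apply/rowP => i; apply/eqP; rewrite -subr_eq0 -normr_eq0 eq_le normr_ge0 andbT.
by rewrite -xz coord_le_edist.
Qed.

Lemma edistxx x : edist x x = 0.
Proof. by rewrite /edist big1 ?sqrtr0// => i _; rewrite subrr expr0n. Qed.

Lemma edist_gt0 x z : x != z -> 0 < edist x z.
Proof. by move=> xz; rewrite lt0r edist_ge0 andbT; apply: contra_neq xz => /edist0P. Qed.

(** Instead of Cauchy-Schwarz: [(a + b)^2 = (1 + b/a) a^2 + (1 + a/b) b^2], and coordinate by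
    coordinate the weighted sum exceeds [(u - w)^2] by an exact square. *)
Lemma edist_triangle x y z : edist x z <= edist x y + edist y z.
Proof.
have [A0|A0] := eqVneq (edist x y) 0; first by rewrite (edist0P A0) edistxx add0r.
have [B0|B0] := eqVneq (edist y z) 0; first by rewrite (edist0P B0) edistxx addr0.
have Ap : 0 < edist x y by rewrite lt0r A0 edist_ge0.
have Bp : 0 < edist y z by rewrite lt0r B0 edist_ge0.
rewrite -(@ler_pXn2r _ 2) ?nnegrE ?edist_ge0 ?addr_ge0 ?edist_ge0//.
set a := edist x y in A0 Ap *; set b := edist y z in B0 Bp *.
have -> : (a + b) ^+ 2 = (1 + b / a) * a ^+ 2 + (1 + a / b) * b ^+ 2.
  by field; rewrite A0 B0.
rewrite !sqr_edist !mulr_sumr -big_split/=; apply: ler_sum => i _.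
set u := x ord0 i; set v := y ord0 i; set w := z ord0 i.
rewrite -subr_ge0.
have -> : (1 + b / a) * (u - v) ^+ 2 + (1 + a / b) * (v - w) ^+ 2 - (u - w) ^+ 2
  = (b * (u - v) - a * (v - w)) ^+ 2 / (a * b) by field; rewrite A0 B0.
by rewrite divr_ge0 ?sqr_ge0// mulr_ge0// ltW.
Qed.

(** [ball] refers to the sup norm, whence the dimension factor; the extra [e] keeps the inequality
    strict in every dimension. *)
Lemma edist_lt_ball x z e : 0 < e -> ball x e z -> edist x z < n%:R * e + e.
Proof.
move=> e0 [_ xz].
have -> : n%:R * e + e = Num.sqrt ((n%:R * e + e) ^+ 2).
  by rewrite sqrtr_sqr ger0_norm// addr_ge0 ?mulr_ge0// ltW.
rewrite ltr_sqrt; last by rewrite exprn_gt0// ltr_wpDl// mulr_ge0// ltW.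
apply: (@le_lt_trans _ _ (n%:R * e ^+ 2)).
  have -> : n%:R * e ^+ 2 = \sum_(i < n) e ^+ 2 by rewrite sumr_const card_ord mulr_natl.
  apply: ler_sum => i _.
  rewrite -real_normK ?num_real//.
  by rewrite ler_pXn2r ?nnegrE ?normr_ge0 ?(ltW e0)// ltW//; exact: xz.
rewrite -subr_gt0.
have -> : (n%:R * e + e) ^+ 2 - n%:R * e ^+ 2 = (n%:R ^+ 2 + n%:R + 1) * e ^+ 2 :> R by ring.
by rewrite mulr_gt0 ?exprn_gt0// ltr_wpDl// addr_ge0// exprn_ge0.
Qed.

Lemma eball_sub_ball x e : eball x e `<=` ball x e.
Proof.
move=> z /= xz; split; first exact: le_lt_trans (edist_ge0 _ _) xz.
move=> i j; rewrite (ord1 i); exact: le_lt_trans (coord_le_edist _ _ _) xz.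
Qed.

Lemma open_eball x r : open (eball x r : set (Rn R n)).
Proof.
rewrite openE => z /= xz; apply/nbhs_ballP.
pose e := (r - edist x z) / (n%:R + 1).
have n1 : 0 < n%:R + 1 :> R by rewrite ltr_wpDl.
have e0 : 0 < e by rewrite divr_gt0// subr_gt0.
exists e => //= w zw; have := edist_lt_ball e0 zw.
rewrite -[X in _ + X]mul1r -mulrDl mulrC divfK ?gt_eqF// => zwr.
by rewrite /eball/=; apply: le_lt_trans (edist_triangle _ z _) _; rewrite -ltrBrDl.
Qed.

Lemma open_eballP (U : set (Rn R n)) x : open U -> U x ->
  exists2 r, 0 < r & eball x r `<=` U.
Proof.
move=> /[swap] Ux; rewrite openE => /(_ x Ux) /nbhs_ballP[r/= r0 rU].
by exists r => //; apply: subset_trans rU; exact: eball_sub_ball.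
Qed.

Lemma closure_eballP (A : set (Rn R n)) x :
  closure A x <-> (forall r, 0 < r -> exists2 z, A z & edist x z < r).
Proof.
split=> [cA r r0|H U].
  have /cA[z [Az xz]] : nbhs x (eball x r).
    apply: open_nbhs_nbhs; split; first exact: open_eball.
    by rewrite /eball/= edistxx.
  by exists z.
rewrite nbhsE => -[V [oV Vx] VU].
have [r r0 rV] := open_eballP oV Vx.
by have [z Az xz] := H r r0; exists z; split => //; exact/VU/rV.
Qed.

Definition ceball x r : set (Rn R n) := [set z | edist x z <= r].

Lemma closed_ceball x r : closed (ceball x r).
Proof.
rewrite -openC openE => z /=; rewrite /ceball/= => /negP; rewrite -ltNge => rz.
apply: (@filterS _ _ _ (eball z (edist x z - r))).
  move=> w /=; rewrite /eball /= => zw /= xw.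
  have := edist_triangle x w z; rewrite (edistC w); lra.
apply: open_nbhs_nbhs; split; first exact: open_eball.
by rewrite /eball/= edistxx subr_gt0.
Qed.

Lemma compact_ceball x r : compact (ceball x r).
Proof.
apply: bounded_closed_compact; last exact: closed_ceball.
exists (`|x| + `|r|); split; first by rewrite num_real.
move=> M xM z /= xz; apply: le_trans (ltW xM).
rewrite -[z](subrK x) addrC; apply: le_trans (ler_normD _ _) _; rewrite lerD2l.
apply: (@le_trans _ _ (r + 0)); last by rewrite addr0 ler_norm.
rewrite leNgt; apply/negP => rz.
have : ball x `|z - x| z.
  apply: eball_sub_ball; apply: le_lt_trans rz; by rewrite addr0.
by rewrite mx_norm_ball /ball_/= -normrN opprB ltxx.
Qed.

End euclid.

(** * Borel sets and Radon measures *)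

Section borel.
Context (R : realType) (n : nat).

Lemma open_mRn (U : set (Rn R n)) : open U -> measurable (U : set (RnB R n)).
Proof. by move=> oU; apply: sub_sigma_algebra. Qed.

Lemma closed_mRn (U : set (Rn R n)) : closed U -> measurable (U : set (RnB R n)).
Proof. by move=> cU; rewrite -[U]setCK; apply: measurableC; apply: open_mRn; exact: closed_openC. Qed.

Lemma measurable_coord (i : 'I_n) :
  measurable_fun setT (fun x : RnB R n => (x : 'rV[R]_n) ord0 i).
Proof.
apply: (measurability _ (RGenOpens.measurableE R)).
move=> _ [_ [a [b ->] <-]]; rewrite setTI; apply: open_mRn.
by apply: (@open_comp (Rn R n) R); [move=> x _; exact: coord_continuous|exact: interval_open].
Qed.

(** The Borel sets are generated by the open sets, the hypothesis speaks of coordinates. An open set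
    is a countable union of sup-norm balls with rational centres and radii [1 / (k + 1)], and each
    such ball is a finite intersection of coordinate conditions. *)
Lemma measurable_toRn d (T : measurableType d) (f : T -> RnB R n) :
  (forall i : 'I_n, measurable_fun setT (fun t => (f t : 'rV[R]_n) ord0 i)) ->
  measurable_fun setT f.
Proof.
move=> mf; apply: (measurability _ (erefl : @measurable _ (RnB R n) = <<s @open (Rn R n) >>)) => _ [U oU <-]; rewrite setTI.
pose box (q : 'rV[rat]_n) (k : nat) : set (Rn R n) :=
  ball (map_mx (@ratr R) q) k.+1%:R^-1.
pose F j := if unpickle j is Some (q, k) then
  if `[< box q k `<=` U >] then box q k else set0 else set0 : set (Rn R n).
have -> : U = \bigcup_j F j.
  apply/seteqP; split => [x Ux|x [j _]]; last first.
    by rewrite /F; case: unpickle => // -[q k]; case: ifPn => // /asboolP; exact.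
  move: oU; rewrite openE => /(_ x Ux) /nbhs_ballP[e/= e0 eU].
  have [k ke] : exists k, k.+1%:R^-1 < e / 2.
    by have := near_infty_natSinv_lt (PosNum (divr_gt0 e0 (ltr0Sn R 1))) => -[N _ /(_ N (leqnn _))]; exists N.
  have hq i : {q : rat | `|x ord0 i - ratr q| < k.+1%:R^-1}.
    apply/cid; have [] := @rat_in_itvoo R (x ord0 i - k.+1%:R^-1) (x ord0 i + k.+1%:R^-1).
      by rewrite ltrD2l gtrN ?invr_gt0.
    move=> q; rewrite in_itv/= => /andP[h1 h2]; exists q.
    by rewrite distrC ltr_distl h1 h2.
  pose q : 'rV[rat]_n := \row_i sval (hq i).
  exists (pickle (q, k)) => //; rewrite /F pickleK.
  have xq : ball (map_mx (@ratr R) q) k.+1%:R^-1 x.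
    split; first by rewrite invr_gt0.
    by move=> i j; rewrite (ord1 i) !mxE /ball/= distrC; case: (hq j).
  case: ifPn => // /asboolP[]; move=> z qz; apply: eU.
  rewrite (splitr e); apply: (@ball_triangle _ _ (map_mx (@ratr R) q)).
    by apply: ball_sym; exact: le_ball (ltW ke) _ _.
  exact: le_ball (ltW ke) _ _.
rewrite preimage_bigcup; apply: bigcupT_measurable => j; rewrite /F.
case: unpickle => [[q k]|]; last by rewrite preimage_set0.
case: ifPn => _; last by rewrite preimage_set0.
have -> : f @^-1` box q k = \big[setI/setT]_(i < n)
   [set t | `|ratr (q ord0 i) - (f t : 'rV[R]_n) ord0 i| < k.+1%:R^-1].
  apply/seteqP; split => t /=.
    move=> [_ qt]; rewrite -bigcap_seq => i _ /=.
    by have := qt ord0 i; rewrite mxE.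
  rewrite -bigcap_seq => qt; split; first by rewrite invr_gt0.
  by move=> i i'; rewrite (ord1 i) mxE; apply: qt => /=; rewrite mem_index_enum.
apply: bigsetI_measurable => i _.
by have := mf i measurableT _ (@measurable_ball R (ratr (q ord0 i)) k.+1%:R^-1); rewrite setTI.
Qed.

Lemma measurable_edist : measurable_fun setT
  (fun p : RnB R n * RnB R n => edist (p.1 : 'rV[R]_n) p.2).
Proof.
rewrite /edist.
apply: (@measurableT_comp _ _ _ _ _ _ (@Num.sqrt R)).
  by apply: continuous_measurable_fun; exact: sqrt_continuous.
apply: measurable_sum => i; apply: measurable_funX; apply: measurable_funB.
  by apply: (measurableT_comp (measurable_coord i)); exact: measurable_fst.
by apply: (measurableT_comp (measurable_coord i)); exact: measurable_snd.
Qed.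

Lemma measurable_eball (x : 'rV[R]_n) r : measurable (eball x r : set (RnB R n)).
Proof. by apply: open_mRn; exact: open_eball. Qed.

Lemma measurable_ceball (x : 'rV[R]_n) r : measurable (ceball x r : set (RnB R n)).
Proof. by apply: closed_mRn; exact: closed_ceball. Qed.

Lemma bigcup_ceball (x : 'rV[R]_n) : \bigcup_k ceball x k%:R = setT.
Proof.
rewrite -subTset => z _.
exists (`|Num.ceil (edist x z)|)%N => //=; rewrite /ceball/= (le_trans (ceil_ge _))//.
by rewrite pmulrn ler_int lez_abs.
Qed.

Lemma radon_sigma_finite (mu : msr R n) : radon mu -> sigma_finite setT mu.
Proof.
move=> rmu; exists (fun k => ceball (0 : 'rV[R]_n) k%:R); first by rewrite bigcup_ceball.
move=> k; split; first exact: measurable_ceball.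
by apply: rmu; exact: compact_ceball.
Qed.

Lemma radonP (mu : msr R n) (x : 'rV[R]_n) :
  (forall r, (mu (ceball x r) < +oo)%E) -> radon mu.
Proof.
move=> H K cK; have [M KM] : exists M, K `<=` ceball x M.
  have [M0 [_ HM]] := compact_bounded cK.
  have {HM} := HM (`|M0| + 1); rewrite (le_lt_trans (ler_norm _)) ?ltrDl// => /(_ isT) HM.
  exists (n%:R * (`|M0| + 1 + `|x| + 1) + (`|M0| + 1 + `|x| + 1)) => z Kz /=.
  apply/ltW/edist_lt_ball; first by rewrite ltr_wpDl// !addr_ge0.
  rewrite mx_norm_ball /ball_/=; apply: le_lt_trans (ler_normB _ _) _.
  have := HM z Kz => /=; rewrite /Rn; set a := `|x|; set b := `|z|; lra.
apply: le_lt_trans (H M); apply: le_measure => //; rewrite inE.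
  by apply: closed_mRn; apply: compact_closed => //; exact: norm_hausdorff.
exact: measurable_ceball.
Qed.

End borel.

(** * Lebesgue measure and Gaussians *)

Section lebesgue1.
Local Open Scope ereal_scope.
Context (R : realType).
Local Notation leb := (@lebesgue_measure R).

(** Uniqueness of Lebesgue measure: the rescaled push-forward agrees with it on half-open
    intervals. *)
Lemma leb_affine (c d : R) (A : set (measurableTypeR R)) : (0 < c)%R -> measurable A ->
  leb ((fun x => c * x + d)%R @^-1` A) = c^-1%:E * leb A.
Proof.
move=> c0 mA.
have mphi : measurable_fun setT (fun x : measurableTypeR R => (c * x + d)%R : measurableTypeR R).
  by apply: measurable_funD => //; apply: measurable_funM.
have c0' : (0 <= c)%R by exact: ltW.
pose m : {measure set (measurableTypeR R) -> \bar R} :=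
  mscale (NngNum c0') (measure_function_pushforward__canonical__measure_function_Measure leb mphi).
have -> : leb A = m A.
  apply: lebesgue_measure_unique => //= _ [[a b] _ <-].
  rewrite /m/= /mscale/= /pushforward.
  have -> : (fun x : R => c * x + d)%R @^-1` `]a, b]%classic%R = `](a - d) / c, (b - d) / c]%classic%R.
    apply/seteqP; split => x /=; rewrite !in_itv/= ltr_pdivrMr// ler_pdivlMr//;
    by rewrite [(x * c)%R]mulrC ltrBlDr lerBrDr.
  rewrite !lebesgue_measure_itv/= !lte_fin.
  have -> : ((a - d) / c < (b - d) / c)%R = (a < b)%R.
    by rewrite ltr_pM2r ?invr_gt0// ltrD2r.
  case: ifP => _; last by rewrite mule0.
  by rewrite -!EFinB -EFinM; congr EFin; field; rewrite gt_eqF.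
rewrite /m/= /mscale/= /pushforward muleA -EFinM mulVf ?gt_eqF//.
by rewrite mul1e.
Qed.

Lemma integral_affine (c d : R) (f : R -> \bar R) : (0 < c)%R ->
  measurable_fun setT f -> (forall x, 0 <= f x) ->
  \int[leb]_x f (c * x + d)%R = c^-1%:E * \int[leb]_x f x.
Proof.
move=> c0 mf f0.
have mphi : measurable_fun setT (fun x : measurableTypeR R => (c * x + d)%R : measurableTypeR R).
  by apply: measurable_funD => //; apply: measurable_funM.
have c0' : (0 <= c^-1)%R by rewrite invr_ge0 ltW.
rewrite -(@ge0_integral_mscale _ _ _ leb _ measurableT (NngNum c0'))//.
transitivity (\int[measure_function_pushforward__canonical__measure_function_Measure leb mphi]_x f x).
  by rewrite ge0_integral_pushforward.
by apply: eq_measure_integral => A mA _; rewrite /= /pushforward leb_affine.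
Qed.

End lebesgue1.

(** * Lebesgue measure in dimension [n] *)

Section lebesguen.
Local Open Scope ereal_scope.
Context (R : realType).
Local Notation leb := (@lebesgue_measure R).

(** These two properties are all that the proof takes from Lebesgue measure; they suffice to compute
    Gaussian integrals. The measure is built one coordinate at a time, from a point mass in
    dimension [0]. *)
Lemma lebn_exists (n : nat) : exists m : msr R n, sigma_finite setT m /\
  forall (f : 'I_n -> R -> R) (c : 'I_n -> R),
    (forall i, measurable_fun setT (f i)) -> (forall i x, (0 <= f i x)%R) ->
    (forall i, \int[leb]_x (f i x)%:E = (c i)%:E) ->
    \int[m]_z (\prod_(i < n) f i ((z : 'rV[R]_n) ord0 i))%:E = (\prod_(i < n) c i)%:E.
Proof.
elim: n => [|n [m [sm IH]]].
  exists (@dirac _ (RnB R 0) (0%R : 'rV[R]_0) R); split.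
    exists (fun=> setT); first by rewrite bigcup_const.
    by move=> _; split => //; rewrite /= /dirac indicE in_setT ltry.
  move=> f c _ _ _; rewrite integral_dirac//; last first.
    by under eq_fun do rewrite big_ord0; exact: measurable_cst.
  by rewrite diracE in_setT mul1e !big_ord0.
pose cons (p : measurableTypeR R * RnB R n) : RnB R n.+1 :=
  (\row_(i < n.+1) (if unlift ord0 i is Some j then (p.2 : 'rV[R]_n) ord0 j else p.1)) : 'rV[R]_n.+1.
have mcons : measurable_fun setT cons.
  apply: measurable_toRn => i; under eq_fun do rewrite mxE.
  case: (unlift ord0 i) => [j|]; last exact: measurable_fst.
  by apply: (measurableT_comp (measurable_coord j)); exact: measurable_snd.
pose m2 : {sigma_finite_measure set (RnB R n) -> \bar R} :=
  sfm sm.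
pose m' : msr R n.+1 :=
  measure_function_pushforward__canonical__measure_function_Measure (leb \x m2) mcons.
have Em' (g : RnB R n.+1 -> \bar R) : measurable_fun setT g -> (forall x, 0 <= g x) ->
    \int[m']_z g z = \int[leb]_r \int[m]_v g (cons (r, v)).
  move=> mg g0; rewrite ge0_integral_pushforward// preimage_setT.
  rewrite (@fubini_tonelli1 _ _ _ _ _ leb m2)//.
  - exact: measurableT_comp.
  - by move=> p; exact: g0.
exists m'; split.
  have [F UF mF] := sigma_finiteT leb.
  have [G UG mG] := sm.
  (* [cons] has a measurable left inverse, through which an exhaustion by products is pulled
     back. *)
  pose uncons (v : RnB R n.+1) : measurableTypeR R * RnB R n :=
    ((v : 'rV[R]_n.+1) ord0 ord0, \row_(j < n) (v : 'rV[R]_n.+1) ord0 (lift ord0 j)).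
  have uncK : cancel cons uncons.
    move=> [r v]; rewrite /uncons/cons; congr pair; first by rewrite mxE unlift_none.
    by apply/rowP => j; rewrite !mxE liftK.
  have munc : measurable_fun setT uncons.
    apply: measurable_fun_pair; first exact: measurable_coord.
    by apply: measurable_toRn => i; under eq_fun do rewrite mxE; exact: measurable_coord.
  pose H k := let p := odflt (0, 0)%N (unpickle k) in uncons @^-1` (F p.1 `*` G p.2).
  exists H.
    apply/esym; rewrite -subTset => v _.
    have [i _ Fi] : (\bigcup_i F i) (uncons v).1 by rewrite -UF.
    have [j _ Gj] : (\bigcup_i G i) (uncons v).2 by rewrite -UG.
    by exists (pickle (i, j)) => //; rewrite /H pickleK.
  move=> k; rewrite /H; set p := odflt _ _.
  have mFG : measurable (F p.1 `*` G p.2).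
    by apply: measurableX; [exact: (mF _).1|exact: (mG _).1].
  split; first by rewrite -[X in measurable X]setTI; exact: munc.
  rewrite /m'/= /pushforward -comp_preimage (_ : uncons \o cons = id); last first.
    by apply/funext => q; exact: uncK.
  rewrite preimage_id product_measure1E//; [|exact: (mF _).1|exact: (mG _).1].
  by rewrite lte_mul_pinfty//; [rewrite ge0_fin_numE; [exact: (mF _).2|exact: measure_ge0]|exact: (mG _).2].
move=> f c mf f0 fc; rewrite Em'.
- under eq_integral => r _.
    under eq_integral => v _.
      rewrite big_ord_recl /cons/= mxE unlift_none EFinM.
      under eq_bigr do rewrite mxE liftK.
      over.
    rewrite ge0_integralZl_EFin//; last 2 first.
      by move=> v _; rewrite lee_fin; apply: prodr_ge0.
      apply/measurable_EFinP; apply: measurable_prod => i _.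
      by apply: (measurableT_comp (mf _)); exact: measurable_coord.
    rewrite (IH (fun i => f (lift ord0 i)) (fun i => c (lift ord0 i)))//.
    over.
  rewrite ge0_integralZr//; first last.
  - by rewrite lee_fin prodr_ge0// => i _; rewrite -lee_fin -fc integral_ge0// => x _; rewrite lee_fin.
  - by move=> x _; rewrite lee_fin.
  - by apply/measurable_EFinP; exact: mf.
  by rewrite fc big_ord_recl EFinM.
- apply/measurable_EFinP; apply: measurable_prod => i _.
  by apply: (measurableT_comp (mf _)); exact: measurable_coord.
- by move=> x; rewrite lee_fin prodr_ge0.
Qed.
End lebesguen.

(** * The Gaussian semigroup *)

Section gaussian.
Context (R : realType) (n : nat).
Local Notation leb := (@lebesgue_measure R).

Definition Leb : msr R n := sval (cid (lebn_exists R n)).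

Lemma Leb_sigma_finite : sigma_finite setT Leb.
Proof. by have [] := svalP (cid (lebn_exists R n)). Qed.

Lemma Leb_prod (f : 'I_n -> R -> R) (c : 'I_n -> R) :
  (forall i, measurable_fun setT (f i)) -> (forall i x, (0 <= f i x)%R) ->
  (forall i, \int[leb]_x (f i x)%:E = (c i)%:E)%E ->
  (\int[Leb]_z (\prod_(i < n) f i ((z : 'rV[R]_n) ord0 i))%:E = (\prod_(i < n) c i)%:E)%E.
Proof. by have [_ H] := svalP (cid (lebn_exists R n)); exact: H. Qed.

Definition g1 (t u : R) : R := (pi * t) `^ (- 2^-1) * expR (- u ^+ 2 * t `^ (-1)).

(* Time is normalized so that the Gaussian of time [t] is [(pi t)^(-n/2) exp (-d^2/t)]. *)
Definition gpeak (t : R) : R := (pi * t) `^ (- (n%:R / 2)).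

Definition gauss (t d : R) : R := gpeak t * expR (- d ^+ 2 * t `^ (-1)).

Lemma g1_ge0 t u : 0 <= g1 t u.
Proof. by rewrite mulr_ge0 ?powR_ge0 ?expR_ge0. Qed.

Lemma gpeak_ge0 t : 0 <= gpeak t. Proof. exact: powR_ge0. Qed.

Lemma gpeak_gt0 t : 0 < t -> 0 < gpeak t.
Proof. by move=> t0; rewrite powR_gt0// mulr_gt0// pi_gt0. Qed.

Lemma gauss_ge0 t d : 0 <= gauss t d.
Proof. by rewrite mulr_ge0 ?gpeak_ge0 ?expR_ge0. Qed.

Lemma gauss_gt0 t d : 0 < t -> 0 < gauss t d.
Proof. by move=> t0; rewrite mulr_gt0 ?gpeak_gt0 ?expR_gt0. Qed.

Lemma gauss_prod t (x z : 'rV[R]_n) : 0 < t ->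
  gauss t (edist x z) = \prod_(i < n) g1 t (x ord0 i - z ord0 i).
Proof.
move=> t0; rewrite /gauss /g1 big_split/= prodr_const card_ord; congr (_ * _).
  by rewrite /gpeak -powR_mulrn ?powR_ge0// -powRrM mulNr [2^-1 * _]mulrC.
by rewrite sqr_edist -sumrN mulr_suml expR_sum; apply: eq_bigr => i _.
Qed.

Lemma measurable_g1 t (c : R) : measurable_fun setT (fun z : R => g1 t (c - z)).
Proof.
apply: measurable_funM => //; apply: measurableT_comp; first exact: measurable_expR.
apply: measurable_funM => //; apply: measurableT_comp => //.
by apply: measurable_funX; exact: measurable_funB.
Qed.

(** In this normalization time [t] corresponds to variance [t / 2]. *)
Lemma g1_normal t u m : 0 < t -> g1 t (u - m) = normal_pdf m (Num.sqrt (t / 2)) u.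
Proof.
move=> t0; have st : Num.sqrt (t / 2) != 0 by rewrite gt_eqF// sqrtr_gt0 divr_gt0.
rewrite normal_pdfE// /g1 /normal_peak /normal_fun sqr_sqrtr ?divr_ge0 ?(ltW t0)//.
have -> : t / 2 * pi *+ 2 = pi * t by rewrite -mulr_natr; field.
have -> : t / 2 *+ 2 = t by rewrite -mulr_natr; field.
congr (_ * _); last by rewrite powR_inv1// ltW.
by rewrite powRN -powR12_sqrt// mulr_ge0 ?pi_ge0// ltW.
Qed.

Lemma g1_sym t u : g1 t (- u) = g1 t u. Proof. by rewrite /g1 sqrrN. Qed.

Lemma g1_mass t x : 0 < t -> (\int[leb]_z (g1 t (x - z))%:E = 1)%E.
Proof.
move=> t0; under eq_integral do rewrite -g1_sym opprB g1_normal//.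
exact: integral_normal_pdf.
Qed.

(** Completing the square: as a function of [z] the product is a constant times a Gaussian of time
    [s = t u / (t + u)] centred at the weighted mean [m], and that Gaussian has mass [1]. *)
Lemma g1_conv (t u x w : R) : 0 < t -> 0 < u ->
  (\int[leb]_z (g1 t (x - z) * g1 u (z - w))%:E = (g1 (t + u) (x - w))%:E)%E.
Proof.
move=> t0 u0; have tu0 : 0 < t + u by rewrite addr_gt0.
pose s := t * u / (t + u); pose m := (u * x + t * w) / (t + u).
have s0 : 0 < s by rewrite divr_gt0// mulr_gt0.
transitivity (\int[leb]_z ((g1 (t + u) (x - w))%:E * (g1 s (m - z))%:E))%E.
  apply: eq_integral => z _; rewrite -EFinM; congr EFin.
  rewrite /g1 mulrACA [RHS]mulrACA -!expRD; congr (_ * expR _).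
    rewrite -!powRM ?(mulr_ge0, pi_ge0, invr_ge0, ltW t0, ltW u0, ltW tu0, ltW s0)//.
    by congr (_ `^ _); rewrite /s; field; rewrite gt_eqF.
  rewrite !powR_inv1 ?(ltW t0) ?(ltW u0) ?(ltW tu0) ?(ltW s0)// /s /m.
  by field; rewrite !gt_eqF.
rewrite ge0_integralZl//; last 3 first.
- by apply/measurable_EFinP; exact: measurable_g1.
- by move=> z _; rewrite lee_fin g1_ge0.
- by rewrite lee_fin g1_ge0.
by rewrite g1_mass// mule1.
Qed.

Lemma measurable_gauss2 : measurable_fun setT
  (fun p : measurableTypeR R * measurableTypeR R => gauss p.1 p.2).
Proof.
apply: measurable_funM.
  apply: (@measurableT_comp _ _ _ _ _ _ (fun t => powR t (- (n%:R / 2)))).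
    exact: measurable_powR.
  by apply: measurable_funM => //; exact: measurable_fst.
apply: measurableT_comp; first exact: measurable_expR.
apply: measurable_funM.
  apply: measurableT_comp => //; apply: measurable_funX; exact: measurable_snd.
apply: (@measurableT_comp _ _ _ _ _ _ (fun t => powR t (-1))).
  exact: measurable_powR.
exact: measurable_fst.
Qed.

Lemma gauss_conv t u (x w : 'rV[R]_n) : 0 < t -> 0 < u ->
  (\int[Leb]_z (gauss t (edist x z) * gauss u (edist (z : 'rV[R]_n) w))%:E
   = (gauss (t + u) (edist x w))%:E)%E.
Proof.
move=> t0 u0.
under eq_integral do rewrite !gauss_prod// -big_split/=.
rewrite (@Leb_prod (fun i z => g1 t (x ord0 i - z) * g1 u (z - w ord0 i))
  (fun i => g1 (t + u) (x ord0 i - w ord0 i)))//.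
- by rewrite gauss_prod// addr_gt0.
- move=> i; apply: measurable_funM; first exact: measurable_g1.
  by under eq_fun do rewrite -g1_sym opprB; exact: measurable_g1.
- by move=> i z; rewrite mulr_ge0 ?g1_ge0.
- by move=> i; rewrite g1_conv.
Qed.

Lemma gauss_mass t (x : 'rV[R]_n) : 0 < t ->
  (\int[Leb]_z (gauss t (edist x z))%:E = 1)%E.
Proof.
move=> t0; under eq_integral do rewrite gauss_prod//.
rewrite (@Leb_prod (fun i z => g1 t (x ord0 i - z)) (fun i => 1)) ?big1//.
- by move=> i; exact: measurable_g1.
- by move=> i z; rewrite g1_ge0.
- by move=> i; rewrite g1_mass.
Qed.

End gaussian.

Section general.
Local Open Scope ereal_scope.
Context d (T : measurableType d) (R : realType) (mu : {measure set T -> \bar R}).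

Lemma integral_bigcup_le (F : (set T)^nat) (f : T -> \bar R) (c : \bar R) :
  nondecreasing_seq F -> (forall i, measurable (F i)) ->
  measurable_fun setT f -> (forall x, 0 <= f x) ->
  (forall i, \int[mu]_(x in F i) f x <= c) ->
  \int[mu]_(x in \bigcup_i F i) f x <= c.
Proof.
move=> ndF mF mf f0 Fc.
have H := @ge0_nondecreasing_set_cvg_integral _ _ _ F f mu ndF mF
  (fun i => measurable_funTS mf) (fun i x _ => f0 x).
rewrite -(cvg_lim _ H)//; apply: lime_le; first by apply/cvg_ex; eexists; exact: H.
by near=> n.
Unshelve. all: by end_near.
Qed.

Lemma integral_gt0 (D : set T) (f : T -> \bar R) : measurable D ->
  measurable_fun D f -> (forall x, D x -> 0 < f x) -> 0 < mu D ->
  0 < \int[mu]_(x in D) f x.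
Proof.
move=> mD mf f0 D0; rewrite lt0e integral_ge0 ?andbT; last by move=> x Dx; exact/ltW/f0.
apply/eqP => if0; have : \int[mu]_(x in D) `|f x| = 0.
  by rewrite -if0; apply: eq_integral => x /[!inE] Dx; rewrite gee0_abs//; exact/ltW/f0.
move/(ae_eq_integral_abs _ mD mf) => [N [mN N0 DN]].
have : D `<=` N.
  by move=> x Dx; apply: DN => /= /(_ Dx) fx0; have := f0 x Dx; rewrite fx0 ltxx.
move=> DN'; have : mu D <= mu N by apply: le_measure; rewrite ?inE.
by rewrite N0 leNgt D0.
Qed.

End general.

Section sections.
Context d1 d2 d3 (T1 : measurableType d1) (T2 : measurableType d2) (T3 : measurableType d3).
Variable f : T1 -> T2 -> T3.
Hypothesis mf : measurable_fun setT (fun p : T1 * T2 => f p.1 p.2).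

Lemma measurable_fix1 x : measurable_fun setT (f x).
Proof. exact: (measurableT_comp mf (measurable_pair1 x)). Qed.

Lemma measurable_fix2 y : measurable_fun setT (f^~ y).
Proof. exact: (measurableT_comp mf (measurable_pair2 y)). Qed.

Lemma measurable_swap2 : measurable_fun setT (fun p : T2 * T1 => f p.2 p.1).
Proof.
apply: (@measurableT_comp _ _ _ _ _ _ (fun p : T1 * T2 => f p.1 p.2) setT (fun p => (p.2, p.1))) => //.
by apply: measurable_fun_pair; [exact: measurable_snd|exact: measurable_fst].
Qed.

End sections.

(** * The Riesz kernel as a mixture of Gaussians *)

Section power_integrals.
Local Open Scope ereal_scope.
Context (R : realType).
Local Notation leb := (@lebesgue_measure R).

Lemma integral_powR (b c d : R) : b != 0%R -> (0 < c < d)%R ->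
  \int[leb]_(x in `[c, d]) (x `^ (b - 1))%:E = ((d `^ b - c `^ b) / b)%:E.
Proof.
move=> b0 /andP[c0 cd].
have dF (x : R) : (0 < x)%R -> is_derive x 1%R (fun x : R => x `^ b / b)%R (x `^ (b - 1))%R.
  move=> x0; have H := is_derive1_powR b x0.
  have H1 : is_derive x 1%R (b^-1 \*: (powR (R:=R))^~ b)%R (b^-1 *: (b * x `^ (b - 1)))%R.
    exact: is_deriveZ.
  rewrite scalerA mulVf// scale1r in H1.
  rewrite (_ : (fun _ => _) = b^-1 \*: (powR (R:=R))^~ b)%R//.
  by apply/funext => y /=; rewrite mulrC.
have cf (e x : R) : (0 < x)%R -> {for x, continuous (fun x : R => x `^ e)%R}.
  move=> x0; apply: differentiable_continuous; apply/derivable1_diffP.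
  by have [] := is_derive1_powR e x0.
rewrite (@continuous_FTC2 R (fun x => x `^ (b - 1))%R (fun x => x `^ b / b)%R)//.
- by rewrite -EFinB mulrBl.
- apply/continuous_in_subspaceT => x; rewrite inE/= in_itv/= => /andP[cx _].
  by apply: cf; exact: lt_le_trans cx.
- have cF (x : R) : (0 < x)%R -> {for x, continuous (fun x : R => x `^ b / b)%R}.
    move=> x0; apply: differentiable_continuous; apply/derivable1_diffP.
    by have [] := dF x x0.
  split.
  + move=> x; rewrite in_itv/= => /andP[cx _]; have [] := dF x (lt_trans c0 cx); by [].
  + by apply: cvg_at_right_filter; apply: cF.
  + by apply: cvg_at_left_filter; apply: cF; exact: lt_trans cd.
- move=> x; rewrite in_itv/= => /andP[cx _].
  by rewrite derive1E; have [_] := dF x (lt_trans c0 cx).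
Qed.

Lemma integral_powR_near0 (b : R) : (0 < b)%R ->
  \int[leb]_(x in `]0%R, 1%R[) (x `^ (b - 1))%:E < +oo.
Proof.
move=> b0; apply: (@le_lt_trans _ _ (b^-1)%:E); last exact: ltry.
pose F (k : nat) : set R := `[k.+2%:R^-1%R, 1%R]%classic.
apply: (@le_trans _ _ (\int[leb]_(x in \bigcup_k F k) (x `^ (b - 1))%:E)).
  apply: ge0_subset_integral => //.
  - by apply: bigcupT_measurable => k; exact: measurable_itv.
  - apply/measurable_EFinP; apply: measurable_funTS; exact: measurable_powR.
  - by move=> x _; rewrite lee_fin powR_ge0.
  - move=> x /=; rewrite in_itv/= => /andP[x0 x1].
    have [N _ /(_ N (leqnn N)) Nx] := near_infty_natSinv_lt (PosNum x0).
    exists N => //=; rewrite /F/= in_itv/= (ltW x1) andbT (le_trans _ (ltW Nx))//.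
    by rewrite lef_pV2 ?posrE// ler_nat.
apply: integral_bigcup_le.
- apply/nondecreasing_seqP => k; apply/subsetPset => x; rewrite /F/= !in_itv/= => /andP[kx ->].
  by rewrite andbT (le_trans _ kx)// lef_pV2 ?posrE// ler_nat.
- by move=> k; exact: measurable_itv.
- by apply/measurable_EFinP; exact: measurable_powR.
- by move=> x; rewrite lee_fin powR_ge0.
- move=> k; rewrite integral_powR ?gt_eqF//; last first.
    by rewrite invr_gt0 ltr0n/= invf_lt1// ltr1n.
  by rewrite lee_fin powR1 ler_piMl ?invr_ge0 ?(ltW b0)// gerBl powR_ge0.
Qed.

Lemma integral_powR_nearoo (b : R) : (b < 0)%R ->
  \int[leb]_(x in `[1%R, +oo[) (x `^ (b - 1))%:E < +oo.
Proof.
move=> b0; apply: (@le_lt_trans _ _ (- b^-1)%:E); last exact: ltry.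
pose F (k : nat) : set R := `[1%R, k.+2%:R%R]%classic.
apply: (@le_trans _ _ (\int[leb]_(x in \bigcup_k F k) (x `^ (b - 1))%:E)).
  apply: ge0_subset_integral => //.
  - by apply: bigcupT_measurable => k; exact: measurable_itv.
  - apply/measurable_EFinP; apply: measurable_funTS; exact: measurable_powR.
  - by move=> x _; rewrite lee_fin powR_ge0.
  - move=> x /=; rewrite in_itv/= andbT => x1.
    exists (`|Num.ceil x|)%N => //=; rewrite /F/= in_itv/= x1/=.
    apply: (le_trans (ceil_ge _)).
    apply: (@le_trans _ _ (`|Num.ceil x|%N%:R)); last by rewrite ler_nat -addn2 leq_addr.
    by rewrite pmulrn ler_int lez_abs.
apply: integral_bigcup_le.
- apply/nondecreasing_seqP => k; apply/subsetPset => x; rewrite /F/= !in_itv/= => /andP[-> kx]/=.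
  by rewrite (le_trans kx)// ler_nat.
- by move=> k; exact: measurable_itv.
- by apply/measurable_EFinP; exact: measurable_powR.
- by move=> x; rewrite lee_fin powR_ge0.
- move=> k; rewrite integral_powR ?lt_eqF//; last by rewrite ltr01/= ltr1n.
  rewrite lee_fin powR1 -[leRHS]mulN1r ler_nM2r ?invr_lt0//.
  by rewrite lerBrDr addNr powR_ge0.
Qed.

End power_integrals.

Lemma integral_homog (R : realType) (c k : R) (F G : R -> \bar R) : (0 < c)%R -> (0 <= k)%R ->
  measurable_fun setT F -> (forall x, 0 <= F x)%E ->
  measurable_fun setT G -> (forall x, 0 <= G x)%E ->
  (forall t, F (c * t)%R = k%:E * G t)%E ->
  (\int[@lebesgue_measure R]_x F x = (c * k)%:E * \int[@lebesgue_measure R]_x G x)%E.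
Proof.
move=> c0 k0 mF F0 mG G0 FG.
have := integral_affine 0%R c0 mF F0.
under eq_integral do rewrite addr0 FG.
rewrite ge0_integralZl// EFinM => H.
rewrite -muleA H muleA -EFinM divff ?mul1e// gt_eqF//.
Qed.

(** * Mixtures of Gaussians over time *)

Section time_mixtures.
Local Open Scope ereal_scope.
Context (R : realType) (n : nat) (alpha : R).
Hypotheses (n3 : (3 <= n)%N) (alpha0 : (0 < alpha)%R) (alpha2 : (alpha <= 2)%R).
Local Notation leb := (@lebesgue_measure R).

(** Set to [0] at nonpositive times, so that the mixing measures may be measures on the whole
    line. *)
Definition gauss0 (t d : R) : R := if (0 < t)%R then gauss n t d else 0%R.

Lemma gauss0_ge0 t d : (0 <= gauss0 t d)%R.
Proof. by rewrite /gauss0; case: ifP => // _; exact: gauss_ge0. Qed.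

Lemma measurable_gauss0 : measurable_fun setT
  (fun p : measurableTypeR R * measurableTypeR R => gauss0 p.1 p.2).
Proof.
apply: measurable_fun_ifT => //; last exact: measurable_gauss2.
by apply: measurable_fun_ltr => //; exact: measurable_fst.
Qed.

Lemma gauss0_le t (d e : R) : (0 <= d <= e)%R -> (gauss0 t e <= gauss0 t d)%R.
Proof.
move=> /andP[d0 de]; rewrite /gauss0; case: ifP => // t0.
rewrite /gauss ler_wpM2l ?gpeak_ge0// ler_expR ler_wpM2r ?powR_ge0//.
by rewrite lerN2 lerXn2r ?nnegrE// (le_trans d0).
Qed.

(** Up to a constant, the potential density of the [alpha / 2]-stable subordinator. *)
Definition tweight (t : R) : R := t `^ (alpha / 2 - 1).

Lemma tweight_ge0 t : (0 <= tweight t)%R. Proof. exact: powR_ge0. Qed.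

Lemma measurable_tweight : measurable_fun setT tweight.
Proof. exact: measurable_powR. Qed.

Let H (d t : R) : \bar R := (tweight t * gauss0 t d)%:E.

Let H_ge0 d t : 0 <= H d t.
Proof. by rewrite lee_fin mulr_ge0 ?tweight_ge0 ?gauss0_ge0. Qed.

Let mH d : measurable_fun setT (H d).
Proof.
apply/measurable_EFinP/measurable_funM; first exact: measurable_tweight.
exact: (measurable_fix2 measurable_gauss0).
Qed.

(** Here [3 <= n] enters: a decay of order [t ^ (- 3 / 2)] is integrable at infinity even for
    [alpha = 2], when the weight is constant. *)
Let gpeak_le1 (t : R) : (1 <= t)%R -> (gpeak n t <= t `^ (- 2^-1 - 1))%R.
Proof.
move=> t1; have t0 : (0 < t)%R by exact: lt_le_trans t1.
apply: (@le_trans _ _ (t `^ (- (n%:R / 2)))%R).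
  rewrite /gpeak !powRN lef_pV2 ?posrE ?powR_gt0 ?mulr_gt0 ?pi_gt0//.
  apply: ge0_ler_powR; rewrite ?nnegrE ?(ltW t0) ?divr_ge0 ?mulr_ge0 ?pi_ge0 ?(ltW t0)//.
  by rewrite ler_peMl ?(ltW t0)// (le_trans _ (pi_ge2 R))// ler1n.
rewrite ler_powR// -lerN2 opprK opprB opprK.
have : (3%:R <= n%:R :> R)%R by rewrite ler_nat.
lra.
Qed.

(** At distance [1] the factor [exp (- 1 / t)] beats every power of [1 / t]. The term of order
    [n + 1] of the exponential series absorbs [t ^ (- n)] from the peak and [t ^ (- 1)] from the
    weight. *)
Let H1_near0 (t : R) : (0 < t < 1)%R -> H 1 t <= (n.+1`!%:R)%:E.
Proof.
move=> /andP[t0 t1]; rewrite lee_fin /gauss0 t0 /gauss expr1n mulN1r powR_inv1 ?(ltW t0)//.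
have E : (expR (- t^-1) <= n.+1`!%:R * t ^+ n.+1)%R.
  rewrite expRN -[leRHS]invrK lef_pV2 ?posrE ?expR_gt0 ?invr_gt0 ?mulr_gt0 ?ltr0n ?fact_gt0 ?exprn_gt0//.
  rewrite invfM mulrC -exprVn.
  by apply: le_trans (expR_ge1Dxn n _); rewrite ?invr_ge0 ?(ltW t0)// lerDr.
have w1 : (tweight t <= t^-1)%R.
  rewrite /tweight -[leRHS](powR_inv1 (ltW t0)).
  rewrite ger_powR//; first by rewrite t0 ltW.
  by rewrite lerDr divr_ge0// ltW.
have g1 : (gpeak n t <= t^-1 ^+ n)%R.
  rewrite exprVn -powR_mulrn ?(ltW t0)// -powRN.
  apply: (@le_trans _ _ (t `^ (- (n%:R / 2)))%R).
    rewrite /gpeak !powRN lef_pV2 ?posrE ?powR_gt0 ?mulr_gt0 ?pi_gt0//.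
    apply: ge0_ler_powR; rewrite ?nnegrE ?(ltW t0) ?divr_ge0 ?mulr_ge0 ?pi_ge0 ?(ltW t0)//.
    by rewrite ler_peMl ?(ltW t0)// (le_trans _ (pi_ge2 R))// ler1n.
  rewrite ger_powR//; first by rewrite t0 ltW.
  by rewrite lerN2 ler_pdivrMr// ler_peMr// ler1n.
apply: (@le_trans _ _ (t^-1 * (t^-1 ^+ n * (n.+1`!%:R * t ^+ n.+1)))%R).
  apply: ler_pM => //; first exact: tweight_ge0.
    by rewrite mulr_ge0 ?gpeak_ge0 ?expR_ge0.
  by apply: ler_pM; rewrite ?gpeak_ge0 ?expR_ge0.
rewrite mulrA -exprS mulrCA -exprMn mulVf ?gt_eqF// expr1n mulr1.
exact: lexx.
Qed.

Let H1_nearoo (t : R) : (1 <= t)%R -> H 1 t <= (t `^ (- 2^-1 - 1))%:E.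
Proof.
move=> t1; have t0 : (0 < t)%R by exact: lt_le_trans t1.
rewrite lee_fin -[leRHS]mul1r; apply: ler_pM; rewrite ?tweight_ge0 ?gauss0_ge0//.
  apply: (@le_trans _ _ (t `^ 0)%R); last by rewrite powRr0.
  apply: ler_powR => //. by rewrite subr_le0 ler_pdivrMr// mul1r.
rewrite /gauss0 t0 /gauss -[leRHS]mulr1; apply: ler_pM; rewrite ?gpeak_ge0 ?expR_ge0 ?gpeak_le1//.
rewrite -[leRHS](expR0 R) ler_expR mulNr oppr_le0 mulr_ge0 ?powR_ge0// sqr_ge0.
Qed.

Lemma tint_fin : \int[leb]_t (H 1 t) < +oo.
Proof.
have -> : \int[leb]_t (H 1 t) = \int[leb]_(t in `]0%R, 1%R[ `|` `[1%R, +oo[) (H 1 t).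
  rewrite [RHS]integral_mkcond; apply: eq_integral => t _; rewrite patchE.
  case: ifPn => // /negP; rewrite inE/= !in_itv/= andbT => /not_orP[h1 h2].
  rewrite /H /gauss0; case: ifPn => [t0|_]; last by rewrite mulr0.
  by case: (ltP t 1%R) => [t1|t1]; [case: h1; rewrite t0|case: h2].
rewrite ge0_integral_setU//; last 2 first.
- exact: (measurable_funTS (mH 1%R)).
- apply/disj_setPS => t /= []; rewrite !in_itv/= andbT => /andP[_ t1] t1'.
  by move: (le_lt_trans t1' t1); rewrite ltxx.
apply: lte_add_pinfty.
  apply: (@le_lt_trans _ _ (\int[leb]_(t in `]0%R, 1%R[) (cst (n.+1`!%:R)%:E t))).
    apply: ge0_le_integral => //; first exact: (measurable_funTS (mH 1%R)).
  rewrite integral_cst//= lebesgue_measure_itv/= lte01 -EFinB -EFinM; exact: ltry.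
have b0 : (- 2^-1 < 0 :> R)%R by lra.
apply: le_lt_trans (integral_powR_nearoo b0).
apply: ge0_le_integral => //; first exact: (measurable_funTS (mH 1%R)).
  by apply/measurable_EFinP; apply: measurable_funTS; exact: measurable_powR.
by move=> t; rewrite /= in_itv/= andbT; exact: H1_nearoo.
Qed.

Lemma tint_gt0 : 0 < \int[leb]_t (H 1 t).
Proof.
apply: (@lt_le_trans _ _ (\int[leb]_(t in `[1%R, 2%R]) (H 1 t))).
  apply: integral_gt0 => //; first exact: (measurable_funTS (mH 1%R)).
    move=> t; rewrite /= in_itv/= => /andP[t1 _].
    have t0 : (0 < t)%R by exact: lt_le_trans t1.
    by rewrite lte_fin mulr_gt0 ?powR_gt0// /gauss0 t0 gauss_gt0.
  by rewrite /= lebesgue_measure_itv/= lte_fin ltr1n -EFinB lte_fin subr_gt0 ltr1n.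
by apply: ge0_subset_integral => //; exact: mH.
Qed.

(* The constant for which the mixture over all times is [d ^ (alpha - n)], see [riesz_kall]. *)
Definition Crz : R := (fine (\int[leb]_t (tweight t * gauss0 t 1)%:E))^-1.

Lemma Crz_gt0 : (0 < Crz)%R.
Proof. by rewrite invr_gt0 fine_gt0// tint_gt0 tint_fin. Qed.

Definition tdens (i : interval R) (t : R) : R := (Crz * \1_[set` i] t * tweight t)%R.

Lemma tdens_ge0 i t : (0 <= tdens i t)%R.
Proof. by rewrite !mulr_ge0 ?tweight_ge0// ltW// Crz_gt0. Qed.

Lemma measurable_tdens i : measurable_fun setT (tdens i).
Proof.
apply: measurable_funM; last exact: measurable_tweight.
by apply: measurable_funM => //; apply: measurable_indic; exact: measurable_itv.
Qed.

Definition tmeas (i : interval R) : {measure set (measurableTypeR R) -> \bar R} :=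
  densm leb (measurable_tdens i) (tdens_ge0 i).

Lemma tmeas_sigma_finite i : sigma_finite setT (tmeas i).
Proof. by apply: dens_sigma_finite; exact: sigma_finiteT. Qed.

Definition mix (tau : {measure set (measurableTypeR R) -> \bar R}) (d : R) : \bar R :=
  \int[tau]_t (gauss0 t d)%:E.

Lemma mix_ge0 tau d : 0 <= mix tau d.
Proof. by apply: integral_ge0 => t _; rewrite lee_fin gauss0_ge0. Qed.

Lemma mix_le tau (d e : R) : (0 <= d <= e)%R -> mix tau e <= mix tau d.
Proof.
move=> de; apply: ge0_le_integral => //.
- by move=> t _; rewrite lee_fin gauss0_ge0.
- by apply/measurable_EFinP; exact: (measurable_fix2 measurable_gauss0).
- by apply/measurable_EFinP; exact: (measurable_fix2 measurable_gauss0).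
- by move=> t _; rewrite lee_fin gauss0_le.
Qed.

Lemma measurable_mix (tau : {measure set (measurableTypeR R) -> \bar R}) :
  sigma_finite setT tau -> measurable_fun setT (mix tau).
Proof.
move=> spi; apply: (@measurable_int2 _ _ _ _ _ tau spi (fun d t => (gauss0 t d)%:E)).
  by apply/measurable_EFinP; exact: (measurable_swap2 measurable_gauss0).
by move=> d t; rewrite lee_fin gauss0_ge0.
Qed.

Definition kmix (i : interval R) (d : R) : \bar R :=
  \int[leb]_(t in [set` i]) (Crz * (tweight t * gauss0 t d))%:E.

Lemma kmix_mix i d : kmix i d = mix (tmeas i) d.
Proof.
apply/esym; rewrite /kmix /mix integral_dens; last 2 first.
- by apply/measurable_EFinP; exact: (measurable_fix2 measurable_gauss0).
- by move=> t; rewrite lee_fin gauss0_ge0.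
rewrite [RHS]integral_mkcond; apply: eq_integral => t _; rewrite patchE -EFinM /tdens.
rewrite indicE; case: ifPn => _; last by rewrite mulr0 !mul0r.
by rewrite mulr1 mulrA.
Qed.

Let mK d : measurable_fun setT (fun t => (Crz * (tweight t * gauss0 t d))%:E : \bar R).
Proof.
apply/measurable_EFinP/measurable_funM => //.
apply: measurable_funM; first exact: measurable_tweight.
exact: (measurable_fix2 measurable_gauss0).
Qed.

Let K_ge0 d t : 0 <= (Crz * (tweight t * gauss0 t d))%:E.
Proof. by rewrite lee_fin !mulr_ge0 ?tweight_ge0 ?gauss0_ge0// ltW// Crz_gt0. Qed.

Lemma kmix_sub (i j : interval R) d : [set` i] `<=` [set` j] -> kmix i d <= kmix j d.
Proof.
move=> ij; rewrite /kmix; apply: ge0_subset_integral => //.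
exact: (measurable_funTS (mK d)).
Qed.

Notation kall := (kmix `]-oo, +oo[).

Lemma kmix_split s d : kall d = kmix `]-oo, s] d + kmix `]s, +oo[ d.
Proof.
rewrite /kmix -ge0_integral_setU//.
- congr integral; apply/seteqP; split => t //=; rewrite !in_itv/= andbT => _.
  by apply/orP; case: leP.
- exact: (measurable_funTS (mK d)).
- apply/disj_setPS => t /= []; rewrite !in_itv/= andbT => h1 h2.
  by move: (lt_le_trans h2 h1); rewrite ltxx.
Qed.

Let tg_scale (c t d : R) : (0 < c)%R ->
  (tweight (c * t) * gauss0 (c * t) (Num.sqrt c * d) =
   c `^ (alpha / 2 - 1 - n%:R / 2) * (tweight t * gauss0 t d))%R.
Proof.
move=> c0; rewrite /gauss0 pmulr_rgt0//; case: ifPn => t0; last by rewrite !mulr0.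
have [c1 t1] := (ltW c0, ltW t0).
have E : (- (Num.sqrt c * d) ^+ 2 * (c * t) `^ (-1) = - d ^+ 2 * t `^ (-1))%R.
  rewrite exprMn sqr_sqrtr// powRM// !powR_inv1//.
  by field; rewrite !gt_eqF.
have cE : (c `^ (alpha / 2 - 1 - n%:R / 2) = c `^ (alpha / 2 - 1) * c `^ (- (n%:R / 2)))%R.
  by rewrite -powRD// (gt_eqF c0) implybT.
rewrite /tweight /gauss /gpeak E cE.
rewrite (powRM _ (pi_ge0 R) (mulr_ge0 c1 t1)) (powRM _ (pi_ge0 R) t1) !(powRM _ c1 t1).
by ring.
Qed.

(** Brownian scaling: times by [c], distances by [sqrt c]. The peak contributes [- n / 2] to the
    exponent, the weight together with the time differential [alpha / 2]. *)
Lemma kmix_scale (c s d : R) : (0 < c)%R ->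
  kmix `](c * s)%R, +oo[ (Num.sqrt c * d)%R = (c `^ (alpha / 2 - n%:R / 2))%:E * kmix `]s, +oo[ d.
Proof.
move=> c0; rewrite /kmix [in LHS]integral_mkcond [in RHS]integral_mkcond.
pose P (i : interval R) e : R -> \bar R := (fun t => (Crz * (tweight t * gauss0 t e))%:E) \_ [set` i].
have mF (i : interval R) e : measurable_fun setT (P i e).
  by apply/(measurable_restrictT _ _).1 => //; exact: (measurable_funTS (mK e)).
have F0 (i : interval R) e x : 0 <= P i e x.
  by rewrite /P patchE; case: ifP.
rewrite (@integral_homog R c _ (P `](c * s)%R, +oo[%R (Num.sqrt c * d)%R) (P `]s, +oo[%R d) c0
  (powR_ge0 c (alpha / 2 - 1 - n%:R / 2)) (mF _ _) (F0 _ _) (mF _ _) (F0 _ _)); last first.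
  move=> t; rewrite /P !patchE !mem_setE !in_itv/= !andbT ltr_pM2l//.
  case: ifPn => _; last by rewrite mule0.
  by rewrite tg_scale// -EFinM; congr EFin; rewrite mulrCA.
congr (_%:E * _); rewrite -[X in (X * _)%R](powRr1 (ltW c0)).
by rewrite -powRD ?(gt_eqF c0) ?implybT//; congr (_ `^ _)%R; ring.
Qed.

End time_mixtures.

(** * Size and monotonicity of the short and the long part *)

Section profile.
Local Open Scope ereal_scope.
Context (R : realType) (n : nat) (alpha : R).
Hypotheses (n3 : (3 <= n)%N) (alpha0 : (0 < alpha)%R) (alpha2 : (alpha <= 2)%R).
Local Notation leb := (@lebesgue_measure R).
Local Notation C := (Crz n alpha).
Local Notation w := (tweight alpha).

Definition klong (s d : R) : \bar R := kmix n alpha `]s, +oo[%R d.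
Definition kshort (s d : R) : \bar R := kmix n alpha `]-oo, s]%R d.
Definition kall (d : R) : \bar R := kmix n alpha `]-oo, +oo[%R d.

Let C0 : (0 < C)%R. Proof. exact: Crz_gt0. Qed.

Lemma ktime_ge0 t d : (0 <= C * (w t * gauss0 n t d))%R.
Proof. by rewrite mulr_ge0 ?(ltW C0)// mulr_ge0 ?tweight_ge0 ?gauss0_ge0. Qed.

Lemma measurable_ktime d : measurable_fun setT (fun t : R => (C * (w t * gauss0 n t d))%:E).
Proof.
apply/measurable_EFinP/measurable_funM => //.
apply: measurable_funM; first exact: measurable_tweight.
exact: (measurable_fix2 (@measurable_gauss0 R n)).
Qed.

Lemma kmixZl (i : interval R) (c d : R) : (0 <= c)%R ->
  \int[leb]_(t in [set` i]) (c%:E * (C * (w t * gauss0 n t d))%:E) = c%:E * kmix n alpha i d.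
Proof.
move=> c0; have H1 := measurable_funTS (D := [set` i]) (measurable_ktime d).
have H2 t : [set` i] t -> 0 <= (C * (w t * gauss0 n t d))%:E by move=> _; rewrite lee_fin ktime_ge0.
have H3 : 0 <= c%:E by rewrite lee_fin.
by rewrite ge0_integralZl.
Qed.

Lemma le_kmix (i : interval R) (c d e : R) : (0 <= c)%R ->
  (forall t, t \in i -> gauss0 n t d <= c * gauss0 n t e)%R ->
  kmix n alpha i d <= c%:E * kmix n alpha i e.
Proof.
move=> c0 H; rewrite -kmixZl//; apply: ge0_le_integral => //.
- by move=> t _; rewrite lee_fin ktime_ge0.
- exact: (measurable_funTS (measurable_ktime _)).
- by apply: measurable_funeM; exact: (measurable_funTS (measurable_ktime _)).
move=> t /H ct; rewrite -EFinM lee_fin [leRHS]mulrCA ler_wpM2l ?(ltW C0)//.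
by rewrite [leRHS]mulrCA ler_wpM2l ?tweight_ge0.
Qed.

Lemma kmix_ge0 i d : 0 <= kmix n alpha i d.
Proof. by apply: integral_ge0 => t _; rewrite lee_fin ktime_ge0. Qed.

Lemma kmix_anti i (d e : R) : (0 <= d <= e)%R -> kmix n alpha i e <= kmix n alpha i d.
Proof. by move=> de; rewrite !kmix_mix//; exact: mix_le. Qed.

Lemma kall_split s d : kall d = kshort s d + klong s d.
Proof. exact: kmix_split. Qed.

Lemma klong_le_kall s d : klong s d <= kall d.
Proof. by apply: kmix_sub. Qed.

Lemma kshort_le_kall s d : kshort s d <= kall d.
Proof. by apply: kmix_sub. Qed.

Lemma klong_anti s r d : (s <= r)%R -> klong r d <= klong s d.
Proof.
move=> sr; apply: kmix_sub => // t /=; rewrite !in_itv/= !andbT.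
exact: le_lt_trans.
Qed.

Lemma kall_pos : kall = klong 0.
Proof.
apply/funext => d; rewrite (kall_split 0 d) [kshort _ _]integral0_eq ?add0e//.
move=> t; rewrite /= in_itv/= => t0; rewrite /gauss0 ltNge t0/=.
by rewrite !mulr0.
Qed.

(** Scaling by [c = d ^ 2] reduces to distance [1], where [Crz] makes the mixture equal to [1]. *)
Lemma kall_gt0E (d : R) : (0 < d)%R -> kall d = (d `^ (alpha - n%:R))%:E.
Proof.
move=> d0; rewrite kall_pos /klong.
have := kmix_scale n3 alpha0 alpha2 0%R 1%R (exprn_gt0 2 d0).
rewrite mulr0 mulr1 sqrtr_sqr gtr0_norm// => ->.
have -> : kmix n alpha `]0%R, +oo[ 1%R = 1.
  have -> : kmix n alpha `]0%R, +oo[ 1%R = kall 1%R by rewrite kall_pos.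
  rewrite /kall /kmix.
  rewrite (_ : [set` `]-oo, +oo[%R] = setT); last by apply/seteqP; split => t //=; rewrite in_itv.
  under eq_integral do rewrite EFinM.
  rewrite ge0_integralZl//; last 3 first.
  - apply/measurable_EFinP/measurable_funM; first exact: measurable_tweight.
    exact: (measurable_fix2 (@measurable_gauss0 R n)).
  - by move=> t _; rewrite lee_fin mulr_ge0 ?tweight_ge0 ?gauss0_ge0.
  - by rewrite lee_fin ltW.
  have f0 := tint_gt0 n alpha; have foo := tint_fin n3 alpha0 alpha2.
  rewrite -[X in _ * X]fineK ?ge0_fin_numE ?(ltW f0)// -EFinM /Crz mulVf//.
  by rewrite gt_eqF// fine_gt0// f0 foo.
rewrite mule1; congr EFin; rewrite -(powR_mulrn 2 (ltW d0)) -powRrM.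
by congr (_ `^ _)%R; field.
Qed.

Lemma kall0 : kall 0 = +oo.
Proof.
have a0 : (alpha - n%:R < 0)%R.
  have : (3%:R <= n%:R :> R)%R by rewrite ler_nat.
  by move: alpha2; lra.
apply/eqyP => M M0; pose d := (M `^ (alpha - n%:R)^-1)%R.
have d0 : (0 < d)%R by rewrite powR_gt0.
apply: (@le_trans _ _ (kall d)); last by apply: kmix_anti => //; rewrite lexx ltW.
by rewrite kall_gt0E// /d -powRrM mulVf ?lt_eqF// powRr1// ltW.
Qed.

Lemma riesz_kall (x z : 'rV[R]_n) : riesz alpha x z = kall (edist x z).
Proof.
rewrite /riesz; case: eqVneq => [->|xz]; first by rewrite edistxx kall0.
by rewrite kall_gt0E// edist_gt0.
Qed.

(** At times above [s] a Gaussian at any distance is at most [exp (1 / s)] times the one at distance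
    [1], where the whole kernel is finite. *)
Lemma klong_fin s d : (0 < s)%R -> klong s d < +oo.
Proof.
move=> s0; apply: (@le_lt_trans _ _ ((expR s^-1)%:E * kall 1)); last first.
  by rewrite kall_gt0E// powR1 mule1 ltry.
apply: (@le_trans _ _ ((expR s^-1)%:E * klong s 1)); last first.
  by rewrite lee_wpmul2l ?lee_fin ?expR_ge0// klong_le_kall.
apply: le_kmix; first exact: expR_ge0.
move=> t; rewrite /= in_itv/= andbT => st; have t0 := lt_trans s0 st.
rewrite /gauss0 t0 /gauss [leRHS]mulrCA ler_wpM2l ?gpeak_ge0// -expRD ler_expR.
rewrite powR_inv1 ?(ltW t0)// expr1n mulN1r mulNr.
apply: (@le_trans _ _ 0%R); first by rewrite oppr_le0 mulr_ge0 ?sqr_ge0// invr_ge0 ltW.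
by rewrite subr_ge0 lef_pV2 ?posrE// ltW.
Qed.

Lemma klong_gt0 s d : (0 <= s)%R -> 0 < klong s d.
Proof.
move=> s0; apply: integral_gt0 => //.
- exact: (measurable_funTS (measurable_ktime _)).
- move=> t; rewrite /= in_itv/= andbT => st; have t0 := le_lt_trans s0 st.
  by rewrite lte_fin mulr_gt0// mulr_gt0 ?powR_gt0// /gauss0 t0 gauss_gt0.
- by rewrite /= lebesgue_measure_itv/= ltry addye// ltry.
Qed.

Lemma klong_scale0 s : (0 < s)%R -> klong s 0 = (s `^ (alpha / 2 - n%:R / 2))%:E * klong 1 0.
Proof.
move=> s0; have := kmix_scale n3 alpha0 alpha2 1%R 0%R s0.
by rewrite mulr1 mulr0.
Qed.

(** Half of the exponent [d ^ 2 / t] pays for the exponential factor; the other half leaves the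
    kernel at distance [d / sqrt 2], which costs [sqrt 2 ^ (n - alpha)], at most [2 ^ n]. *)
Lemma kshort_le (s rho d : R) : (0 < s)%R -> (0 <= rho <= d)%R ->
  kshort s d <= (2 ^+ n * expR (- rho ^+ 2 / (2 * s)))%:E * kall d.
Proof.
move=> s0 /andP[rho0 rhod]; have := le_trans rho0 rhod.
rewrite le_eqVlt => /predU1P[<-|d0].
  by rewrite kall0 gt0_muley ?leey// lte_fin mulr_gt0 ?exprn_gt0 ?expR_gt0.
apply: (@le_trans _ _ ((expR (- rho ^+ 2 / (2 * s)))%:E * kall (d / Num.sqrt 2)%R)).
  apply: (@le_trans _ _ ((expR (- rho ^+ 2 / (2 * s)))%:E * kshort s (d / Num.sqrt 2)%R)); last first.
    by rewrite lee_wpmul2l ?lee_fin ?expR_ge0// kshort_le_kall.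
  apply: le_kmix; first exact: expR_ge0.
  move=> t; rewrite /= in_itv/= => ts.
  rewrite /gauss0; case: ifPn => t0; last by rewrite mulr0.
  rewrite /gauss [leRHS]mulrCA ler_wpM2l ?gpeak_ge0// -expRD ler_expR.
  rewrite powR_inv1 ?(ltW t0)// exprMn exprVn sqr_sqrtr//.
  have -> : (- d ^+ 2 * t^-1 = - (d ^+ 2 / (2 * t)) + - (d ^+ 2 / 2) * t^-1)%R.
    by field; rewrite gt_eqF.
  rewrite lerD2r mulNr lerN2 ler_pdivrMr ?mulr_gt0// mulrAC ler_pdivlMr ?mulr_gt0//.
  apply: ler_pM; rewrite ?sqr_ge0 ?mulr_ge0 ?(ltW t0)//.
    by rewrite lerXn2r ?nnegrE// ltW.
  by rewrite ler_pM2l.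
rewrite [in leRHS]mulrC EFinM -muleA lee_wpmul2l ?lee_fin ?expR_ge0//.
have s2 : (0 < Num.sqrt 2 :> R)%R by rewrite sqrtr_gt0.
rewrite !kall_gt0E ?divr_gt0// -EFinM lee_fin.
rewrite -[(d / _)%R]mulrC powRM ?invr_ge0 ?(ltW s2) ?(ltW d0)//.
rewrite ler_wpM2r ?powR_ge0//.
rewrite -powR_inv1 ?(ltW s2)// -powRrM mulN1r opprB -powR_mulrn//.
apply: (@le_trans _ _ (Num.sqrt 2 `^ n%:R)%R).
  rewrite ler_powR ?gerBl ?(ltW alpha0)//.
  by rewrite -[X in (X <= _)%R]sqrtr1 ler_sqrt ?ler1n.
apply: ge0_ler_powR; rewrite ?nnegrE ?(ltW s2)//.
rewrite -[X in (X <= _)%R]mul1r -{2}(sqr_sqrtr (ler0n R 2)) expr2 ler_pM2r//.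
by rewrite -[X in (X <= _)%R]sqrtr1 ler_sqrt ?ler1n.
Qed.

Definition klow : R := (C * gpeak n 1 / 2)%R.

Lemma klow_gt0 : (0 < klow)%R.
Proof. by rewrite divr_gt0// mulr_gt0// gpeak_gt0. Qed.

(** For times between [s / 2] and [s] the exponent is at most [2 rho ^ 2 / s]; the weight is at
    least [1] because these times are at most [1]. The [2] in [klow] comes from the length [s / 2]
    of the interval. *)
Lemma kmix_lower (s rho d : R) : (0 < s <= 1)%R -> (0 <= d <= rho)%R ->
  (klow * expR (- (2 * rho ^+ 2 / s)))%:E <= kmix n alpha `](s / 2)%R, s] d.
Proof.
move=> /andP[s0 s1] /andP[d0 drho].
have s20 : (0 < s / 2)%R by rewrite divr_gt0.
have ss : (s / 2 < s)%R by rewrite gtr_pMr// invf_lt1// ltr1n.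
pose c := (C * (gpeak n s * expR (- (2 * rho ^+ 2 / s))))%R.
have c0 : (0 <= c)%R by rewrite mulr_ge0 ?(ltW C0)// mulr_ge0 ?gpeak_ge0 ?expR_ge0.
apply: (@le_trans _ _ (\int[leb]_(t in `](s / 2)%R, s]) (cst c%:E t))); last first.
  apply: ge0_le_integral => //.
  - exact: (measurable_funTS (measurable_ktime _)).
  move=> t; rewrite /= in_itv/= => /andP[st ts]; have t0 := lt_trans s20 st.
  rewrite lee_fin ler_wpM2l ?(ltW C0)// -[leLHS]mul1r; apply: ler_pM => //.
  - by rewrite mulr_ge0 ?gpeak_ge0 ?expR_ge0.
  - apply: (@le_trans _ _ (t `^ 0)%R); first by rewrite powRr0.
    rewrite /tweight ger_powR//; first by rewrite t0 (le_trans ts).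
    by rewrite subr_le0 ler_pdivrMr// mul1r.
  rewrite /gauss0 t0; apply: ler_pM; rewrite ?gpeak_ge0 ?expR_ge0//.
    rewrite /gpeak !powRN lef_pV2 ?posrE ?powR_gt0 ?mulr_gt0 ?pi_gt0//.
    by apply: ge0_ler_powR; rewrite ?nnegrE ?divr_ge0 ?mulr_ge0 ?pi_ge0 ?(ltW t0) ?(ltW s0)// ler_pM2l ?pi_gt0.
  rewrite ler_expR powR_inv1 ?(ltW t0)// mulNr lerN2 -mulrA.
  rewrite (_ : (2 * (rho ^+ 2 / s) = rho ^+ 2 * (s / 2)^-1)%R); last by field; rewrite gt_eqF.
  apply: ler_pM; rewrite ?sqr_ge0 ?invr_ge0 ?(ltW t0)//.
    by rewrite lerXn2r ?nnegrE// (le_trans d0).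
  by rewrite lef_pV2 ?posrE// ltW.
rewrite integral_cst//= lebesgue_measure_itv/= lte_fin ss -EFinB -EFinM lee_fin.
(* [gpeak n s * s] is a multiple of [s ^ (1 - n / 2)], and the exponent is negative. *)
have gs : (gpeak n 1 <= gpeak n s * s)%R.
  rewrite /gpeak mulr1 powRM ?pi_ge0 ?(ltW s0)// -mulrA ler_peMr ?powR_ge0//.
  rewrite -[X in (_ * X)%R](powRr1 (ltW s0)) -powRD; last by rewrite (gt_eqF s0) implybT.
  apply: (@le_trans _ _ (s `^ 0)%R); first by rewrite powRr0.
  rewrite ger_powR//; first by rewrite s0.
  have : (3%:R <= n%:R :> R)%R by rewrite ler_nat.
  lra.
rewrite /klow /c (_ : (s - s / 2 = s / 2)%R); last by field.
have -> : (C * (gpeak n s * expR (- (2 * rho ^+ 2 / s))) * (s / 2) =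
  (C * expR (- (2 * rho ^+ 2 / s)) / 2) * (gpeak n s * s))%R by ring.
have -> : (C * gpeak n 1 / 2 * expR (- (2 * rho ^+ 2 / s)) =
  (C * expR (- (2 * rho ^+ 2 / s)) / 2) * gpeak n 1)%R by ring.
by rewrite ler_wpM2l// divr_ge0// mulr_ge0 ?expR_ge0// ltW.
Qed.

Lemma kshort_lower (s rho d : R) : (0 < s <= 1)%R -> (0 <= d <= rho)%R ->
  (klow * expR (- (2 * rho ^+ 2 / s)))%:E <= kshort s d.
Proof.
move=> s01 drho; apply: le_trans (kmix_lower s01 drho) _.
by apply: kmix_sub => // t /=; rewrite !in_itv/= => /andP[].
Qed.

Lemma klong_split (s r d : R) : (s <= r)%R ->
  klong s d = kmix n alpha `]s, r] d + klong r d.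
Proof.
move=> sr; rewrite /klong /kmix -ge0_integral_setU//.
- congr integral; apply/seteqP; split => t /=; rewrite !in_itv/= !andbT.
    by move=> st; case: (leP t r) => tr; [left|right]; rewrite ?st.
  by move=> [/andP[]//|]; exact: le_lt_trans.
- exact: (measurable_funTS (measurable_ktime _)).
- by move=> t _; rewrite lee_fin ktime_ge0.
- apply/disj_setPS => t /= []; rewrite !in_itv/= andbT => /andP[_ h1] h2.
  by move: (lt_le_trans h2 h1); rewrite ltxx.
Qed.

(** Times between [1] and [2] contribute a definite amount, of which the fraction [1 - q] is lost at
    distance [delta], since there the exponent is at least [delta ^ 2 / 2]. The uniform gap is what
    forces [kmid s] to concentrate for small [s]. *)
Lemma klong1_strict (delta : R) : (0 < delta)%R -> exists2 e : R, (0 < e)%R &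
  forall d, (delta <= d)%R -> klong 1 d + e%:E <= klong 1 0.
Proof.
move=> delta0; pose q := expR (- (delta ^+ 2 / 2)).
have q1 : (q < 1)%R.
  by rewrite -[ltRHS](expR0 R) ltr_expR oppr_lt0 divr_gt0// exprn_gt0.
pose K := kmix n alpha `]1%R, 2%R].
have K0 : 0 < K 0%R.
  apply: integral_gt0 => //.
  - exact: (measurable_funTS (measurable_ktime _)).
  - move=> t; rewrite /= in_itv/= => /andP[st _]; have t0 := lt_trans ltr01 st.
    by rewrite lte_fin mulr_gt0// mulr_gt0 ?powR_gt0// /gauss0 t0 gauss_gt0.
  - by rewrite /= lebesgue_measure_itv/= lte_fin ltr1n -EFinB lte_fin subr_gt0 ltr1n.
have le12 : (1 <= 2 :> R)%R by rewrite ler1n.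
have Kfin : K 0%R \is a fin_num.
  rewrite ge0_fin_numE ?(ltW K0)//; apply: le_lt_trans (klong_fin 0%R ltr01).
  by rewrite (klong_split 0%R le12) leeDl// kmix_ge0.
exists ((1 - q) * fine (K 0%R))%R.
  by rewrite mulr_gt0 ?subr_gt0// fine_gt0// K0 -ge0_fin_numE// ltW.
move=> d deltad; have d0 : (0 <= d)%R by rewrite (le_trans (ltW delta0)).
rewrite !(klong_split _ le12) addeAC EFinM fineK//.
apply: leeD; last by apply: kmix_anti => //; rewrite lexx.
have : K d <= q%:E * K 0%R.
  apply: le_kmix; first exact: expR_ge0.
  move=> t; rewrite in_itv/= => /andP[st ts]; have t0 := lt_trans ltr01 st.
  rewrite /gauss0 t0 /gauss [leRHS]mulrCA ler_wpM2l ?gpeak_ge0// -expRD ler_expR.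
  rewrite expr0n/= oppr0 mul0r addr0 mulNr lerN2 powR_inv1 ?(ltW t0)//.
  apply: ler_pM; rewrite ?sqr_ge0 ?invr_ge0//.
    by rewrite lerXn2r ?nnegrE// ltW.
  by rewrite lef_pV2 ?posrE.
move=> /leeD2r - /(_ ((1 - q)%:E * K 0%R)) /le_trans; apply.
by rewrite -[leRHS]/(K 0%R) -(fineK Kfin) -!EFinM -EFinD lee_fin -mulrDl addrC subrK mul1r.
Qed.

Lemma klong_cvg d : klong k.+1%:R^-1 d @[k --> \oo] --> kall d.
Proof.
rewrite kall_pos /klong /kmix.
have -> : [set` `]0%R, +oo[%R] = \bigcup_k [set` `]k.+1%:R^-1, +oo[%R] :> set R.
  apply/seteqP; split => [x|x [k _]] /=; rewrite !in_itv/= !andbT.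
    move=> x0; have [N _ /(_ N (leqnn N)) Nx] := near_infty_natSinv_lt (PosNum x0).
    by exists N => //=; rewrite in_itv/= Nx.
  by apply: le_lt_trans; rewrite invr_ge0.
apply: ge0_nondecreasing_set_cvg_integral => //.
- apply/nondecreasing_seqP => k; apply/subsetPset => t /=; rewrite !in_itv/= !andbT.
  by apply: le_lt_trans; rewrite lef_pV2 ?posrE// ler_nat.
- by move=> k; exact: (measurable_funTS (measurable_ktime _)).
- by move=> k t _; rewrite lee_fin ktime_ge0.
Qed.

Lemma klong_nd d : nondecreasing_seq (fun k : nat => klong k.+1%:R^-1 d).
Proof.
by apply/nondecreasing_seqP => k; apply: klong_anti; rewrite lef_pV2 ?posrE// ler_nat.
Qed.

End profile.

(** * The mean-value kernels *)

Section reflection.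
Local Open Scope ereal_scope.
Context (R : realType).
Local Notation leb := (@lebesgue_measure R).

Lemma integral_opp (f : R -> \bar R) : measurable_fun setT f -> (forall x, 0 <= f x) ->
  \int[leb]_x f (- x)%R = \int[leb]_x f x.
Proof.
move=> mf f0.
have mphi : measurable_fun setT (fun x : measurableTypeR R => (- x)%R : measurableTypeR R).
  exact: oppr_measurable.
transitivity (\int[measure_function_pushforward__canonical__measure_function_Measure leb mphi]_x f x).
  by rewrite ge0_integral_pushforward.
by apply: eq_measure_integral => A mA _; exact: lebesgue_measureN.
Qed.

End reflection.

(** * The first-passage law of times for [alpha < 2] *)

Section beta.
Local Open Scope ereal_scope.
Context (R : realType) (a : R).
Hypotheses (a0 : (0 < a)%R) (a1 : (a < 1)%R).
Local Notation leb := (@lebesgue_measure R).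

(* The mixing measure of [kmid s] is a Beta distribution in the inverse time. *)
Definition betad (x : R) : R := if (0 < x < 1)%R then (x `^ (a - 1) * (1 - x) `^ (- a))%R else 0%R.

Lemma betad_ge0 x : (0 <= betad x)%R.
Proof. by rewrite /betad; case: ifP => // _; rewrite mulr_ge0 ?powR_ge0. Qed.

Lemma measurable_betad : measurable_fun setT betad.
Proof.
apply: measurable_fun_ifT => //.
  by apply: measurable_and; apply: measurable_fun_ltr.
apply: measurable_funM; first exact: measurable_powR.
apply: (@measurableT_comp _ _ _ _ _ _ (fun x : R => x `^ (- a))%R); first exact: measurable_powR.
exact: measurable_funB.
Qed.

Definition pow01 (b x : R) : R := if (0 < x < 1)%R then (x `^ (b - 1))%R else 0%R.

Let pow01_ge0 b x : (0 <= pow01 b x)%R.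
Proof. by rewrite /pow01; case: ifP => // _; rewrite powR_ge0. Qed.

Let measurable_pow01 b : measurable_fun setT (pow01 b).
Proof.
apply: measurable_fun_ifT => //.
by apply: measurable_and; apply: measurable_fun_ltr.
Qed.

Let int_pow01 b : (0 < b)%R -> \int[leb]_x (pow01 b x)%:E < +oo.
Proof.
move=> b0; apply: le_lt_trans (integral_powR_near0 b0).
rewrite [leRHS]integral_mkcond; apply: ge0_le_integral => //.
- by move=> x _; rewrite lee_fin.
- by apply/measurable_EFinP; exact: measurable_pow01.
- apply/(measurable_restrictT _ _).1 => //; apply/measurable_EFinP.
  by apply: measurable_funTS; exact: measurable_powR.
- move=> x _; rewrite patchE mem_setE in_itv/= /pow01; case: ifP => //.
Qed.

(** Split at [1 / 2]: on each half one of the two singular factors is at most [2]. *)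
Let betad_le x : (betad x <= 2 * pow01 a x + 2 * pow01 (1 - a) (1 - x))%R.
Proof.
rewrite /betad /pow01 subr_gt0 ltrBlDr ltrDl andbC.
case: ifPn => [/andP[x1 x0]|_]; last by rewrite !mulr0 addr0.
have h (y b : R) : (2^-1 <= y)%R -> (-1 <= b <= 0)%R -> (y `^ b <= 2)%R.
  move=> hy /andP[b1 b0]; have hy0 : (0 < y)%R by apply: lt_le_trans hy; rewrite invr_gt0.
  rewrite -[b]opprK powRN -[leRHS]invrK lef_pV2 ?posrE ?invr_gt0 ?powR_gt0//.
  apply: (@le_trans _ _ (2^-1 `^ (- b))%R); last first.
    by apply: ge0_ler_powR; rewrite ?nnegrE ?oppr_ge0// ltW.
  apply: (@le_trans _ _ (2^-1 `^ 1)%R); first by rewrite powRr1// invr_ge0.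
  rewrite ger_powR// ?invr_gt0 ?ltr0n/= ?invf_le1 ?ler1n//.
  by rewrite lerNl.
case: (leP x 2^-1%R) => hx.
  apply: (@le_trans _ _ (2 * x `^ (a - 1))%R); last by rewrite lerDl mulr_ge0 ?powR_ge0.
  rewrite mulrC ler_wpM2r ?powR_ge0// h//; first by lra.
  by rewrite lerN2 (ltW a1)/= oppr_le0 ltW.
apply: (@le_trans _ _ (2 * (1 - x) `^ (1 - a - 1))%R); last by rewrite lerDr mulr_ge0 ?powR_ge0.
rewrite (_ : (1 - a - 1 = - a)%R); last by ring.
rewrite ler_wpM2r ?powR_ge0// h//; first exact: ltW.
by apply/andP; split; [rewrite lerBrDr addNr ltW|rewrite subr_le0 ltW].
Qed.

Lemma betad_fin : \int[leb]_x (betad x)%:E < +oo.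
Proof.
have m1 : measurable_fun setT (fun x : R => (pow01 a x)%:E).
  by apply/measurable_EFinP; exact: measurable_pow01.
have m2 : measurable_fun setT (fun x : R => (pow01 (1 - a) (1 - x))%:E).
  by apply/measurable_EFinP; apply: (measurableT_comp (measurable_pow01 _)); exact: measurable_funB.
apply: (@le_lt_trans _ _ (\int[leb]_x (2%:E * (pow01 a x)%:E + 2%:E * (pow01 (1 - a) (1 - x))%:E))).
  apply: ge0_le_integral => //.
  - by move=> x _; rewrite lee_fin betad_ge0.
  - by apply/measurable_EFinP; exact: measurable_betad.
  - by apply: emeasurable_funD; exact: measurable_funeM.
  - by move=> x _; rewrite -!EFinM -EFinD lee_fin.
rewrite ge0_integralD//; last 4 first.
- by move=> x _; rewrite mule_ge0 ?lee_fin.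
- exact: measurable_funeM.
- by move=> x _; rewrite mule_ge0 ?lee_fin.
- exact: measurable_funeM.
apply: lte_add_pinfty.
  rewrite ge0_integralZl//; last by move=> x _; rewrite lee_fin.
  by apply: lte_mul_pinfty; rewrite ?lee_fin// int_pow01.
rewrite ge0_integralZl//; last by move=> x _; rewrite lee_fin.
apply: lte_mul_pinfty; rewrite ?lee_fin//.
pose g x := (pow01 (1 - a) (1 + x))%:E.
have mg : measurable_fun setT g.
  by apply/measurable_EFinP; apply: (measurableT_comp (measurable_pow01 _)); exact: measurable_funD.
have -> : \int[leb]_x (pow01 (1 - a) (1 - x))%:E = \int[leb]_x (g (- x)%R) by [].
rewrite integral_opp//; last by move=> x; rewrite lee_fin.
have -> : \int[leb]_x g x = \int[leb]_x (pow01 (1 - a) (1 * x + 1))%:E.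
  by apply: eq_integral => x _; rewrite /g mul1r [(x + 1)%R]addrC.
rewrite (@integral_affine R 1%R 1%R (fun x => (pow01 (1 - a) x)%:E))//; last 2 first.
- by apply/measurable_EFinP; exact: measurable_pow01.
- by move=> x; rewrite lee_fin.
by rewrite invr1 mul1e int_pow01// subr_gt0.
Qed.

Lemma betad_gt0 : 0 < \int[leb]_x (betad x)%:E.
Proof.
apply: (@lt_le_trans _ _ (\int[leb]_(x in `]0%R, 1%R[) (betad x)%:E)).
  apply: integral_gt0 => //.
  - by apply/measurable_EFinP; apply: measurable_funTS; exact: measurable_betad.
  - move=> x; rewrite /= in_itv/= => x01; rewrite lte_fin /betad x01.
    by case/andP: x01 => x0 x1; rewrite mulr_gt0 ?powR_gt0 ?subr_gt0.
  - by rewrite /= lebesgue_measure_itv/= lte01 oppr0 adde0 lte01.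
apply: ge0_subset_integral => //.
- by apply/measurable_EFinP; exact: measurable_betad.
- by move=> x _; rewrite lee_fin betad_ge0.
Qed.

Definition Beta : R := fine (\int[leb]_x (betad x)%:E).

Lemma Beta_gt0 : (0 < Beta)%R.
Proof. by rewrite fine_gt0// betad_gt0 betad_fin. Qed.

Lemma BetaE : \int[leb]_x (betad x)%:E = Beta%:E.
Proof. by rewrite fineK// ge0_fin_numE ?(ltW betad_gt0)// betad_fin. Qed.

(** A density in the inverse time [p = 1 / u]. In the time [u] it reads [s ^ a / (u (u - s) ^ a)]
    over the Beta constant, for [u > s]: the law of an [a]-stable subordinator at its first passage
    over [s]. *)
Definition etad (s p : R) : R :=
  if (0 < p < s^-1)%R then (Beta^-1 * s `^ a * (p `^ (a - 1) * (1 - s * p) `^ (- a)))%R else 0%R.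

Lemma etad_ge0 s p : (0 <= etad s p)%R.
Proof.
rewrite /etad; case: ifP => // _.
by rewrite !mulr_ge0 ?invr_ge0 ?powR_ge0 ?(ltW Beta_gt0).
Qed.

Lemma measurable_etad s : measurable_fun setT (etad s).
Proof.
apply: measurable_fun_ifT => //.
  by apply: measurable_and; apply: measurable_fun_ltr.
apply: measurable_funM => //; apply: measurable_funM; first exact: measurable_powR.
apply: (@measurableT_comp _ _ _ _ _ _ (fun x : R => x `^ (- a))%R); first exact: measurable_powR.
by apply: measurable_funB => //; exact: measurable_funM.
Qed.

Let minv : measurable_fun setT (fun p : measurableTypeR R => (p `^ (-1))%R : measurableTypeR R).
Proof. exact: measurable_powR. Qed.

Definition eta0 (s : R) : {measure set (measurableTypeR R) -> \bar R} :=
  measure_function_pushforward__canonical__measure_function_Measure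
    (densm leb (measurable_etad s) (etad_ge0 s)) minv.

Lemma integral_eta0 s (f : R -> \bar R) : measurable_fun setT f -> (forall x, 0 <= f x) ->
  \int[eta0 s]_u f u = \int[leb]_p ((etad s p)%:E * f (p `^ (-1))%R).
Proof.
move=> mf f0; rewrite ge0_integral_pushforward// integral_dens//.
  exact: (measurableT_comp mf minv).
by move=> x; exact: f0.
Qed.

(** In terms of the subordinator this is the strong Markov property: beyond [s], the potential
    density is that of the process restarted from its first-passage point. In inverse time,
    [r - 1 / p = (r / p) (p - 1 / r)], and an affine substitution leaves the Beta integral. *)
Lemma eta0_key (s r : R) : (0 < s)%R ->
  \int[eta0 s]_u (if (0 < u < r)%R then (r - u) `^ (a - 1) else 0%R)%:E =
  (if (s < r)%R then r `^ (a - 1) else 0%R)%:E.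
Proof.
move=> s0; rewrite integral_eta0; last 2 first.
- apply/measurable_EFinP; apply: measurable_fun_ifT => //.
    by apply: measurable_and; apply: measurable_fun_ltr.
  apply: (@measurableT_comp _ _ _ _ _ _ (fun x : R => x `^ (a - 1))%R); first exact: measurable_powR.
  exact: measurable_funB.
- by move=> u; rewrite lee_fin; case: ifP => // _; rewrite powR_ge0.
have [rs|sr] := leP r s.
  rewrite integral0_eq// => p _; rewrite /etad; case: ifPn => [/andP[p0 ps]|_]; last by rewrite mul0e.
  rewrite powR_inv1 ?(ltW p0)// [X in if X then _ else _](_ : _ = false) ?mule0//.
  apply/negbTE; rewrite negb_and -!leNgt; apply/orP; right; rewrite (le_trans rs)//.
  by rewrite -[leLHS]invrK lef_pV2 ?posrE ?invr_gt0// ltW.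
have r0 : (0 < r)%R by exact: lt_trans sr.
(* The substitution [p = del * x + r^-1] maps [(0, 1)] onto [(r^-1, s^-1)]. *)
pose del := (s^-1 - r^-1)%R.
have del0 : (0 < del)%R by rewrite subr_gt0 ltf_pV2 ?posrE.
pose F (p : R) : R := if (r^-1 < p < s^-1)%R then
  (Beta^-1 * s `^ a * (r `^ (a - 1) * (p - r^-1) `^ (a - 1) * (1 - s * p) `^ (- a)))%R else 0%R.
transitivity (\int[leb]_p (F p)%:E).
  apply: eq_integral => p _; rewrite -EFinM; congr EFin; rewrite /etad /F.
  have [p0|p0] := ltP 0%R p; last first.
    rewrite mul0r ifF//; apply/negbTE; rewrite negb_and -leNgt (le_trans p0)//.
    by rewrite invr_ge0 ltW.
  rewrite powR_inv1 ?(ltW p0)// invr_gt0 p0/=.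
  rewrite (_ : (p^-1 < r)%R = (r^-1 < p)%R); last first.
    by rewrite -[RHS]ltf_pV2 ?posrE ?invr_gt0// invrK.
  case: (ltP r^-1%R p) => rp /=; case: (ltP p s^-1%R) => ps /=; rewrite ?mulr0 ?mul0r//.
  have -> : (r - p^-1 = r * p^-1 * (p - r^-1))%R by field; rewrite !gt_eqF.
  rewrite powRM; last 2 first.
  - by rewrite divr_ge0 ?(ltW r0) ?(ltW p0).
  - by rewrite subr_ge0 ltW.
  rewrite powRM ?invr_ge0 ?(ltW r0) ?(ltW p0)//.
  have -> : (p^-1 `^ (a - 1) = (p `^ (a - 1))^-1)%R.
    by rewrite -powR_inv1 ?(ltW p0)// -powRrM mulN1r powRN.
  have pa0 : (p `^ (a - 1) != 0)%R by rewrite gt_eqF// powR_gt0.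
  by field; rewrite pa0 (gt_eqF Beta_gt0).
have mF : measurable_fun setT (fun p => (F p)%:E).
  apply/measurable_EFinP; apply: measurable_fun_ifT => //.
    by apply: measurable_and; apply: measurable_fun_ltr.
  apply: measurable_funM => //; apply: measurable_funM.
    apply: measurable_funM => //.
    apply: (@measurableT_comp _ _ _ _ _ _ (fun x : R => x `^ (a - 1))%R); first exact: measurable_powR.
    exact: measurable_funB.
  apply: (@measurableT_comp _ _ _ _ _ _ (fun x : R => x `^ (- a))%R); first exact: measurable_powR.
  by apply: measurable_funB => //; exact: measurable_funM.
have F0 p : 0 <= (F p)%:E.
  rewrite lee_fin /F; case: ifP => // _.
  by rewrite !mulr_ge0 ?invr_ge0 ?powR_ge0 ?(ltW Beta_gt0).
have mb : measurable_fun setT (fun p => (betad p)%:E).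
  by apply/measurable_EFinP; exact: measurable_betad.
have b0 p : 0 <= (betad p)%:E by rewrite lee_fin betad_ge0.
have := integral_affine r^-1%R del0 mF F0.
under eq_integral => x _.
  have -> : (F (del * x + r^-1))%:E = (Beta^-1 * r `^ (a - 1) * del^-1)%:E * (betad x)%:E.
    rewrite -EFinM; congr EFin; rewrite /F /betad ltrDr pmulr_rgt0//.
    rewrite -ltrBrDr -/del gtr_pMr//; case: ifPn => [/andP[x0 x1]|_]; last by rewrite mulr0.
    rewrite addrK powRM ?(ltW del0) ?(ltW x0)//.
    have -> : (1 - s * (del * x + r^-1) = s * del * (1 - x))%R.
      by rewrite /del; field; rewrite !gt_eqF.
    rewrite powRM ?subr_ge0 ?(ltW x1) ?mulr_ge0 ?(ltW s0) ?(ltW del0)//.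
    rewrite powRM ?(ltW s0) ?(ltW del0)//.
    rewrite (powRN s) (_ : (del^-1 = del `^ (a - 1) * del `^ (- a))%R); last first.
      rewrite -powRD ?(gt_eqF del0) ?implybT// (_ : (a - 1 + - a = - 1)%R) ?powR_inv1 ?ltW//.
      by ring.
    have sa0 : (s `^ a != 0)%R by rewrite gt_eqF// powR_gt0.
    have Bn0 : (Beta != 0)%R by rewrite gt_eqF// Beta_gt0.
    by field; rewrite sa0 Bn0.
  over.
rewrite ge0_integralZl//; last first.
  by rewrite lee_fin !mulr_ge0 ?invr_ge0 ?powR_ge0 ?(ltW Beta_gt0) ?(ltW del0).
rewrite BetaE -EFinM => /(congr1 (fun x => del%:E * x)).
rewrite muleA -EFinM -EFinM divff ?gt_eqF// mul1e => <-; congr EFin.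
by field; rewrite !gt_eqF ?Beta_gt0.
Qed.

Lemma eta0_mass (s : R) : (0 < s)%R -> eta0 s setT = 1.
Proof.
move=> s0; have is0 : (0 < s^-1)%R by rewrite invr_gt0.
rewrite /= /pushforward preimage_setT /dens.
have mF : measurable_fun setT (fun p => (etad s p)%:E).
  by apply/measurable_EFinP; exact: measurable_etad.
have F0 p : 0 <= (etad s p)%:E by rewrite lee_fin etad_ge0.
have mb : measurable_fun setT (fun p => (betad p)%:E).
  by apply/measurable_EFinP; exact: measurable_betad.
have b0 p : 0 <= (betad p)%:E by rewrite lee_fin betad_ge0.
have E x : (etad s (s^-1 * x + 0))%:E = (Beta^-1 * s)%:E * (betad x)%:E.
    rewrite addr0 -EFinM; congr EFin; rewrite /etad /betad pmulr_rgt0//.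
    rewrite gtr_pMr//; case: ifPn => [/andP[x0 x1]|_]; last by rewrite mulr0.
    rewrite powRM ?(ltW is0) ?(ltW x0)// (mulVKf (lt0r_neq0 s0)).
    have -> : (s^-1 `^ (a - 1) = s * (s `^ a)^-1)%R.
      rewrite -powR_inv1 ?(ltW s0)// -powRrM mulN1r opprB powRD ?(gt_eqF s0) ?implybT//.
      by rewrite powRr1 ?(ltW s0)// powRN.
    have sa0 : (s `^ a != 0)%R by rewrite gt_eqF// powR_gt0.
    by field; rewrite sa0 gt_eqF// Beta_gt0.
have := integral_affine 0%R is0 mF F0.
rewrite (_ : (fun x : R => (etad s (s^-1 * x + 0))%:E) =
  (fun x : R => (Beta^-1 * s)%:E * (betad x)%:E)); last by apply/funext.
rewrite ge0_integralZl//; last by rewrite lee_fin mulr_ge0 ?invr_ge0 ?(ltW Beta_gt0) ?(ltW s0).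
rewrite BetaE -EFinM invrK => /(congr1 (fun x => s^-1%:E * x)).
rewrite muleA -!EFinM mulVf ?gt_eqF// mul1e => <-; congr EFin.
by field; rewrite !gt_eqF ?Beta_gt0.
Qed.

End beta.

Section eta.
Local Open Scope ereal_scope.
Context (R : realType).
Local Notation leb := (@lebesgue_measure R).

(** The conditions on [alpha] and [s] sit under the existential, so that [etam] is a total function.
    For [alpha = 2] the subordinator is a pure drift and the law a point mass at [s]. The third
    clause expresses that the law lives on times at least [s]; the last bounds it below by the large
    jumps, whose size does not shrink with [s]. *)
Lemma eta_exists (alpha s : R) : exists eta : {measure set (measurableTypeR R) -> \bar R},
  (0 < alpha)%R -> (alpha <= 2)%R -> (0 < s)%R ->
  [/\ eta setT = 1,
   forall r, \int[eta]_u (if (0 < u < r)%R then (r - u) `^ (alpha / 2 - 1) else 0%R)%:E =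
     (if (s < r)%R then r `^ (alpha / 2 - 1) else 0%R)%:E,
   forall f g : R -> \bar R, measurable_fun setT f -> (forall x, 0 <= f x) ->
     measurable_fun setT g -> (forall x, 0 <= g x) ->
     (forall u, (s <= u)%R -> f u <= g u) -> \int[eta]_u f u <= \int[eta]_u g u,
   alpha = 2%R -> eta = @dirac _ (measurableTypeR R) s R &
   forall f : R -> \bar R, measurable_fun setT f -> (forall x, 0 <= f x) ->
    (alpha < 2)%R -> (s <= 2^-1)%R ->
    (s `^ (alpha / 2))%:E *
      \int[leb]_(p in `]1%R, 2%R[) (((Beta (alpha / 2))^-1 * p `^ (alpha / 2 - 1))%:E * f (p `^ (-1))%R)
    <= \int[eta]_u f u].
Proof.
have [[alpha0 alpha2]|] := pselect (0 < alpha /\ alpha <= 2)%R; last first.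
  by move=> h; exists (@dirac _ (measurableTypeR R) s R) => h1 h2; case: h.
have [->|alphan2] := eqVneq alpha 2%R.
  exists (@dirac _ (measurableTypeR R) s R) => _ _ s0; split.
  - by rewrite /= /dirac indicE in_setT.
  - move=> r; rewrite divff// subrr integral_dirac//; last first.
      apply/measurable_EFinP; apply: measurable_fun_ifT => //.
        by apply: measurable_and; apply: measurable_fun_ltr.
      apply: (@measurableT_comp _ _ _ _ _ _ (fun x : R => x `^ 0)%R); first exact: measurable_powR.
      exact: measurable_funB.
    by rewrite diracE in_setT mul1e s0/= !powRr0.
  - move=> f g mf f0 mg g0 fg.
    by rewrite !integral_dirac// diracE in_setT !mul1e fg.
  - by [].
  - by move=> f _ _; rewrite ltxx.
have a0 : (0 < alpha / 2)%R by rewrite divr_gt0.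
have a1 : (alpha / 2 < 1)%R by rewrite ltr_pdivrMr// mul1r lt_neqAle alphan2.
exists (eta0 a0 a1 s) => _ _ s0; split.
- exact: eta0_mass.
- by move=> r; exact: eta0_key.
- move=> f g mf f0 mg g0 fg; rewrite !integral_eta0//.
  apply: ge0_le_integral => //.
  + by move=> p _; rewrite mule_ge0 ?lee_fin ?etad_ge0.
  + apply: emeasurable_funM; first by apply/measurable_EFinP; exact: measurable_etad.
    exact: (measurableT_comp mf (@measurable_powR R (-1))).
  + apply: emeasurable_funM; first by apply/measurable_EFinP; exact: measurable_etad.
    exact: (measurableT_comp mg (@measurable_powR R (-1))).
  move=> p _; rewrite /etad; case: ifPn => [/andP[p0 ps]|_]; last by rewrite !mul0e.
  apply: lee_wpmul2l.
    by rewrite lee_fin !mulr_ge0 ?invr_ge0 ?powR_ge0 ?(ltW (Beta_gt0 a0 a1)).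
  apply: fg; rewrite powR_inv1 ?(ltW p0)// -[leLHS]invrK lef_pV2 ?posrE ?invr_gt0//.
  exact: ltW.
- by move=> h; rewrite h eqxx in alphan2.
- move=> f mf f0 _ s2; rewrite integral_eta0// -ge0_integralZl//; last 3 first.
  + apply: measurable_funTS; apply: emeasurable_funM.
      apply/measurable_EFinP/measurable_funM => //; exact: measurable_powR.
    exact: (measurableT_comp mf (@measurable_powR R (-1))).
  + by move=> p _; rewrite mule_ge0// lee_fin mulr_ge0 ?invr_ge0 ?powR_ge0 ?(ltW (Beta_gt0 a0 a1)).
  + by rewrite lee_fin powR_ge0.
  rewrite integral_mkcond; apply: ge0_le_integral => //.
  + move=> p _; rewrite patchE; case: ifP => // _; rewrite !mule_ge0// ?lee_fin ?powR_ge0//.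
    by rewrite mulr_ge0 ?invr_ge0 ?powR_ge0 ?(ltW (Beta_gt0 a0 a1)).
  + apply/(measurable_restrictT _ _).1 => //; apply: measurable_funTS; apply: measurable_funeM.
    apply: emeasurable_funM.
      apply/measurable_EFinP/measurable_funM => //; exact: measurable_powR.
    exact: (measurableT_comp mf (@measurable_powR R (-1))).
  + apply: emeasurable_funM; first by apply/measurable_EFinP; exact: measurable_etad.
    exact: (measurableT_comp mf (@measurable_powR R (-1))).
  move=> p _; rewrite patchE mem_setE in_itv/=; case: ifPn => [/andP[p1 p2]|_]; last first.
    by rewrite mule_ge0// lee_fin etad_ge0.
  have p0 : (0 < p)%R by exact: lt_trans p1.
  have sp : (p < s^-1)%R.
    by apply: (lt_le_trans p2); rewrite -[leLHS]invrK lef_pV2 ?posrE ?invr_gt0.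
  rewrite /etad p0 sp/= muleA -EFinM lee_wpmul2r// lee_fin.
  rewrite (_ : (s `^ (alpha / 2) * ((Beta (alpha / 2))^-1 * p `^ (alpha / 2 - 1)) =
     (Beta (alpha / 2))^-1 * s `^ (alpha / 2) * p `^ (alpha / 2 - 1))%R); last by ring.
  rewrite mulrA ler_peMr//.
    by rewrite !mulr_ge0 ?invr_ge0 ?powR_ge0 ?(ltW (Beta_gt0 a0 a1)).
  have sp0 : (0 < 1 - s * p)%R by rewrite subr_gt0 -ltr_pdivlMl// mulr1.
  rewrite powRN -[leLHS]invr1 lef_pV2 ?posrE ?powR_gt0//.
  apply: (@le_trans _ _ ((1 - s * p) `^ 0)%R); last by rewrite powRr0.
  by rewrite ger_powR ?sp0 ?gerBl ?mulr_ge0 ?ltW.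
Qed.

End eta.

Lemma measurable_comp2 d1 d2 d3 d4 (T1 : measurableType d1) (T2 : measurableType d2)
  (T3 : measurableType d3) (S : measurableType d4) (f : T1 -> T2 -> T3) (g : S -> T1) (h : S -> T2) :
  measurable_fun setT (fun p : T1 * T2 => f p.1 p.2) ->
  measurable_fun setT g -> measurable_fun setT h ->
  measurable_fun setT (fun x => f (g x) (h x)).
Proof.
move=> mf mg mh.
apply: (measurableT_comp (f := fun p : T1 * T2 => f p.1 p.2) (g := fun x => (g x, h x))) => //.
exact/measurable_fun_pairP.
Qed.

(** * Convolution of Gaussian mixtures *)

Section mix_composition.
Local Open Scope ereal_scope.
Context (R : realType) (n : nat).
Local Notation L := (Leb R n).
Local Notation T := (RnB R n).
Local Notation time := {measure set (measurableTypeR R) -> \bar R}.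

Definition gauss2 (t u d : R) : R :=
  if (0 < t)%R && (0 < u)%R then gauss n (t + u) d else 0%R.

Lemma gauss2_ge0 t u d : (0 <= gauss2 t u d)%R.
Proof. by rewrite /gauss2; case: ifP => // _; exact: gauss_ge0. Qed.

Lemma gauss2C t u d : gauss2 t u d = gauss2 u t d.
Proof. by rewrite /gauss2 andbC addrC. Qed.

Lemma measurable_gauss2d d : measurable_fun setT
  (fun p : measurableTypeR R * measurableTypeR R => gauss2 p.1 p.2 d).
Proof.
apply: measurable_fun_ifT => //.
  by apply: measurable_and; apply: measurable_fun_ltr.
apply: (@measurableT_comp _ _ _ _ _ _ (fun t : measurableTypeR R => gauss n t d)).
  exact: (measurable_fix2 (@measurable_gauss2 R n)).
by apply: measurable_funD; [exact: measurable_fst|exact: measurable_snd].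
Qed.

Lemma gauss0_conv (t u : R) (x w : 'rV[R]_n) :
  \int[L]_z ((gauss0 n t (edist x z))%:E * (gauss0 n u (edist (z : 'rV[R]_n) w))%:E) =
  (gauss2 t u (edist x w))%:E.
Proof.
rewrite /gauss0 /gauss2; case: (ltP 0%R t) => t0; last by under eq_integral do rewrite mul0e; rewrite integral0.
case: (ltP 0%R u) => u0; last by under eq_integral do rewrite mule0; rewrite integral0.
rewrite -(gauss_conv x w t0 u0); apply: eq_integral => z _; by rewrite -EFinM.
Qed.

(* Convolution of Gaussians adds their times. *)
Definition mixc (tau1 tau2 : time) (d : R) : \bar R :=
  \int[tau1]_t \int[tau2]_u (gauss2 t u d)%:E.

Lemma mixcC (tau1 tau2 : time) d : sigma_finite setT tau1 -> sigma_finite setT tau2 ->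
  mixc tau1 tau2 d = mixc tau2 tau1 d.
Proof.
move=> s1 s2.
have mg : measurable_fun setT (fun p : measurableTypeR R * measurableTypeR R =>
    (gauss2 p.1 p.2 d)%:E : \bar R).
  by apply/measurable_EFinP; exact: measurable_gauss2d.
have g0 (t u : measurableTypeR R) : 0 <= (gauss2 t u d)%:E by rewrite lee_fin gauss2_ge0.
apply: (etrans (@tonelli _ _ _ _ _ _ _ s1 s2 (fun t u => (gauss2 t u d)%:E) mg g0)).
by apply: eq_integral => u _; apply: eq_integral => t _; rewrite gauss2C.
Qed.

Lemma measurable_edist1 (x : 'rV[R]_n) : measurable_fun setT (fun z : T => edist x z).
Proof. exact: (measurable_fix1 (@measurable_edist R n)). Qed.

Lemma measurable_edist2 (x : 'rV[R]_n) : measurable_fun setT (fun z : T => edist (z : 'rV[R]_n) x).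
Proof. exact: (measurable_fix2 (@measurable_edist R n)). Qed.

Lemma measurable_gauss0_edist (x : 'rV[R]_n) : measurable_fun setT
  (fun p : T * measurableTypeR R => (gauss0 n p.2 (edist x (p.1 : 'rV[R]_n)))%:E : \bar R).
Proof.
apply/measurable_EFinP; apply: (measurable_comp2 (@measurable_gauss0 R n)).
  exact: measurable_snd.
exact: (measurableT_comp (measurable_edist1 x) measurable_fst).
Qed.

(** By Tonelli the space integral is done first, and the Gaussian semigroup evaluates it. *)
Lemma mix_comp (tau1 tau2 : time) (x w : 'rV[R]_n) :
  sigma_finite setT tau1 -> sigma_finite setT tau2 ->
  \int[L]_z (mix n tau1 (edist x z) * mix n tau2 (edist (z : 'rV[R]_n) w)) =
  mixc tau1 tau2 (edist x w).
Proof.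
move=> s1 s2.
have mg d : measurable_fun setT (fun t : measurableTypeR R => (gauss0 n t d)%:E : \bar R).
  by apply/measurable_EFinP; exact: (measurable_fix2 (@measurable_gauss0 R n)).
have g0 t d : 0 <= (gauss0 n t d)%:E by rewrite lee_fin gauss0_ge0.
have m2 : measurable_fun setT (fun z : T => mix n tau2 (edist (z : 'rV[R]_n) w)).
  apply: (@measurableT_comp _ _ _ _ _ _ (mix n tau2)); last exact: measurable_edist2.
  exact: measurable_mix.
transitivity (\int[L]_z \int[tau1]_t
  ((gauss0 n t (edist x z))%:E * mix n tau2 (edist (z : 'rV[R]_n) w))).
  by apply: eq_integral => z _; rewrite ge0_integralZr// mix_ge0.
rewrite (tonelli (Leb_sigma_finite R n) s1); last 2 first.
- apply: emeasurable_funM; first exact: measurable_gauss0_edist.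
  exact: (measurableT_comp m2 measurable_fst).
- by move=> z t; rewrite mule_ge0 ?mix_ge0.
apply: eq_integral => t _.
transitivity (\int[L]_z \int[tau2]_u
  ((gauss0 n t (edist x z))%:E * (gauss0 n u (edist (z : 'rV[R]_n) w))%:E)).
  by apply: eq_integral => z _; rewrite ge0_integralZl.
rewrite (tonelli (Leb_sigma_finite R n) s2); last 2 first.
- apply: emeasurable_funM.
    have m1 : measurable_fun setT (fun z : T => (gauss0 n t (edist x (z : 'rV[R]_n)))%:E : \bar R).
      apply/measurable_EFinP.
      exact: (measurableT_comp (measurable_fix1 (@measurable_gauss0 R n) t) (measurable_edist1 x)).
    exact: (measurableT_comp m1 measurable_fst).
  by under eq_fun => p do rewrite edistC; exact: measurable_gauss0_edist.
- by move=> z u; rewrite mule_ge0.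
by apply: eq_integral => u _; rewrite gauss0_conv.
Qed.

(** Only an inequality, as [tau] may charge nonpositive times, where [gauss0] vanishes. *)
Lemma mix_mass (tau : time) (x : 'rV[R]_n) : sigma_finite setT tau ->
  \int[L]_z mix n tau (edist x z) <= tau setT.
Proof.
move=> st; rewrite /mix (tonelli (Leb_sigma_finite R n) st); last 2 first.
- exact: measurable_gauss0_edist.
- by move=> *; rewrite lee_fin gauss0_ge0.
rewrite (eq_integral (fun t : measurableTypeR R => (if (0 < t)%R then 1%R else 0%R)%:E)); last first.
  move=> t _; rewrite /gauss0; case: ifPn => t0; first by rewrite gauss_mass.
  by rewrite integral0.
rewrite -[leRHS]mul1e -integral_cst//.
apply: ge0_le_integral => //.
- by move=> t _; case: ifP.
- by apply/measurable_EFinP; apply: measurable_fun_ifT => //; exact: measurable_fun_ltr.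
by move=> t _; case: ifP.
Qed.

End mix_composition.

(** * Identities and bounds between the kernels, read on the time axis *)

Section kernel_identities.
Local Open Scope ereal_scope.
Context (R : realType) (n : nat) (alpha : R).
Hypotheses (n3 : (3 <= n)%N) (alpha0 : (0 < alpha)%R) (alpha2 : (alpha <= 2)%R).
Local Notation leb := (@lebesgue_measure R).
Local Notation L := (Leb R n).
Local Notation T := (RnB R n).
Local Notation C := (Crz n alpha).
Local Notation w := (tweight alpha).
Local Notation tm := (tmeas n3 alpha0 alpha2).
Local Notation kl := (klong n alpha).
Local Notation ks := (kshort n alpha).
Local Notation ka := (kall n alpha).

Definition etam (s : R) : {measure set (measurableTypeR R) -> \bar R} :=
  sval (cid (eta_exists alpha s)).

(* Composed with [kall] this is [klong s], see [comp_ka]. *)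
Definition kmid (s d : R) : \bar R := mix n (etam s) d.

Local Notation km := kmid.

Lemma etam_mass s : (0 < s)%R -> etam s setT = 1.
Proof. by move=> s0; have [] := svalP (cid (eta_exists alpha s)) alpha0 alpha2 s0. Qed.

Lemma etam_sigma_finite s : (0 < s)%R -> sigma_finite setT (etam s).
Proof.
move=> s0; exists (fun _ => setT); first by rewrite bigcup_const.
by move=> _; split => //; rewrite etam_mass// ltry.
Qed.

Lemma etam_key s r : (0 < s)%R ->
  \int[etam s]_u (if (0 < u < r)%R then w (r - u)%R else 0%R)%:E = (if (s < r)%R then w r else 0%R)%:E.
Proof. by move=> s0; have [_ +] := svalP (cid (eta_exists alpha s)) alpha0 alpha2 s0. Qed.

Lemma le_etam s (f g : R -> \bar R) : (0 < s)%R -> measurable_fun setT f ->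
  (forall x, 0 <= f x) -> measurable_fun setT g -> (forall x, 0 <= g x) ->
  (forall u, (s <= u)%R -> f u <= g u) -> \int[etam s]_u f u <= \int[etam s]_u g u.
Proof. by move=> s0; have [_ _ + _ _] := svalP (cid (eta_exists alpha s)) alpha0 alpha2 s0; exact. Qed.

Lemma kmid_ge0 s d : 0 <= km s d. Proof. exact: mix_ge0. Qed.

Lemma kmid_two s d : (0 < s)%R -> alpha = 2%R -> km s d = (gauss n s d)%:E.
Proof.
move=> s0 a2; have [_ _ _ + _] := svalP (cid (eta_exists alpha s)) alpha0 alpha2 s0.
move=> /(_ a2) E; rewrite /kmid /mix /etam E integral_dirac//.
  by rewrite diracE in_setT mul1e /gauss0 s0.
by apply/measurable_EFinP; exact: (measurable_fix2 (@measurable_gauss0 R n)).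
Qed.

(** A lower bound for the part of [kmid s] with times in [(1 / 2, 1)], stripped of the factor
    [s ^ (alpha / 2)]; it stands for the jumps of the stable process. *)
Definition klevy (d : R) : \bar R :=
  \int[leb]_(p in `]1%R, 2%R[) (((Beta (alpha / 2))^-1 * p `^ (alpha / 2 - 1))%:E *
     (gauss0 n (p `^ (-1))%R d)%:E).

Lemma kmid_levy s d : (0 < s)%R -> (s <= 2^-1)%R -> (alpha < 2)%R ->
  (s `^ (alpha / 2))%:E * klevy d <= km s d.
Proof.
move=> s0 s2 a2; have [_ _ _ _] := svalP (cid (eta_exists alpha s)) alpha0 alpha2 s0.
apply => //; last by move=> x; rewrite lee_fin gauss0_ge0.
by apply/measurable_EFinP; exact: (measurable_fix2 (@measurable_gauss0 R n)).
Qed.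

Lemma klevy_gt0 d : (alpha < 2)%R -> 0 < klevy d.
Proof.
move=> a2; apply: integral_gt0 => //.
- apply: measurable_funTS; apply: emeasurable_funM; apply/measurable_EFinP.
    by apply: measurable_funM => //; exact: measurable_powR.
  apply: (measurableT_comp (measurable_fix2 (@measurable_gauss0 R n) d)).
  exact: measurable_powR.
- move=> p; rewrite /= in_itv/= => /andP[p1 _]; have p0 : (0 < p)%R by exact: lt_trans p1.
  have p1' : (0 < p `^ (-1))%R by exact: powR_gt0.
  rewrite -EFinM lte_fin /gauss0 p1'; apply: mulr_gt0; last exact: gauss_gt0.
  apply: mulr_gt0; last exact: powR_gt0.
  rewrite invr_gt0; apply: Beta_gt0; first by rewrite divr_gt0.
  by rewrite ltr_pdivrMr// mul1r.
- by rewrite /= lebesgue_measure_itv/= lte_fin ltr1n -EFinB lte_fin subr_gt0 ltr1n.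
Qed.

Let mtd i : measurable_fun setT (fun t => (tdens n alpha i t)%:E : \bar R).
Proof. by apply/measurable_EFinP; exact: measurable_tdens. Qed.

Let td0 i t : 0 <= (tdens n alpha i t)%:E.
Proof. by rewrite lee_fin tdens_ge0. Qed.

Let mg2 d : measurable_fun setT (fun p : measurableTypeR R * measurableTypeR R => (gauss2 n p.1 p.2 d)%:E : \bar R).
Proof. by apply/measurable_EFinP; exact: measurable_gauss2d. Qed.

Let g20 (t u d : R) : 0 <= (gauss2 n t u d)%:E.
Proof. by rewrite lee_fin gauss2_ge0. Qed.

Lemma integral_tmeas i (g : R -> \bar R) : measurable_fun setT g -> (forall x, 0 <= g x) ->
  \int[tm i]_t g t = \int[leb]_t ((tdens n alpha i t)%:E * g t).
Proof. by move=> mg g0; rewrite integral_dens. Qed.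

Lemma mixc_tmeas i (tau : {measure set (measurableTypeR R) -> \bar R}) d :
  sigma_finite setT tau ->
  mixc n (tm i) tau d =
  \int[tau]_u \int[leb]_t ((tdens n alpha i t)%:E * (gauss2 n t u d)%:E).
Proof.
move=> st; rewrite /mixc.
rewrite (@tonelli _ _ _ _ _ _ _ (tmeas_sigma_finite n3 alpha0 alpha2 i) st
  (fun t u => (gauss2 n t u d)%:E) (mg2 d)); last by move=> *; exact: g20.
apply: eq_integral => u _; rewrite integral_tmeas//.
exact: (measurable_fix2 (f := fun t u => (gauss2 n t u d)%:E) (mg2 d) u).
Qed.

Lemma integral_shift (u : R) (f : R -> \bar R) : measurable_fun setT f -> (forall x, 0 <= f x) ->
  \int[leb]_x f x = \int[leb]_x f (x - u)%R.
Proof.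
move=> mf f0; have := integral_affine (- u)%R ltr01 mf f0.
rewrite invr1 mul1e => <-; congr integral; apply/funext => x; by rewrite mul1r.
Qed.

(** Shifting the time of [kall] by [u] and exchanging the integrals brings [etam_key] inside: the
    composed times are those beyond [s], with the same weight. *)
Lemma mixc_all_etam s d : (0 < s)%R -> mixc n (tm `]-oo, +oo[) (etam s) d = kl s d.
Proof.
move=> s0; have se := etam_sigma_finite s0; rewrite mixc_tmeas//.
pose F (t u : measurableTypeR R) : \bar R := (C * gauss0 n t d)%:E *
   (if (0 < u < t)%R then w (t - u)%R else 0%R)%:E.
have mF1 : measurable_fun setT (fun p : measurableTypeR R * measurableTypeR R =>
    (if (0 < p.2 < p.1)%R then w (p.1 - p.2)%R else 0%R)%:E : \bar R).
  apply/measurable_EFinP; apply: measurable_fun_ifT => //.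
    by apply: measurable_and; apply: measurable_fun_ltr.
  apply: (measurableT_comp (measurable_tweight alpha)).
  by apply: measurable_funB.
have mF2 : measurable_fun setT (fun t : measurableTypeR R => (C * gauss0 n t d)%:E : \bar R).
  by apply/measurable_EFinP; apply: measurable_funM => //; exact: (measurable_fix2 (@measurable_gauss0 R n)).
have mF : measurable_fun setT (fun p : measurableTypeR R * measurableTypeR R => F p.1 p.2).
  by apply: emeasurable_funM => //; exact: (measurableT_comp mF2 measurable_fst).
have C0 : (0 <= C)%R by exact/ltW/Crz_gt0.
have F20 t : 0 <= (C * gauss0 n t d)%:E by rewrite lee_fin mulr_ge0 ?gauss0_ge0.
have F10 t u : 0 <= (if (0 < u < t)%R then w (t - u)%R else 0%R)%:E.
  by rewrite lee_fin; case: ifP => // _; exact: tweight_ge0.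
have F0 t u : 0 <= F t u by exact: mule_ge0.
transitivity (\int[etam s]_u \int[leb]_t F t u).
  apply: eq_integral => u _.
  have mf : measurable_fun setT (fun t => (tdens n alpha `]-oo, +oo[ t)%:E * (gauss2 n t u d)%:E).
    apply: emeasurable_funM => //.
    exact: (measurable_fix2 (f := fun t u => (gauss2 n t u d)%:E) (mg2 d) u).
  rewrite (integral_shift u mf); last by move=> x; exact: mule_ge0.
  apply: eq_integral => t _; rewrite /F -!EFinM; congr EFin.
  rewrite /tdens /gauss2 /gauss0 indicE mem_set/= ?in_itv//= mulr1 subr_gt0 subrK.
  rewrite [(0 < u < t)%R]andbC; case: (ltP u t) => ut /=; last by rewrite !mulr0.
  case: (ltP 0%R u) => u0; last by rewrite !mulr0.
  by rewrite (lt_trans u0 ut) mulrAC.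
have sl := sigma_finiteT leb.
rewrite -(@tonelli _ _ _ _ _ _ _ sl se F mF F0).
rewrite /klong /kmix [RHS]integral_mkcond; apply: eq_integral => t _.
rewrite /F ge0_integralZl//; last exact: (measurable_fix1
  (f := fun t u : measurableTypeR R => (if (0 < u < t)%R then w (t - u)%R else 0%R)%:E : \bar R) mF1 t).
rewrite etam_key// patchE mem_setE in_itv/= andbT.
case: ifP => _; last by rewrite mule0.
by rewrite -EFinM mulrA mulrAC.
Qed.


(** The total mass of the kernel [kshort s] in space, each Gaussian having mass [1]. *)
Definition cshort (s : R) : \bar R := \int[leb]_(t in `]0%R, s]) (C * w t)%:E.

Lemma cshort_gt0 s : (0 < s)%R -> 0 < cshort s.
Proof.
move=> s0; apply: integral_gt0 => //.
- apply: measurable_funTS; apply/measurable_EFinP; apply: measurable_funM => //.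
  exact: measurable_tweight.
- move=> t; rewrite /= in_itv/= => /andP[t0 _].
  by rewrite lte_fin mulr_gt0 ?Crz_gt0// powR_gt0.
- by rewrite /= lebesgue_measure_itv/= lte_fin s0 -EFinB lte_fin subr_gt0.
Qed.

Lemma cshort_fin s : (s < 1)%R -> cshort s < +oo.
Proof.
move=> s1; have a0 : (0 < alpha / 2)%R by rewrite divr_gt0.
have mw : measurable_fun setT (fun t : R => (w t)%:E : \bar R).
  by apply/measurable_EFinP; exact: measurable_tweight.
have w0 t : 0 <= (w t)%:E by rewrite lee_fin tweight_ge0.
have C0 : (0 <= C)%R by exact/ltW/Crz_gt0.
rewrite /cshort; under eq_integral do rewrite EFinM.
rewrite ge0_integralZl//; last exact: (measurable_funTS mw).
apply: lte_mul_pinfty => //.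
apply: le_lt_trans (integral_powR_near0 a0).
apply: ge0_subset_integral => //; first exact: (measurable_funTS mw).
by move=> t; rewrite /= !in_itv/= => /andP[-> /le_lt_trans]; apply.
Qed.

Lemma tdens_short s t : (0 < t)%R ->
  (tdens n alpha `]-oo, s]%R t)%:E = ((fun t => (C * w t)%:E) \_ `]0%R, s]%classic) t.
Proof.
move=> t0; rewrite /tdens patchE indicE !mem_setE !in_itv/= t0/=.
by case: ifP => _; rewrite ?mulr1// mulr0 mul0r.
Qed.

(** Lengthening the time from [u] to [t + u] helps the exponential and costs the ratio of the peaks,
    which is at least [(r / (r + s)) ^ n]. *)
Lemma gauss_add_le (s r t u d : R) : (0 < t <= s)%R -> (0 < r <= u)%R ->
  ((r / (r + s)) ^+ n * gauss n u d <= gauss n (t + u) d)%R.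
Proof.
move=> /andP[t0 ts] /andP[r0 ru]; have u0 := lt_le_trans r0 ru; have s0 := lt_le_trans t0 ts.
have tu0 : (0 < t + u)%R by exact: addr_gt0.
rewrite /gauss mulrA; apply: ler_pM; rewrite ?expR_ge0 ?mulr_ge0 ?gpeak_ge0//.
  by rewrite exprn_ge0// divr_ge0 ?ltW// addr_gt0.
  rewrite -ler_pdivlMr ?gpeak_gt0// /gpeak !powRN invrK.
  rewrite (_ : ((pi * (t + u)) `^ (n%:R / 2))^-1 * (pi * u) `^ (n%:R / 2) = (u / (t + u)) `^ (n%:R / 2))%R; last first.
    rewrite powRM ?pi_ge0 ?(ltW tu0)// powRM ?pi_ge0 ?(ltW u0)//.
    rewrite powRM ?invr_ge0 ?(ltW tu0) ?(ltW u0)//.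
    rewrite -(powR_inv1 (ltW tu0)) -powRrM mulN1r powRN.
    have h1 : (pi `^ (n%:R / 2) != 0 :> R)%R by rewrite gt_eqF// powR_gt0// pi_gt0.
    have h2 : ((t + u) `^ (n%:R / 2) != 0 :> R)%R by rewrite gt_eqF// powR_gt0.
    by field; rewrite h1 h2.
  have b1 : (r / (r + s) <= u / (t + u))%R.
    rewrite ler_pdivrMr ?addr_gt0// mulrAC ler_pdivlMr//; nra.
  have b2 : (0 < u / (t + u) <= 1)%R.
    by rewrite divr_gt0//= ler_pdivrMr// mul1r lerDr ltW.
  apply: (@le_trans _ _ ((u / (t + u)) ^+ n)%R).
    by rewrite lerXn2r ?nnegrE ?divr_ge0 ?addr_ge0 ?(ltW r0) ?(ltW s0) ?(ltW t0) ?(ltW u0).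
  rewrite -powR_mulrn; last by case/andP: b2 => /ltW.
  rewrite ger_powR//; have : (0 <= n%:R :> R)%R by []. 
  by lra.
rewrite ler_expR !powR_inv1 ?(ltW tu0) ?(ltW u0)// !mulNr lerN2.
by rewrite ler_wpM2l ?sqr_ge0// lef_pV2 ?posrE// lerDr ltW.
Qed.

(** The times of [etam r] are at least [r], and a delay of at most [s] hardly changes their
    Gaussians when [s] is small against [r]. *)
Lemma mixc_short_etam s r d : (0 < s)%R -> (0 < r)%R ->
  cshort s * (((r / (r + s)) ^+ n)%:E * km r d) <= mixc n (tm `]-oo, s]%R) (etam r) d.
Proof.
move=> s0 r0; have se := etam_sigma_finite r0; rewrite mixc_tmeas//.
have c0 : 0 <= cshort s by exact/ltW/cshort_gt0.
have e0 : (0 <= (r / (r + s)) ^+ n)%R by rewrite exprn_ge0// divr_ge0 ?ltW// addr_gt0.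
have mg : measurable_fun setT (fun u : R => (gauss0 n u d)%:E : \bar R).
  by apply/measurable_EFinP; exact: (measurable_fix2 (@measurable_gauss0 R n)).
have g0 u : 0 <= (gauss0 n u d)%:E by rewrite lee_fin gauss0_ge0.
have mC : measurable_fun setT (fun t => (C * w t)%:E : \bar R).
  by apply/measurable_EFinP; apply: measurable_funM => //; exact: measurable_tweight.
have C0 : (0 <= C)%R by exact/ltW/Crz_gt0.
rewrite /kmid /mix -!ge0_integralZl//; last 2 first.
- exact: emeasurable_funM.
- by move=> u _; exact: mule_ge0.
apply: le_etam => //.
- by apply: emeasurable_funM => //; exact: emeasurable_funM.
- by move=> u; rewrite !mule_ge0.
- apply: (@measurable_int2 _ _ _ _ _ leb (sigma_finiteT leb)
    (fun u t => (tdens n alpha `]-oo, s] t)%:E * (gauss2 n t u d)%:E)).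
    apply: emeasurable_funM; first exact: (measurableT_comp (mtd _) measurable_snd).
    exact: (measurable_swap2 (f := fun t u => (gauss2 n t u d)%:E) (mg2 d)).
  by move=> u t; exact: mule_ge0.
- by move=> u; apply: integral_ge0 => t _; exact: mule_ge0.
move=> u ru; have u0 := lt_le_trans r0 ru.
rewrite /cshort integral_mkcond -ge0_integralZr//; last 3 first.
- by apply/(measurable_restrictT _ _).1 => //; exact: (measurable_funTS mC).
- by move=> t _; rewrite patchE; case: ifP => // _; rewrite lee_fin mulr_ge0 ?tweight_ge0.
- exact: mule_ge0.
apply: ge0_le_integral => //.
- move=> t _; apply: mule_ge0; last exact: mule_ge0.
  by rewrite patchE; case: ifP => // _; rewrite lee_fin mulr_ge0 ?tweight_ge0.
- apply: emeasurable_funM => //.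
  by apply/(measurable_restrictT _ _).1 => //; exact: (measurable_funTS mC).
- apply: emeasurable_funM => //.
    exact: mtd.
  exact: (measurable_fix2 (f := fun t u => (gauss2 n t u d)%:E) (mg2 d) u).
move=> t _; case: (ltP 0%R t) => t0; last first.
  by rewrite patchE mem_setE in_itv/= ltNge t0/= mul0e mule_ge0.
rewrite tdens_short//; rewrite patchE mem_setE in_itv/= t0/=; case: ifP => ts; last by rewrite !mul0e.
apply: lee_wpmul2l; first by rewrite lee_fin mulr_ge0 ?tweight_ge0.
rewrite -EFinM lee_fin /gauss0 /gauss2 u0 t0/=.
by apply: gauss_add_le; rewrite ?t0 ?ts ?r0.
Qed.

(** After the shift by [t <= s] only the weights differ; their ratio is at most [u / (u - t)], hence
    at most [1 + s / r] because [u - t > r]. *)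
Lemma mixc_short_long s r d : (0 < s)%R -> (0 < r)%R ->
  mixc n (tm `]-oo, s]%R) (tm `]r, +oo[%R) d <= cshort s * ((1 + s / r)%:E * kl r d).
Proof.
move=> s0 r0.
have mC : measurable_fun setT (fun t => (C * w t)%:E : \bar R).
  by apply/measurable_EFinP; apply: measurable_funM => //; exact: measurable_tweight.
have C0 : (0 <= C)%R by exact/ltW/Crz_gt0.
have i0 : 0 <= (1 + s / r)%:E * kl r d.
  by rewrite mule_ge0// ?kmix_ge0// lee_fin addr_ge0// divr_ge0// ltW.
rewrite /mixc integral_tmeas; last 2 first.
- apply: (@measurable_int2 _ _ _ _ _ _ (tmeas_sigma_finite n3 alpha0 alpha2 _)
    (fun t u => (gauss2 n t u d)%:E)) => //; exact: mg2.
- by move=> t; apply: integral_ge0.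
have mp : measurable_fun setT ((fun t => (C * w t)%:E : \bar R) \_ `]0%R, s]%classic).
  by apply/(measurable_restrictT _ _).1 => //; exact: (measurable_funTS mC).
have p0 t : 0 <= ((fun t => (C * w t)%:E : \bar R) \_ `]0%R, s]%classic) t.
  by rewrite patchE; case: ifP => // _; rewrite lee_fin mulr_ge0 ?tweight_ge0.
rewrite /cshort [in leRHS]integral_mkcond -ge0_integralZr//.
apply: ge0_le_integral => //.
- by move=> t _; apply: mule_ge0 => //; apply: integral_ge0.
- apply: emeasurable_funM => //; first exact: mtd.
  apply: (@measurable_int2 _ _ _ _ _ _ (tmeas_sigma_finite n3 alpha0 alpha2 _)
    (fun t u => (gauss2 n t u d)%:E)) => //; exact: mg2.
- exact: emeasurable_funM.
move=> t _; case: (ltP 0%R t) => t0; last first.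
  have -> : \int[tm `]r, +oo[%R]_u (gauss2 n t u d)%:E = 0.
    by rewrite integral0_eq// => u _; rewrite /gauss2 ltNge t0.
  by rewrite mule0; exact: mule_ge0.
rewrite tdens_short//; rewrite patchE mem_setE in_itv/= t0/=; case: ifP => ts; last by rewrite !mul0e.
apply: lee_wpmul2l; first by rewrite lee_fin mulr_ge0 ?tweight_ge0.
have mg : measurable_fun setT (fun u => (gauss2 n t u d)%:E).
  exact: (measurable_fix1 (f := fun t u => (gauss2 n t u d)%:E) (mg2 d) t).
rewrite integral_tmeas//.
have mf : measurable_fun setT (fun u => (tdens n alpha `]r, +oo[%R u)%:E * (gauss2 n t u d)%:E).
  by apply: emeasurable_funM => //; exact: mtd.
rewrite (integral_shift t mf); last by move=> u; exact: mule_ge0.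
rewrite /klong -kmixZl//; last by rewrite addr_ge0// divr_ge0// ltW.
rewrite [leRHS]integral_mkcond; apply: ge0_le_integral; first exact: measurableT.
- by move=> u _; exact: mule_ge0.
- apply: (measurableT_comp mf); exact: measurable_funB.
- apply/(measurable_restrictT _ _).1 => //; apply: measurable_funTS; apply: measurable_funeM.
  exact: measurable_ktime.
move=> u _; rewrite patchE mem_setE in_itv/= andbT /tdens indicE mem_setE in_itv/= andbT.
case: (ltP r (u - t)%R) => rut; last first.
  rewrite mulr0 !mul0r mul0e; case: ifP => // _.
  by rewrite mule_ge0 ?lee_fin ?ktime_ge0// addr_ge0// divr_ge0// ltW.
have ut0 : (0 < u - t)%R by exact: lt_trans rut.
have ru : (r < u)%R by rewrite (lt_trans rut)// ltrBlDr ltrDl.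
have u0 := lt_trans r0 ru.
rewrite ru mulr1 /gauss2 t0 ut0 /= (addrC t) subrK /gauss0 u0 -!EFinM lee_fin.
have -> : ((1 + s / r) * (C * (w u * gauss n u d)) = C * ((1 + s / r) * w u) * gauss n u d)%R.
  by rewrite mulrCA !mulrA.
rewrite ler_wpM2r ?gauss_ge0// ler_wpM2l//.
rewrite /tweight -[in leLHS](divfK (lt0r_neq0 u0) (u - t)%R) powRM ?(ltW u0)//; last by rewrite divr_ge0 ?(ltW u0) ?(ltW ut0).
rewrite ler_wpM2r ?powR_ge0//.
have q0 : (0 < (u - t) / u)%R by rewrite divr_gt0.
have q1 : ((u - t) / u <= 1)%R by rewrite ler_pdivrMr// mul1r lerBlDr lerDl ltW.
apply: (@le_trans _ _ (((u - t) / u) `^ (-1))%R).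
  rewrite ger_powR ?q0//; have : (0 <= alpha / 2)%R by rewrite divr_ge0// ltW.
  by lra.
rewrite powR_inv1 ?(ltW q0)// invf_div ler_pdivrMr//.
have -> : (1 + s / r = (r + s) / r)%R by field; rewrite gt_eqF.
rewrite mulrAC ler_pdivlMr//; nra.
Qed.

End kernel_identities.

(** * Integral operators with radial kernels *)

Section nonneg_measurable.
Local Open Scope ereal_scope.
Context d (S : measurableType d) (R : realType).
Implicit Types f g : S -> \bar R.

(* Locked, so that [done] does not try to unfold it. *)
Definition nnm f : Prop := locked (measurable_fun setT f /\ forall x, 0 <= f x).

Lemma nnmI f : measurable_fun setT f -> (forall x, 0 <= f x) -> nnm f.
Proof. by move=> mf f0; rewrite /nnm -lock. Qed.

Lemma nnm_m f : nnm f -> measurable_fun setT f.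
Proof. by rewrite /nnm -lock => -[]. Qed.

Lemma nnm_ge0 f : nnm f -> forall x, 0 <= f x.
Proof. by rewrite /nnm -lock => -[]. Qed.

Lemma nnmD f g : nnm f -> nnm g -> nnm (fun x => f x + g x).
Proof.
by move=> /[dup] /nnm_m mf /nnm_ge0 f0 /[dup] /nnm_m mg /nnm_ge0 g0; apply: nnmI; [exact: emeasurable_funD|move=> x; exact: adde_ge0].
Qed.

Lemma nnmM f g : nnm f -> nnm g -> nnm (fun x => f x * g x).
Proof.
by move=> /[dup] /nnm_m mf /nnm_ge0 f0 /[dup] /nnm_m mg /nnm_ge0 g0; apply: nnmI; [exact: emeasurable_funM|move=> x; exact: mule_ge0].
Qed.

Lemma nnm_cst (c : \bar R) : 0 <= c -> nnm (fun=> c).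
Proof. by move=> c0; exact: nnmI. Qed.

Lemma nnm_min f g : nnm f -> nnm g -> nnm (fun x => Order.min (f x) (g x)).
Proof.
move=> /[dup] /nnm_m mf /nnm_ge0 f0 /[dup] /nnm_m mg /nnm_ge0 g0; apply: nnmI; first exact: measurable_mine.
by move=> x; rewrite le_min f0 g0.
Qed.

Lemma nnm_indic (D : set S) : measurable D -> nnm (fun x => (\1_D x)%:E : \bar R).
Proof.
move=> mD; apply: nnmI; last by move=> x; rewrite lee_fin.
by apply/measurable_EFinP; exact: measurable_indic.
Qed.

Lemma nnm_EFin (h : S -> R) : measurable_fun setT h -> (forall x, (0 <= h x)%R) ->
  nnm (fun x => (h x)%:E).
Proof. by move=> mh h0; apply: nnmI=> [|x]; [exact/measurable_EFinP|rewrite lee_fin]. Qed.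

Variable m : {measure set S -> \bar R}.

Lemma integral_nnm_ge0 f : nnm f -> 0 <= \int[m]_x f x.
Proof. by move=> /nnm_ge0 f0; exact: integral_ge0. Qed.

Lemma le_integral_nnm f g : nnm f -> nnm g -> (forall x, f x <= g x) ->
  \int[m]_x f x <= \int[m]_x g x.
Proof. by move=> /[dup] /nnm_m mf /nnm_ge0 f0 /[dup] /nnm_m mg /nnm_ge0 g0 fg; exact: ge0_le_integral. Qed.

Lemma integral_nnmD f g : nnm f -> nnm g ->
  \int[m]_x (f x + g x) = \int[m]_x f x + \int[m]_x g x.
Proof. by move=> /[dup] /nnm_m mf /nnm_ge0 f0 /[dup] /nnm_m mg /nnm_ge0 g0; rewrite ge0_integralD. Qed.

Lemma integral_nnmZl f (c : \bar R) : nnm f -> 0 <= c ->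
  \int[m]_x (c * f x) = c * \int[m]_x f x.
Proof. by move=> /[dup] /nnm_m mf /nnm_ge0 f0 c0; rewrite ge0_integralZl. Qed.

Lemma integral_nnmZr f (c : \bar R) : nnm f -> 0 <= c ->
  \int[m]_x (f x * c) = \int[m]_x f x * c.
Proof. by move=> /[dup] /nnm_m mf /nnm_ge0 f0 c0; rewrite ge0_integralZr. Qed.

Lemma cvg_integral_nd (f : nat -> S -> \bar R) g : (forall k, nnm (f k)) ->
  (forall x, nondecreasing_seq (f^~ x)) -> (forall x, f k x @[k --> \oo] --> g x) ->
  \int[m]_x f k x @[k --> \oo] --> \int[m]_x g x.
Proof.
move=> nf nd fg; have -> : g = (fun x => limn (f^~ x)).
  by apply/funext => x; apply/esym/cvg_lim => //; exact: fg.
apply: (cvg_monotone_convergence measurableT) => [k|k x _|x _] /=.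
- exact: (nnm_m (nf k)).
- exact: (nnm_ge0 (nf k)).
- exact: nd.
Qed.

Lemma cvg_integral_ni (f : nat -> S -> \bar R) g : (forall k, nnm (f k)) -> nnm g ->
  (forall x, nonincreasing_seq (f^~ x)) -> (forall x, f k x @[k --> \oo] --> g x) ->
  \int[m]_x f 0%N x < +oo -> \int[m]_x f k x @[k --> \oo] --> \int[m]_x g x.
Proof.
move=> nf ng ni fg f0.
have i0 : m.-integrable setT (f 0%N).
  apply/integrableP; split; first exact: (nnm_m (nf 0%N)).
  by under eq_integral => x _ do rewrite gee0_abs ?(nnm_ge0 (nf 0%N))//.
have ab : {ae m, forall x k, setT x -> `|f k x| <= f 0%N x}.
  by apply: aeW => x k _; rewrite gee0_abs ?(nnm_ge0 (nf k))//; exact: ni.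
have ac : {ae m, forall x, setT x -> f k x @[k --> \oo] --> g x} by apply: aeW => x _.
by have [_ _] := dominated_convergence measurableT (fun k => (nnm_m (nf k))) (nnm_m ng) ac i0 ab.
Qed.

End nonneg_measurable.

Section ereal_limits.
Local Open Scope ereal_scope.
Context (R : realType).
Implicit Types (a : nat -> \bar R) (b c : \bar R).

Lemma cvge_ub a b c : a k @[k --> \oo] --> b -> (forall k, a k <= c) -> b <= c.
Proof.
move=> ab h; rewrite -(cvg_lim _ ab)//; apply: lime_le; first exact: cvgP ab.
exact: nearW.
Qed.

Lemma cvge_lb a b c : a k @[k --> \oo] --> b -> (forall k, c <= a k) -> c <= b.
Proof.
move=> ab h; rewrite -(cvg_lim _ ab)//; apply: lime_ge; first exact: cvgP ab.
exact: nearW.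
Qed.

Lemma cvge_nd_ub a b k : nondecreasing_seq a -> a k @[k --> \oo] --> b -> a k <= b.
Proof.
move=> nd ab; rewrite -(cvg_lim _ ab)//; apply: lime_ge; first exact: cvgP ab.
by exists k => // j /= kj; exact: nd.
Qed.

Lemma cvge_gt_ex a b c : a k @[k --> \oo] --> b -> c < b -> exists k, c < a k.
Proof.
move=> ab cb; apply: contrapT => /forallNP h; move: cb; apply/negP; rewrite -leNgt.
by apply: cvge_ub ab _ => k; rewrite leNgt; apply/negP; exact: h.
Qed.

Lemma cvge_nd_gt a b c : nondecreasing_seq a -> a k @[k --> \oo] --> b -> c < b ->
  exists N, forall k, (N <= k)%N -> c < a k.
Proof.
move=> nd ab /(cvge_gt_ex ab)[N cN]; exists N => k Nk.
by apply: lt_le_trans cN _; exact: nd.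
Qed.

(** The factor [c] may be [+oo]: the sequence is then identically [0], or positive from some index
    on, and in both cases the product is eventually constant. *)
Lemma cvg_mule_nd a b c :
  (forall k, 0 <= a k) -> nondecreasing_seq a -> a k @[k --> \oo] --> b -> 0 <= c ->
  a k * c @[k --> \oo] --> b * c.
Proof.
move=> a0 nd ab; case: c => [c| |]// c0; first exact: cvgeZr.
have ale k : a k <= b by exact: cvge_nd_ub.
have [b0|b0] := leP b 0.
  have a0' k : a k = 0 by apply/eqP; rewrite eq_le a0 (le_trans (ale k) b0).
  have -> : b = 0 by apply/eqP; rewrite eq_le b0 (le_trans (a0 0%N) (ale 0%N)).
  rewrite (_ : (fun k => a k * +oo) = fun=> 0 * +oo); first exact: cvg_cst.
  by apply/funext => k; rewrite a0'.
have [N aN] := cvge_gt_ex ab b0.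
rewrite gt0_muley//; apply: cvg_near_cst; exists N => // k /= Nk.
by rewrite gt0_muley//; apply: lt_le_trans aN _; exact: nd.
Qed.

End ereal_limits.

(** * Operators and potentials with a radial kernel *)

Section kernel_integrals.
Local Open Scope ereal_scope.
Context (R : realType) (n : nat).
Local Notation L := (Leb R n).
Local Notation T := (RnB R n).
Implicit Types (m : msr R n) (k : R -> \bar R) (h : T -> \bar R) (x : 'rV[R]_n).

Definition kint m k h x : \bar R := \int[m]_w (k (edist x (w : 'rV[R]_n)) * h w).

Definition pot k m x : \bar R := \int[m]_w k (edist x (w : 'rV[R]_n)).

Lemma pot_kint k m x : pot k m x = kint m k (fun=> 1) x.
Proof. by apply: eq_integral => w _; rewrite mule1. Qed.

Lemma nnm_edist k x : nnm k -> nnm (fun w : T => k (edist x (w : 'rV[R]_n))).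
Proof.
by move=> /[dup] /nnm_m mk /nnm_ge0 k0; apply: nnmI => //; exact: (measurableT_comp mk (measurable_edist1 x)).
Qed.

Lemma nnm_edistr k x : nnm k -> nnm (fun w : T => k (edist (w : 'rV[R]_n) x)).
Proof.
by move=> /[dup] /nnm_m mk /nnm_ge0 k0; apply: nnmI => //; exact: (measurableT_comp mk (measurable_edist2 x)).
Qed.

Lemma nnm_kernel k h x : nnm k -> nnm h -> nnm (fun w : T => k (edist x (w : 'rV[R]_n)) * h w).
Proof. by move=> nk nh; apply: nnmM => //; exact: nnm_edist. Qed.

Lemma kint_ge0 m k h x : nnm k -> nnm h -> 0 <= kint m k h x.
Proof. by move=> nk nh; apply: integral_nnm_ge0; exact: nnm_kernel. Qed.

Lemma nnm_kint m k h : sigma_finite setT m -> nnm k -> nnm h -> nnm (kint m k h : T -> \bar R).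
Proof.
move=> sm nk nh; apply: nnmI; last by move=> x; exact: kint_ge0.
apply: (@measurable_int2 _ _ _ _ _ m sm (fun x w : T => k (edist (x : 'rV[R]_n) w) * h w)).
  apply: emeasurable_funM.
    exact: (measurableT_comp (nnm_m nk) (@measurable_edist R n)).
  exact: (measurableT_comp (nnm_m nh) measurable_snd).
by move=> x w; rewrite mule_ge0 ?(nnm_ge0 nk) ?(nnm_ge0 nh).
Qed.

Lemma pot_ge0 k m x : nnm k -> 0 <= pot k m x.
Proof. by move=> nk; apply: integral_nnm_ge0; exact: nnm_edist. Qed.

Lemma nnm_pot k m : sigma_finite setT m -> nnm k -> nnm (pot k m : T -> \bar R).
Proof.
move=> sm nk; rewrite (_ : (pot k m : T -> \bar R) = kint m k (fun=> 1)).
  by apply: nnm_kint => //; exact: nnm_cst.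
by apply/funext => x; exact: pot_kint.
Qed.

Lemma le_kint m k h h' x : nnm k -> nnm h -> nnm h' -> (forall z, h z <= h' z) ->
  kint m k h x <= kint m k h' x.
Proof.
move=> nk nh nh' hh'; apply: le_integral_nnm; try exact: nnm_kernel.
by move=> w; rewrite lee_wpmul2l// (nnm_ge0 nk).
Qed.

Lemma le_kintk m k k' h x : nnm k -> nnm k' -> nnm h ->
  (forall d, (0 <= d)%R -> k d <= k' d) -> kint m k h x <= kint m k' h x.
Proof.
move=> nk nk' nh kk'; apply: le_integral_nnm; try exact: nnm_kernel.
by move=> w; rewrite lee_wpmul2r ?(nnm_ge0 nh)// kk'// edist_ge0.
Qed.

Lemma le_pot m k k' x : nnm k -> nnm k' ->
  (forall d, (0 <= d)%R -> k d <= k' d) -> pot k m x <= pot k' m x.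
Proof. by move=> nk nk' kk'; rewrite !pot_kint; apply: le_kintk => //; exact: nnm_cst. Qed.

Lemma kintD m k h h' x : nnm k -> nnm h -> nnm h' ->
  kint m k (fun z => h z + h' z) x = kint m k h x + kint m k h' x.
Proof.
move=> nk nh nh'; rewrite -integral_nnmD; try exact: nnm_kernel.
by apply: eq_integral => w _; rewrite ge0_muleDr ?(nnm_ge0 nh) ?(nnm_ge0 nh').
Qed.

Lemma kintDk m k k' h x : nnm k -> nnm k' -> nnm h ->
  kint m (fun d => k d + k' d) h x = kint m k h x + kint m k' h x.
Proof.
move=> nk nk' nh; rewrite -integral_nnmD; try exact: nnm_kernel.
by apply: eq_integral => w _; rewrite ge0_muleDl ?(nnm_ge0 nk) ?(nnm_ge0 nk').
Qed.

Lemma potDk m k k' x : nnm k -> nnm k' ->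
  pot (fun d => k d + k' d) m x = pot k m x + pot k' m x.
Proof. by move=> nk nk'; rewrite !pot_kint kintDk//; exact: nnm_cst. Qed.

Lemma kintZ m k h x (c : \bar R) : nnm k -> nnm h -> 0 <= c ->
  kint m k (fun z => c * h z) x = c * kint m k h x.
Proof.
move=> nk nh c0; rewrite -integral_nnmZl//; last exact: nnm_kernel.
by apply: eq_integral => w _; rewrite muleCA.
Qed.

Lemma kintZk m k h x (c : \bar R) : nnm k -> nnm h -> 0 <= c ->
  kint m (fun d => c * k d) h x = c * kint m k h x.
Proof.
move=> nk nh c0; rewrite -integral_nnmZl//; last exact: nnm_kernel.
by apply: eq_integral => w _; rewrite muleA.
Qed.

Lemma cvg_kint_nd m k (h : nat -> T -> \bar R) g x : nnm k -> (forall j, nnm (h j)) ->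
  (forall z, nondecreasing_seq (h^~ z)) -> (forall z, h j z @[j --> \oo] --> g z) ->
  kint m k (h j) x @[j --> \oo] --> kint m k g x.
Proof.
move=> nk nh nd hg; apply: cvg_integral_nd => [j|z i j ij|z].
- exact: nnm_kernel.
- by rewrite lee_wpmul2l ?(nnm_ge0 nk)// nd.
- rewrite muleC (_ : (fun j => k (edist x z) * h j z) = fun j => h j z * k (edist x z)); last first.
    by apply/funext => j; rewrite muleC.
  apply: cvg_mule_nd => // [j|]; [exact: (nnm_ge0 (nh j))|exact: (nnm_ge0 nk)].
Qed.

Lemma cvg_kintk_nd m (k : nat -> R -> \bar R) k' h x : (forall j, nnm (k j)) -> nnm h ->
  (forall d, (0 <= d)%R -> nondecreasing_seq (k^~ d)) ->
  (forall d, (0 <= d)%R -> k j d @[j --> \oo] --> k' d) ->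
  kint m (k j) h x @[j --> \oo] --> kint m k' h x.
Proof.
move=> nk nh nd hg; apply: cvg_integral_nd => [j|z i j ij|z].
- exact: nnm_kernel.
- by rewrite lee_wpmul2r ?(nnm_ge0 nh)// nd// edist_ge0.
- apply: cvg_mule_nd; [by move=> j; exact: (nnm_ge0 (nk j))|exact: nd (edist_ge0 _ _)| |exact: (nnm_ge0 nh)].
  by apply: hg; exact: edist_ge0.
Qed.

Lemma cvg_kint_ni m k (h : nat -> T -> \bar R) g x : nnm k ->
  (forall d, (0 <= d)%R -> k d \is a fin_num) -> (forall j, nnm (h j)) -> nnm g ->
  (forall z, nonincreasing_seq (h^~ z)) -> (forall z, h j z @[j --> \oo] --> g z) ->
  kint m k (h 0%N) x < +oo ->
  kint m k (h j) x @[j --> \oo] --> kint m k g x.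
Proof.
move=> nk fk nh ng nd hg h0; apply: cvg_integral_ni => // [j||z i j ij|z].
- exact: nnm_kernel.
- exact: nnm_kernel.
- by rewrite lee_wpmul2l ?(nnm_ge0 nk)// nd.
- by apply: cvgeZl; [apply: fk; exact: edist_ge0|exact: hg].
Qed.

Definition lsc (v : T -> \bar R) := forall (x : 'rV[R]_n) (c : \bar R), c < v x ->
  exists2 e : R, (0 < e)%R & forall z : 'rV[R]_n, (edist x z < e)%R -> c < v z.

Lemma lsc_min v w : lsc v -> lsc w -> lsc (fun x => Order.min (v x) (w x)).
Proof.
move=> lv lw x c; rewrite lt_min => /andP[/lv[e e0 he] /lw[e' e0' he']].
exists (Num.min e e'); first by rewrite lt_min e0 e0'.
by move=> z; rewrite !lt_min => /andP[/he -> /he' ->].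
Qed.

Lemma open_lsc v (c : \bar R) : lsc v -> open ([set x | c < v x] : set (Rn R n)).
Proof.
move=> lv; rewrite openE => x /= /lv[e e0 he].
have nb : nbhs (x : Rn R n) (eball x e : set (Rn R n)).
  by apply: open_nbhs_nbhs; split; [exact: open_eball|rewrite /eball/= edistxx].
by apply: filterS nb => z; exact: he.
Qed.

Local Notation time := {measure set (measurableTypeR R) -> \bar R}.

Lemma nnm_mix (tau : time) : sigma_finite setT tau -> nnm (mix n tau).
Proof. by move=> st; apply: nnmI; [exact: measurable_mix|exact: mix_ge0]. Qed.

Let shift (k : nat) (d : R) : R := (d + k.+1%:R^-1)%R.

Let shift_cvg d : shift k d @[k --> \oo] --> d.
Proof. by rewrite -[X in _ --> X]addr0; apply: cvgD; [exact: cvg_cst|exact: cvg_harmonic]. Qed.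

Let shift_ni i j d : (i <= j)%N -> (shift j d <= shift i d)%R.
Proof. by move=> ij; rewrite lerD2l lef_pV2 ?posrE// ler_nat. Qed.

Lemma cvg_gauss0_shift t d : gauss0 n t (shift k d) @[k --> \oo] --> gauss0 n t d.
Proof.
rewrite /gauss0; case: ifP => t0; last exact: cvg_cst.
apply: cvgMr; apply: continuous_cvg; first exact: continuous_expR.
apply: cvgMl; apply: cvgN; rewrite expr2; under eq_cvg do rewrite expr2.
by apply: cvgM; exact: shift_cvg.
Qed.

Lemma cvg_mix_shift (tau : time) d : (0 <= d)%R ->
  mix n tau (shift k d) @[k --> \oo] --> mix n tau d.
Proof.
move=> d0; have s0 (j : nat) : (0 <= shift j d)%R by rewrite addr_ge0.
apply: cvg_integral_nd => [k|t i j ij|t].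
- apply: nnmI; last by move=> t; rewrite lee_fin gauss0_ge0.
  by apply/measurable_EFinP; exact: (measurable_fix2 (@measurable_gauss0 R n)).
- by rewrite lee_fin gauss0_le// s0 shift_ni.
- by apply: cvg_EFin; [near=> k|exact: cvg_gauss0_shift].
Unshelve. all: by end_near. Qed.

(** Enlarging all distances by [1 / (k + 1)] gives integrals [G k] that increase to the integral at
    [x], and by the triangle inequality [G k] is a lower bound at every point within [1 / (k + 1)]
    of [x]. *)
Lemma lsc_kint_mix (tau : time) m h : sigma_finite setT tau -> nnm h ->
  lsc (kint m (mix n tau) h).
Proof.
move=> st nh x c cv.
have s0 (j : nat) w : (0 <= shift j (edist x w))%R by rewrite addr_ge0 ?edist_ge0.
pose G (k : nat) := \int[m]_w (mix n tau (shift k (edist x (w : 'rV[R]_n))) * h w).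
have nG (k : nat) : nnm (fun w : T => mix n tau (shift k (edist x (w : 'rV[R]_n))) * h w).
  apply: nnmM => //; apply: nnmI; last by move=> w; exact: mix_ge0.
  have ms : measurable_fun setT (fun w : T => shift k (edist x (w : 'rV[R]_n))).
    by apply: measurable_funD => //; exact: measurable_edist1.
  exact: (measurableT_comp (nnm_m (nnm_mix st)) ms).
have cG : G k @[k --> \oo] --> kint m (mix n tau) h x.
  apply: cvg_integral_nd => // [w i j ij|w].
    by rewrite lee_wpmul2r ?(nnm_ge0 nh)// mix_le// s0 shift_ni.
  apply: cvg_mule_nd.
  - by move=> k; exact: mix_ge0.
  - by move=> i j ij; rewrite mix_le// s0 shift_ni.
  - by apply: cvg_mix_shift; exact: edist_ge0.
  - exact: (nnm_ge0 nh).
have [k ck] := cvge_gt_ex cG cv.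
exists (k.+1%:R^-1)%R; first by rewrite invr_gt0 ltr0n.
move=> z xz; refine (lt_le_trans ck _); rewrite /G /kint.
apply: le_integral_nnm; [exact: nG|by apply: nnm_kernel; [exact: nnm_mix|exact: nh]|].
move=> w; rewrite lee_wpmul2r ?(nnm_ge0 nh)// mix_le// edist_ge0/= /shift.
by rewrite (le_trans (edist_triangle z x w))// addrC lerD2l edistC ltW.
Qed.

Definition comp (k1 k2 : R -> \bar R) x (w : 'rV[R]_n) : \bar R :=
  \int[L]_z (k1 (edist x z) * k2 (edist (z : 'rV[R]_n) w)).

Lemma nnm_comp (k1 k2 : R -> \bar R) x : nnm k1 -> nnm k2 ->
  nnm (fun w : T => comp k1 k2 x (w : 'rV[R]_n)).
Proof.
move=> n1 n2; have := nnm_kint (Leb_sigma_finite R n) n2 (nnm_edist x n1).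
congr nnm; apply/funext => w; apply: eq_integral => z _.
by rewrite muleC [edist w z]edistC.
Qed.

Lemma kint_assoc m (k1 k2 : R -> \bar R) h x : sigma_finite setT m -> nnm k1 -> nnm k2 -> nnm h ->
  kint L k1 (kint m k2 h) x = \int[m]_w (comp k1 k2 x (w : 'rV[R]_n) * h w).
Proof.
move=> sm n1 n2 nh.
have m1 := (nnm_m (nnm_edist x n1)).
have m2 : measurable_fun setT (fun q : T * T => k2 (edist (q.1 : 'rV[R]_n) (q.2 : 'rV[R]_n))).
  exact: (measurableT_comp (nnm_m n2) (@measurable_edist R n)).
pose F (z w : T) := k1 (edist x (z : 'rV[R]_n)) * (k2 (edist (z : 'rV[R]_n) w) * h w).
have mF : measurable_fun setT (fun q : T * T => F q.1 q.2).
  apply: emeasurable_funM; first exact: (measurableT_comp m1 measurable_fst).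
  by apply: emeasurable_funM; [exact: m2|exact: (measurableT_comp (nnm_m nh) measurable_snd)].
have F0 z w : 0 <= F z w by rewrite /F !mule_ge0 ?(nnm_ge0 n1) ?(nnm_ge0 n2) ?(nnm_ge0 nh).
transitivity (\int[L]_z \int[m]_w F z w).
  apply: eq_integral => z _; rewrite /F integral_nnmZl//; first exact: nnm_kernel.
  exact: (nnm_ge0 n1).
rewrite (@tonelli _ _ _ _ _ _ _ (Leb_sigma_finite R n) sm F mF F0).
apply: eq_integral => w _; rewrite /comp -integral_nnmZr; last exact: (nnm_ge0 nh).
  by apply: eq_integral => z _; rewrite /F muleA.
by apply: nnmM; [exact: nnm_edist|exact: nnm_edistr].
Qed.

Lemma pot_assoc m (k1 k2 : R -> \bar R) x : sigma_finite setT m -> nnm k1 -> nnm k2 ->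
  kint L k1 (pot k2 m) x = \int[m]_w comp k1 k2 x (w : 'rV[R]_n).
Proof.
move=> sm n1 n2; rewrite (_ : pot k2 m = kint m k2 (fun=> 1)); last first.
  by apply/funext => z; exact: pot_kint.
rewrite kint_assoc//; last exact: nnm_cst.
by apply: eq_integral => w _; rewrite mule1.
Qed.

End kernel_integrals.

(** * The algebra of the operators [kall], [kshort], [klong] and [kmid] *)

Section riesz_potentials.
Local Open Scope ereal_scope.
Context (R : realType) (n : nat) (alpha : R).
Hypotheses (n3 : (3 <= n)%N) (alpha0 : (0 < alpha)%R) (alpha2 : (alpha <= 2)%R).
Local Notation leb := (@lebesgue_measure R).
Local Notation L := (Leb R n).
Local Notation T := (RnB R n).
Local Notation tm := (tmeas n3 alpha0 alpha2).
Local Notation kl := (klong n alpha).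
Local Notation ks := (kshort n alpha).
Local Notation ka := (kall n alpha).
Local Notation km := (kmid n alpha).
Local Notation "'c_ s" := (cshort n alpha s) (at level 8, s at level 2, format "''c_' s").
Implicit Types (m : msr R n) (h v : T -> \bar R) (x w : 'rV[R]_n) (s r : R).

Let sL : sigma_finite setT L := Leb_sigma_finite R n.

Lemma kmixE i : kmix n alpha i = mix n (tm i).
Proof. by apply/funext => d; exact: kmix_mix. Qed.

Let st i : sigma_finite setT (tm i) := tmeas_sigma_finite n3 alpha0 alpha2 i.

Lemma nnm_kmix i : nnm (kmix n alpha i).
Proof. by rewrite kmixE; exact: nnm_mix. Qed.

Lemma nnm_km s : (0 < s)%R -> nnm (km s).
Proof. by move=> s0; apply: nnm_mix; exact: etam_sigma_finite. Qed.

Lemma km_le s d : (0 < s)%R -> km s d <= (gpeak n s)%:E.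
Proof.
move=> s0; rewrite -[leRHS]mule1 -(etam_mass alpha0 alpha2 s0) -integral_cst//.
apply: (le_etam alpha0 alpha2 s0) => //.
- by apply/measurable_EFinP; exact: (measurable_fix2 (@measurable_gauss0 R n)).
- by move=> t; rewrite lee_fin gauss0_ge0.
- by move=> t; rewrite lee_fin gpeak_ge0.
move=> u su; have u0 := lt_le_trans s0 su.
rewrite lee_fin /gauss0 u0 /gauss -[leRHS]mulr1 ler_pM ?gpeak_ge0 ?expR_ge0//.
  rewrite /gpeak !powRN lef_pV2 ?posrE ?powR_gt0 ?mulr_gt0 ?pi_gt0//.
  by rewrite ge0_ler_powR ?nnegrE ?mulr_ge0 ?pi_ge0 ?(ltW s0) ?(ltW u0)// ler_wpM2l ?pi_ge0.
by rewrite -expR0 ler_expR mulNr oppr_le0 mulr_ge0 ?sqr_ge0 ?powR_ge0.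
Qed.

Lemma km_fin s d : (0 < s)%R -> km s d \is a fin_num.
Proof.
move=> s0; rewrite ge0_fin_numE ?kmid_ge0//; apply: le_lt_trans (km_le d s0) _; exact: ltry.
Qed.

Lemma kl_fin s d : (0 < s)%R -> kl s d \is a fin_num.
Proof. by move=> s0; rewrite ge0_fin_numE ?kmix_ge0//; exact: klong_fin. Qed.

Lemma comp_kaC s x w : (0 < s)%R -> comp ka (km s) x w = kl s (edist x w).
Proof.
move=> s0; rewrite /comp /kall kmixE /kmid mix_comp//; last exact: etam_sigma_finite.
by rewrite mixc_all_etam.
Qed.

Lemma comp_ka s x w : (0 < s)%R -> comp (km s) ka x w = kl s (edist x w).
Proof.
move=> s0; have se := etam_sigma_finite alpha0 alpha2 s0.
by rewrite /comp /kall kmixE /kmid mix_comp// mixcC// mixc_all_etam.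
Qed.

Lemma comp_km s r x w : (0 < s)%R -> (0 < r)%R -> comp (km s) (km r) x w = comp (km r) (km s) x w.
Proof.
move=> s0 r0.
have [se re] := (etam_sigma_finite alpha0 alpha2 s0, etam_sigma_finite alpha0 alpha2 r0).
by rewrite /comp /kmid !mix_comp// mixcC.
Qed.

Lemma kint_ka m h s x : sigma_finite setT m -> nnm h -> (0 < s)%R ->
  kint L ka (kint m (km s) h) x = kint m (kl s) h x.
Proof.
move=> sm nh s0; rewrite (kint_assoc x sm (nnm_kmix _) (nnm_km s0) nh).
by apply: eq_integral => w _; rewrite comp_kaC.
Qed.

Lemma kint_kmC m h s r x : sigma_finite setT m -> nnm h -> (0 < s)%R -> (0 < r)%R ->
  kint L (km s) (kint m (km r) h) x = kint L (km r) (kint m (km s) h) x.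
Proof.
move=> sm nh s0 r0.
rewrite (kint_assoc x sm (nnm_km s0) (nnm_km r0) nh) (kint_assoc x sm (nnm_km r0) (nnm_km s0) nh).
by apply: eq_integral => w _; rewrite comp_km.
Qed.

Lemma kint_pot m s x : sigma_finite setT m -> (0 < s)%R ->
  kint L (km s) (pot ka m) x = pot (kl s) m x.
Proof.
move=> sm s0; rewrite (pot_assoc x sm (nnm_km s0) (nnm_kmix _)).
by apply: eq_integral => w _; rewrite comp_ka.
Qed.

Lemma kint_potC m s r x : sigma_finite setT m -> (0 < s)%R -> (0 < r)%R ->
  kint L (km s) (pot (kl r) m) x = kint L (km r) (pot (kl s) m) x.
Proof.
move=> sm s0 r0.
have E u : (0 < u)%R -> pot (kl u) m = kint L (km u) (pot ka m).
  by move=> u0; apply/funext => z; rewrite kint_pot.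
by rewrite (E _ r0) (E _ s0); exact: (kint_kmC x sL (nnm_pot sm (nnm_kmix _)) s0 r0).
Qed.

Lemma kint_km1 s x : (0 < s)%R -> kint L (km s) (fun=> 1) x <= 1.
Proof.
move=> s0; rewrite /kint; under eq_integral do rewrite mule1.
by rewrite -(etam_mass alpha0 alpha2 s0); apply: mix_mass; exact: etam_sigma_finite.
Qed.

Lemma pot_split s m x : pot ka m x = pot (ks s) m x + pot (kl s) m x.
Proof.
rewrite -potDk; [|exact: nnm_kmix|exact: nnm_kmix].
by apply: eq_integral => w _; rewrite (kall_split n3 alpha0 alpha2 s).
Qed.

(** Split [kall] at [s] in the convolution of [kall] with [kmid r], which is [klong r]; the long
    piece, [klong s] with [kmid r], equals [klong r] with [kmid s], both being [kall] composed with
    [kmid s] and [kmid r]. *)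
Lemma kl_star s r x w : (0 < s)%R -> (0 < r)%R ->
  kl r (edist x w) = comp (kl r) (km s) x w + comp (ks s) (km r) x w.
Proof.
move=> s0 r0.
have nk u : (0 < u)%R -> nnm (fun z : T => km u (edist (z : 'rV[R]_n) w)).
  by move=> u0; apply: nnm_edistr; exact: nnm_km.
have -> : comp (kl r) (km s) x w = comp (kl s) (km r) x w.
  apply: (etrans (esym (kint_ka x sL (nk _ s0) r0))).
  apply: (etrans _ (kint_ka x sL (nk _ r0) s0)).
  apply: (congr1 (fun v => kint L ka v x)); apply/funext => z.
  exact: (comp_km (z : 'rV[R]_n) w r0 s0).
rewrite -comp_kaC// addeC -integral_nnmD.
- apply: eq_integral => z _; rewrite (kall_split n3 alpha0 alpha2 s) ge0_muleDl//; exact: kmix_ge0.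
- by apply: nnmM; [apply: nnm_edist; exact: nnm_kmix|exact: nk].
- by apply: nnmM; [apply: nnm_edist; exact: nnm_kmix|exact: nk].
Qed.

(** Together with [short_upper]: divided by its mass ['c_s], the short kernel acts almost as the
    identity when [s] is small against [r]. The lower bound covers all means by [km r], the upper
    bound only [kl r]-potentials. *)
Lemma short_lower m h s r x : sigma_finite setT m -> nnm h -> (0 < s)%R -> (0 < r)%R ->
  'c_s * (((r / (r + s)) ^+ n)%:E * kint m (km r) h x) <= kint L (ks s) (kint m (km r) h) x.
Proof.
move=> sm nh s0 r0.
have c0 : 0 <= 'c_s by exact/ltW/cshort_gt0.
have e0 : 0 <= ((r / (r + s)) ^+ n)%:E.
  by rewrite lee_fin exprn_ge0// divr_ge0 ?ltW// addr_gt0.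
rewrite (kint_assoc x sm (nnm_kmix _) (nnm_km r0) nh).
have nk := nnm_kernel x (nnm_km r0) nh.
rewrite -!integral_nnmZl//; last by apply: nnmM => //; exact: nnm_cst.
apply: le_integral_nnm.
- by do 2!(apply: nnmM; first exact: nnm_cst).
- by apply: nnmM => //; apply: nnm_comp; [exact: nnm_kmix|exact: nnm_km].
move=> w; rewrite !(muleA _ _ (h w)) lee_wpmul2r ?(nnm_ge0 nh)//.
rewrite /comp /kshort kmixE mix_comp//; last exact: etam_sigma_finite.
exact: mixc_short_etam.
Qed.

Lemma short_upper m s r x : sigma_finite setT m -> (0 < s)%R -> (0 < r)%R ->
  kint L (ks s) (pot (kl r) m) x <= 'c_s * ((1 + s / r)%:E * pot (kl r) m x).
Proof.
move=> sm s0 r0.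
have c0 : 0 <= 'c_s by exact/ltW/cshort_gt0.
have e0 : 0 <= (1 + s / r)%:E by rewrite lee_fin addr_ge0// divr_ge0// ltW.
have nks := nnm_kmix `]-oo, s]%R; have nkl := nnm_kmix `]r, +oo[%R.
have nk := nnm_edist x nkl.
rewrite (pot_assoc x sm nks nkl).
rewrite /pot -(integral_nnmZl _ nk e0) -integral_nnmZl//; last by apply: nnmM => //; exact: nnm_cst.
apply: le_integral_nnm.
- exact: nnm_comp.
- by do 2!(apply: nnmM; first exact: nnm_cst).
by move=> w; rewrite /comp !kmixE mix_comp// -kmixE; exact: mixc_short_long.
Qed.

End riesz_potentials.

(** * Approximate identities, tail estimates, Harnack *)

Section approximation.
Local Open Scope ereal_scope.
Context (R : realType) (n : nat) (alpha : R).
Hypotheses (n3 : (3 <= n)%N) (alpha0 : (0 < alpha)%R) (alpha2 : (alpha <= 2)%R).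
Local Notation leb := (@lebesgue_measure R).
Local Notation L := (Leb R n).
Local Notation T := (RnB R n).
Local Notation tm := (tmeas n3 alpha0 alpha2).
Local Notation kl := (klong n alpha).
Local Notation ks := (kshort n alpha).
Local Notation ka := (kall n alpha).
Local Notation km := (kmid n alpha).
Implicit Types (m : msr R n) (h v : T -> \bar R) (x w : 'rV[R]_n) (s r : R).

Let sL : sigma_finite setT L := Leb_sigma_finite R n.
Let nk i : nnm (kmix n alpha i) := nnm_kmix n3 alpha0 alpha2 i.
Let nm s : (0 < s)%R -> nnm (km s) := @nnm_km R n alpha alpha0 alpha2 s.

Lemma harm_gt0 (k : nat) : (0 < k.+1%:R^-1 :> R)%R.
Proof. by rewrite invr_gt0 ltr0n. Qed.

Lemma pot_kl_nd m x : nondecreasing_seq (fun k : nat => pot (kl k.+1%:R^-1) m x).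
Proof.
move=> i j ij; apply: le_pot; [exact: nk|exact: nk|].
move=> d d0; exact: klong_nd.
Qed.

Lemma pot_kl_cvg m x : pot (kl k.+1%:R^-1) m x @[k --> \oo] --> pot ka m x.
Proof.
apply: cvg_integral_nd => [k|w|w].
- by apply: nnm_edist; exact: nk.
- exact: klong_nd.
- exact: klong_cvg.
Qed.

Lemma lsc_kmix_pot m i : lsc (pot (kmix n alpha i) m).
Proof.
rewrite (_ : pot _ m = kint m (mix n (tm i)) (fun=> 1)).
  by apply: lsc_kint_mix; [exact: tmeas_sigma_finite|exact: nnm_cst].
by apply/funext => x; rewrite pot_kint kmixE.
Qed.

Lemma lsc_kint_km m h s : (0 < s)%R -> nnm h -> lsc (kint m (km s) h).
Proof. by move=> s0 nh; apply: lsc_kint_mix => //; exact: etam_sigma_finite. Qed.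

Lemma pot_dirac k x z : nnm k -> pot k (dirac_at x) z = k (edist z x).
Proof.
move=> nk'; rewrite /pot /dirac_at integral_dirac//; last exact: nnm_m (nnm_edist z nk').
by rewrite diracE in_setT mul1e.
Qed.

Lemma dirac_sigma_finite x : sigma_finite setT (dirac_at x : msr R n).
Proof.
exists (fun=> setT); first by rewrite bigcup_const.
by move=> _; split; [exact: measurableT|rewrite /= /dirac indicE in_setT ltry].
Qed.

(** The means of [kl 1] around [x] tend to its maximum [kl 1 0], which exceeds its values off the
    ball by [e']; the mass left outside the ball must therefore become small. *)
Lemma kint_km_concentrates x (delta e : R) : (0 < delta)%R -> (0 < e)%R ->
  exists N, forall k, (N <= k)%N ->
    (1 - e)%:E <= kint L (km k.+1%:R^-1) (fun z => (\1_(eball x delta : set T) z)%:E) x.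
Proof.
move=> d0 e0; have [e' e'0 he'] := klong1_strict n3 alpha0 alpha2 d0.
pose K := fine (kl 1 0).
have KE : kl 1 0 = K%:E by rewrite fineK// kl_fin.
have nb := nnm_indic R (measurable_eball x delta).
pose J k := kint L (km k.+1%:R^-1) (pot (kl 1) (dirac_at x)) x.
(* With the two times exchanged, [J] is the mean by a fixed kernel of an increasing sequence, so
   that monotone convergence applies. *)
have JE k : J k = kint L (km 1) (pot (kl k.+1%:R^-1) (dirac_at x)) x.
  exact: (kint_potC n3 alpha0 alpha2 x (dirac_sigma_finite x) (harm_gt0 k) ltr01).
have nJ : nondecreasing_seq J.
  move=> i j ij; rewrite !JE; apply: le_kint; [exact: nm|
    by apply: nnm_pot; [exact: dirac_sigma_finite|exact: nk]|
    by apply: nnm_pot; [exact: dirac_sigma_finite|exact: nk]|].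
  by move=> z; exact: pot_kl_nd.
have cJ : J k @[k --> \oo] --> kl 1 0.
  rewrite -(edistxx x) -(comp_ka n3 alpha0 alpha2 x x ltr01).
  rewrite (_ : J = fun k => kint L (km 1) (pot (kl k.+1%:R^-1) (dirac_at x)) x); last first.
    by apply/funext => k; exact: JE.
  rewrite (_ : comp _ _ x x = kint L (km 1) (pot ka (dirac_at x)) x); last first.
    by apply: eq_integral => z _; rewrite pot_dirac//; exact: nk.
  apply: cvg_kint_nd.
  - exact: nm.
  - by move=> j; apply: nnm_pot; [exact: dirac_sigma_finite|exact: nk].
  - by move=> z; exact: pot_kl_nd.
  - by move=> z; exact: pot_kl_cvg.
have Ke : (e' <= K)%R.
  by rewrite -lee_fin -KE; apply: le_trans (he' delta (lexx _)); rewrite leeDr ?kmix_ge0.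
have [N hN] : exists N, forall k, (N <= k)%N -> (K - e * e')%:E < J k.
  by apply: (cvge_nd_gt nJ cJ); rewrite KE lte_fin ltrBlDr ltrDl mulr_gt0.
exists N => k Nk; have s0 := harm_gt0 k; set s := (k.+1%:R^-1 : R)%R in s0 *.
set p := kint _ _ _ _.
have p0 : 0 <= p by apply: kint_ge0; [exact: nm|exact: nb].
have Jp : J k <= (K - e')%:E + e'%:E * p.
  have nc : nnm (fun _ : T => (K - e')%:E) by apply: nnm_cst; rewrite lee_fin subr_ge0.
  have c1 : 0 <= (K - e')%:E by rewrite lee_fin subr_ge0.
  have c2 : 0 <= e'%:E by rewrite lee_fin ltW.
  have ne : nnm (fun z : T => e'%:E * (\1_(eball x delta : set T) z)%:E).
    by apply: nnmM; [exact: nnm_cst|exact: nb].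
  apply: (@le_trans _ _ (kint L (km s) (fun z => (K - e')%:E + e'%:E * (\1_(eball x delta : set T) z)%:E) x)).
    apply: le_kint; [exact: nm|by apply: nnm_pot; [exact: dirac_sigma_finite|exact: nk]|exact: nnmD|].
    move=> z; rewrite pot_dirac; last exact: nk.
    rewrite indicE; case: (boolP (z \in _)) => [zb|/negP zb].
      rewrite mule1 -EFinD subrK -KE; apply: kmix_anti => //.
      by rewrite lexx edist_ge0.
    rewrite mule0 adde0 EFinB leeBrDr// -KE edistC; apply: he'.
    by rewrite leNgt; apply/negP => h; apply: zb; rewrite inE.
  rewrite kintD//; last exact: nm.
  apply: leeD.
    rewrite -[leRHS]mule1 (_ : (fun _ : T => (K - e')%:E) = (fun _ : T => (K - e')%:E * 1)); last first.
      by apply/funext => z; rewrite mule1.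
    rewrite kintZ//; [|exact: nm|exact: nnm_cst].
    by apply: lee_wpmul2l => //; exact: kint_km1.
  by rewrite kintZ//; exact: nm.
have := lt_le_trans (hN k Nk) Jp; clear Jp; move: p p0.
case=> [p| |]// p0; last by rewrite leey.
rewrite -EFinM -EFinD lte_fin lee_fin => h.
have : (e' * (1 - e) < e' * p)%R by lra.
by rewrite ltr_pM2l// => /ltW.
Qed.

Lemma kint_km_lsc_gt v x (c : R) : nnm v -> lsc v -> c%:E < v x ->
  exists N, forall k, (N <= k)%N -> c%:E <= kint L (km k.+1%:R^-1) v x.
Proof.
move=> nv lv cv; have [c0|c0] := leP c 0%R.
  exists 0%N => k _; apply: (@le_trans _ _ 0); first by rewrite lee_fin.
  by apply: kint_ge0 => //; apply: nm; exact: harm_gt0.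
have [c' cc' c'v] : exists2 c' : R, (c < c')%R & c'%:E < v x.
  case: (v x) cv => [r| |]//; rewrite ?lte_fin => h; last first.
    by exists (c + 1)%R; rewrite ?ltrDl// ltry.
  by exists ((c + r) / 2)%R; rewrite ?lte_fin; lra.
have c'0 : (0 < c')%R by exact: lt_trans cc'.
have [d d0 hd] := lv _ _ c'v.
have cc0 : (0 < 1 - c / c')%R by rewrite subr_gt0 ltr_pdivrMr// mul1r.
have [N hN] := kint_km_concentrates x d0 cc0.
exists N => k Nk.
apply: (@le_trans _ _ (kint L (km k.+1%:R^-1) (fun z => c'%:E * (\1_(eball x d : set T) z)%:E) x)).
  rewrite kintZ ?lee_fin ?(ltW c'0)//; [|exact: nm (harm_gt0 k)|exact: nnm_indic (measurable_eball x d)].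
  apply: (@le_trans _ _ (c'%:E * (1 - (1 - c / c'))%:E)).
    by rewrite -EFinM lee_fin opprB addrC subrK mulrC divfK ?gt_eqF.
  by apply: lee_wpmul2l; [rewrite lee_fin ltW|exact: hN].
apply: le_kint => //; [exact: nm (harm_gt0 k)| |].
  by apply: nnmM; [apply: nnm_cst; rewrite lee_fin ltW|exact: nnm_indic (measurable_eball x d)].
move=> z; rewrite indicE; case: (boolP (z \in _)) => [|_]; last by rewrite mule0 nnm_ge0.
by rewrite inE mule1 => /hd/ltW.
Qed.

(** The means concentrate at [x], so by lower semicontinuity their lower limit is at least [v x]. *)
Lemma lsc_le_lim v x (b : \bar R) : nnm v -> lsc v ->
  (forall k : nat, kint L (km k.+1%:R^-1) v x <= b) -> v x <= b.
Proof.
move=> nv lv h; rewrite leNgt; apply/negP => bv.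
have b0 : 0 <= b by apply: le_trans (h 0%N); apply: kint_ge0 => //; exact: nm (harm_gt0 0).
case: b h bv b0 => [b| |]// h bv _; last by move: bv; rewrite ltNge leey.
have [c bc cv] : exists2 c : R, (b < c)%R & c%:E < v x.
  case: (v x) bv => [r| |]//; rewrite ?lte_fin => br; last first.
    by exists (b + 1)%R; rewrite ?ltrDl// ltry.
  by exists ((b + r) / 2)%R; rewrite ?lte_fin; lra.
have [N hN] := kint_km_lsc_gt nv lv cv.
by have := le_trans (hN N (leqnn _)) (h N); rewrite lee_fin leNgt bc.
Qed.

(* Bounds the proportion of the short part in the kernel beyond distance [rho]. *)
Definition gtail s (rho : R) : R := (2 ^+ n * expR (- rho ^+ 2 / (2 * s)))%R.

Lemma gtail_ge0 s rho : (0 <= gtail s rho)%R.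
Proof. by rewrite mulr_ge0 ?exprn_ge0 ?expR_ge0. Qed.

Lemma expR_neg_le (y : R) : (0 < y)%R -> (expR (- y) <= y^-1)%R.
Proof.
move=> y0; rewrite expRN lef_pV2 ?posrE ?expR_gt0//.
by apply: le_trans (expR_ge1Dx _); rewrite lerDr.
Qed.

Lemma gtail_le s rho : (0 < s)%R -> (0 < rho)%R -> (gtail s rho <= 2 ^+ n * (2 * s) / rho ^+ 2)%R.
Proof.
move=> s0 r0; rewrite /gtail -mulrA ler_wpM2l ?exprn_ge0// mulNr.
have r2 : (0 < rho ^+ 2 / (2 * s))%R by rewrite divr_gt0 ?exprn_gt0 ?mulr_gt0.
by apply: le_trans (expR_neg_le r2) _; rewrite invf_div.
Qed.

Lemma gtail_small (rho e : R) : (0 < rho)%R -> (0 < e)%R ->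
  exists2 s0 : R, (0 < s0)%R & forall s, (0 < s <= s0)%R -> (gtail s rho <= e)%R.
Proof.
move=> r0 e0; have p0 : (0 < 2 ^+ n * 2 :> R)%R by rewrite mulr_gt0// exprn_gt0.
exists (e * rho ^+ 2 / (2 ^+ n * 2))%R; first by rewrite divr_gt0// mulr_gt0// exprn_gt0.
move=> s /andP[s0 ss]; apply: le_trans (gtail_le s0 r0) _.
by rewrite ler_pdivrMr ?exprn_gt0// mulrA mulrC -ler_pdivlMr.
Qed.

Lemma gtail_far s (e : R) : (0 < s)%R -> (0 < e)%R ->
  exists2 rho : R, (0 < rho)%R & (gtail s rho <= e)%R.
Proof.
move=> s0 e0; pose q := (2 ^+ n * (2 * s) / e)%R.
have q0 : (0 < q)%R by rewrite divr_gt0// !mulr_gt0// exprn_gt0.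
have qE : (2 ^+ n * (2 * s) = e * q)%R by rewrite [RHS]mulrC divfK ?gt_eqF.
have q1 : (0 < 1 + q)%R by rewrite addr_gt0.
exists (1 + q)%R => //; apply: le_trans (gtail_le s0 q1) _.
by rewrite ler_pdivrMr ?exprn_gt0// qE ler_pM2l//; nra.
Qed.

Lemma ks_le s (rho d : R) : (0 < s)%R -> (0 <= rho <= d)%R -> ks s d <= (gtail s rho)%:E * ka d.
Proof. by move=> s0 rd; exact: kshort_le. Qed.

(** With [g = gtail s rho] one has [kl >= (1 - g) ka], and [1 / (1 - g) <= 1 + 2 g] for
    [g <= 1 / 2]. *)
Lemma ka_le_kl s (rho d : R) : (0 < s)%R -> (0 < rho <= d)%R -> (gtail s rho <= 2^-1)%R ->
  ka d <= (1 + 2 * gtail s rho)%:E * kl s d.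
Proof.
move=> s0 /andP[r0 rd] e2; have d0 := lt_le_trans r0 rd.
have := ks_le s0 (_ : (0 <= rho <= d)%R); rewrite (ltW r0) rd => /(_ isT).
have := kall_split n3 alpha0 alpha2 s d; have e0 := gtail_ge0 s rho.
rewrite (kall_gt0E n3 alpha0 alpha2 d0).
have f2 : kl s d \is a fin_num by exact: kl_fin.
have p1 : 0 <= ks s d by exact: kmix_ge0.
case: (ks s d) p1 => [a| |]// p1.
rewrite -(fineK f2) -EFinD => -[->]; rewrite -!EFinM !lee_fin => h.
have l0 : (0 <= fine (kl s d))%R by apply: fine_ge0; exact: kmix_ge0.
rewrite lee_fin in p1; move: (fine _) (gtail s rho) l0 e0 e2 h => l g l0 e0 e2 h.
have : (0 <= a * (2^-1 - g))%R by rewrite mulr_ge0// subr_ge0.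
lra.
Qed.

(* A Harnack inequality: the shift of the point is absorbed in the constant. *)
Lemma kl_harnack (r s D : R) : (0 < r)%R -> (0 < s)%R -> (0 <= D)%R ->
  exists2 C : R, (0 <= C)%R & forall d d0, (0 <= d)%R -> (0 <= d0 <= d + D)%R ->
    kl r d <= C%:E * kl s d0.
Proof.
move=> r0 s0 D0; have h2 : (0 < 2^-1 :> R)%R by rewrite invr_gt0.
have [rho rho0 hrho] := gtail_far s0 h2.
(* Beyond [M] a shift by [D] at most halves the distance, and [ka] is at most twice [kl s]; up to
   [M] the kernel [kl s] has a positive lower bound, while [kl r] is bounded. *)
pose M := (rho + (2 * D + 1))%R.
have M0 : (0 < M)%R by rewrite addr_gt0// ltr_wpDl ?mulr_ge0.
pose C1 := (fine (kl r 0) / fine (kl s M))%R.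
have kp u d : (0 < u)%R -> (0 < fine (kl u d))%R.
  move=> u0; rewrite -lte_fin fineK ?kl_fin//; apply: klong_gt0 => //; exact: ltW.
have C10 : (0 <= C1)%R by rewrite divr_ge0// ltW// kp.
pose C2 := (2 `^ (n%:R - alpha) * 2)%R.
have C20 : (0 <= C2)%R by rewrite mulr_ge0 ?powR_ge0.
exists (C1 + C2)%R => [|d d0 dge /andP[d00 d0d]]; first exact: addr_ge0.
have kl0 : 0 <= kl s d0 by exact: kmix_ge0.
have [dM|dM] := leP d0 M.
  apply: (@le_trans _ _ (C1%:E * kl s M)).
    apply: (@le_trans _ _ (kl r 0)); first by apply: kmix_anti => //; rewrite lexx.
    rewrite -(fineK (kl_fin n3 alpha0 alpha2 0 r0)) -(fineK (kl_fin n3 alpha0 alpha2 M s0)).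
    by rewrite -EFinM lee_fin /C1 divfK// gt_eqF// kp.
  apply: (@le_trans _ _ (C1%:E * kl s d0)).
    by apply: lee_wpmul2l; [rewrite lee_fin|apply: kmix_anti => //; rewrite d00].
  by apply: lee_wpmul2r => //; rewrite lee_fin lerDl.
have d0p : (0 < d0)%R by exact: lt_trans dM.
have dh : (d0 / 2 <= d)%R by move: dM; rewrite /M; nra.
apply: (@le_trans _ _ (ka (d0 / 2)%R)).
  apply: le_trans (klong_le_kall n3 alpha0 alpha2 _ _) _.
  by apply: kmix_anti => //; rewrite dh divr_ge0.
have -> : ka (d0 / 2)%R = (2 `^ (n%:R - alpha))%:E * ka d0.
  rewrite !(kall_gt0E n3 alpha0 alpha2) ?divr_gt0// -EFinM; congr EFin.
  rewrite powRM ?invr_ge0// mulrC; congr (_ * _)%R.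
  by rewrite -powR_inv1// -powRrM mulN1r opprB.
apply: (@le_trans _ _ (C2%:E * kl s d0)); last first.
  by apply: lee_wpmul2r => //; rewrite lee_fin lerDr.
rewrite /C2 EFinM -muleA lee_wpmul2l ?lee_fin ?powR_ge0//.
apply: (@le_trans _ _ ((1 + 2 * gtail s rho)%:E * kl s d0)).
  apply: ka_le_kl => //; rewrite rho0 ltW//; apply: le_lt_trans dM.
  by rewrite lerDl addr_ge0 ?mulr_ge0.
by apply: lee_wpmul2r => //; rewrite lee_fin; lra.
Qed.

(** By the Harnack inequality, finiteness of long potentials depends neither on the point nor on the
    cut; it may be tested at the origin with the cut [1]. *)
Lemma pot_kl_fin (m : msr R n) r s x0 x : (0 < r)%R -> (0 < s)%R ->
  pot (kl s) m x0 < +oo -> pot (kl r) m x < +oo.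
Proof.
move=> r0 s0 h; have [C C0 hC] := kl_harnack r0 s0 (edist_ge0 x x0).
apply: (@le_lt_trans _ _ (C%:E * pot (kl s) m x0)); last exact: lte_mul_pinfty.
rewrite /pot -integral_nnmZl ?lee_fin//; last by apply: nnm_edist; exact: nk.
apply: le_integral_nnm; [by apply: nnm_edist; exact: nk| |].
  by apply: nnmM; [apply: nnm_cst; rewrite lee_fin|apply: nnm_edist; exact: nk].
move=> w; apply: hC; rewrite ?edist_ge0//= addrC [edist x x0]edistC.
exact: edist_triangle.
Qed.

Lemma potentialE (m : msr R n) : potential alpha m = pot ka m.
Proof. by apply/funext => x; apply: eq_integral => w _; exact: riesz_kall. Qed.

Lemma Mplus_pot_kl_fin (m : msr R n) s x : (0 < s)%R -> Mplus alpha m -> pot (kl s) m x < +oo.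
Proof.
move=> s0 [_ [x0]]; rewrite potentialE => h; apply: (pot_kl_fin _ s0 s0 (x0 := x0)).
apply: le_lt_trans h; apply: le_pot; [exact: nk|exact: nk|].
by move=> d _; exact: klong_le_kall.
Qed.

End approximation.

(** * Weak compactness *)

Section ultralimits.
Context (R : realType) (U : set_system nat) (UU : UltraFilter U).

Lemma ultra_cvg (a : nat -> R) (M : R) : (forall j, 0 <= a j <= M) ->
  cvg (a @ U).
Proof.
move=> aM; have Ua : U (a @^-1` `[0, M]%classic).
  by apply: (@filterE _ U) => j /=; rewrite in_itv/= aM.
have := @segment_compact R 0 M.
move=> /(_ (a @ U) _ Ua)[] p [_ cp]; apply/cvg_ex; exists p => V nV /=.
have [//|UC] := in_ultra_setVsetC (a @^-1` V) UU.
by have [q []] := cp (~` V) V UC nV.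
Qed.

Lemma ultra_lim_le (a b : nat -> R) : cvg (a @ U) -> cvg (b @ U) ->
  (forall j, a j <= b j) -> lim (a @ U) <= lim (b @ U).
Proof. by move=> ca cb ab; apply: ler_lim => //; exact: filterE. Qed.

End ultralimits.

(** * From an ultralimit of finite measures to a Borel measure *)

Section halmos.
Local Open Scope ereal_scope.
Context (R : realType) (n : nat) (U : set_system nat) (UU : UltraFilter U).
Local Notation T := (RnB R n).
Variables (theta : nat -> msr R n) (M : R).
Hypothesis thetaM : forall j, theta j setT <= M%:E.

(* Halmos' construction of a measure from the content [umass]. *)
Definition umass (A : set T) : R := lim ((fun j => fine (theta j A)) @ U).

Let thle j (A : set T) : measurable A -> theta j A <= M%:E.
Proof.
move=> mA; apply: le_trans (thetaM j).
by apply: le_measure; rewrite ?inE//; exact: measurableT.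
Qed.

Let thfin j (A : set T) : measurable A -> theta j A \is a fin_num.
Proof. by move=> mA; rewrite ge0_fin_numE ?measure_ge0//; exact: le_lt_trans (thle j mA) (ltry _). Qed.

Lemma umass_cvg (A : set T) : measurable A -> cvg ((fun j => fine (theta j A)) @ U).
Proof.
move=> mA; apply: (ultra_cvg UU (M := M)) => j.
rewrite fine_ge0 ?measure_ge0//=.
by rewrite -lee_fin fineK ?thfin// thle.
Qed.

Lemma umass_le (A : set T) : measurable A -> (umass A <= M)%R.
Proof.
move=> mA; apply: limr_le; first exact: umass_cvg.
by apply: (@filterE _ U) => j; rewrite -lee_fin fineK ?thfin// thle.
Qed.

Lemma le_umass (A B : set T) : measurable A -> measurable B -> A `<=` B -> (umass A <= umass B)%R.
Proof.
move=> mA mB AB; apply: (ultra_lim_le UU); [exact: umass_cvg|exact: umass_cvg|].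
by move=> j; rewrite -lee_fin !fineK ?thfin// le_measure ?inE.
Qed.

Lemma umassD (A B : set T) : measurable A -> measurable B ->
  lim ((fun j => fine (theta j A) + fine (theta j B))%R @ U) = (umass A + umass B)%R.
Proof.
by move=> mA mB; apply: limD; exact: umass_cvg.
Qed.

Lemma umassU (A B : set T) : measurable A -> measurable B -> A `&` B = set0 ->
  umass (A `|` B) = (umass A + umass B)%R.
Proof.
move=> mA mB AB; rewrite -umassD//; congr lim; congr (_ @ U); apply/funext => j.
by rewrite -fineD ?thfin// measureU.
Qed.

Lemma umassU_le (A B : set T) : measurable A -> measurable B ->
  (umass (A `|` B) <= umass A + umass B)%R.
Proof.
move=> mA mB; have -> : A `|` B = A `|` (B `\` A).
  apply/seteqP; split=> [x [Ax|Bx]|x [Ax|[Bx _]]]; [by left| |by left|by right].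
  by have [Ax|Ax] := pselect (A x); [left|right].
have mBA : measurable (B `\` A) by exact: measurableD.
rewrite umassU//; last by rewrite setDIK.
by rewrite lerD2l le_umass// => x [].
Qed.

Lemma umass0 : umass set0 = 0%R.
Proof.
rewrite /umass (_ : (fun j => _) = fun=> 0%R); first by rewrite lim_cst.
by apply/funext => j; rewrite measure0.
Qed.

(** [umass] is only finitely additive; approximation from inside by compact sets makes it countably
    subadditive on open sets. *)
Definition inner (V : set T) : \bar R :=
  ereal_sup [set (umass K)%:E | K in [set K : set T | compact (K : set (Rn R n)) /\ K `<=` V]].

Let mcompact (K : set T) : compact (K : set (Rn R n)) -> measurable K.
Proof. by move=> cK; apply: closed_mRn; apply: compact_closed => //; exact: norm_hausdorff. Qed.

Lemma inner_ge (K V : set T) : compact (K : set (Rn R n)) -> K `<=` V -> (umass K)%:E <= inner V.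
Proof. by move=> cK KV; apply: ereal_sup_ubound; exists K. Qed.

Lemma inner_le (V : set T) (c : \bar R) :
  (forall K : set T, compact (K : set (Rn R n)) -> K `<=` V -> (umass K)%:E <= c) -> inner V <= c.
Proof. by move=> h; apply: ge_ereal_sup => _ [K [cK KV] <-]; exact: h. Qed.

Lemma le_inner (V W : set T) : V `<=` W -> inner V <= inner W.
Proof. by move=> VW; apply: inner_le => K cK KV; apply: inner_ge => //; exact: subset_trans VW. Qed.

Lemma inner_ge0 (V : set T) : 0 <= inner V.
Proof. by rewrite -[leLHS]/((0%R : R)%:E) -umass0; apply: inner_ge => //; exact: compact0. Qed.

Lemma inner_leM (V : set T) : inner V <= M%:E.
Proof. by apply: inner_le => K cK _; rewrite lee_fin; apply: umass_le; exact: mcompact. Qed.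

Lemma inner_umass (V : set T) : measurable V -> inner V <= (umass V)%:E.
Proof. by move=> mV; apply: inner_le => K cK KV; rewrite lee_fin le_umass//; exact: mcompact. Qed.

(** The points at distance at least [1 / (k + 1)] from the complement: closed sets that fill [V]
    when [V] is open. *)
Let shrink (V : set T) (k : nat) : set T :=
  [set x | forall z : 'rV[R]_n, (edist (x : 'rV[R]_n) z < k.+1%:R^-1)%R -> V z].

Let closed_shrink V k : closed (shrink V k : set (Rn R n)).
Proof.
apply/closure_id; rewrite eqEsubset; split; first exact: subset_closure.
move=> x /closure_eballP h z xz.
have e0 : (0 < k.+1%:R^-1 - edist x z)%R by rewrite subr_gt0.
have [y Fy xy] := h _ e0; apply: Fy.
by apply: le_lt_trans (edist_triangle _ x _) _; rewrite edistC -ltrBrDr.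
Qed.

Let shrink_sub V k : shrink V k `<=` V.
Proof. by move=> x; apply; rewrite edistxx invr_gt0. Qed.

Let shrink_mono V i j : (i <= j)%N -> shrink V i `<=` shrink V j.
Proof.
move=> ij x h z xz; apply: h; apply: lt_le_trans xz _.
by rewrite lef_pV2 ?posrE// ler_nat.
Qed.

(** Otherwise points of [K] that escape for each [N] have a cluster point in [K]; it lies in some
    [V i] together with a ball, and this ball catches points with arbitrarily large [N]. *)
Let compact_shrink (V : nat -> set T) (K : set T) : compact (K : set (Rn R n)) ->
  (forall i, open (V i : set (Rn R n))) -> K `<=` \bigcup_i V i ->
  exists N, K `<=` \bigcup_(i in `I_N) shrink (V i) N.
Proof.
move=> cK oV KV; apply: contrapT => /forallNP h.
have {}h N : exists x, K x /\ ~ (\bigcup_(i in `I_N) shrink (V i) N) x.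
  by have /existsNP[x /not_implyP] := h N; exists x.
have [x hx] := choice h; pose y : nat -> Rn R n := x.
have yK : (y @ \oo) K by apply: (@filterE _ \oo) => k; exact: (hx k).1.
have [p [Kp cp]] := cK (y @ \oo) _ yK.
have [i _ Vp] := KV p Kp; have [e e0 he] := open_eballP (oV i) Vp.
have e20 : (0 < e / 2)%R by rewrite divr_gt0.
have nb : nbhs p (eball p (e / 2)%R).
  by apply: open_nbhs_nbhs; split; [exact: open_eball|rewrite /eball/= edistxx].
have yF : (y @ \oo) [set q | exists k, [/\ q = y k, (i < k)%N & (k.+1%:R^-1 < e / 2)%R]].
  have [m _ hm] := near_infty_natSinv_lt (PosNum e20).
  exists (maxn m i.+1) => // k /=; rewrite geq_max => /andP[mk ik].
  by exists k; split => //; exact: hm.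
have [q [[k [-> ik ke]] pq]] := cp _ _ yF nb.
apply: (hx k).2; exists i => //= z xz; apply: he.
apply: le_lt_trans (edist_triangle p (y k) z) _.
by rewrite [ltRHS](splitr e) ltrD// (lt_trans xz).
Qed.

Lemma umass_bigsetU_le (S : nat -> set T) (N : nat) : (forall i, measurable (S i)) ->
  (umass (\big[setU/set0]_(i < N) S i))%:E <= \sum_(i < N) (umass (S i))%:E.
Proof.
move=> mS; elim: N => [|N IH]; first by rewrite !big_ord0 umass0.
rewrite !big_ord_recr/=; apply: le_trans (leeD2r _ IH).
by rewrite -EFinD lee_fin umassU_le//; exact: bigsetU_measurable.
Qed.

Lemma umass_cover (V : nat -> set T) (K : set T) : compact (K : set (Rn R n)) ->
  (forall i, open (V i : set (Rn R n))) -> K `<=` \bigcup_i V i ->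
  (umass K)%:E <= \sum_(i <oo) inner (V i).
Proof.
move=> cK oV KV; have [N KN] := compact_shrink cK oV KV.
have cS i : compact ((K `&` shrink (V i) N : set T) : set (Rn R n)).
  by apply: compact_closedI => //; exact: closed_shrink.
apply: (@le_trans _ _ (\sum_(0 <= i < N) inner (V i))); last first.
  by apply: nneseries_lim_ge => i _ _; exact: inner_ge0.
rewrite big_mkord.
have -> : K = \big[setU/set0]_(i < N) (K `&` shrink (V i) N).
  rewrite -(bigcup_mkord N (fun i => K `&` shrink (V i) N)) -setI_bigcupr.
  apply/seteqP; split=> [x Kx|x []//].
  by split => //; exact: KN.
apply: (@le_trans _ _ (\sum_(i < N) (umass (K `&` shrink (V i) N))%:E)).
  apply: (umass_bigsetU_le N (S := fun i => K `&` shrink (V i) N)) => i.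
  exact: mcompact.
apply: lee_sum => i _; apply: inner_ge => //.
by move=> x [_ /shrink_sub].
Qed.

Lemma inner_bigcup (V : nat -> set T) : (forall i, open (V i : set (Rn R n))) ->
  inner (\bigcup_i V i) <= \sum_(i <oo) inner (V i).
Proof. by move=> oV; apply: inner_le => K cK KV; exact: umass_cover. Qed.

Definition halmos (E : set T) : \bar R :=
  ereal_inf [set inner V | V in [set V : set T | open (V : set (Rn R n)) /\ E `<=` V]].

Lemma halmos_le (E V : set T) : open (V : set (Rn R n)) -> E `<=` V -> halmos E <= inner V.
Proof. by move=> oV EV; apply: ereal_inf_lbound; exists V. Qed.

Lemma halmos_ge (E : set T) (c : \bar R) :
  (forall V : set T, open (V : set (Rn R n)) -> E `<=` V -> c <= inner V) -> c <= halmos E.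
Proof. by move=> h; apply: le_ereal_inf_tmp => _ [V [oV EV] <-]; exact: h. Qed.

Lemma halmos_open (V : set T) : open (V : set (Rn R n)) -> halmos V = inner V.
Proof.
move=> oV; apply/eqP; rewrite eq_le halmos_le//=.
by apply: halmos_ge => W _; exact: le_inner.
Qed.

Let halmos0 : halmos set0 = 0.
Proof.
rewrite halmos_open; last exact: open0.
apply/eqP; rewrite eq_le inner_ge0 andbT; apply: inner_le => K _.
by rewrite subset0 => ->; rewrite umass0.
Qed.

Let halmos_ge0 E : 0 <= halmos E.
Proof. by apply: halmos_ge => V _ _; exact: inner_ge0. Qed.

Let le_halmos : {homo halmos : A B / A `<=` B >-> A <= B}.
Proof. by move=> A B AB; apply: halmos_ge => V oV BV; apply: halmos_le => //; exact: subset_trans BV. Qed.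

Let halmos_leM E : halmos E <= M%:E.
Proof. by apply: le_trans (inner_leM setT); apply: halmos_le => //; exact: openT. Qed.

Let halmos_fin E : halmos E \is a fin_num.
Proof. by rewrite ge0_fin_numE//; apply: le_lt_trans (halmos_leM E) (ltry _). Qed.

Let halmos_sub : sigma_subadditive halmos.
Proof.
move=> F; apply/lee_addgt0Pr => e e0.
have hV i : exists V : set T, [/\ open (V : set (Rn R n)), F i `<=` V &
    inner V <= halmos (F i) + (e / (2 ^ i.+1)%:R)%:E].
  have d0 : (0 < e / (2 ^ i.+1)%:R)%R by rewrite divr_gt0// ltr0n expn_gt0.
  have [_ [V [oV FV] <-] h] := lb_ereal_inf_adherent d0 (halmos_fin (F i)).
  by exists V; split => //; exact: ltW.
have [V h] := choice hV.
apply: (@le_trans _ _ (inner (\bigcup_i V i))).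
  apply: halmos_le; first by apply: bigcup_open => i _; case: (h i).
  by apply: subset_bigcup => i _; case: (h i).
apply: (@le_trans _ _ (\sum_(i <oo) inner (V i))).
  by apply: inner_bigcup => i; case: (h i).
apply: (@le_trans _ _ (\sum_(i <oo) (halmos (F i) + (e / (2 ^ i.+1)%:R)%:E))).
  by apply: lee_nneseries => i _; [move=> _; exact: inner_ge0|case: (h i)].
by apply: epsilon_trick => //; exact: ltW.
Qed.

HB.instance Definition _ := isOuterMeasure.Build R T halmos
  halmos0 halmos_ge0 le_halmos halmos_sub.

(** If a compact [K] inside [W] and [V] nearly exhausts the inner content there, then [W] minus [K]
    is an open set containing the rest of [X], and the contents of disjoint compact sets add up. *)
Let halmos_cara (V : set T) : open (V : set (Rn R n)) -> halmos.-caratheodory V.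
Proof.
move=> oV; apply: le_caratheodory_measurable => X; apply: halmos_ge => W oW XW.
have oWV : open ((W `&` V : set T) : set (Rn R n)) by exact: openI.
apply: (@le_trans _ _ (inner (W `&` V) + halmos (X `&` ~` V))).
  by rewrite leeD2r// halmos_le//; apply: setSI.
rewrite -leeBrDr ?halmos_fin//; apply: inner_le => K cK KWV.
rewrite leeBrDr ?halmos_fin//; rewrite addeC -leeBrDr//.
have oWK : open ((W `\` K : set T) : set (Rn R n)).
  apply: openI => //; apply: closed_openC; apply: compact_closed => //; exact: norm_hausdorff.
apply: (@le_trans _ _ (inner (W `\` K))).
  apply: halmos_le => // x [Xx nVx]; split; first exact: XW.
  by move=> /KWV[].
apply: inner_le => K' cK' K'W; rewrite leeBrDr// -EFinD addrC -umassU; try exact: mcompact.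
  apply: inner_ge; first exact: compactU.
  by move=> x [/KWV[]//|/K'W[]].
by apply/seteqP; split => // x [Kx /K'W[]].
Qed.

Let halmos_borel (A : set T) : measurable A -> halmos.-caratheodory A.
Proof.
apply: smallest_sub; last by move=> V; exact: halmos_cara.
split.
- exact: caratheodory_measurable_set0.
- by move=> B hB; rewrite setTD; exact: caratheodory_measurable_setC.
- by move=> F hF; exact: caratheodory_measurable_bigcup.
Qed.

Let halmos_sigma : semi_sigma_additive (halmos : set T -> \bar R).
Proof.
move=> F mF tF mUF.
apply: (@caratheodory_measure_sigma_additive R T halmos F) => //.
- by move=> i; exact: halmos_borel.
- exact: halmos_borel.
Qed.

HB.instance Definition _ := isMeasure.Build _ T R halmos halmos0 halmos_ge0 halmos_sigma.

Definition halmosm : msr R n := halmos.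

Lemma halmosm_open (V : set T) : open (V : set (Rn R n)) -> halmosm V <= (umass V)%:E.
Proof.
move=> oV; rewrite [halmosm V](halmos_open oV); apply: inner_umass; exact: open_mRn.
Qed.

Lemma halmosm_fin : halmosm setT < +oo.
Proof. by apply: le_lt_trans (halmos_leM setT) (ltry _). Qed.

(** Tightness keeps the mass from escaping to infinity: a compact set retains all but [e] of it. *)
Lemma halmosm_setT : (forall e, (0 < e)%R -> exists K : set T, compact (K : set (Rn R n)) /\
    U [set j | theta j (~` K) <= e%:E]) ->
  halmosm setT = (umass setT)%:E.
Proof.
move=> tight; apply/eqP; rewrite eq_le halmosm_open/=; last exact: openT.
apply/lee_addgt0Pr => e e0; have [K [cK UK]] := tight _ e0; have mK := mcompact cK.
apply: (@le_trans _ _ ((umass K + e)%:E)); last first.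
  rewrite EFinD leeD2r// [halmosm _](halmos_open (openT : open (setT : set (Rn R n)))).
  exact: inner_ge.
have mC : measurable (~` K) by exact: measurableC.
rewrite lee_fin -(setUv K) umassU//; last exact: setICr.
rewrite lerD2l; apply: limr_le; first exact: umass_cvg.
by apply: filterS UK => j /= h; rewrite -lee_fin fineK// thfin.
Qed.

End halmos.

(** * Layer-cake sums *)

Section layers.
Local Open Scope ereal_scope.
Context (R : realType).

Lemma layer_count (N : nat) (t : R) : (0 <= t)%R ->
  ((t <= N%:R -> t <= \sum_(i < N) (i%:R < t)%R%:R) /\ \sum_(i < N) (i%:R < t)%R%:R <= t + 1)%R.
Proof.
move=> t0; elim: N => [|N [IH1 IH2]]; first by rewrite big_ord0 addr_ge0.
have S1 : (N%:R < t -> \sum_(i < N) (i%:R < t)%R%:R = N%:R :> R)%R.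
  move=> Nt; rewrite (eq_bigr (fun=> 1%R)); last first.
    by move=> i _; rewrite (_ : (i%:R < t)%R)//; apply: lt_trans Nt; rewrite ltr_nat.
  by rewrite sumr_const card_ord.
rewrite big_ord_recr/=; case: (ltP N%:R%R t) => Nt /=.
  by rewrite S1// -natr1; split=> [//|]; rewrite lerD2r ltW.
by rewrite addr0; split => // _; exact: IH1.
Qed.

Context d (S : measurableType d) (m : {measure set S -> \bar R}) (psi : S -> R) (B : R).
Hypotheses (mpsi : measurable_fun setT psi) (psiB : forall x, (0 <= psi x <= B)%R) (B0 : (0 < B)%R).

Definition layer (N i : nat) : set S := [set x | (i%:R * (B / N.+1%:R) < psi x)%R].

Lemma measurable_layer N i : measurable (layer N i).
Proof.
have := measurable_fun_ltr (measurable_cst (i%:R * (B / N.+1%:R))%R) mpsi.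
move=> /(_ measurableT [set true]); rewrite setTI; apply.
by [].
Qed.

Lemma integral_layers N :
  \int[m]_x (\sum_(i < N.+1) (B / N.+1%:R)%:E * (\1_(layer N i) x)%:E) =
  \sum_(i < N.+1) (B / N.+1%:R)%:E * m (layer N i).
Proof.
have b0 : 0 <= (B / N.+1%:R)%:E by rewrite lee_fin divr_ge0// ltW.
have nl i : nnm (fun x : S => (\1_(layer N i) x)%:E : \bar R).
  exact: nnm_indic (measurable_layer N i).
rewrite ge0_integral_sum//.
- apply: eq_bigr => i _; rewrite (integral_nnmZl _ (nl i) b0) integral_indic ?setIT//.
  exact: measurable_layer.
- by move=> i; apply: nnm_m; apply: nnmM => //; exact: nnm_cst.
- by move=> i x _; rewrite mule_ge0.
Qed.

Let layer_sum N x : \sum_(i < N.+1) (B / N.+1%:R)%:E * (\1_(layer N i) x)%:E =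
  (B / N.+1%:R * \sum_(i < N.+1) (i%:R < psi x / (B / N.+1%:R))%R%:R)%:E.
Proof.
rewrite mulr_sumr -sumEFin; apply: eq_bigr => i _; rewrite -EFinM; congr (_ * _)%:E.
rewrite indicE /layer mem_setE; congr (_%:R); congr nat_of_bool.
by rewrite ltr_pdivlMr// divr_gt0.
Qed.

Lemma le_layers N : \int[m]_x (psi x)%:E <= \sum_(i < N.+1) (B / N.+1%:R)%:E * m (layer N i).
Proof.
have b0 : (0 < B / N.+1%:R)%R by rewrite divr_gt0.
rewrite -integral_layers; apply: ge0_le_integral => //.
- by move=> x _; rewrite lee_fin; case/andP: (psiB x).
- exact/measurable_EFinP.
- apply: emeasurable_sum => i; apply: measurable_funeM.
  by apply/measurable_EFinP; apply: measurable_indic; exact: measurable_layer.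
move=> x _; rewrite layer_sum lee_fin -ler_pdivrMl// mulrC.
have /andP[p0 pB] := psiB x.
have q0 : (0 <= psi x / (B / N.+1%:R))%R by rewrite divr_ge0// ltW.
apply: (layer_count N.+1 q0).1.
by rewrite ler_pdivrMr// mulrC divfK.
Qed.

Lemma layers_le N : \sum_(i < N.+1) (B / N.+1%:R)%:E * m (layer N i) <=
  \int[m]_x (psi x)%:E + (B / N.+1%:R)%:E * m setT.
Proof.
have b0 : (0 < B / N.+1%:R)%R by rewrite divr_gt0.
rewrite -integral_layers -integral_cst// -ge0_integralD//; last 3 first.
- by move=> x _; rewrite lee_fin; case/andP: (psiB x).
- exact/measurable_EFinP.
- by move=> x _; rewrite lee_fin ltW.
apply: ge0_le_integral => //.
- by move=> x _; rewrite layer_sum lee_fin mulr_ge0 ?(ltW b0)// sumr_ge0.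
- apply: emeasurable_sum => i; apply: measurable_funeM.
  by apply/measurable_EFinP; apply: measurable_indic; exact: measurable_layer.
- by apply: emeasurable_funD => //; exact/measurable_EFinP.
move=> x _; rewrite layer_sum -EFinD lee_fin.
have /andP[p0 pB] := psiB x.
have q0 : (0 <= psi x / (B / N.+1%:R))%R by rewrite divr_ge0// ltW.
apply: le_trans (ler_wpM2l (ltW b0) (layer_count N.+1 q0).2) _.
by rewrite mulrDr mulr1 mulrCA divff ?gt_eqF// mulr1.
Qed.

End layers.

(** * Convergence of integrals along the ultrafilter *)

Section prokhorov.
Local Open Scope ereal_scope.
Context (R : realType) (n : nat).
Local Notation T := (RnB R n).

(** The layers of a lower semicontinuous function are open, and on open sets the measure is below
    the ultralimit. With [N + 1] layers the error is at most [B / (N + 1)] times the total mass. *)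
Let halmos_integral_le (U : set_system nat) (UU : UltraFilter U) (theta : nat -> msr R n) (M : R)
    (thM : forall j, theta j setT <= M%:E) (psi : T -> R) (B l : R) :
  measurable_fun setT psi -> (forall x, (0 <= psi x <= B)%R) -> (0 < B)%R ->
  (forall c : R, open ([set x | (c < psi x)%R] : set (Rn R n))) ->
  (fun j => fine (\int[theta j]_x (psi x)%:E)) @ U --> l ->
  \int[halmosm UU thM]_x (psi x)%:E <= l%:E.
Proof.
move=> mpsi psiB B0 opsi psil.
have M0 : (0 <= M)%R by rewrite -lee_fin; apply: le_trans (thM 0%N); exact: measure_ge0.
have key (N : nat) : \int[halmosm UU thM]_x (psi x)%:E <= (l + B / N.+1%:R * M)%:E.
  apply: le_trans (le_layers _ mpsi psiB B0 N) _.
  have oV i : open (layer psi B N i : set (Rn R n)) by exact: opsi.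
  have mV i : measurable (layer psi B N i) by exact: open_mRn.
  apply: (@le_trans _ _ (\sum_(i < N.+1) (B / N.+1%:R * umass U theta (layer psi B N i))%:E)).
    apply: lee_sum => i _; rewrite [leRHS]EFinM; apply: lee_wpmul2l.
      by rewrite lee_fin divr_ge0// ltW.
    exact: halmosm_open.
  rewrite sumEFin lee_fin.
  have cG : (fun j => \sum_(i < N.+1) B / N.+1%:R * fine (theta j (layer psi B N i)))%R @ U -->
      (\sum_(i < N.+1) B / N.+1%:R * umass U theta (layer psi B N i))%R.
    move: (B / N.+1%:R)%R => c; elim: N.+1 => [|k IH].
      by rewrite big_ord0; under eq_fun do rewrite big_ord0; exact: cvg_cst.
    rewrite big_ord_recr/=; under eq_fun do rewrite big_ord_recr/=.
    apply: cvgD; first exact: IH.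
    by apply: cvgM; [exact: cvg_cst|exact: (umass_cvg UU thM (mV k))].
  have cH : (fun j => fine (\int[theta j]_x (psi x)%:E) + B / N.+1%:R * M)%R @ U -->
      (l + B / N.+1%:R * M)%R.
    by apply: cvgD => //; exact: cvg_cst.
  rewrite -(cvg_lim _ cG)// -(cvg_lim _ cH)//.
  apply: ler_lim; [exact: cvgP cG|exact: cvgP cH|].
  apply: (@filterE _ U) => j; rewrite -lee_fin EFinD.
  have If : \int[theta j]_x (psi x)%:E \is a fin_num.
    rewrite ge0_fin_numE; last by apply: integral_ge0 => x _; rewrite lee_fin; case/andP: (psiB x).
    apply: (@le_lt_trans _ _ (\int[theta j]_x (cst B%:E) x)).
      apply: ge0_le_integral => //.
      - by move=> x _; rewrite lee_fin; case/andP: (psiB x).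
      - exact/measurable_EFinP.
      - by move=> x _; rewrite lee_fin; case/andP: (psiB x).
    rewrite integral_cst//; apply: lte_mul_pinfty; rewrite ?lee_fin ?(ltW B0)//.
    by apply: le_lt_trans (thM j) (ltry _).
  rewrite fineK//; apply: (le_trans _ (le_trans (layers_le (theta j) mpsi psiB B0 N) _)).
    rewrite -sumEFin; apply: lee_sum => i _; rewrite [leLHS]EFinM fineK//.
    rewrite ge0_fin_numE ?measure_ge0//; apply: le_lt_trans _ (ltry M).
    by apply: le_trans (thM j); apply: le_measure; rewrite ?inE//; exact: measurableT.
  apply: leeD2l; rewrite [leRHS]EFinM; apply: lee_wpmul2l => //.
  by rewrite lee_fin divr_ge0// ltW.
apply/lee_addgt0Pr => e e0.
have [N _ hN] : \forall N \near \oo, (N.+1%:R^-1 < e / (B * M + 1) :> R)%R.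
  have q0 : (0 < e / (B * M + 1))%R.
    by rewrite divr_gt0// ltr_wpDl// mulr_ge0// ltW.
  exact: (near_infty_natSinv_lt (PosNum q0)).
apply: le_trans (key N) _; rewrite EFinD leeD2l// lee_fin.
have := hN N (leqnn N); rewrite /= ltr_pdivlMr; last by rewrite ltr_wpDl// mulr_ge0// ltW.
have : (0 <= N.+1%:R^-1 :> R)%R by rewrite invr_ge0.
have : (0 <= B * M)%R by rewrite mulr_ge0// ltW.
move: (N.+1%:R^-1)%R => q h1 h2 h3.
by rewrite mulrAC; move: h1 h3; rewrite mulrDr mulr1 [(q * _)%R]mulrC; lra.
Qed.

(* One half of Prokhorov's theorem: the limit is taken along an ultrafilter,
   so only those test functions whose integrals converge are controlled. *)
Lemma prokhorov (theta : nat -> msr R n) (M : R) : (forall j, theta j setT <= M%:E) ->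
  (forall e, (0 < e)%R -> exists K : set T, compact (K : set (Rn R n)) /\
     exists N, forall j, (N <= j)%N -> theta j (~` K) <= e%:E) ->
  exists th : msr R n, th setT < +oo /\
    forall (psi : T -> R) (B l : R), measurable_fun setT psi ->
     (forall x, (0 <= psi x <= B)%R) ->
     (forall c : R, open ([set x | (c < psi x)%R] : set (Rn R n))) ->
     (forall c : R, open ([set x | (psi x < c)%R] : set (Rn R n))) ->
     \int[theta j]_x (psi x)%:E @[j --> \oo] --> l%:E -> \int[th]_x (psi x)%:E = l%:E.
Proof.
move=> thM tight.
have [U [UU oU]] := ultraFilterLemma (eventually_filter : ProperFilter \oo).
exists (halmosm UU thM); split; first exact: halmosm_fin.
have eT : halmosm UU thM setT = (umass U theta setT)%:E.
  apply: halmosm_setT => e /tight[K [cK [N hN]]]; exists K; split => //.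
  by apply: oU; exists N.
move=> psi B0 l mpsi psiB0 opsi opsi' psil.
pose B := (B0 + 1)%R.
have B0p : (0 <= B0)%R by have /andP[/le_trans] := psiB0 point; apply.
have Bp : (0 < B)%R by rewrite ltr_wpDl.
have psiB x : (0 <= psi x <= B)%R.
  by have /andP[-> h] := psiB0 x; rewrite (le_trans h)// lerDl.
have If (m : msr R n) : m setT < +oo -> \int[m]_x (psi x)%:E \is a fin_num.
  move=> mf; rewrite ge0_fin_numE; last by apply: integral_ge0 => x _; rewrite lee_fin; case/andP: (psiB x).
  apply: (@le_lt_trans _ _ (\int[m]_x (cst B%:E) x)).
    apply: ge0_le_integral => //.
    - by move=> x _; rewrite lee_fin; case/andP: (psiB x).
    - exact/measurable_EFinP.
    - by move=> x _; rewrite lee_fin; case/andP: (psiB x).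
  by rewrite integral_cst//; apply: lte_mul_pinfty; rewrite ?lee_fin ?(ltW Bp).
have thf j : theta j setT < +oo by apply: le_lt_trans (thM j) (ltry _).
have psiU : (fun j => fine (\int[theta j]_x (psi x)%:E)) @ U --> l.
  apply: fine_cvg; apply: cvg_trans psil.
  by apply: cvg_app; exact: oU.
(* The opposite inequality is the same bound for [B - psi]; it can be subtracted because tightness
   preserves the total mass. *)
have compl (m : msr R n) : m setT < +oo ->
    \int[m]_x (B - psi x)%:E = (B * fine (m setT) - fine (\int[m]_x (psi x)%:E))%:E.
  move=> mf; have mfin : m setT \is a fin_num by rewrite ge0_fin_numE ?measure_ge0.
  have E : \int[m]_x (B - psi x)%:E + \int[m]_x (psi x)%:E = B%:E * m setT.
    rewrite -ge0_integralD//.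
    - by rewrite -integral_cst//; apply: eq_integral => x _; rewrite -EFinD subrK.
    - by move=> x _; rewrite lee_fin subr_ge0; case/andP: (psiB x).
    - by apply/measurable_EFinP; exact: measurable_funB.
    - by move=> x _; rewrite lee_fin; case/andP: (psiB x).
    - exact/measurable_EFinP.
  have Ifm := If m mf.
  rewrite EFinB EFinM !fineK// -E addeK//.
apply/eqP; rewrite eq_le (halmos_integral_le UU thM mpsi psiB Bp)//=.
have thf' := halmosm_fin UU thM.
have := halmos_integral_le UU thM (psi := fun x => (B - psi x)%R) (B := B)
  (l := (B * umass U theta setT - l)%R) _ _ Bp _ _.
rewrite compl// eT => h.
suff : (B * umass U theta setT - fine (\int[halmosm UU thM]_x (psi x)%:E) <= B * umass U theta setT - l)%R.
  by rewrite lerD2l lerN2 -lee_fin fineK// If.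
rewrite -lee_fin; apply: h.
- exact: measurable_funB.
- by move=> x; have /andP[p0 pB] := psiB x; rewrite subr_ge0 pB lerBlDr lerDl.
- move=> c; rewrite (_ : [set x | _] = [set x | (psi x < B - c)%R]); first exact: opsi'.
  by apply/seteqP; split=> x /=; rewrite ltrBrDr addrC -ltrBrDr.
- rewrite (_ : (fun j => _) = (fun j => B * fine (theta j setT) - fine (\int[theta j]_x (psi x)%:E))%R); last first.
    by apply/funext => j; rewrite compl.
  apply: cvgB => //.
  by apply: cvgM; [exact: cvg_cst|exact: (umass_cvg UU thM measurableT)].
Qed.

End prokhorov.

(** * Supermean-valued functions are potentials *)

Section kernel_bounds.
Local Open Scope ereal_scope.
Context (R : realType) (n : nat) (alpha : R).
Hypotheses (n3 : (3 <= n)%N) (alpha0 : (0 < alpha)%R) (alpha2 : (alpha <= 2)%R).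
Local Notation leb := (@lebesgue_measure R).
Local Notation L := (Leb R n).
Local Notation T := (RnB R n).
Local Notation kl := (klong n alpha).
Local Notation ks := (kshort n alpha).
Local Notation ka := (kall n alpha).
Local Notation km := (kmid n alpha).
Implicit Types (m : msr R n) (h v : T -> \bar R) (x w : 'rV[R]_n) (s r t d : R).

Let mg0 d : measurable_fun setT (fun t : R => (gauss0 n t d)%:E : \bar R).
Proof. by apply/measurable_EFinP; exact: (measurable_fix2 (@measurable_gauss0 R n)). Qed.

Lemma kmid_gt0 s d : (0 < s)%R -> 0 < km s d.
Proof.
(* The values at nonpositive times are irrelevant and can be made positive. *)
move=> s0; pose f u : \bar R := (if (0 < u)%R then gauss n u d else 1%R)%:E.
have f0 u : 0 < f u by rewrite /f lte_fin; case: ifP => // u0; exact: gauss_gt0.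
have mf : measurable_fun setT f.
  apply/measurable_EFinP; apply: measurable_fun_ifT => //; first exact: measurable_fun_ltr.
  exact: (measurable_fix2 (@measurable_gauss2 R n)).
apply: (@lt_le_trans _ _ (\int[etam alpha s]_u f u)).
  by apply: integral_gt0 => //; rewrite etam_mass.
apply: (le_etam alpha0 alpha2 s0) => //.
- by move=> u; exact: ltW.
- by move=> u; rewrite lee_fin gauss0_ge0.
by move=> u su; rewrite /f /gauss0 (lt_le_trans s0 su).
Qed.

(** All mixing times are at least [t], so each Gaussian keeps at least the fraction
    [exp (- d ^ 2 / t)] of its peak. *)
Lemma kmid_lower t d : (0 < t)%R -> (expR (- d ^+ 2 / t))%:E * km t 0 <= km t d.
Proof.
move=> t0; have e0 : 0 <= (expR (- d ^+ 2 / t))%:E by rewrite lee_fin expR_ge0.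
have g0 (u e : R) : 0 <= (gauss0 n u e)%:E by rewrite lee_fin gauss0_ge0.
rewrite /kmid /mix -ge0_integralZl//; last exact: mg0.
apply: (le_etam alpha0 alpha2 t0) => //.
- exact: measurable_funeM.
- by move=> u; exact: mule_ge0.
move=> u tu; have u0 := lt_le_trans t0 tu.
rewrite -EFinM lee_fin /gauss0 u0 /gauss mulrCA ler_wpM2l ?gpeak_ge0//.
rewrite expr0n/= oppr0 mul0r expR0 mulr1 ler_expR !mulNr lerN2 powR_inv1 ?(ltW u0)//.
by rewrite ler_wpM2l ?sqr_ge0// lef_pV2 ?posrE.
Qed.

(** The factor [exp (- d ^ 2 / t)] separates the two kernels: one uses times up to [t], the other
    times from [t] on. A function with finite [km t] means is thereby integrable against the
    truncated kernel. *)
Lemma ktrunc_le r t : (0 < r)%R -> (r <= t)%R -> exists2 K : R, (0 <= K)%R &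
  forall d, kmix n alpha `]r, t]%R d <= K%:E * km t d.
Proof.
move=> r0 rt; have t0 := lt_le_trans r0 rt.
have C0 : (0 <= Crz n alpha)%R by exact/ltW/Crz_gt0.
pose K1 := (Crz n alpha * (tweight alpha r * gpeak n r))%R.
have K10 : (0 <= K1)%R by apply: mulr_ge0 => //; apply: mulr_ge0; [exact: tweight_ge0|exact: gpeak_ge0].
pose K0 := fine (km t 0).
have kf : km t 0 = K0%:E by rewrite fineK// km_fin.
have K00 : (0 < K0)%R by rewrite -lte_fin -kf kmid_gt0.
have bd d : kmix n alpha `]r, t]%R d <= (K1 * expR (- d ^+ 2 / t) * (t - r))%:E.
  apply: (@le_trans _ _ (\int[leb]_(u in `]r, t]) (cst (K1 * expR (- d ^+ 2 / t))%:E u))).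
    apply: ge0_le_integral => //.
    - by move=> u _; rewrite lee_fin ktime_ge0.
    - exact: (measurable_funTS (measurable_ktime n alpha d)).
    - move=> u; rewrite /= in_itv/= => /andP[ru ut]; have u0 := lt_trans r0 ru.
      rewrite lee_fin /K1 -!mulrA ler_wpM2l// ler_pM ?tweight_ge0 ?gauss0_ge0//.
        rewrite /tweight -(opprB 1) !powRN lef_pV2 ?posrE ?powR_gt0//.
        rewrite ge0_ler_powR ?nnegrE ?(ltW r0) ?(ltW u0) ?(ltW ru)//.
        by rewrite subr_ge0 ler_pdivrMr// mul1r.
      rewrite /gauss0 u0 /gauss ler_pM ?gpeak_ge0 ?expR_ge0//.
        rewrite /gpeak !powRN lef_pV2 ?posrE ?powR_gt0 ?mulr_gt0 ?pi_gt0//.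
        rewrite ge0_ler_powR ?nnegrE ?mulr_ge0 ?pi_ge0 ?(ltW r0) ?(ltW u0)//.
        by rewrite ler_wpM2l ?pi_ge0 ?ltW.
      rewrite ler_expR !mulNr lerN2 powR_inv1 ?(ltW u0)//.
      by rewrite ler_wpM2l ?sqr_ge0// lef_pV2 ?posrE.
  rewrite integral_cst//= lebesgue_measure_itv/= lte_fin.
  case: ifP => [_|]; first by rewrite -EFinB -EFinM.
  by move=> _; rewrite mule0 lee_fin; apply: mulr_ge0; [apply: mulr_ge0 => //; exact: expR_ge0|rewrite subr_ge0].
exists (K1 * (t - r) / K0)%R; first by apply: divr_ge0; [apply: mulr_ge0 => //; rewrite subr_ge0|exact: ltW].
move=> d; apply: le_trans (bd d) _.
apply: (@le_trans _ _ ((K1 * (t - r) / K0)%:E * ((expR (- d ^+ 2 / t))%:E * km t 0))).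
  rewrite kf -!EFinM lee_fin mulrAC -mulrA [leRHS]mulrACA mulVf ?gt_eqF// mulr1.
  by rewrite mulrA.
apply: lee_wpmul2l; last exact: kmid_lower.
by rewrite lee_fin; apply: divr_ge0; [apply: mulr_ge0 => //; rewrite subr_ge0|exact: ltW].
Qed.

(** By scaling [kl s 0] decays at least like [s ^ (- 1 / 2)], since [n - alpha >= 1]; this explains
    the square in the threshold. *)
Lemma kl_vanish (e : R) : (0 < e)%R -> exists2 t : R, (1 <= t)%R &
  forall s d, (t <= s)%R -> kl s d <= e%:E.
Proof.
move=> e0; pose K := fine (kl 1 0).
have KE : kl 1 0 = K%:E by rewrite fineK// kl_fin.
have K0 : (0 < K)%R by rewrite -lte_fin -KE klong_gt0.
exists (1 + (K / e) ^+ 2)%R; first by rewrite lerDl sqr_ge0.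
move=> s d ts; have s1 : (1 <= s)%R by apply: le_trans ts; rewrite lerDl sqr_ge0.
have s0 : (0 < s)%R by exact: lt_le_trans s1.
apply: (@le_trans _ _ (kl s 0)).
  rewrite /klong !kmixE// /mix; apply: ge0_le_integral => //.
  - by move=> t _; rewrite lee_fin gauss0_ge0.
  - exact: mg0.
  - exact: mg0.
  move=> t _; rewrite lee_fin /gauss0; case: ifP => // t0.
  rewrite /gauss ler_wpM2l ?gpeak_ge0// ler_expR expr0n/= oppr0 mul0r mulNr oppr_le0.
  by rewrite mulr_ge0 ?sqr_ge0 ?powR_ge0.
rewrite klong_scale0// KE -EFinM lee_fin.
apply: (@le_trans _ _ (s `^ (- 2^-1) * K)%R).
  rewrite ler_wpM2r ?(ltW K0)// ler_powR//.
  have : (3%:R <= n%:R :> R)%R by rewrite ler_nat.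
  by move: alpha2; lra.
rewrite powRN powR12_sqrt ?(ltW s0)// mulrC ler_pdivrMr ?sqrtr_gt0//.
rewrite mulrC -ler_pdivrMr// -[leLHS]ger0_norm ?divr_ge0 ?(ltW K0) ?(ltW e0)//.
by rewrite -sqrtr_sqr ler_wsqrtr// (le_trans _ ts)// lerDr.
Qed.

(** From [1 - exp (- y) <= y] with [y] the difference of the squared distances over [t], for the
    times [t > r]. *)
Lemma kl_modulus r d d' : (0 < r)%R ->
  kl r d <= kl r d' + (`|d ^+ 2 - d' ^+ 2| / r)%:E * kl r 0.
Proof.
move=> r0; have q0 : (0 <= `|d ^+ 2 - d' ^+ 2| / r)%R by rewrite divr_ge0// ltW.
rewrite /klong -kmixZl//; set q := (_ / r)%R in q0 *.
have mk e := measurable_ktime n alpha e.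
have k0 e t : 0 <= (Crz n alpha * (tweight alpha t * gauss0 n t e))%:E.
  by rewrite lee_fin ktime_ge0.
have kq0 t : 0 <= q%:E * (Crz n alpha * (tweight alpha t * gauss0 n t 0))%:E.
  by rewrite mule_ge0.
have m1 := measurable_funTS (D := `]r, +oo[%classic) (mk d').
have m2 := measurable_funTS (D := `]r, +oo[%classic) (measurable_funeM q%:E (mk 0%R)).
rewrite /kmix -ge0_integralD//.
apply: ge0_le_integral => //; first exact: (measurable_funTS (mk d)).
  exact: emeasurable_funD.
move=> t; rewrite /= in_itv/= andbT => rt; have t0 := lt_trans r0 rt.
rewrite -EFinM -EFinD lee_fin (mulrCA q) -mulrDr ler_wpM2l ?(ltW (Crz_gt0 n3 alpha0 alpha2))//.
rewrite (mulrCA q) -mulrDr ler_wpM2l ?tweight_ge0// /gauss0 t0 /gauss.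
rewrite (mulrCA q) -mulrDr ler_wpM2l ?gpeak_ge0//.
rewrite expr0n/= oppr0 mul0r expR0 mulr1 powR_inv1 ?(ltW t0)//.
have [dd|dd] := leP (d' ^+ 2)%R (d ^+ 2)%R.
  apply: (@le_trans _ _ (expR (- d' ^+ 2 / t))); last by rewrite lerDl.
  by rewrite ler_expR ler_wpM2r ?invr_ge0 ?(ltW t0)// lerN2.
have h1 : (expR (- d ^+ 2 / t) <= 1)%R.
  by rewrite -expR0 ler_expR mulNr oppr_le0 divr_ge0 ?sqr_ge0 ?ltW.
have -> : (- d' ^+ 2 / t = - d ^+ 2 / t - (d' ^+ 2 - d ^+ 2) / t)%R by ring.
rewrite expRD; set y := ((d' ^+ 2 - d ^+ 2) / t)%R.
have y0 : (0 <= y)%R by rewrite divr_ge0 ?(ltW t0)// subr_ge0 ltW.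
have yq : (y <= q)%R.
  rewrite /y /q distrC gtr0_norm ?subr_gt0// ler_wpM2l ?subr_ge0 ?(ltW dd)//.
  by rewrite lef_pV2 ?posrE ?ltW.
have h2 : (1 - y <= expR (- y))%R by exact: expR_ge1Dx.
have h3 : (0 <= expR (- d ^+ 2 / t))%R by exact: expR_ge0.
by move: (expR _) (expR _) h1 h2 h3 => a b h1 h2 h3; nra.
Qed.

Lemma continuous_kl r : (0 < r)%R -> continuous (fun d : R => fine (kl r d)).
Proof.
move=> r0 d; apply/cvgrPdist_lt => e e0.
pose K := (fine (kl r 0) / r)%R.
have K0 : (0 <= K)%R by rewrite divr_ge0 ?(ltW r0)// fine_ge0// kmix_ge0.
have mod a b : (fine (kl r a) - fine (kl r b) <= K * `|a ^+ 2 - b ^+ 2|)%R.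
  have := kl_modulus a b r0.
  rewrite -(fineK (kl_fin n3 alpha0 alpha2 a r0)) -(fineK (kl_fin n3 alpha0 alpha2 b r0)).
  rewrite -(fineK (kl_fin n3 alpha0 alpha2 0 r0)) -EFinM -EFinD lee_fin /K => h.
  rewrite /= lerBlDl; apply: le_trans h _; rewrite lerD2l.
  by rewrite mulrC mulrCA mulrA [(_ * fine _)%R]mulrC mulrAC.
have c2 : ((d' : R) ^+ 2)%R @[d' --> d] --> (d ^+ 2)%R by exact: exprn_continuous.
have e1 : (0 < e / (K + 1))%R by rewrite divr_gt0// ltr_wpDl.
have /cvgrPdist_lt /(_ _ e1) := c2; apply: filterS => d' h.
have h' : (K * `|d ^+ 2 - d' ^+ 2| < e)%R.
  move: h; rewrite ltr_pdivlMr ?ltr_wpDl//; have := normr_ge0 (d ^+ 2 - d' ^+ 2)%R.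
  by move: (`|d ^+ 2 - d' ^+ 2|)%R => q q0; rewrite mulrDr mulr1 mulrC; lra.
rewrite ltr_norml; apply/andP; split; last exact: le_lt_trans (mod d d') h'.
rewrite ltrNl opprB; apply: le_lt_trans (mod d' d) _.
by rewrite distrC.
Qed.

Lemma continuous_edist x : continuous (fun z : Rn R n => edist x z).
Proof.
move=> z V /nbhs_ballP[e /= e0 he].
have nb : nbhs (z : Rn R n) (eball z e : set (Rn R n)).
  by apply: open_nbhs_nbhs; split; [exact: open_eball|rewrite /eball/= edistxx].
apply: filterS nb => y zy; apply: he; rewrite /ball/=.
have := edist_triangle x z y; have := edist_triangle x y z.
move: zy; rewrite /eball/= (edistC y z) ltr_norml => h1 h2 h3.
by apply/andP; split; lra.
Qed.

End kernel_bounds.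

Section monotone_ereal_limits.
Local Open Scope ereal_scope.
Context (R : realType).
Implicit Types (a : nat -> \bar R) (b : \bar R).

Lemma adde_cancel (a b c d e : \bar R) : e \is a fin_num ->
  a + e + b = c + (e + d) -> c + d = a + b.
Proof.
move=> ef; rewrite addeAC [e + d]addeC addeA => /(congr1 (fun x => x - e)).
by rewrite !addeK.
Qed.

Lemma adde_cancell (a b c : \bar R) : a \is a fin_num -> a + b = a + c -> b = c.
Proof. by move=> af /(congr1 (fun x => x - a)); rewrite ![a + _]addeC !addeK. Qed.

Lemma nat_above (t : R) : exists k : nat, (t < k%:R)%R.
Proof. by exists (Num.truncn t).+1; exact: truncnS_gt. Qed.

Lemma cvge_ni0 a : nonincreasing_seq a -> (forall k, 0 <= a k) ->
  (forall e : R, (0 < e)%R -> exists k, a k <= e%:E) -> a k @[k --> \oo] --> 0.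
Proof.
move=> ni a0 h; suff -> : 0 = ereal_inf (range a) by exact: ereal_nonincreasing_cvgn.
apply/eqP; rewrite eq_le; apply/andP; split.
  by apply: le_ereal_inf_tmp => _ [k _ <-].
apply/lee_addgt0Pr => e /h[k ke]; rewrite add0e; apply: le_trans ke.
by apply: ereal_inf_lbound; exists k.
Qed.

Lemma cvge_nd_eps a b : nondecreasing_seq a -> (forall k, a k <= b) ->
  (forall e : R, (0 < e)%R -> exists k, b <= a k + e%:E) -> a k @[k --> \oo] --> b.
Proof.
move=> nd ab h; suff -> : b = ereal_sup (range a) by exact: ereal_nondecreasing_cvgn.
apply/eqP; rewrite eq_le; apply/andP; split; last by apply: ge_ereal_sup => _ [k _ <-].
apply/lee_addgt0Pr => e /h[k ke]; apply: le_trans ke _; rewrite leeD2r//.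
by apply: ereal_sup_ubound; exists k.
Qed.

Lemma cvge0_ex a (e : R) : (0 < e)%R -> a k @[k --> \oo] --> 0 -> exists k, a k <= e%:E.
Proof.
move=> e0 a0; apply: contrapT => /forallNP h.
have : e%:E <= 0 by apply: cvge_lb a0 _ => k; rewrite leNgt; apply/negP => /ltW; exact: h.
by rewrite leNgt lte_fin e0.
Qed.

End monotone_ereal_limits.

Lemma pot_ball_ge (R : realType) (n : nat) (k : R -> \bar R) (m : msr R n) (x : 'rV[R]_n) (q : R) (c : \bar R) :
  nnm k -> (0 <= c)%E -> (forall d, (0 <= d <= q)%R -> (c <= k d)%E) ->
  (c * m (ceball x q) <= pot k m x)%E.
Proof.
move=> nk c0 h; have mB := measurable_ceball x q.
have ni := nnm_indic R mB.
have E : (\int[m]_z (\1_(ceball x q : set (RnB R n)) z)%:E)%E = m (ceball x q).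
  by rewrite integral_indic ?setIT.
rewrite -E -integral_nnmZl// /pot.
apply: le_integral_nnm.
- by apply: nnmM => //; exact: nnm_cst.
- exact: nnm_edist.
move=> w; rewrite indicE; case: (boolP (w \in _)) => [|_].
  by rewrite inE mule1 => wq; apply: h; rewrite edist_ge0.
by rewrite mule0; exact: nnm_ge0 (nnm_edist x nk) w.
Qed.

Lemma continuous_div (R : realType) (n : nat) (f g : Rn R n -> R) :
  continuous f -> continuous g -> (forall z, g z != 0) -> continuous (fun z => f z / g z).
Proof. by move=> cf cg g0 z; have h := cvgM (@cf z) (cvgV (g0 z) (@cg z)); exact: h. Qed.

Section difference.
Local Open Scope ereal_scope.
Context (R : realType) (n : nat) (alpha : R).
Hypotheses (n3 : (3 <= n)%N) (alpha0 : (0 < alpha)%R) (alpha2 : (alpha <= 2)%R).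
Local Notation L := (Leb R n).
Local Notation T := (RnB R n).
Local Notation km := (kmid n alpha).
Implicit Types (f g : T -> \bar R) (x : 'rV[R]_n).

(** [kmid] is positive at every distance, so a single finite mean forces finiteness almost
    everywhere. *)
Lemma kint_km_ae_fin f x s : (0 < s)%R -> nnm f -> kint L (km s) f x < +oo ->
  {ae L, forall z, f z \is a fin_num}.
Proof.
move=> s0 nf fin; have nk := nnm_kernel x (nnm_km n alpha0 alpha2 s0) nf.
have i : L.-integrable setT (fun w : T => km s (edist x (w : 'rV[R]_n)) * f w).
  apply/integrableP; split; first exact: nnm_m nk.
  under eq_integral => w _ do rewrite gee0_abs ?(nnm_ge0 nk)//.
  exact: fin.
have := integrable_ae measurableT i; apply: filterS => z /(_ I).
have := kmid_gt0 n alpha0 alpha2 (edist x z) s0; have := km_fin n alpha0 alpha2 (edist x z) s0.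
case: (f z) => [r| |]//; case: (km s _) => [k| |]// _; rewrite lte_fin => k0.
  by rewrite gt0_muley// lte_fin.
by rewrite gt0_muleNy// lte_fin.
Qed.

(* Where [g] is infinite the difference is set to [0]. *)
Definition ediff f g (z : T) : R := Num.max 0%R (fine (g z) - fine (f z))%R.

Lemma nnm_ediff f g : nnm f -> nnm g -> nnm (fun z => (ediff f g z)%:E).
Proof.
move=> nf ng; apply: nnm_EFin; last by move=> z; rewrite le_max lexx.
apply: measurable_maxr => //.
by apply: measurable_funB; apply: measurableT_comp => //; exact: nnm_m.
Qed.

(** The additive form avoids subtracting integrals that may be infinite. *)
Lemma kint_ediff k f g x : nnm k -> nnm f -> nnm g -> (forall z, f z <= g z) ->
  {ae L, forall z, g z \is a fin_num} ->
  kint L k g x = kint L k f x + kint L k (fun z => (ediff f g z)%:E) x.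
Proof.
move=> nk nf ng fg gfin; have nd := nnm_ediff nf ng.
rewrite -kintD//; apply: ge0_ae_eq_integral => //.
- exact: nnm_m (nnm_kernel x nk ng).
- exact: nnm_m (nnm_kernel x nk (nnmD nf nd)).
- by move=> z _; exact: nnm_ge0 (nnm_kernel x nk ng) z.
- by move=> z _; exact: nnm_ge0 (nnm_kernel x nk (nnmD nf nd)) z.
apply: filterS gfin => z gz _; congr (_ * _).
have fz : f z \is a fin_num.
  by rewrite ge0_fin_numE ?(nnm_ge0 nf)//; apply: le_lt_trans (fg z) _; rewrite -ge0_fin_numE ?(nnm_ge0 ng).
rewrite -(fineK gz) -{1}(fineK fz) -EFinD; congr EFin; rewrite /ediff max_r; first by rewrite addrC subrK.
by rewrite subr_ge0 -lee_fin !fineK.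
Qed.

End difference.

(** * Representation by normalized differences *)

Section supermean.
Local Open Scope ereal_scope.
Context (R : realType) (n : nat) (alpha : R).
Hypotheses (n3 : (3 <= n)%N) (alpha0 : (0 < alpha)%R) (alpha2 : (alpha <= 2)%R).
Local Notation L := (Leb R n).
Local Notation T := (RnB R n).
Local Notation kl := (klong n alpha).
Local Notation ks := (kshort n alpha).
Local Notation ka := (kall n alpha).
Local Notation km := (kmid n alpha).
Local Notation kt r t := (kmix n alpha `]r, t]%R).
Implicit Types (m : msr R n) (x w : 'rV[R]_n) (s r t : R).

Let sL : sigma_finite setT L := Leb_sigma_finite R n.
Let nk i : nnm (kmix n alpha i) := nnm_kmix n3 alpha0 alpha2 i.
Let nm s : (0 < s)%R -> nnm (km s) := @nnm_km R n alpha alpha0 alpha2 s.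

Lemma pot_vanish m x (e : R) : (0 < e)%R -> pot (kl 1) m x < +oo ->
  exists2 t, (1 <= t)%R & forall t', (t <= t')%R -> pot (kl t') m x <= e%:E.
Proof.
move=> e0 fin.
have c : pot (kl j.+1%:R) m x @[j --> \oo] --> 0.
  rewrite -(integral0 m setT).
  apply: (@cvg_integral_ni _ _ _ m (fun j (w : T) => kl j.+1%:R (edist x (w : 'rV[R]_n))) (fun=> 0)).
  - by move=> j; apply: nnm_edist; exact: nk.
  - exact: nnm_cst.
  - by move=> w i j ij; apply: (klong_anti n3 alpha0 alpha2); rewrite ler_nat.
  - move=> w; apply: cvge_ni0.
    + by move=> i j ij; apply: (klong_anti n3 alpha0 alpha2); rewrite ler_nat.
    + by move=> k; exact: kmix_ge0.
    + move=> d d0; have [t t1 ht] := kl_vanish n3 alpha0 alpha2 d0.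
      have [k tk] := nat_above t; exists k; apply: ht; apply: ltW; rewrite -natr1.
      by apply: lt_trans tk _; rewrite ltrDl.
  - exact: fin.
have [j jh] := cvge0_ex e0 c.
exists j.+1%:R => [|t' jt]; first by rewrite ler1n.
apply: le_trans jh; apply: le_pot; [exact: nk|exact: nk|] => d _.
exact: (klong_anti n3 alpha0 alpha2).
Qed.

(** The difference of [kl_star] at [r] and at [t]. The truncation is needed because [kl r] need not
    be integrable against [v], whereas the truncated kernel is. *)
Lemma trunc_star s r t x w : (0 < s)%R -> (0 < r)%R -> (r <= t)%R ->
  kt r t (edist x w) + comp (ks s) (km t) x w =
  comp (kt r t) (km s) x w + comp (ks s) (km r) x w.
Proof.
move=> s0 r0 rt; have t0 := lt_le_trans r0 rt.
have starr := kl_star n3 alpha0 alpha2 x w s0 r0.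
have start := kl_star n3 alpha0 alpha2 x w s0 t0.
have cE : comp (kl r) (km s) x w = comp (kt r t) (km s) x w + comp (kl t) (km s) x w.
  rewrite -integral_nnmD.
  - apply: eq_integral => z _; rewrite (klong_split n3 alpha0 alpha2 _ rt) ge0_muleDl//; exact: kmix_ge0.
  - by apply: nnmM; [exact: nnm_edist|apply: nnm_edistr; exact: nm].
  - by apply: nnmM; [apply: nnm_edist; exact: nk|apply: nnm_edistr; exact: nm].
have n1 k1 k2 : nnm k1 -> nnm k2 -> 0 <= comp k1 k2 x w.
  by move=> h1 h2; exact: nnm_ge0 (nnm_comp x h1 h2) w.
have Xf : comp (kl t) (km s) x w \is a fin_num.
  rewrite ge0_fin_numE; last by apply: n1; [exact: nk|exact: nm].
  apply: (@le_lt_trans _ _ (kl t (edist x w))); last exact: klong_fin.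
  by rewrite start leeDl//; apply: n1; [exact: nk|exact: nm].
have := klong_split n3 alpha0 alpha2 (edist x w) rt.
rewrite starr cE start => E.
exact: adde_cancel Xf E.
Qed.

Variables (v : T -> \bar R) (mu : msr R n).
Hypotheses (nv : nnm v) (lv : lsc v) (muM : Mplus alpha mu).
Hypothesis (vM : forall s x, (0 < s)%R -> kint L (km s) v x <= v x).
Hypothesis (vU : forall x, v x <= pot ka mu x).

Let smu : sigma_finite setT mu := radon_sigma_finite muM.1.
Let nU : nnm (pot ka mu : T -> \bar R) := nnm_pot smu (nk _).
Let Mv r : T -> \bar R := kint L (km r) v.

Let nMv r : (0 < r)%R -> nnm (Mv r).
Proof. by move=> r0; apply: nnm_kint => //; exact: nm. Qed.

Let nKl r : nnm (pot (kl r) mu : T -> \bar R) := nnm_pot smu (nk _).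

Let Mv_le r x : (0 < r)%R -> Mv r x <= pot (kl r) mu x.
Proof.
move=> r0; rewrite -(kint_pot n3 alpha0 alpha2 x smu r0).
by apply: le_kint => //; exact: nm.
Qed.

Let kl_mu_fin r x : (0 < r)%R -> pot (kl r) mu x < +oo.
Proof. by move=> r0; exact: Mplus_pot_kl_fin. Qed.

Let vfin : {ae L, forall z, v z \is a fin_num}.
Proof.
apply: (kint_km_ae_fin alpha0 alpha2 ltr01 nv (x := 0%R)).
exact: le_lt_trans (Mv_le _ ltr01) (kl_mu_fin _ ltr01).
Qed.

Let Ufin : {ae L, forall z, pot ka mu z \is a fin_num}.
Proof.
apply: (kint_km_ae_fin alpha0 alpha2 ltr01 nU (x := 0%R)).
by rewrite kint_pot//; exact: kl_mu_fin.
Qed.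

Let h s : T -> \bar R := fun z => (ediff (Mv s) v z)%:E.

Let nh s : (0 < s)%R -> nnm (h s).
Proof. by move=> s0; apply: nnm_ediff => //; exact: nMv. Qed.

Let kt_fin r t x : (0 < r)%R -> (r <= t)%R -> kint L (kt r t) v x < +oo.
Proof.
move=> r0 rt; have t0 := lt_le_trans r0 rt.
have [K K0 hK] := ktrunc_le n3 alpha0 alpha2 r0 rt.
apply: (@le_lt_trans _ _ (K%:E * Mv t x)); last first.
  by apply: lte_mul_pinfty => //; exact: le_lt_trans (Mv_le _ t0) (kl_mu_fin _ t0).
have nK : nnm (fun d => K%:E * km t d).
  by apply: nnmM; [apply: nnm_cst; rewrite lee_fin|exact: nm].
rewrite -kintZk//; last exact: nm.
by apply: le_kintk.
Qed.

(** [trunc_star] is integrated against [v]; the integral of [Mv s] against the truncated kernel is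
    finite and cancels, which leaves the difference [h s]. *)
Let trunc_h s r t x : (0 < s)%R -> (0 < r)%R -> (r <= t)%R ->
  kint L (kt r t) (h s) x + kint L (ks s) (Mv t) x = kint L (ks s) (Mv r) x.
Proof.
move=> s0 r0 rt; have t0 := lt_le_trans r0 rt.
have nc k1 k2 : nnm k1 -> nnm k2 -> nnm (fun w : T => comp k1 k2 x (w : 'rV[R]_n) * v w).
  by move=> h1 h2; apply: nnmM => //; exact: nnm_comp.
have E1 : kint L (kt r t) v x + kint L (ks s) (Mv t) x =
    kint L (kt r t) (Mv s) x + kint L (ks s) (Mv r) x.
  rewrite /Mv (kint_assoc x sL (nk _) (nm t0) nv) (kint_assoc x sL (nk _) (nm s0) nv).
  rewrite (kint_assoc x sL (nk _) (nm r0) nv) -!integral_nnmD.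
  - apply: eq_integral => w _; rewrite -!ge0_muleDl ?trunc_star//.
    + exact: nnm_ge0 (nnm_comp x (nk _) (nm s0)) w.
    + exact: nnm_ge0 (nnm_comp x (nk _) (nm r0)) w.
    + exact: kmix_ge0.
    + exact: nnm_ge0 (nnm_comp x (nk _) (nm t0)) w.
  - exact: nc (nk _) (nm s0).
  - exact: nc (nk _) (nm r0).
  - exact: nnm_kernel x (nk _) nv.
  - exact: nc (nk _) (nm t0).
have nMs := nMv s0.
have Mvv z : Mv s z <= v z by exact: vM.
have E2 := kint_ediff x (nk `]r, t]%R) nMs nv Mvv vfin.
have Pf : kint L (kt r t) (Mv s) x \is a fin_num.
  rewrite ge0_fin_numE; last exact: kint_ge0.
  apply: le_lt_trans (kt_fin x r0 rt); exact: le_kint.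
rewrite E2 -addeA in E1.
exact: adde_cancell Pf E1.
Qed.

Let cs s := cshort n alpha s.

(** As the truncation [t] tends to infinity, the remaining term is at most a constant times the
    [kl t]-potential of [mu], and this tends to [0]. *)
Let kint_h s r x : (0 < s < 1)%R -> (0 < r)%R ->
  kint L (kl r) (h s) x = kint L (ks s) (Mv r) x.
Proof.
move=> /andP[s0 s1] r0.
pose t (j : nat) := (r + j%:R)%R.
have rt j : (r <= t j)%R by rewrite lerDl.
have ts i j : (i <= j)%N -> (t i <= t j)%R by move=> ij; rewrite lerD2l ler_nat.
have nhs := nh s0.
have cE : kint L (kt r (t j)) (h s) x @[j --> \oo] --> kint L (kl r) (h s) x.
  apply: cvg_kintk_nd => //.
    move=> d d0 i j ij; apply: (kmix_sub n3 alpha0 alpha2) => u; rewrite /= !in_itv/= => /andP[-> /le_trans].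
    by apply; exact: ts.
  move=> d d0; apply: cvge_nd_eps.
  - move=> i j ij; apply: (kmix_sub n3 alpha0 alpha2) => u; rewrite /= !in_itv/= => /andP[-> /le_trans].
    by apply; exact: ts.
  - move=> j; apply: (kmix_sub n3 alpha0 alpha2) => u; rewrite /= !in_itv/= => /andP[-> _].
    by [].
  - move=> e e0; have [t0 t1 ht] := kl_vanish n3 alpha0 alpha2 e0.
    have [k tk] := nat_above t0; exists k.
    rewrite (klong_split n3 alpha0 alpha2 d (rt k)) leeD2l//; apply: ht; apply: ltW.
    by apply: lt_le_trans tk _; rewrite /t lerDr ltW.
have Bge0 u : (0 < u)%R -> 0 <= kint L (ks s) (Mv u) x.
  by move=> u0; apply: kint_ge0; [exact: nk|exact: nMv].
have t0 j : (0 < t j)%R by exact: lt_le_trans (rt j).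
apply/eqP; rewrite eq_le; apply/andP; split.
  by apply: cvge_ub cE _ => j; rewrite -(trunc_h x s0 r0 (rt j)) leeDl// Bge0.
apply/lee_addgt0Pr => e e0.
pose c := fine (cs s).
have cf : cs s = c%:E.
  by rewrite fineK// ge0_fin_numE ?cshort_fin//; exact/ltW/cshort_gt0.
have c0 : (0 < c)%R by rewrite -lte_fin -cf; exact: cshort_gt0.
have e2 : (0 < e / (2 * c))%R by rewrite divr_gt0// mulr_gt0.
have [t1 t11 ht] := pot_vanish e2 (kl_mu_fin x ltr01).
have [j t1j] := nat_above t1.
have tj : (t1 <= t j)%R by apply: ltW; apply: lt_le_trans t1j _; rewrite /t lerDr ltW.
rewrite -(trunc_h x s0 r0 (rt j)); apply: leeD.
  apply: le_kintk; [exact: nk|exact: nk|exact: nhs|] => d d0; apply: (kmix_sub n3 alpha0 alpha2) => u.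
  by rewrite /= !in_itv/= => /andP[-> _].
apply: (@le_trans _ _ (kint L (ks s) (pot (kl (t j)) mu) x)).
  by apply: le_kint; [exact: nk|exact: nMv|exact: nKl|move=> z; exact: Mv_le].
apply: le_trans (short_upper n3 alpha0 alpha2 x smu s0 (t0 j)) _.
rewrite -/(cs s) cf.
apply: (@le_trans _ _ (c%:E * (2%:E * (e / (2 * c))%:E))).
  apply: lee_wpmul2l; first by rewrite lee_fin ltW.
  apply: lee_pmul; [| |rewrite lee_fin|exact: ht].
  - by rewrite lee_fin addr_ge0// divr_ge0// ltW.
  - by apply: pot_ge0; exact: nk.
  - have h1 : (s / t j <= 1)%R.
      by rewrite ler_pdivrMr// mul1r (le_trans (ltW s1))// (le_trans t11).
    by lra.
rewrite -!EFinM lee_fin le_eqVlt; apply/orP; left; apply/eqP.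
by field; rewrite gt_eqF.
Qed.

Let cs_fin s : (0 < s < 1)%R -> cs s \is a fin_num.
Proof.
by move=> /andP[s0 s1]; rewrite ge0_fin_numE ?cshort_fin//; exact/ltW/cshort_gt0.
Qed.

Let mdens s : measurable_fun setT (fun z : T => (fine (cs s))^-1 * ediff (Mv (`|s| + (s == 0)%R%:R)) v z)%R.
Proof.
apply: measurable_funM => //; apply/measurable_EFinP; apply: nnm_m; apply: nh.
have [->|s0] := eqVneq s 0%R; first by rewrite normr0 add0r.
by rewrite addr0 normr_gt0.
Qed.

Let dens0 s z : (0 <= (fine (cs s))^-1 * ediff (Mv (`|s| + (s == 0)%R%:R)) v z)%R.
Proof.
apply: mulr_ge0; last by rewrite le_max lexx.
rewrite invr_ge0; apply: fine_ge0; apply: integral_ge0 => t.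
rewrite /= in_itv/= => /andP[t0 _]; rewrite lee_fin mulr_ge0 ?powR_ge0//.
exact/ltW/Crz_gt0.
Qed.

(* The density is written with [`|s| + (s == 0)] only to be total in [s]. *)
Let rhos s : msr R n := densm L (mdens s) (dens0 s).

Let srhos s : sigma_finite setT (rhos s).
Proof. exact: dens_sigma_finite. Qed.

Let int_rhos s (f : T -> \bar R) : (0 < s < 1)%R -> nnm f ->
  \int[rhos s]_z f z = (fine (cs s))^-1%:E * \int[L]_z (f z * h s z).
Proof.
move=> /[dup] s01 /andP[s0 s1] nf; have nhs := nh s0.
have i0 : 0 <= (fine (cs s))^-1%:E by rewrite lee_fin invr_ge0 fine_ge0//; exact/ltW/cshort_gt0.
rewrite integral_dens; [|exact: nnm_m nf|exact: nnm_ge0 nf].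
rewrite -integral_nnmZl//; last exact: nnmM.
have sE : (`|s| + (s == 0)%R%:R = s)%R by rewrite gt_eqF// addr0 gtr0_norm.
by apply: eq_integral => z _; rewrite sE EFinM -muleA [f z * _]muleC.
Qed.

Let P s r x := pot (kl r) (rhos s) x.

Let PE s r x : (0 < s < 1)%R -> (0 < r)%R -> cs s * P s r x = kint L (ks s) (Mv r) x.
Proof.
move=> s01 r0; rewrite -(kint_h x s01 r0) /P /pot int_rhos//; last by apply: nnm_edist; exact: nk.
have s0 : (0 < s)%R by case/andP: s01.
have c0 : (0 < fine (cs s))%R by rewrite -lte_fin fineK ?cs_fin//; exact: cshort_gt0.
by rewrite -{1}(fineK (cs_fin s01)) muleA -EFinM divff ?gt_eqF// mul1e.
Qed.

Let Pf s r x : (0 < s < 1)%R -> (0 < r)%R -> P s r x <= (1 + s / r)%:E * pot (kl r) mu x.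
Proof.
move=> /[dup] s01 /andP[s0 s1] r0.
have c0 : (0 < fine (cs s))%R by rewrite -lte_fin fineK ?cs_fin//; exact: cshort_gt0.
rewrite -(@lee_pmul2l _ (cs s)) ?cs_fin//; last exact: cshort_gt0.
rewrite PE//; apply: le_trans (short_upper n3 alpha0 alpha2 x smu s0 r0).
by apply: le_kint; [exact: nk|exact: nMv|exact: nKl|move=> z; exact: Mv_le].
Qed.

Let P_lower s r x : (0 < s < 1)%R -> (0 < r)%R ->
  ((r / (r + s)) ^+ n)%:E * Mv r x <= P s r x.
Proof.
move=> /[dup] s01 /andP[s0 s1] r0.
rewrite -(@lee_pmul2l _ (cs s)) ?cs_fin//; last exact: cshort_gt0.
by rewrite PE//; exact: short_lower.
Qed.

(** [short_upper] concerns potentials only. It is applied to the potential of [mu], and the lower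
    bound to its excess over [v]; together they bound the share of [v] from above. *)
Let P_upper s r x : (0 < s < 1)%R -> (0 < r)%R ->
  P s r x + ((r / (r + s)) ^+ n)%:E * (pot (kl r) mu x - Mv r x) <= (1 + s / r)%:E * pot (kl r) mu x.
Proof.
move=> /[dup] s01 /andP[s0 s1] r0.
pose g (z : T) : \bar R := (ediff v (pot ka mu) z)%:E.
have ng : nnm g by exact: nnm_ediff.
have AE z : pot (kl r) mu z = Mv r z + kint L (km r) g z.
  by rewrite -(kint_pot n3 alpha0 alpha2 z smu r0); apply: kint_ediff => //; exact: nm.
have Mvf : Mv r x \is a fin_num.
  rewrite ge0_fin_numE; last by apply: kint_ge0 => //; exact: nm.
  exact: le_lt_trans (Mv_le x r0) (kl_mu_fin x r0).
have -> : pot (kl r) mu x - Mv r x = kint L (km r) g x by rewrite AE addeAC subee// add0e.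
have e0 : (0 <= (r / (r + s)) ^+ n)%R by rewrite exprn_ge0// divr_ge0 ?ltW// addr_gt0.
have ng' : nnm (kint L (km r) g : T -> \bar R) by apply: nnm_kint => //; exact: nm.
have nMr := nMv r0.
rewrite -(@lee_pmul2l _ (cs s)) ?cs_fin//; last exact: cshort_gt0.
apply: le_trans (short_upper n3 alpha0 alpha2 x smu s0 r0).
have -> : kint L (ks s) (pot (kl r) mu) x = kint L (ks s) (Mv r) x + kint L (ks s) (kint L (km r) g) x.
  rewrite -kintD//; last exact: nk.
  by apply: eq_integral => z _; rewrite AE.
rewrite ge0_muleDr; last 2 first.
- by apply: pot_ge0; exact: nk.
- by apply: mule_ge0; [rewrite lee_fin|apply: kint_ge0 => //; exact: nm].
by rewrite PE//; apply: leeD => //; exact: short_lower.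
Qed.

Let sj (j : nat) : R := (2^-1 * j.+1%:R^-1)%R.

Let sj01 j : (0 < sj j < 1)%R.
Proof.
have h1 : (0 < j.+1%:R^-1 :> R)%R by rewrite invr_gt0.
have h2 : (j.+1%:R^-1 <= 1 :> R)%R by rewrite invf_le1// ler1n.
rewrite /sj; move: (j.+1%:R^-1)%R h1 h2 => u u0 u1.
by apply/andP; split; lra.
Qed.

Let sj0 : sj j @[j --> \oo] --> (0%R : R).
Proof.
rewrite -(mulr0 (2^-1)%R); apply: cvgM; first exact: cvg_cst.
exact: cvg_harmonic.
Qed.

Let P_cvg r x : (0 < r)%R -> P (sj j) r x @[j --> \oo] --> Mv r x.
Proof.
move=> r0; have Kf := kl_mu_fin x r0.
have A0 : 0 <= pot (kl r) mu x by apply: pot_ge0; exact: nk.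
have B0 : 0 <= Mv r x by apply: kint_ge0 => //; exact: nm.
have BA := Mv_le x r0.
have pA : pot (kl r) mu x \is a fin_num by rewrite ge0_fin_numE.
have pB : Mv r x \is a fin_num by rewrite ge0_fin_numE//; exact: le_lt_trans Kf.
pose A := fine (pot (kl r) mu x); pose B := fine (Mv r x).
have AE : pot (kl r) mu x = A%:E by rewrite fineK.
have BE : Mv r x = B%:E by rewrite fineK.
have q1 : ((r / (r + sj j)) ^+ n)%R @[j --> \oo] --> (1%R : R).
  have q0 : (r / (r + sj j))%R @[j --> \oo] --> (r / (r + 0))%R.
    apply: cvgM; first exact: cvg_cst.
    apply: cvgV; first by rewrite addr0; exact: lt0r_neq0.
    by apply: cvgD => //; exact: cvg_cst.
  have := cvg_comp _ _ q0 (@exprn_continuous R n (r / (r + 0))%R).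
  by rewrite addr0 divff ?gt_eqF// expr1n.
have u1 : (1 + sj j / r)%R @[j --> \oo] --> (1%R : R).
  have : (1 + sj j / r)%R @[j --> \oo] --> (1 + 0 / r)%R.
    apply: cvgD; first exact: cvg_cst.
    by apply: cvgM => //; exact: cvg_cst.
  by rewrite mul0r addr0.
rewrite BE; apply: (@squeeze_cvge _ _ _ _ (fun j => ((r / (r + sj j)) ^+ n * B)%:E) _
   (fun j => ((1 + sj j / r) * A - (r / (r + sj j)) ^+ n * (A - B))%:E)).
- apply: nearW => j; have := P_lower x (sj01 j) r0; have := P_upper x (sj01 j) r0.
  rewrite AE BE -EFinB -!EFinM => h1 ->/=.
  by rewrite EFinB leeBrDr.
- apply: cvg_EFin; first exact: nearW.
  have : ((r / (r + sj j)) ^+ n * B)%R @[j --> \oo] --> (1 * B)%R.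
    by apply: cvgM => //; exact: cvg_cst.
  by rewrite mul1r.
- apply: cvg_EFin; first exact: nearW.
  have : ((1 + sj j / r) * A - (r / (r + sj j)) ^+ n * (A - B))%R @[j --> \oo] -->
      (1 * A - 1 * (A - B))%R.
    apply: cvgB; first by apply: cvgM => //; exact: cvg_cst.
    by apply: cvgM => //; exact: cvg_cst.
  by rewrite !mul1r subKr.
Qed.

(** A weight that turns the measures [rhos] into finite ones; it is divided out again after the
    limit is taken. *)
Let kl1 (z : T) : R := fine (kl 1 (edist (0 : 'rV[R]_n) (z : 'rV[R]_n))).

Let kl1E z : (kl1 z)%:E = kl 1 (edist (0 : 'rV[R]_n) (z : 'rV[R]_n)).
Proof. by rewrite fineK// kl_fin. Qed.

Let kl1_gt0 z : (0 < kl1 z)%R.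
Proof. by rewrite -lte_fin kl1E klong_gt0. Qed.

Let mkl1 : measurable_fun setT kl1.
Proof.
by apply: measurableT_comp => //; apply: nnm_m; apply: nnm_edist; exact: nk.
Qed.

Let kl1_ge0 z : (0 <= kl1 z)%R. Proof. exact: ltW. Qed.

Let theta j : msr R n := densm (rhos (sj j)) mkl1 kl1_ge0.

Let int_theta j (f : T -> \bar R) : nnm f -> \int[theta j]_z f z = \int[rhos (sj j)]_z ((kl1 z)%:E * f z).
Proof. by move=> nf; rewrite integral_dens//; [exact: nnm_m|exact: nnm_ge0]. Qed.

Let Mtheta : R := (2 * fine (pot (kl 1) mu 0))%R.

Let Pf2 j r x : (1 <= r)%R -> P (sj j) r x <= 2%:E * pot (kl r) mu x.
Proof.
move=> r1; have r0 : (0 < r)%R by exact: lt_le_trans r1.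
apply: le_trans (Pf x (sj01 j) r0) _; apply: lee_wpmul2r; first by apply: pot_ge0; exact: nk.
have /andP[h0 h1] := sj01 j.
have : (sj j / r <= 1)%R by rewrite ler_pdivrMr// mul1r (le_trans (ltW h1)).
by rewrite lee_fin => h2; lra.
Qed.

Let thetaM j : theta j setT <= Mtheta%:E.
Proof.
have -> : theta j setT = P (sj j) 1 0.
  rewrite [theta j setT]densE /P /pot; apply: eq_integral => z _; exact: kl1E.
apply: le_trans (Pf2 j 0 (lexx _)) _; rewrite /Mtheta EFinM fineK//.
by rewrite ge0_fin_numE ?kl_mu_fin//; apply: pot_ge0; exact: nk.
Qed.

(** Beyond radius [q] the weight [kl 1] is at most [2 kl t], and for large [t] the [kl t]-potentials
    at the origin are small uniformly in [j]. *)
Let theta_tight e : (0 < e)%R -> exists K : set T, compact (K : set (Rn R n)) /\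
  exists N, forall j, (N <= j)%N -> theta j (~` K) <= e%:E.
Proof.
move=> e0; have e4 : (0 < e / 4)%R by rewrite divr_gt0.
have [t t1 ht] := pot_vanish e4 (kl_mu_fin 0 ltr01).
have t0 : (0 < t)%R by exact: lt_le_trans t1.
have h2 : (0 < 2^-1 :> R)%R by rewrite invr_gt0.
have [q q0 hq] := gtail_far n t0 h2.
exists (ceball 0 q); split; first exact: compact_ceball.
exists 0%N => j _.
have mC : measurable (~` (ceball 0 q : set T)) by apply: measurableC; exact: measurable_ceball.
rewrite [theta j _]densE.
have nklt := nnm_edist (0 : 'rV[R]_n) (nk `]t, +oo[%R).
have n2 : nnm (fun z : T => 2%:E * kl t (edist (0 : 'rV[R]_n) (z : 'rV[R]_n))).
  by apply: nnmM => //; apply: nnm_cst; rewrite lee_fin.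
apply: (@le_trans _ _ (\int[rhos (sj j)]_(z in ~` (ceball 0 q : set T)) (2%:E * kl t (edist (0 : 'rV[R]_n) (z : 'rV[R]_n))))).
  apply: ge0_le_integral => //.
  - by move=> z _; rewrite lee_fin.
  - by apply: measurable_funTS; exact/measurable_EFinP.
  - by apply: measurable_funTS; exact: nnm_m n2.
  move=> z /negP; rewrite /ceball/= -ltNge => qz; rewrite kl1E.
  apply: le_trans (klong_le_kall n3 alpha0 alpha2 _ _) _.
  apply: le_trans (ka_le_kl n3 alpha0 alpha2 (rho := q) t0 _ hq) _; first by rewrite q0 ltW.
  apply: lee_wpmul2r; first exact: kmix_ge0.
  by rewrite lee_fin; lra.
apply: (@le_trans _ _ (\int[rhos (sj j)]_z (2%:E * kl t (edist (0 : 'rV[R]_n) (z : 'rV[R]_n))))).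
  apply: ge0_subset_integral => //; first exact: nnm_m n2.
  by move=> z _; exact: nnm_ge0 n2 z.
rewrite integral_nnmZl//.
apply: (@le_trans _ _ (2%:E * (2%:E * (e / 4)%:E))).
  apply: lee_wpmul2l => //; apply: le_trans (Pf2 j 0 t1) _.
  by apply: lee_wpmul2l => //; exact: ht.
by rewrite -!EFinM lee_fin; lra.
Qed.

Lemma potential_of_supermean : exists2 rho : msr R n, Mplus alpha rho & forall x, pot ka rho x = v x.
Proof.
have [th [thf hth]] := prokhorov thetaM theta_tight.
have sth : sigma_finite setT th.
  by exists (fun=> setT); [rewrite bigcup_const|move=> _; split => //; exact: measurableT].
have mi : measurable_fun setT (fun z : T => (kl1 z)^-1)%R.
  rewrite (_ : (fun z : T => _) = (fun z => kl1 z `^ (-1))%R); last first.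
    by apply/funext => z; rewrite powR_inv1.
  by apply: (measurableT_comp (measurable_powR _)).
have i0 z : (0 <= (kl1 z)^-1)%R by rewrite invr_ge0.
pose rho : msr R n := densm th mi i0.
have key r x : (0 < r)%R -> pot (kl r) rho x = Mv r x.
  move=> r0; pose q (z : T) := fine (kl r (edist x (z : 'rV[R]_n))).
  have qE z : (q z)%:E = kl r (edist x (z : 'rV[R]_n)) by rewrite fineK// kl_fin.
  have q0 z : (0 <= q z)%R by apply: fine_ge0; exact: kmix_ge0.
  have nkr := nnm_edist x (nk `]r, +oo[%R).
  have mq : measurable_fun setT q by apply: measurableT_comp => //; exact: nnm_m nkr.
  (* The quotient of two long kernels is continuous, and bounded by the Harnack inequality: an
     admissible test function. *)
  pose psi (z : T) := (q z * (kl1 z)^-1)%R.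
  have qpsi z : (kl1 z * psi z)%R = q z.
    by rewrite mulrC; exact: (divfK (lt0r_neq0 (kl1_gt0 z)) (q z)).
  have mpsi : measurable_fun setT psi by exact: measurable_funM.
  have [C C0 hC] := kl_harnack n3 alpha0 alpha2 r0 ltr01 (edist_ge0 x 0).
  have psiC z : (0 <= psi z <= C)%R.
    apply/andP; split; first by apply: mulr_ge0; [exact: q0|exact: i0].
    have t1 : (edist (0 : 'rV[R]_n) (z : 'rV[R]_n) <= edist x (z : 'rV[R]_n) + edist x 0)%R.
      by rewrite addrC [edist x 0]edistC; exact: edist_triangle.
    have b0 : (0 <= edist (0 : 'rV[R]_n) (z : 'rV[R]_n) <= edist x (z : 'rV[R]_n) + edist x 0)%R.
      by rewrite t1 edist_ge0.
    have := hC _ _ (edist_ge0 x z) b0.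
    rewrite -(qE z) -(kl1E z) -EFinM lee_fin => t2.
    have := ler_pdivrMr C (q z) (kl1_gt0 z); rewrite t2; exact: id.
  have cpsi : continuous (fun z : Rn R n => fine (kl r (edist x z)) * (fine (kl 1 (edist 0 z)))^-1)%R.
    have cq : continuous (fun z : Rn R n => fine (kl r (edist x z))).
      by move=> z; apply: (cvg_comp _ _ (@continuous_edist R n x z) (@continuous_kl R n alpha n3 alpha0 alpha2 r r0 (edist x z))).
    have ck : continuous (fun z : Rn R n => fine (kl 1 (edist 0 z))).
      by move=> z; apply: (cvg_comp _ _ (@continuous_edist R n 0%R z) (@continuous_kl R n alpha n3 alpha0 alpha2 1%R ltr01 (edist 0 z))).
    exact: (continuous_div cq ck (fun z => lt0r_neq0 (kl1_gt0 z))).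
  have Mvf : Mv r x \is a fin_num.
    rewrite ge0_fin_numE; last by apply: kint_ge0 => //; exact: nm.
    exact: le_lt_trans (Mv_le x r0) (kl_mu_fin x r0).
  have npsi : nnm (fun z => (psi z)%:E) by apply: nnm_EFin => // z; case/andP: (psiC z).
  have lim : \int[theta j]_z (psi z)%:E @[j --> \oo] --> (fine (Mv r x))%:E.
    rewrite (fineK Mvf) (_ : (fun j => _) = (fun j => P (sj j) r x)); first exact: P_cvg.
    apply/funext => j; rewrite (int_theta j npsi); apply: eq_integral => z _.
    by rewrite -EFinM qpsi; exact: qE.
  have := hth psi C _ mpsi psiC _ _ lim; rewrite (fineK Mvf) => <-.
  - rewrite /pot integral_dens; [|exact: nnm_m nkr|exact: nnm_ge0 nkr].
    by apply: eq_integral => z _; rewrite -(qE z) -EFinM mulrC.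
  - by move=> c; apply: (@open_comp (Rn R n) R psi [set y | (c < y)%R]) => [z _|]; [exact: cpsi|exact: open_gt].
  - by move=> c; apply: (@open_comp (Rn R n) R psi [set y | (y < c)%R]) => [z _|]; [exact: cpsi|exact: open_lt].
have rrho : radon rho.
  apply: (radonP (x := 0%R)) => q.
  have c0 := klong_gt0 n3 alpha0 alpha2 `|q| (ler01 : (0 <= 1 :> R)%R).
  have h1 : kl 1 `|q| * rho (ceball 0 q) <= Mv 1 (0 : 'rV[R]_n)%R.
    rewrite -(key 1%R _ ltr01); apply: pot_ball_ge; [exact: nk|exact: ltW|] => d /andP[d0 dq].
    by apply: kmix_anti; rewrite // d0 (le_trans dq)// ler_norm.
  have f1 := le_lt_trans h1 (le_lt_trans (Mv_le _ ltr01) (kl_mu_fin _ ltr01)).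
  rewrite ltNge; apply/negP; rewrite leye_eq => /eqP E; move: f1.
  by rewrite E gt0_muley.
have srho := radon_sigma_finite rrho.
(* The [kl r]-potentials of [rho] are the means of [v]. For [r] tending to [0] they stay below [v]
   by the supermean property, and lower semicontinuity gives the converse. *)
have vE x : pot ka rho x = v x.
  apply/eqP; rewrite eq_le; apply/andP; split.
    apply: (cvge_ub (a := fun k : nat => pot (kl k.+1%:R^-1) rho x)); [exact: pot_kl_cvg|move=> k].
    by rewrite key ?harm_gt0//; apply: vM; exact: harm_gt0.
  apply: (lsc_le_lim n3 alpha0 alpha2 nv lv) => k.
  have <- : pot (kl k.+1%:R^-1) rho x = kint L (km k.+1%:R^-1) v x by exact: key (harm_gt0 R k).
  by apply: (cvge_nd_ub (a := fun k : nat => pot (kl k.+1%:R^-1) rho x)); [exact: pot_kl_nd|exact: pot_kl_cvg].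
exists rho => //; split => //.
have [x0 hx] := muM.2; exists x0; rewrite potentialE// vE.
by apply: le_lt_trans (vU x0) _; rewrite -potentialE.
Qed.

End supermean.

(** * Capacity and dominating measures *)

Section constructions.
Local Open Scope ereal_scope.
Context (R : realType) (n : nat).
Local Notation T := (RnB R n).
Implicit Types (m : msr R n) (B : set T).

Lemma dens_exists m (g : T -> \bar R) : nnm g -> (forall z, g z \is a fin_num) ->
  exists m' : msr R n, forall f : T -> \bar R, nnm f -> \int[m']_z f z = \int[m]_z (g z * f z).
Proof.
move=> ng gf.
have mg : measurable_fun setT (fun z : T => fine (g z)) by apply: measurableT_comp => //; exact: nnm_m.
have g0 z : (0 <= fine (g z))%R by apply: fine_ge0; exact: nnm_ge0.
exists (densm m mg g0) => f nf; rewrite integral_dens; [|exact: nnm_m nf|exact: nnm_ge0 nf].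
by apply: eq_integral => z _; rewrite fineK.
Qed.

Lemma restr_exists m B (c : R) : measurable B -> (0 <= c)%R ->
  exists m' : msr R n, forall f : T -> \bar R, nnm f ->
    \int[m']_z f z = c%:E * \int[m]_z ((\1_B z)%:E * f z).
Proof.
move=> mB c0; have nB := nnm_indic R mB.
have nc : nnm (fun z : T => c%:E * (\1_B z)%:E) by apply: nnmM => //; apply: nnm_cst; rewrite lee_fin.
have fc (z : T) : c%:E * (\1_B z)%:E \is a fin_num by rewrite -EFinM.
have [m' hm'] := dens_exists m nc fc.
exists m' => f nf; rewrite (hm' f nf) -integral_nnmZl; [|exact: nnmM|by rewrite lee_fin].
by apply: eq_integral => z _; rewrite muleA.
Qed.

Lemma addm_exists m1 m2 : exists m' : msr R n, forall f : T -> \bar R, nnm f ->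
  \int[m']_z f z = \int[m1]_z f z + \int[m2]_z f z.
Proof.
exists (measure_add m1 m2) => f nf; rewrite ge0_integral_measure_add//.
  by move=> z _; exact: nnm_ge0 nf z.
exact: nnm_m.
Qed.

Lemma int_indic m B : measurable B -> \int[m]_z (\1_B z)%:E = m B.
Proof. by move=> mB; rewrite integral_indic ?setIT. Qed.

Lemma aeS m (P Q : T -> Prop) : {ae m, forall z, P z} -> (forall z, P z -> Q z) ->
  {ae m, forall z, Q z}.
Proof. by move=> aeP PQ; apply: filterS aeP. Qed.

Lemma aeI m (P Q : T -> Prop) : {ae m, forall z, P z} -> {ae m, forall z, Q z} ->
  {ae m, forall z, P z /\ Q z}.
Proof. exact: filterI. Qed.

Lemma measure_leT m B : measurable B -> m B <= m setT.
Proof. by move=> mB; apply: le_measure => //; rewrite inE; [exact: mB|exact: measurableT]. Qed.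

Lemma nnm_int_eq0 m (f : T -> \bar R) : nnm f -> \int[m]_z f z <= 0 -> {ae m, forall z, f z = 0}.
Proof.
move=> nf f0.
have E : \int[m]_z `|f z| = 0.
  apply/eqP; rewrite eq_le; apply/andP; split; last exact: integral_ge0.
  by apply: le_trans f0; apply: le_integral_nnm => // [|z]; rewrite ?gee0_abs ?(nnm_ge0 nf)//;
    rewrite (_ : (fun z => `|f z|) = f)//; apply/funext => z; rewrite gee0_abs ?(nnm_ge0 nf).
have := (ae_eq_integral_abs m measurableT (nnm_m nf)).1 E.
by apply: filterS => z /(_ I).
Qed.

Lemma eq_integral_nnm m (f g : T -> \bar R) : nnm f -> nnm g -> {ae m, forall z, f z = g z} ->
  \int[m]_z f z = \int[m]_z g z.
Proof.
move=> nf ng fg; apply: ge0_ae_eq_integral; [exact: measurableT|exact: nnm_m|exact: nnm_m| | |].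
- by move=> z _; exact: nnm_ge0 nf z.
- by move=> z _; exact: nnm_ge0 ng z.
- by apply: filterS fg => z ->.
Qed.

End constructions.

Section potentials.
Local Open Scope ereal_scope.
Context (R : realType) (n : nat) (alpha : R).
Hypotheses (n3 : (3 <= n)%N) (alpha0 : (0 < alpha)%R) (alpha2 : (alpha <= 2)%R).
Local Notation L := (Leb R n).
Local Notation T := (RnB R n).
Local Notation kl := (klong n alpha).
Local Notation ks := (kshort n alpha).
Local Notation ka := (kall n alpha).
Local Notation km := (kmid n alpha).
Implicit Types (m : msr R n) (f g : T -> \bar R) (x z y : 'rV[R]_n) (s r : R) (A E : set (Rn R n)).

Let sL : sigma_finite setT L := Leb_sigma_finite R n.
Let nk i : nnm (kmix n alpha i) := nnm_kmix n3 alpha0 alpha2 i.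
Let nm s : (0 < s)%R -> nnm (km s) := @nnm_km R n alpha alpha0 alpha2 s.

(** Lebesgue measure charges every ball, since the means by [kmid] concentrate on it. *)
Lemma Leb_ae_ex (P : 'rV[R]_n -> Prop) x (d : R) : (0 < d)%R ->
  {ae L, forall z : T, P z} -> exists2 z : 'rV[R]_n, (edist x z < d)%R & P z.
Proof.
move=> d0 aeP; apply: contrapT => h.
have h2 : (0 < 2^-1 :> R)%R by rewrite invr_gt0.
have [N hN] := kint_km_concentrates n3 alpha0 alpha2 x d0 h2.
have := hN N (leqnn N); rewrite /kint.
have mB := measurable_eball x d.
have nB := nnm_indic R mB.
have nf := nnm_kernel x (nm (harm_gt0 R N)) nB.
rewrite (eq_integral_nnm nf (@nnm_cst _ T R 0 (lexx 0))); last first.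
  apply: (aeS aeP) => z Pz; rewrite indicE memNset ?mule0//= => zB.
  by apply: h; exists z.
by rewrite integral0 lee_fin; lra.
Qed.

(** The [km 1] mean of the Riesz potential is the [kl 1]-potential; if it is finite, so is the Riesz
    potential almost everywhere, in particular somewhere. *)
Lemma pot_kl_Mplus m x : pot (kl 1) m x < +oo -> Mplus alpha m.
Proof.
move=> fin.
have rm : radon m.
  apply: (radonP (x := x)) => q.
  have c0 := klong_gt0 n3 alpha0 alpha2 `|q| (ler01 : (0 <= 1 :> R)%R).
  have h1 : kl 1 `|q| * m (ceball x q) <= pot (kl 1) m x.
    apply: pot_ball_ge; [exact: nk|exact: ltW|] => d /andP[d0 dq].
    by apply: kmix_anti; rewrite // d0 (le_trans dq)// ler_norm.
  have f1 := le_lt_trans h1 fin.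
  rewrite ltNge; apply/negP; rewrite leye_eq => /eqP E; move: f1.
  by rewrite E gt0_muley.
split => //; have sm := radon_sigma_finite rm.
have nU := nnm_pot sm (nk `]-oo, +oo[%R).
have fU : kint L (km 1) (pot ka m) x < +oo by rewrite (kint_pot n3 alpha0 alpha2 x sm ltr01).
have [z _ zf] := Leb_ae_ex x ltr01 (kint_km_ae_fin alpha0 alpha2 ltr01 nU fU).
exists z; rewrite (potentialE n3 alpha0 alpha2) -ge0_fin_numE; first exact: zf.
exact: nnm_ge0 nU z.
Qed.

Lemma Mplus_dirac y : Mplus alpha (dirac_at y).
Proof.
apply: (@pot_kl_Mplus _ 0); rewrite pot_dirac; last exact: nk.
exact: klong_fin.
Qed.

Lemma kint_pot_le m s x : sigma_finite setT m -> (0 < s)%R -> kint L (km s) (pot ka m) x <= pot ka m x.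
Proof.
move=> sm s0; rewrite (kint_pot n3 alpha0 alpha2 x sm s0); apply: le_pot; [exact: nk|exact: nk|].
by move=> d _; exact: (klong_le_kall n3 alpha0 alpha2).
Qed.

Lemma Mplus_pot_nnm m i : Mplus alpha m -> nnm (pot (kmix n alpha i) m : T -> \bar R).
Proof. by move=> M; apply: nnm_pot; [exact: radon_sigma_finite M.1|exact: nk]. Qed.

(** A minimum of two potentials is lower semicontinuous, dominates its means and lies below a
    potential. *)
Lemma potential_min m1 m2 : Mplus alpha m1 -> Mplus alpha m2 -> exists2 m, Mplus alpha m &
  forall x, pot ka m x = Order.min (pot ka m1 x) (pot ka m2 x).
Proof.
move=> M1 M2; have n1 := Mplus_pot_nnm `]-oo, +oo[%R M1; have n2 := Mplus_pot_nnm `]-oo, +oo[%R M2.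
have nv := nnm_min n1 n2.
apply: (@potential_of_supermean R n alpha n3 alpha0 alpha2 _ m1 nv _ M1).
- by apply: lsc_min; exact: lsc_kmix_pot.
- move=> s x s0; rewrite le_min; apply/andP; split.
    apply: le_trans (kint_pot_le x (radon_sigma_finite M1.1) s0).
    by apply: le_kint; [exact: nm|exact: nv|exact: n1|move=> z; rewrite ge_min lexx].
  apply: le_trans (kint_pot_le x (radon_sigma_finite M2.1) s0).
  by apply: le_kint; [exact: nm|exact: nv|exact: n2|move=> z; rewrite ge_min lexx orbT].
- by move=> x; rewrite ge_min lexx.
Qed.

Lemma le_kint_pot m m' s x : Mplus alpha m -> Mplus alpha m' -> (0 < s)%R ->
  (forall z, pot ka m z <= pot ka m' z) -> pot (kl s) m x <= pot (kl s) m' x.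
Proof.
move=> M M' s0 h; have sm := radon_sigma_finite M.1; have sm' := radon_sigma_finite M'.1.
rewrite -(kint_pot n3 alpha0 alpha2 x sm s0) -(kint_pot n3 alpha0 alpha2 x sm' s0).
by apply: le_kint; [exact: nm|exact: Mplus_pot_nnm|exact: Mplus_pot_nnm|].
Qed.

Lemma pot_kl_ext m m' x : (forall s, (0 < s)%R -> pot (kl s) m x <= pot (kl s) m' x) ->
  pot ka m x <= pot ka m' x.
Proof.
move=> h; apply: (cvge_ub (a := fun k : nat => pot (kl k.+1%:R^-1) m x)); first exact: pot_kl_cvg.
move=> k; apply: le_trans (h _ (harm_gt0 R k)) _; apply: le_pot; [exact: nk|exact: nk|].
by move=> d _; exact: (klong_le_kall n3 alpha0 alpha2).
Qed.

(** Equality of one mean at one point already gives equality almost everywhere, by positivity of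
    [kmid]. *)
Lemma kint_ediff_eq0 f g s x : (0 < s)%R -> nnm f -> nnm g -> (forall z, f z <= g z) ->
  kint L (km s) g x <= kint L (km s) f x -> kint L (km s) g x < +oo ->
  {ae L, forall z, g z = f z}.
Proof.
move=> s0 nf ng fg gf fin.
have gfin := kint_km_ae_fin alpha0 alpha2 s0 ng fin.
have nd := nnm_ediff nf ng.
have E := kint_ediff x (nm s0) nf ng fg gfin.
have ff : kint L (km s) f x \is a fin_num.
  rewrite ge0_fin_numE; last by apply: kint_ge0; [exact: nm|exact: nf].
  by apply: le_lt_trans fin; apply: le_kint; [exact: nm|exact: nf|exact: ng|exact: fg].
have d0 : kint L (km s) (fun z => (ediff f g z)%:E) x <= 0.
  by move: gf; rewrite E -[leRHS]adde0 (leeD2lE _ _ ff).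
have := nnm_int_eq0 (nnm_kernel x (nm s0) nd) d0.
move=> ae0; apply: (aeS (aeI gfin ae0)) => z [gz] /eqP.
have k0 := kmid_gt0 n alpha0 alpha2 (edist x z) s0.
rewrite mule_eq0 gt_eqF//= => /eqP[]; rewrite /ediff => dz.
have fz : f z \is a fin_num.
  by rewrite ge0_fin_numE ?(nnm_ge0 nf)//; apply: le_lt_trans (fg z) _; rewrite -ge0_fin_numE ?(nnm_ge0 ng).
rewrite -(fineK gz) -(fineK fz); congr EFin; apply/eqP; rewrite eq_le; apply/andP; split; last first.
  by rewrite -lee_fin !fineK.
by rewrite -subr_le0 -dz le_max lexx orbT.
Qed.

Lemma eq_kint_ae k f g x : nnm k -> nnm f -> nnm g -> {ae L, forall z, g z = f z} ->
  kint L k g x = kint L k f x.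
Proof.
move=> hk nf ng gf; apply: eq_integral_nnm; [exact: nnm_kernel|exact: nnm_kernel|].
by apply: (aeS gf) => z ->.
Qed.

End potentials.

(** * Sets of capacity zero and the class of dominating measures *)

Section capacity.
Local Open Scope ereal_scope.
Context (R : realType) (n : nat) (alpha : R).
Hypotheses (n3 : (3 <= n)%N) (alpha0 : (0 < alpha)%R) (alpha2 : (alpha <= 2)%R).
Local Notation T := (RnB R n).
Local Notation ka := (kall n alpha).
Implicit Types (m lam : msr R n) (x y : 'rV[R]_n) (A E : set (Rn R n)) (B : set T).

Let nk i : nnm (kmix n alpha i) := nnm_kmix n3 alpha0 alpha2 i.

Lemma energyE m : energy alpha m = \int[m]_x pot ka m x.
Proof. by rewrite -(potentialE n3 alpha0 alpha2). Qed.

Lemma cap_zero_sub E E' : E `<=` E' -> cap_zero alpha E' -> cap_zero alpha E.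
Proof.
move=> EE' cE'; apply/eqP; rewrite -leye_eq -[X in X <= _]cE'.
apply: le_ereal_inf => _ [m [[rm [em cm]] m1] <-]; exists m => //; split => //; split => //; split => //.
by apply: negligibleS cm => z nz Ez; exact/nz/EE'.
Qed.

Lemma not_cap_zeroP E : ~ cap_zero alpha E -> exists2 lam, Eplus alpha E lam & lam setT = 1.
Proof.
move=> cE; apply: contrapT => h; apply: cE; rewrite /cap_zero /inv_cap.
rewrite (_ : [set energy alpha mu | mu in _] = set0) ?ereal_inf0//.
by rewrite -subset0 => e [m [Em m1] _]; apply: h; exists m.
Qed.

Lemma cap_zero0 : cap_zero alpha (set0 : set (Rn R n)).
Proof.
apply: contrapT => /not_cap_zeroP[lam [_ [_ cl]] l1].
have : lam setT = 0 by apply: (negligibleP _ measurableT).1; rewrite -setC0.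
by rewrite l1 => /eqP; rewrite onee_eq0.
Qed.

(* The restriction of [lam] to [B], normalized, competes for the capacity of [E] in [B]. *)
Lemma cap_zero_null lam E B : measurable B -> lam setT < +oo -> energy alpha lam < +oo ->
  concentrated lam E -> cap_zero alpha (E `&` B) -> lam B = 0.
Proof.
move=> mB lf ef cE cEB; apply: contrapT => /eqP lB0; have nB := nnm_indic R mB.
have Bf : lam B \is a fin_num.
  by rewrite ge0_fin_numE//; apply: le_lt_trans lf; exact: measure_leT.
have b0 : (0 < fine (lam B))%R by rewrite -lte_fin fineK// lt0e lB0/=.
pose c : R := (fine (lam B))^-1%R.
have c0 : (0 <= c)%R by rewrite invr_ge0 ltW.
have [m hm] := restr_exists lam mB c0.
have mE (D : set T) : measurable D -> m D = c%:E * \int[lam]_z ((\1_B z)%:E * (\1_D z)%:E).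
  by move=> mD; rewrite -(hm _ (nnm_indic R mD)) int_indic.
have m1 : m setT = 1.
  rewrite mE; last exact: measurableT.
  rewrite (_ : \int[_]_z _ = lam B).
    by rewrite -(fineK Bf) -EFinM mulVf// gt_eqF.
  rewrite -(int_indic lam mB); apply: eq_integral => z _.
  by rewrite [\1_setT z]indicE mem_setT mule1.
have rm : radon m.
  apply: (radonP (x := 0%R)) => q; apply: (@le_lt_trans _ _ 1); last exact: ltry.
  by rewrite -m1; apply: measure_leT; exact: measurable_ceball.
have nB1 (f : T -> \bar R) z : nnm f -> (\1_B z)%:E * f z <= f z.
  move=> nf; rewrite -[leRHS]mul1e; apply: lee_wpmul2r; first exact: nnm_ge0 nf z.
  by rewrite lee_fin indicE; case: (_ \in _).
have hmle (f : T -> \bar R) : nnm f -> \int[m]_z f z <= c%:E * \int[lam]_z f z.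
  move=> nf; rewrite (hm _ nf); apply: lee_wpmul2l; first by rewrite lee_fin.
  by apply: le_integral_nnm; [exact: nnmM|exact: nf|move=> z; exact: nB1].
have nl : nnm (pot ka lam : T -> \bar R).
  apply: nnm_pot; last exact: nk.
  by exists (fun=> setT); [rewrite bigcup_const|move=> _; split => //; exact: measurableT].
have nm : nnm (pot ka m : T -> \bar R).
  by apply: nnm_pot; [exact: radon_sigma_finite|exact: nk].
have em : energy alpha m < +oo.
  rewrite energyE; apply: (@le_lt_trans _ _ (c%:E * (c%:E * energy alpha lam))); last first.
    apply: lte_mul_pinfty; [by rewrite lee_fin|by []|].
    by apply: lte_mul_pinfty; [rewrite lee_fin|by []|exact: ef].
  apply: le_trans (hmle _ nm) _; apply: lee_wpmul2l; first by rewrite lee_fin.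
  rewrite energyE -integral_nnmZl; [|exact: nl|by rewrite lee_fin].
  apply: le_integral_nnm; [exact: nm|by apply: nnmM; [apply: nnm_cst; rewrite lee_fin|exact: nl]|].
  by move=> z; apply: hmle; apply: nnm_edist; exact: nk.
have cm : concentrated m (E `&` B).
  have [N [mN N0 sN]] := cE.
  exists (N `|` ~` B); split; first by apply: measurableU => //; exact: measurableC.
    have mNB : measurable (N `|` ~` B) by apply: measurableU => //; exact: measurableC.
    rewrite (mE _ mNB); apply/eqP; rewrite mule_eq0; apply/orP; right; apply/eqP.
    apply/eqP; rewrite eq_le; apply/andP; split; last first.
      by apply: integral_nnm_ge0; apply: nnmM => //; exact: nnm_indic.
    rewrite -N0 -(int_indic lam mN); apply: le_integral_nnm.
    - by apply: nnmM => //; exact: nnm_indic.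
    - exact: nnm_indic.
    move=> z; rewrite !indicE -EFinM lee_fin in_setU in_setC.
    by case: (z \in B); case: (z \in N); rewrite /= ?mulr1 ?mul0r ?mulr0.
  move=> z /= nz; have [Bz|nBz] := pselect (B z); last by right.
  by left; apply: sN => /= Ez; exact: nz.
have : inv_cap alpha (E `&` B) <= energy alpha m.
  by apply: ereal_inf_lbound; exists m => //; split => //; split.
by rewrite [inv_cap _ _]cEB leye_eq => /eqP E1; move: em; rewrite E1 ltxx.
Qed.

(** A competitor for the union would vanish on [B1] and on [B2]. The set [E] is arbitrary, so only
    its traces on Borel sets can be added up in this way. *)
Lemma cap_zeroU E B1 B2 : measurable B1 -> measurable B2 ->
  cap_zero alpha (E `&` B1) -> cap_zero alpha (E `&` B2) -> cap_zero alpha (E `&` (B1 `|` B2)).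
Proof.
move=> mB1 mB2 c1 c2; apply: contrapT => /not_cap_zeroP[lam [rl [el cl]] l1].
have lf : lam setT < +oo by rewrite l1 ltry.
have l10 : lam B1 = 0.
  by apply: (cap_zero_null mB1 lf el cl); apply: cap_zero_sub c1 => z [[? _] ?].
have l20 : lam B2 = 0.
  by apply: (cap_zero_null mB2 lf el cl); apply: cap_zero_sub c2 => z [[? _] ?].
have neg : lam.-negligible setT.
  rewrite -(setUv (B1 `|` B2)); apply: negligibleU.
    by apply: negligibleU; exact/negligibleP.
  by apply: negligibleS cl => z /= nz [_].
have : lam setT = 0 by exact: (negligibleP _ measurableT).1 neg.
by rewrite l1 => /eqP; rewrite onee_eq0.
Qed.

Definition dominates A y m : Prop := Mplus alpha m /\
  ne_on alpha A (fun z => potential alpha (dirac_at y) z <= potential alpha m z).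

(** The exceptional set may be taken as the trace on [A] of a Borel set, which makes it null for
    measures of finite energy. *)
Lemma dominatesP A y m : dominates A y m <->
  Mplus alpha m /\ cap_zero alpha (A `&` [set z | pot ka m z < ka (edist z y)]).
Proof.
rewrite /dominates !(potentialE n3 alpha0 alpha2); split=> -[M].
  move=> [E [EA [cE h]]]; split => //; apply: cap_zero_sub cE => z [Az /= lz].
  apply: contrapT => nE; have := h z Az nE; rewrite pot_dirac; last exact: nk.
  by rewrite leNgt lz.
move=> c; split => //; exists (A `&` [set z | pot ka m z < ka (edist z y)]); split; first by move=> z [].
split => // z Az nz; rewrite pot_dirac; last exact: nk.
by rewrite leNgt; apply/negP => lz; exact: nz.
Qed.

Lemma measurable_sublevel y m : Mplus alpha m ->
  measurable ([set z | pot ka m z < ka (edist z y)] : set T).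
Proof.
move=> M; rewrite -[X in measurable X]setTI; apply: measurable_lte => //.
  exact: nnm_m (Mplus_pot_nnm n3 alpha0 alpha2 _ M).
exact: nnm_m (nnm_edistr y (nk _)).
Qed.

Lemma dominates_dirac A y : dominates A y (dirac_at y).
Proof.
apply/dominatesP; split; first exact: Mplus_dirac.
apply: cap_zero_sub cap_zero0 => z [_ /=]; rewrite pot_dirac; last exact: nk.
by rewrite ltxx.
Qed.

(** The new inequality is asked only where [m] dominates, so the exceptional set does not grow; the
    pole may change at the same time. *)
Lemma dominates_ge A y y' m m' : dominates A y m -> Mplus alpha m' ->
  (forall z, A z -> ka (edist z y) <= pot ka m z -> ka (edist z y') <= pot ka m' z) -> dominates A y' m'.
Proof.
move=> /dominatesP[M c] M' h; apply/dominatesP; split; first exact: M'.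
apply: (cap_zero_sub _ c) => z [Az lz].
split; first exact: Az.
by rewrite /= ltNge; apply/negP => hz; have := h z Az hz; rewrite leNgt lz.
Qed.

Lemma dominates_min A y m1 m2 : dominates A y m1 -> dominates A y m2 -> exists2 m, dominates A y m &
  forall x, pot ka m x = Order.min (pot ka m1 x) (pot ka m2 x).
Proof.
move=> /dominatesP[M1 c1] /dominatesP[M2 c2].
have [m M mE] := potential_min n3 alpha0 alpha2 M1 M2; exists m => //.
apply/dominatesP; split => //.
apply: cap_zero_sub (cap_zeroU (measurable_sublevel y M1) (measurable_sublevel y M2) c1 c2).
by move=> z [Az /=]; rewrite mE gt_min => /orP[?|?]; split => //; [left|right].
Qed.

End capacity.

(** * The balayage as a limit of dominating measures *)

Section pointwise_infimum.
Local Open Scope ereal_scope.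
Context d (S : measurableType d) (R : realType).
Variable h : nat -> S -> \bar R.
Hypotheses (nh : forall k, nnm (h k)) (ni : forall z, nonincreasing_seq (h^~ z)).

Definition einf (z : S) : \bar R := ereal_inf (range (h^~ z)).

Lemma cvg_einf z : h k z @[k --> \oo] --> einf z.
Proof. exact: ereal_nonincreasing_cvgn. Qed.

Lemma einf_le k z : einf z <= h k z.
Proof. by apply: ereal_inf_lbound; exists k. Qed.

Lemma nnm_einf : nnm einf.
Proof.
apply: nnmI; last by move=> z; apply: le_ereal_inf_tmp => _ [k _ <-]; exact: nnm_ge0 (nh k) z.
by apply: (emeasurable_fun_cvg h) => [k|z _]; [exact: nnm_m (nh k)|exact: cvg_einf].
Qed.

End pointwise_infimum.

Section balayage.
Local Open Scope ereal_scope.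
Context (R : realType) (n : nat) (alpha : R).
Hypotheses (n3 : (3 <= n)%N) (alpha0 : (0 < alpha)%R) (alpha2 : (alpha <= 2)%R).
Local Notation L := (Leb R n).
Local Notation T := (RnB R n).
Local Notation kl := (klong n alpha).
Local Notation ks := (kshort n alpha).
Local Notation ka := (kall n alpha).
Local Notation km := (kmid n alpha).
Local Notation E s rho := (gtail n s rho).
Implicit Types (m : msr R n) (x z : 'rV[R]_n) (s r rho q : R).

Let sL : sigma_finite setT L := Leb_sigma_finite R n.
Let nk i : nnm (kmix n alpha i) := nnm_kmix n3 alpha0 alpha2 i.
Let nm s : (0 < s)%R -> nnm (km s) := @nnm_km R n alpha alpha0 alpha2 s.

Variables (A : set (Rn R n)) (y : 'rV[R]_n) (nu : msr R n).
Hypothesis nuB : is_balayage alpha (dirac_at y) A nu.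

Let nuM : Mplus alpha nu := nuB.1.

Lemma balayage_le m x : dominates alpha A y m -> pot ka nu x <= pot ka m x.
Proof.
move=> dm; rewrite -!(potentialE n3 alpha0 alpha2) nuB.2.
by apply: ereal_inf_lbound; exists m.
Qed.

Lemma balayage_ge (b : \bar R) x : (forall m, dominates alpha A y m -> b <= pot ka m x) -> b <= pot ka nu x.
Proof.
move=> h; rewrite -(potentialE n3 alpha0 alpha2) nuB.2.
by apply: le_ereal_inf_tmp => _ [m dm <-]; rewrite (potentialE n3 alpha0 alpha2); exact: h.
Qed.

(** One number, the [kl 1]-potential at the origin, selects the sequence. The infimum [w] of the
    decreasing potentials minimizes this mean, and positivity of [kmid 1] then puts [w] below every
    competitor almost everywhere. *)
Lemma balayage_sequence : exists nu_ : nat -> msr R n,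
  [/\ forall k, dominates alpha A y (nu_ k),
      forall k x, pot ka (nu_ k) x <= ka (edist x y),
      forall x, nonincreasing_seq (fun k => pot ka (nu_ k) x) &
      forall s x, (0 < s)%R -> pot (kl s) (nu_ k) x @[k --> \oo] --> pot (kl s) nu x].
Proof.
pose I := ereal_inf [set pot (kl 1) m 0 | m in dominates alpha A y].
have I0 : 0 <= I by apply: le_ereal_inf_tmp => _ [m _ <-]; apply: pot_ge0; exact: nk.
have Ifin : I \is a fin_num.
  rewrite ge0_fin_numE//; apply: (@le_lt_trans _ _ (pot (kl 1) (dirac_at y) 0)); last first.
    by apply: (Mplus_pot_kl_fin n3 alpha0 alpha2 _ ltr01); exact: Mplus_dirac.
  by apply: ereal_inf_lbound; exists (dirac_at y) => //; exact: dominates_dirac.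
have /choice[mm hmm] j : exists m, dominates alpha A y m /\ pot (kl 1) m 0 <= I + (j.+1%:R^-1)%:E.
  have : I < I + (j.+1%:R^-1)%:E by rewrite lteDl// lte_fin; exact: harm_gt0.
  by move=> /ereal_inf_lt[_ [m dm <-] /ltW h]; exists m.
have /choice[mn hmn] (p : msr R n * msr R n) : exists m, dominates alpha A y p.1 ->
    dominates alpha A y p.2 -> dominates alpha A y m /\
    forall x, pot ka m x = Order.min (pot ka p.1 x) (pot ka p.2 x).
  have [[d1 d2]|nd] := pselect (dominates alpha A y p.1 /\ dominates alpha A y p.2).
    by have [m dm mE] := dominates_min n3 alpha0 alpha2 d1 d2; exists m.
  by exists nu => d1 d2; exfalso; apply: nd.
pose nu_ := nat_rect (fun=> msr R n) (dirac_at y) (fun k m => mn (m, mm k)).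
have dk k : dominates alpha A y (nu_ k).
  elim: k => [|k IHk]; first exact: dominates_dirac.
  exact: (hmn (nu_ k, mm k) IHk (hmm k).1).1.
have stepE k x : pot ka (nu_ k.+1) x = Order.min (pot ka (nu_ k) x) (pot ka (mm k) x).
  exact: (hmn (nu_ k, mm k) (dk k) (hmm k).1).2.
have Mk k : Mplus alpha (nu_ k) := (dk k).1.
pose U k (z : T) := pot ka (nu_ k) z.
have nU k : nnm (U k) by exact: Mplus_pot_nnm.
have niU z : nonincreasing_seq (U^~ z).
  by apply/nonincreasing_seqP => k; rewrite /U stepE ge_min lexx.
pose w := einf U.
have nw : nnm w by exact: nnm_einf.
have kU s k x : (0 < s)%R -> kint L (km s) (U k) x = pot (kl s) (nu_ k) x.
  by move=> s0; exact: (kint_pot n3 alpha0 alpha2 x (radon_sigma_finite (Mk k).1) s0).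
have fin0 s x : (0 < s)%R -> kint L (km s) (U 0%N) x < +oo.
  by move=> s0; rewrite kU//; exact: Mplus_pot_kl_fin.
have fkm s d : (0 < s)%R -> (0 <= d)%R -> km s d \is a fin_num by move=> s0 _; exact: (km_fin n alpha0 alpha2).
have cw s x : (0 < s)%R -> kint L (km s) (U k) x @[k --> \oo] --> kint L (km s) w x.
  move=> s0; apply: (cvg_kint_ni (nm s0)) => //; [by move=> d; exact: fkm|by move=> z; exact: cvg_einf|exact: fin0].
have wle s k x : (0 < s)%R -> kint L (km s) w x <= kint L (km s) (U k) x.
  by move=> s0; apply: le_kint; [exact: nm|exact: nw|exact: nU|move=> z; exact: einf_le].
have wI : kint L (km 1) w 0 <= I.
  apply/lee_addgt0Pr => e e0; have [k ke] := nat_above e^-1.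
  apply: le_trans (wle _ k.+1 _ ltr01) _; rewrite kU//.
  apply: (@le_trans _ _ (pot (kl 1) (mm k) 0)).
    apply: le_kint_pot => //; first exact: (hmm k).1.1.
    by move=> z; rewrite stepE ge_min lexx orbT.
  apply: le_trans (hmm k).2 _; rewrite leeD2l// lee_fin.
  rewrite -[leRHS]invrK lef_pV2 ?posrE ?invr_gt0//; apply: ltW; apply: lt_le_trans ke _.
  by rewrite ler_nat.
(* The minimum with the potential of [m] stays in the class, so its mean cannot fall below [I];
   hence [w] and [W] have the same mean and agree almost everywhere. *)
have wlim s m x : (0 < s)%R -> dominates alpha A y m -> kint L (km s) w x <= pot (kl s) m x.
  move=> s0 dm; have Mm := dm.1; have nUm := Mplus_pot_nnm n3 alpha0 alpha2 `]-oo, +oo[%R Mm.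
  pose V k (z : T) := Order.min (U k z) (pot ka m z).
  have nV k : nnm (V k) by exact: nnm_min (nU k) nUm.
  have niV z : nonincreasing_seq (V^~ z).
    by move=> i j ij; rewrite /V le_min !ge_min lexx orbT andbT niU.
  pose W := einf V.
  have nW : nnm W by exact: nnm_einf.
  have Ww z : W z <= w z.
    apply: le_ereal_inf_tmp => _ [k _ <-]; apply: le_trans (einf_le V k z) _.
    by rewrite /V ge_min lexx.
  have WU z : W z <= pot ka m z.
    by apply: le_trans (einf_le V 0%N z) _; rewrite /V ge_min lexx orbT.
  have cW : kint L (km 1) (V k) 0 @[k --> \oo] --> kint L (km 1) W 0.
    apply: (cvg_kint_ni (nm ltr01)) => //; [by move=> d; exact: fkm|by move=> z; exact: cvg_einf|].
    apply: le_lt_trans (fin0 _ 0%R ltr01); apply: le_kint; [exact: nm|exact: nV|exact: nU|].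
    by move=> z; rewrite /V ge_min lexx.
  have IW : I <= kint L (km 1) W 0.
    apply: cvge_lb cW _ => k; have [p dp pE] := dominates_min n3 alpha0 alpha2 (dk k) dm.
    apply: (@le_trans _ _ (pot (kl 1) p 0)); first by apply: ereal_inf_lbound; exists p.
    rewrite -(kint_pot n3 alpha0 alpha2 0 (radon_sigma_finite dp.1.1) ltr01).
    rewrite (_ : (pot ka p : T -> \bar R) = V k)//; apply/funext => z; exact: pE.
  have wfin : kint L (km 1) w 0 < +oo by apply: le_lt_trans (wle _ 0%N _ ltr01) _; exact: fin0.
  have ae := kint_ediff_eq0 alpha0 alpha2 ltr01 nW nw Ww (le_trans wI IW) wfin.
  rewrite (eq_kint_ae x (nm s0) nW nw ae) -(kint_pot n3 alpha0 alpha2 x (radon_sigma_finite Mm.1) s0).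
  by apply: le_kint; [exact: nm|exact: nW|exact: nUm|exact: WU].
have nUn := Mplus_pot_nnm n3 alpha0 alpha2 `]-oo, +oo[%R nuM.
have snu := radon_sigma_finite nuM.1.
have wu s x : (0 < s)%R -> kint L (km s) w x <= pot ka nu x.
  move=> s0; apply: balayage_ge => m dm; apply: le_trans (wlim _ _ x s0 dm) _.
  by apply: le_pot; [exact: nk|exact: nk|move=> d _; exact: (klong_le_kall n3 alpha0 alpha2)].
have wE s x : (0 < s)%R -> kint L (km s) w x = pot (kl s) nu x.
  move=> s0; rewrite -(kint_pot n3 alpha0 alpha2 x snu s0).
  apply/eqP; rewrite eq_le; apply/andP; split; last first.
    apply: le_kint; [exact: nm|exact: nUn|exact: nw|move=> z].
    by apply: le_ereal_inf_tmp => _ [k _ <-]; exact: balayage_le.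
  have nv : nnm (kint L (km s) w : T -> \bar R) by apply: nnm_kint; [exact: sL|exact: nm|exact: nw].
  apply: (lsc_le_lim n3 alpha0 alpha2 nv); first exact: lsc_kint_km.
  move=> k.
  (* The smoothing operators commute; after the exchange [wu] applies inside. *)
  rewrite (kint_kmC alpha0 alpha2 x sL nw (harm_gt0 R k) s0).
  apply: le_kint; [exact: nm| |exact: nUn|].
    by apply: nnm_kint; [exact: sL|apply: nm; exact: harm_gt0|exact: nw].
  by move=> z; apply: wu; exact: harm_gt0.
exists nu_; split => //.
- move=> k x; have := niU x 0%N k (leq0n k); rewrite /U /=; rewrite pot_dirac//; exact: nk.
- move=> s x s0; rewrite -(wE s x s0).
  rewrite (_ : (fun k => _) = (fun k => kint L (km s) (U k) x)); first exact: cw.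
  by apply/funext => k; rewrite kU.
Qed.

End balayage.

(** * Measures that vanish near a point *)

Section null_balls.
Local Open Scope ereal_scope.
Context (R : realType) (n : nat) (alpha : R).
Hypotheses (n3 : (3 <= n)%N) (alpha0 : (0 < alpha)%R) (alpha2 : (alpha <= 2)%R).
Local Notation L := (Leb R n).
Local Notation T := (RnB R n).
Local Notation kl := (klong n alpha).
Local Notation ks := (kshort n alpha).
Local Notation ka := (kall n alpha).
Local Notation km := (kmid n alpha).
Implicit Types (m : msr R n) (x z a : 'rV[R]_n) (s r rho q : R).

Let nk i : nnm (kmix n alpha i) := nnm_kmix n3 alpha0 alpha2 i.

Lemma pot_null_le (k k' : R -> \bar R) m a q : nnm k -> nnm k' -> m (eball a q) = 0 ->
  (forall d, (q <= d)%R -> k d <= k' d) -> pot k m a <= pot k' m a.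
Proof.
move=> hk hk' m0 kk'; have mB := measurable_eball a q.
have mC : measurable (~` (eball a q : set T)) by exact: measurableC.
have nC := nnm_indic R mC; have ne := nnm_edist a hk; have ne' := nnm_edist a hk'.
have nC1 := nnmM nC ne.
have ae : {ae m, forall z : T, k (edist a (z : 'rV[R]_n)) =
    (\1_(~` (eball a q : set T)) z)%:E * k (edist a (z : 'rV[R]_n))}.
  exists (eball a q); split => // z /= h; apply: contrapT => nz; apply: h.
  by rewrite indicE mem_set// mul1e.
rewrite /pot (eq_integral_nnm ne nC1 ae); apply: le_integral_nnm => // z.
rewrite indicE; case: (boolP (z \in _)) => [|_]; last by rewrite mul0e; exact: nnm_ge0 ne' z.
by rewrite inE mul1e => /negP; rewrite -leNgt; exact: kk'.
Qed.

(** The tail beyond [q] is of order [exp (- q ^ 2 / (2 s))], the kernel within [q / 4] at least of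
    order [exp (- q ^ 2 / (8 s))]. The quotient [exp (- b / s)], with [b] three eighths of [q ^ 2],
    is at most [s / b]. *)
Lemma gtail_vs_low (C q e s1 : R) : (0 <= C)%R -> (0 < q)%R -> (0 < e)%R -> (0 < s1)%R ->
  exists2 s, (0 < s <= Num.min s1 1)%R &
    (C * gtail n s q <= e * (klow n alpha * expR (- (2 * (q / 4) ^+ 2 / s))))%R.
Proof.
move=> C0 q0 e0 s10; have l0 := klow_gt0 n3 alpha0 alpha2; move: (klow n alpha) l0 => l l0.
pose D := (C * 2 ^+ n)%R.
have D0 : (0 <= D)%R by rewrite mulr_ge0// exprn_ge0.
pose b := (3 / 8 * q ^+ 2)%R.
have b0 : (0 < b)%R by rewrite mulr_gt0// exprn_gt0.
pose s2 := (e * l * b / (D + 1))%R.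
have D1 : (0 < D + 1)%R by rewrite ltr_wpDl.
have s20 : (0 < s2)%R by apply: divr_gt0 => //; apply: mulr_gt0 => //; exact: mulr_gt0.
pose s := Num.min s2 (Num.min s1 1)%R.
have s0 : (0 < s)%R by rewrite !lt_min s20 s10 ltr01.
have ss2 : (s <= s2)%R by rewrite ge_min lexx.
exists s; first by rewrite s0 ge_min lexx orbT.
have -> : gtail n s q = (2 ^+ n * (expR (- (b / s)) * expR (- (2 * (q / 4) ^+ 2 / s))))%R.
  rewrite /gtail -expRD; congr (_ * expR _)%R; rewrite /b; field; exact: lt0r_neq0.
rewrite !mulrA; apply: ler_wpM2r; first exact: expR_ge0.
have h := expR_neg_le (divr_gt0 b0 s0).
apply: (@le_trans _ _ (D * (s / b))%R).
  by rewrite -/D; apply: ler_wpM2l => //; apply: le_trans h _; rewrite invf_div.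
rewrite mulrA ler_pdivrMr//.
apply: (@le_trans _ _ ((D + 1) * s2)%R); last first.
  by rewrite /s2 mulrC divfK// gt_eqF.
by apply: ler_pM => //; [exact: ltW|rewrite lerDl].
Qed.

Lemma pot_null_fin m a q : Mplus alpha m -> (0 < q)%R -> m (eball a q) = 0 -> pot ka m a < +oo.
Proof.
move=> M q0 m0; have h2 : (0 < 2^-1 :> R)%R by rewrite invr_gt0.
have [s s0 hs] := gtail_small n q0 h2.
have ss : (gtail n s q <= 2^-1)%R by apply: hs; rewrite s0 lexx.
have c0 : (0 <= 1 + 2 * gtail n s q)%R by rewrite addr_ge0// mulr_ge0// gtail_ge0.
apply: (@le_lt_trans _ _ ((1 + 2 * gtail n s q)%:E * pot (kl s) m a)); last first.
  apply: lte_mul_pinfty; [by rewrite lee_fin|by []|].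
  exact: (Mplus_pot_kl_fin n3 alpha0 alpha2 a s0 M).
have nc : nnm (fun d => (1 + 2 * gtail n s q)%:E * kl s d).
  by apply: nnmM; [apply: nnm_cst; rewrite lee_fin|exact: nk].
have -> : (1 + 2 * gtail n s q)%:E * pot (kl s) m a = pot (fun d => (1 + 2 * gtail n s q)%:E * kl s d) m a.
  rewrite /pot integral_nnmZl; [by []|by apply: nnm_edist; exact: nk|by rewrite lee_fin].
apply: (pot_null_le (q := q)); [exact: nk|exact: nc|exact: m0|].
by move=> d qd; apply: (ka_le_kl n3 alpha0 alpha2 s0 _ ss); rewrite q0.
Qed.

Lemma pot_short_null m a q s : (0 < q)%R -> (0 < s)%R -> m (eball a q) = 0 ->
  pot (ks s) m a <= (gtail n s q)%:E * pot ka m a.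
Proof.
move=> q0 s0 m0; have g0 := gtail_ge0 n s q.
have nc : nnm (fun d => (gtail n s q)%:E * ka d).
  by apply: nnmM; [apply: nnm_cst; rewrite lee_fin|exact: nk].
have -> : (gtail n s q)%:E * pot ka m a = pot (fun d => (gtail n s q)%:E * ka d) m a.
  rewrite /pot integral_nnmZl; [by []|by apply: nnm_edist; exact: nk|by rewrite lee_fin].
apply: (pot_null_le (q := q)); [exact: nk|exact: nc|exact: m0|].
by move=> d qd; apply: (ks_le n3 alpha0 alpha2 s0); rewrite ltW.
Qed.

Variables (nu : msr R n) (nu_ : nat -> msr R n).
Hypotheses (nuM : Mplus alpha nu) (nuM_ : forall k, Mplus alpha (nu_ k)).
Hypothesis nu_ge : forall k x, pot ka nu x <= pot ka (nu_ k) x.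
Hypothesis nu_cvg : forall s x, (0 < s)%R -> pot (kl s) (nu_ k) x @[k --> \oo] --> pot (kl s) nu x.

(* The balls are compared through the positive kernel [kl (s/2) - kl s]. *)
Lemma null_ball_seq a q (e : R) : (0 < q)%R -> (0 < e)%R -> nu (eball a q) = 0 ->
  exists k, nu_ k (ceball a (q / 4)%R) <= e%:E.
Proof.
move=> q0 e0 nu0.
have uf : pot ka nu a \is a fin_num.
  by rewrite ge0_fin_numE; [exact: pot_null_fin nu0|apply: pot_ge0; exact: nk].
pose ua := fine (pot ka nu a).
have ua0 : (0 <= ua)%R by apply: fine_ge0; apply: pot_ge0; exact: nk.
have e2 : (0 < e / 2)%R by rewrite divr_gt0.
have [s /andP[s0 s1] hs] := gtail_vs_low ua0 q0 e2 ltr01.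
have s1' : (s <= 1)%R by apply: le_trans s1 _; rewrite ge_min lexx.
pose c := (klow n alpha * expR (- (2 * (q / 4) ^+ 2 / s)))%R.
have c0 : (0 < c)%R by rewrite mulr_gt0 ?expR_gt0//; exact: klow_gt0 n3 alpha0 alpha2.
have sh0 : (0 < s / 2)%R by rewrite divr_gt0.
have shs : (s / 2 <= s)%R by rewrite ler_pdivrMr// ler_peMr// ?ler1n// ltW.
pose K := kmix n alpha `](s / 2)%R, s]%R.
have KE m : pot (kl (s / 2)) m a = pot K m a + pot (kl s) m a.
  rewrite -potDk; [|exact: nk|exact: nk].
  by apply: eq_integral => w _; exact: (klong_split n3 alpha0 alpha2 _ shs).
have d0 : (0 < c * (e / 2))%R by rewrite mulr_gt0.
have lf : pot (kl (s / 2)) nu a \is a fin_num.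
  by rewrite ge0_fin_numE; [exact: Mplus_pot_kl_fin|apply: pot_ge0; exact: nk].
have lf2 : pot (kl s) nu a \is a fin_num.
  by rewrite ge0_fin_numE; [exact: Mplus_pot_kl_fin|apply: pot_ge0; exact: nk].
have [k hk] : exists k, pot (kl (s / 2)) (nu_ k) a <= pot (kl (s / 2)) nu a + (c * (e / 2))%:E.
  apply: contrapT => /forallNP h.
  have : pot (kl (s / 2)) nu a + (c * (e / 2))%:E <= pot (kl (s / 2)) nu a.
    by apply: (cvge_lb (@nu_cvg _ a sh0)) => k; rewrite leNgt; apply/negP => /ltW; exact: h.
  have lt : pot (kl (s / 2)) nu a < pot (kl (s / 2)) nu a + (c * (e / 2))%:E.
    by rewrite (lteDl _ lf) lte_fin.
  by rewrite leNgt lt.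
exists k; rewrite -(@lee_pmul2l _ c%:E)//.
apply: (@le_trans _ _ (pot K (nu_ k) a)).
  apply: pot_ball_ge; [exact: nk|by rewrite lee_fin ltW|].
  by move=> d dq; apply: (kmix_lower n3 alpha0 alpha2); rewrite ?s0.
(* The [kl s]-potential of [nu_ k] is at least that of [nu], so closeness of the
   [kl (s / 2)]-potentials bounds the difference of the [K]-potentials. *)
have h1 : pot K (nu_ k) a + pot (kl s) nu a <= pot K nu a + (c * (e / 2))%:E + pot (kl s) nu a.
  apply: (@le_trans _ _ (pot K (nu_ k) a + pot (kl s) (nu_ k) a)).
    by rewrite leeD2l//; apply: le_kint_pot.
  by rewrite -KE (le_trans hk)// KE addeAC.
have h2 : pot K (nu_ k) a <= pot K nu a + (c * (e / 2))%:E by move: h1; rewrite (leeD2rE _ _ lf2).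
apply: le_trans h2 _; apply: (@le_trans _ _ ((e / 2 * c)%:E + (c * (e / 2))%:E)); last first.
  by rewrite -EFinM -EFinD lee_fin; lra.
rewrite leeD2r//; apply: (@le_trans _ _ (pot (ks s) nu a)).
  apply: le_pot; [exact: nk|exact: nk|] => d _; apply: (kmix_sub n3 alpha0 alpha2) => u.
  by rewrite /= !in_itv/= => /andP[_ ->].
apply: le_trans (pot_short_null q0 s0 nu0) _.
by rewrite -(fineK uf) -EFinM lee_fin mulrC.
Qed.

End null_balls.

Lemma small_part (R : realType) (g : R) (a b u : \bar R) : (0 <= g)%R -> (0 <= a)%E -> (0 <= b)%E ->
  u \is a fin_num -> u = (a + b)%E -> (u <= (1 + 2 * g)%:E * b)%E -> (a <= (2 * g)%:E * u)%E.
Proof.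
move=> g0 a0 b0 uf uE; subst u; case: a a0 uf => [a| |]//; case: b b0 => [b| |]// b0 a0 _.
rewrite !lee_fin in a0 b0.
rewrite -EFinD -!EFinM !lee_fin => h.
have : (0 <= g * a)%R by rewrite mulr_ge0.
lra.
Qed.

(** * The balayage does not charge points away from the set *)

Section off_the_set.
Local Open Scope ereal_scope.
Context (R : realType) (n : nat) (alpha : R).
Hypotheses (n3 : (3 <= n)%N) (alpha0 : (0 < alpha)%R) (alpha2 : (alpha <= 2)%R).
Local Notation L := (Leb R n).
Local Notation T := (RnB R n).
Local Notation kl := (klong n alpha).
Local Notation ks := (kshort n alpha).
Local Notation ka := (kall n alpha).
Local Notation km := (kmid n alpha).
Implicit Types (m : msr R n) (x z : 'rV[R]_n) (s r rho q : R).

Let sL : sigma_finite setT L := Leb_sigma_finite R n.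
Let nk i : nnm (kmix n alpha i) := nnm_kmix n3 alpha0 alpha2 i.
Let nm s : (0 < s)%R -> nnm (km s) := @nnm_km R n alpha alpha0 alpha2 s.

Variables (A : set (Rn R n)) (y : 'rV[R]_n) (nu : msr R n).
Hypothesis nuB : is_balayage alpha (dirac_at y) A nu.

Let nuM : Mplus alpha nu := nuB.1.

(* The part of [nu_ k] near [x] is smeared out by [km s]: far away this hardly
   changes its potential. *)
Lemma far_upper x rho s : (0 < rho)%R -> (forall a, A a -> (2 * rho <= edist x a)%R) -> (0 < s)%R ->
  (gtail n s rho <= 2^-1)%R -> pot ka nu x <= (1 + 2 * gtail n s rho)%:E * pot (kl s) nu x.
Proof.
move=> rho0 far s0 Es.
have [nu_ [dnu _ _ cnu]] := balayage_sequence n3 alpha0 alpha2 nuB.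
pose c := (1 + 2 * gtail n s rho)%R.
have c0 : (0 <= c)%R by rewrite addr_ge0// mulr_ge0// gtail_ge0.
have c1 : 0 <= c%:E by rewrite lee_fin.
rewrite -/c.
have cc : c%:E * pot (kl s) (nu_ k) x @[k --> \oo] --> c%:E * pot (kl s) nu x.
  by apply: cvgeZl => //; exact: (@cnu s x s0).
apply: (cvge_lb cc) => k.
have M := (dnu k).1; have Dm := dnu k; move: (nu_ k) M Dm => m M Dm {cc cnu dnu nu_}.
have sm := radon_sigma_finite M.1.
pose B : set T := eball x rho; pose C : set T := ~` B.
have mB : measurable B by exact: measurable_eball.
have mC : measurable C by exact: measurableC.
have nB := nnm_indic R mB; have nC := nnm_indic R mC.
have [m1 hm1] := restr_exists m mC ler01.
have [m2 hm2] := restr_exists m mB ler01.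
have pm1 k' z : nnm k' -> pot k' m1 z = \int[m]_w ((\1_C w)%:E * k' (edist z (w : 'rV[R]_n))).
  by move=> hk; rewrite /pot hm1 ?mul1e//; exact: nnm_edist.
have pm2 k' z : nnm k' -> pot k' m2 z = \int[m]_w ((\1_B w)%:E * k' (edist z (w : 'rV[R]_n))).
  by move=> hk; rewrite /pot hm2 ?mul1e//; exact: nnm_edist.
have ind1 (D : set T) (f : T -> \bar R) w : nnm f -> (\1_D w)%:E * f w <= f w.
  move=> nf; rewrite -[leRHS]mul1e; apply: lee_wpmul2r; first exact: nnm_ge0 nf w.
  by rewrite lee_fin indicE; case: (_ \in _).
have le1 k' z : nnm k' -> pot k' m1 z <= pot k' m z.
  move=> hk; have ne := nnm_edist z hk; rewrite pm1//; apply: le_integral_nnm; [exact: nnmM nC ne|exact: ne|].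
  by move=> w; exact: (ind1 C _ w ne).
have le2 k' z : nnm k' -> pot k' m2 z <= pot k' m z.
  move=> hk; have ne := nnm_edist z hk; rewrite pm2//; apply: le_integral_nnm; [exact: nnmM nB ne|exact: ne|].
  by move=> w; exact: (ind1 B _ w ne).
have M2 : Mplus alpha m2.
  apply: (pot_kl_Mplus n3 alpha0 alpha2 (x := 0%R)); apply: le_lt_trans (le2 _ _ (nk _)) _.
  exact: (Mplus_pot_kl_fin n3 alpha0 alpha2 _ ltr01 M).
have sm2 := radon_sigma_finite M2.1.
have m2T : m2 setT < +oo.
  rewrite -(int_indic m2 measurableT) hm2; last exact: (nnm_indic R measurableT).
  rewrite mul1e; apply: (@le_lt_trans _ _ (m (ceball x rho))); last exact: M.1 _ (@compact_ceball R n x rho).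
  have mcb := measurable_ceball x rho.
  rewrite -(int_indic m mcb); apply: le_integral_nnm.
  - by apply: nnmM => //; exact: (nnm_indic R measurableT).
  - exact: nnm_indic.
  move=> w; rewrite !indicE mem_setT mule1 lee_fin.
  case: (boolP (w \in B)) => // wB; rewrite mem_set//.
  by move: wB; rewrite inE => /ltW.
have ng0 : nnm (pot (km s) m2 : T -> \bar R) by apply: nnm_pot => //; exact: nm.
have nc : nnm (fun _ : T => c%:E) by exact: nnm_cst.
pose g (z : T) := c%:E * pot (km s) m2 z.
have ng : nnm g by exact: nnmM.
have gf z : g z \is a fin_num.
  rewrite fin_numM//; rewrite ge0_fin_numE; last by apply: pot_ge0; exact: nm.
  apply: (@le_lt_trans _ _ ((gpeak n s)%:E * m2 setT)); last first.
    by apply: lte_mul_pinfty => //; rewrite lee_fin powR_ge0.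
  rewrite -(int_indic m2 measurableT) -integral_nnmZl; last 2 first.
  - exact: (nnm_indic R measurableT).
  - by rewrite lee_fin powR_ge0.
  apply: le_integral_nnm; first by apply: nnm_edist; exact: nm.
    by apply: nnmM; [apply: nnm_cst; rewrite lee_fin powR_ge0|exact: (nnm_indic R measurableT)].
  by move=> w; rewrite indicE mem_setT mule1; exact: (km_le n alpha0 alpha2).
(* The near part, smeared by [km s] and multiplied by [c]: by [ka_le_kl] its potential exceeds that
   of the near part at all points at distance at least [rho] from the latter, in particular on
   [A]. *)
have [m3 hm3] := dens_exists L ng gf.
have pm3 k' z : nnm k' -> pot k' m3 z = c%:E * kint L k' (pot (km s) m2) z.
  move=> hk; rewrite /pot (hm3 _ (nnm_edist z hk)) -(kintZ L z hk ng0 c1).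
  by apply: eq_integral => w _; rewrite muleC.
have ka3 z : pot ka m3 z = c%:E * pot (kl s) m2 z.
  rewrite (pm3 _ _ (nk _)) (_ : (pot (km s) m2 : T -> \bar R) = kint m2 (km s) (fun=> 1)); last first.
    by apply/funext => w; exact: pot_kint.
  rewrite (kint_ka n3 alpha0 alpha2 z sm2 _ s0); last exact: nnm_cst.
  by rewrite -pot_kint.
have [m4 hm4] := addm_exists m1 m3.
have pm4 k' z : nnm k' -> pot k' m4 z = pot k' m1 z + pot k' m3 z.
  by move=> hk; rewrite /pot (hm4 _ (nnm_edist z hk)).
have M4 : Mplus alpha m4.
  apply: (pot_kl_Mplus n3 alpha0 alpha2 (x := 0%R)); rewrite (pm4 _ _ (nk _)); apply: lte_add_pinfty.
    apply: le_lt_trans (le1 _ _ (nk _)) _.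
    exact: (Mplus_pot_kl_fin n3 alpha0 alpha2 _ ltr01 M).
  apply: (@le_lt_trans _ _ (pot ka m3 0%R)).
    by apply: le_pot; [exact: nk|exact: nk|move=> d _; exact: (klong_le_kall n3 alpha0 alpha2)].
  rewrite ka3; apply: lte_mul_pinfty => //.
  exact: (Mplus_pot_kl_fin n3 alpha0 alpha2 _ s0 M2).
have ns z := nnm_edist z (nk `]s, +oo[%R).
have na z := nnm_edist z (nk `]-oo, +oo[%R).
have ka4 z : pot ka m4 z = \int[m]_w ((\1_C w)%:E * ka (edist z (w : 'rV[R]_n)) +
    c%:E * ((\1_B w)%:E * kl s (edist z (w : 'rV[R]_n)))).
  rewrite (pm4 _ _ (nk _)) ka3 (pm1 _ _ (nk _)) (pm2 _ _ (nk _)).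
  have n1 := nnmM nC (na z); have n2 := nnmM nB (ns z).
  by rewrite -(integral_nnmZl _ n2 c1) -(integral_nnmD _ n1 (nnmM nc n2)).
have n4 z : nnm (fun w : T => (\1_C w)%:E * ka (edist z (w : 'rV[R]_n)) +
    c%:E * ((\1_B w)%:E * kl s (edist z (w : 'rV[R]_n)))).
  by apply: nnmD; [exact: nnmM nC (na z)|exact: nnmM nc (nnmM nB (ns z))].
have kacl d : (rho <= d)%R -> ka d <= c%:E * kl s d.
  by move=> rd; apply: (ka_le_kl n3 alpha0 alpha2 s0 _ Es); rewrite rho0.
have D4 : dominates alpha A y m4.
  apply: (dominates_ge n3 alpha0 alpha2 Dm M4) => z Az h; apply: le_trans h _.
  rewrite ka4; apply: le_integral_nnm; [exact: na|exact: n4|] => w.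
  rewrite !indicE in_setC; case: (boolP (w \in B)) => /= wB; last by rewrite mul1e mul0e mule0 adde0.
  rewrite mul0e add0e mul1e; apply: kacl; move: wB; rewrite inE /B/eball/= => wB.
  have := far z Az; have := edist_triangle x w z; rewrite (edistC z w); lra.
apply: le_trans (balayage_le n3 alpha0 alpha2 nuB x D4) _.
rewrite ka4 /pot -(integral_nnmZl _ (ns x) c1); apply: le_integral_nnm; [exact: n4|exact: nnmM nc (ns x)|] => w.
rewrite !indicE in_setC; case: (boolP (w \in B)) => /= wB; first by rewrite mul0e add0e mul1e.
rewrite mul1e mul0e mule0 adde0; apply: kacl.
by move: wB; rewrite notin_setE /B/eball/= => /negP; rewrite -leNgt.
Qed.

(** By [far_upper] the short potential at [x] is at most [2 gtail s rho] times the potential, too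
    little to account for any mass within [rho / 4] as [s] tends to [0]. *)
Lemma balayage_null_far x rho : (0 < rho)%R -> (forall a, A a -> (2 * rho <= edist x a)%R) ->
  nu (ceball x (rho / 4)%R) = 0.
Proof.
move=> rho0 far; have h2 : (0 < 2^-1 :> R)%R by rewrite invr_gt0.
have [s1 s10 hs1] := gtail_small n rho0 h2.
have u0 : 0 <= pot ka nu x by apply: pot_ge0; exact: nk.
have uf : pot ka nu x \is a fin_num.
  rewrite ge0_fin_numE//; apply: le_lt_trans (far_upper rho0 far s10 (hs1 _ _)) _; first by rewrite s10 lexx.
  apply: lte_mul_pinfty; [by rewrite lee_fin addr_ge0// mulr_ge0// gtail_ge0|by []|].
  exact: (Mplus_pot_kl_fin n3 alpha0 alpha2 _ s10 nuM).
pose ux := fine (pot ka nu x).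
have ux0 : (0 <= 2 * ux)%R by rewrite mulr_ge0// fine_ge0.
apply/eqP; rewrite eq_le measure_ge0 andbT; apply/lee_addgt0Pr => e e0; rewrite add0e.
have [s /andP[s0 ss] hs] := gtail_vs_low n3 alpha0 alpha2 ux0 rho0 e0 s10.
have /andP[ss1 sle1] : (s <= s1)%R && (s <= 1)%R by move: ss; rewrite le_min.
have Es : (gtail n s rho <= 2^-1)%R by apply: hs1; rewrite s0.
pose c := (klow n alpha * expR (- (2 * (rho / 4) ^+ 2 / s)))%R.
have c0 : (0 < c)%R by rewrite mulr_gt0 ?expR_gt0//; exact: klow_gt0 n3 alpha0 alpha2.
rewrite -(@lee_pmul2l _ c%:E)//.
apply: (@le_trans _ _ (pot (ks s) nu x)).
  apply: pot_ball_ge; [exact: nk|by rewrite lee_fin ltW|].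
  by move=> d dq; apply: (kshort_lower n3 alpha0 alpha2); rewrite ?s0.
apply: (@le_trans _ _ ((2 * gtail n s rho)%:E * pot ka nu x)); last first.
  by rewrite -(fineK uf) -EFinM lee_fin -/ux; move: hs; rewrite -/c; lra.
apply: (small_part (gtail_ge0 n s rho) _ _ uf (pot_split n3 alpha0 alpha2 s nu x) (far_upper rho0 far s0 Es)).
- by apply: pot_ge0; exact: nk.
- by apply: pot_ge0; exact: nk.
Qed.

End off_the_set.

Section almost_everywhere.
Local Open Scope ereal_scope.
Context (R : realType) (n : nat).
Local Notation T := (RnB R n).
Implicit Types (m : msr R n) (f g : T -> \bar R).

Lemma nnm_scale f (c : \bar R) : 0 <= c -> nnm f -> nnm (fun z => c * f z).
Proof. by move=> c0 nf; apply: nnmM => //; exact: nnm_cst. Qed.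

Lemma ae_ex m (P : T -> Prop) : 0 < m setT -> {ae m, forall z, P z} -> exists z, P z.
Proof.
move=> m0 aeP; apply: contrapT => /forallNP h.
have neg : m.-negligible setT by apply: negligibleS aeP => z _ /=; exact: h.
have E : m setT = 0 by exact: (negligibleP _ measurableT).1 neg.
by move: m0; rewrite E ltxx.
Qed.

Lemma int_fin_ae m f : nnm f -> \int[m]_z f z < +oo -> {ae m, forall z, f z \is a fin_num}.
Proof.
move=> nf fin.
have i : m.-integrable setT f.
  apply/integrableP; split; first exact: nnm_m nf.
  by under eq_integral => w _ do rewrite gee0_abs ?(nnm_ge0 nf)//.
by apply: (aeS (integrable_ae measurableT i)) => z /(_ I).
Qed.

Lemma eq_ae_int_le m f g : nnm f -> nnm g -> (forall z, f z <= g z) ->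
  \int[m]_z g z <= \int[m]_z f z -> \int[m]_z g z < +oo -> {ae m, forall z, g z = f z}.
Proof.
move=> nf ng fg gf fin.
have gfin := int_fin_ae ng fin.
have nd := nnm_ediff nf ng.
have sumE z : g z \is a fin_num -> g z = f z + (ediff f g z)%:E.
  move=> gz; have fz : f z \is a fin_num.
    by rewrite ge0_fin_numE ?(nnm_ge0 nf)//; apply: le_lt_trans (fg z) _; rewrite -ge0_fin_numE ?(nnm_ge0 ng).
  rewrite -(fineK gz) -{1}(fineK fz) -EFinD; congr EFin; rewrite /ediff max_r; first by rewrite addrC subrK.
  by rewrite subr_ge0 -lee_fin !fineK.
have E : \int[m]_z g z = \int[m]_z f z + \int[m]_z (ediff f g z)%:E.
  rewrite -(integral_nnmD _ nf nd); apply: (eq_integral_nnm ng (nnmD nf nd)).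
  by apply: (aeS gfin) => z; exact: sumE.
have ff : \int[m]_z f z \is a fin_num.
  rewrite ge0_fin_numE; last exact: integral_nnm_ge0.
  by apply: le_lt_trans fin; exact: le_integral_nnm.
have d0 : \int[m]_z (ediff f g z)%:E <= 0 by move: gf; rewrite E -[leRHS]adde0 (leeD2lE _ _ ff).
apply: (aeS (aeI gfin (nnm_int_eq0 nd d0))) => z [gz dz].
by rewrite (sumE z gz) dz adde0.
Qed.

End almost_everywhere.

(** * Points of contact *)

Section maximum_principle.
Local Open Scope ereal_scope.
Context (R : realType) (n : nat) (alpha : R).
Hypotheses (n3 : (3 <= n)%N) (alpha0 : (0 < alpha)%R) (alpha2 : (alpha <= 2)%R).
Local Notation T := (RnB R n).
Local Notation ka := (kall n alpha).
Local Notation b := (n%:R - alpha)%R.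
Implicit Types (m : msr R n) (x z : 'rV[R]_n) (K : set (Rn R n)).

Let nk i : nnm (kmix n alpha i) := nnm_kmix n3 alpha0 alpha2 i.

Lemma codim_gt0 : (0 < b)%R.
Proof.
have : (3%:R <= n%:R :> R)%R by rewrite ler_nat.
by move: alpha2; lra.
Qed.

Lemma ka_scale (c d d' : R) : (0 < c)%R -> (0 <= d)%R -> (0 <= d')%R -> (d' <= c * d)%R ->
  ka d <= (c `^ b)%:E * ka d'.
Proof.
move=> c0 d0 d'0 dd'; have cb : (0 < c `^ b)%R by exact: powR_gt0.
move: d'0; rewrite le_eqVlt => /orP[/eqP<-|d'0].
  by rewrite (kall0 n3 alpha0 alpha2) gt0_muley ?lte_fin// leey.
have dp : (0 < d)%R by rewrite -(pmulr_rgt0 _ c0); exact: lt_le_trans dd'.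
rewrite !(kall_gt0E n3 alpha0 alpha2)// -EFinM lee_fin.
rewrite -[(alpha - n%:R)%R]opprB !powRN ler_pdivlMr ?powR_gt0// mulrC.
rewrite ler_pdivrMr ?powR_gt0// -(powRM _ (ltW c0) d0).
apply: ge0_ler_powR; [exact: ltW codim_gt0|by rewrite nnegrE ltW| |exact: dd'].
by rewrite nnegrE mulr_ge0// ltW.
Qed.

(** A point [x'] less than twice as far as the infimum replaces a nearest one; the triangle
    inequality turns [2] into [3]. *)
Lemma almost_nearest K x : closed K -> K !=set0 ->
  exists2 x', K x' & forall w, K w -> (edist x' w <= 3 * edist x w)%R.
Proof.
move=> cK [k0 Kk0]; have [Kx|nKx] := pselect (K x).
  by exists x => // w _; have := edist_ge0 x w; lra.
have [r r0 hr] := open_eballP (closed_openC cK) nKx.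
pose D := [set edist x w | w in K].
have D0 : has_inf D.
  by split; [exists (edist x k0); exists k0|exists 0%R => _ [w _ <-]; exact: edist_ge0].
have rD : (r <= inf D)%R.
  apply: lb_le_inf; first by exists (edist x k0); exists k0.
  by move=> _ [w Kw <-]; rewrite leNgt; apply/negP => /hr; exact.
have i0 : (0 < inf D)%R by exact: lt_le_trans rD.
have [_ [x' Kx' <-] hx'] := inf_adherent i0 D0.
exists x' => // w Kw.
have h : (inf D <= edist x w)%R by apply: ge_inf; [exact: D0.2|exists w].
have := edist_triangle x' x w; rewrite (edistC x' x); lra.
Qed.

(** Replacing [x] by an almost nearest point of [K] multiplies distances to [K] by at most [3],
    hence the kernel by at least [3 ^ (alpha - n)]. Boundedness is all that is wanted, so the
    constant is harmless. *)
Lemma weak_maximum_principle m K (M : R) : measurable (K : set T) -> closed K -> (0 <= M)%R ->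
  m (~` (K : set T)) = 0 -> (forall x, K x -> pot ka m x <= M%:E) ->
  forall x, pot ka m x <= (3 `^ b * M)%:E.
Proof.
move=> mK cK M0 mKC hK x.
have [K0|] := pselect (K !=set0); last first.
  move=> /set0P/negP; rewrite negbK => /eqP K0; move: mKC; rewrite K0 setC0 => mT.
  rewrite /pot (_ : \int[m]_w _ = 0) ?lee_fin ?mulr_ge0 ?powR_ge0//.
  rewrite (eq_integral_nnm (nnm_edist x (nk _)) (@nnm_cst _ T R 0 (lexx 0))) ?integral0//.
  by exists setT; split => //; exact: measurableT.
have [x' Kx' h] := almost_nearest x cK K0.
have p0 : 0 <= (3 `^ b)%:E by rewrite lee_fin powR_ge0.
rewrite EFinM; apply: le_trans (lee_wpmul2l p0 (hK _ Kx')).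
have nx := nnm_edist x (nk `]-oo, +oo[%R); have nx' := nnm_edist x' (nk `]-oo, +oo[%R).
rewrite /pot -(integral_nnmZl _ nx' p0).
have ni := nnm_indic R mK.
rewrite (eq_integral_nnm nx (nnmM ni nx)); last first.
  exists (~` (K : set T)); split => //; first exact: measurableC.
  by move=> w /= hw Kw; apply: hw; rewrite indicE mem_set// mul1e.
apply: le_integral_nnm; [exact: nnmM ni nx|exact: nnm_scale p0 nx'|] => w.
rewrite indicE; case: (boolP (w \in _)) => [|_]; last first.
  by rewrite mul0e; apply: mule_ge0 => //; exact: nnm_ge0 nx' w.
by rewrite inE mul1e => Kw; apply: ka_scale; rewrite ?edist_ge0//; exact: h.
Qed.

End maximum_principle.

(** * Contact of the two potentials near a point of the set *)

Section touching.
Local Open Scope ereal_scope.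
Context (R : realType) (n : nat) (alpha : R).
Hypotheses (n3 : (3 <= n)%N) (alpha0 : (0 < alpha)%R) (alpha2 : (alpha <= 2)%R).
Local Notation T := (RnB R n).
Local Notation kl := (klong n alpha).
Local Notation ks := (kshort n alpha).
Local Notation ka := (kall n alpha).
Local Notation b := (n%:R - alpha)%R.
Implicit Types (m lam : msr R n) (x z a : 'rV[R]_n) (s r q : R).

Let nk i : nnm (kmix n alpha i) := nnm_kmix n3 alpha0 alpha2 i.

Lemma pot_swap k m lam : nnm k -> sigma_finite setT m -> sigma_finite setT lam ->
  \int[m]_z pot k lam z = \int[lam]_z pot k m z.
Proof.
move=> hk sm sl; rewrite /pot (tonelli sm sl (f := fun z w : T => k (edist (z : 'rV[R]_n) (w : 'rV[R]_n)))).
- by apply: eq_integral => z _; apply: eq_integral => w _; rewrite edistC.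
- exact: (measurableT_comp (nnm_m hk) (@measurable_edist R n)).
- by move=> z w; exact: nnm_ge0 hk _.
Qed.

(** The sublevel sets of the potential of a measure [l] of finite energy are closed, and one of them
    is charged: otherwise the energy would exceed every [k]. The restriction of [l] to it has a
    potential bounded there, hence everywhere by the weak maximum principle. *)
Lemma bounded_potential_exists (S : set (Rn R n)) : ~ cap_zero alpha S ->
  exists lam (M : R), [/\ radon lam, lam setT \is a fin_num, 0 < lam setT, concentrated lam S &
    (0 <= M)%R /\ forall x, pot ka lam x <= M%:E].
Proof.
move=> /not_cap_zeroP[l [rl [el cl]] l1].
have sl := radon_sigma_finite rl.
have nU : nnm (pot ka l : T -> \bar R) := nnm_pot sl (nk _).
have lU : lsc (pot ka l : T -> \bar R) by exact: lsc_kmix_pot.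
pose K (k : nat) : set (Rn R n) := [set z | pot ka l z <= k%:R%:E].
have cK k : closed (K k).
  rewrite -openC (_ : ~` _ = [set z | k%:R%:E < pot ka l z]); first exact: open_lsc.
  by rewrite /K; apply/seteqP; split => z /=; [move/negP; rewrite -ltNge|move=> h; apply/negP; rewrite -ltNge].
have mK k : measurable (K k : set T) by exact: closed_mRn.
have [k K0] : exists k, 0 < l (K k).
  apply: contrapT => /forallNP h.
  have lK0 k : l (K k) = 0.
    by apply/eqP; rewrite eq_le measure_ge0 andbT leNgt; apply/negP; exact: h.
  have ef : energy alpha l \is a fin_num.
    by rewrite ge0_fin_numE// (energyE n3 alpha0 alpha2); exact: integral_nnm_ge0.
  have [k ke] := nat_above (fine (energy alpha l)).
  have : k%:R%:E <= energy alpha l.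
    have mC : measurable (~` (K k : set T)) by exact: measurableC.
    have lC : l (~` (K k : set T)) = 1.
      have : l setT = l (K k) + l (~` (K k : set T)).
        by rewrite -(setUv (K k : set T)) measureU// setICr.
      by rewrite lK0 add0e l1.
    rewrite -[k%:R%:E]mule1 -lC (energyE n3 alpha0 alpha2) -(int_indic l mC).
    have nC := nnm_indic R mC.
    rewrite -(integral_nnmZl _ nC); last by rewrite lee_fin.
    apply: le_integral_nnm; [by apply: nnmM => //; apply: nnm_cst; rewrite lee_fin|exact: nU|] => z.
    rewrite indicE; case: (boolP (z \in _)) => [|_]; last by rewrite mule0; exact: nnm_ge0 nU z.
    by rewrite inE mule1 /K/= => /negP; rewrite -ltNge => /ltW.
  by rewrite -(fineK ef) lee_fin leNgt ke.
have [m hm] := restr_exists l (mK k) ler01.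
have nK := nnm_indic R (mK k).
have mE (D : set T) : measurable D -> m D = \int[l]_z ((\1_(K k : set T) z)%:E * (\1_D z)%:E).
  by move=> mD; rewrite -(int_indic m mD) (hm _ (nnm_indic R mD)) mul1e.
have ind1 (f : T -> \bar R) w : nnm f -> (\1_(K k : set T) w)%:E * f w <= f w.
  move=> nf; rewrite -[leRHS]mul1e; apply: lee_wpmul2r; first exact: nnm_ge0 nf w.
  by rewrite lee_fin indicE; case: (_ \in _).
have mle (f : T -> \bar R) : nnm f -> \int[m]_z f z <= \int[l]_z f z.
  by move=> nf; rewrite (hm _ nf) mul1e; apply: le_integral_nnm; [exact: nnmM|exact: nf|move=> w; exact: ind1].
have mleD (D : set T) : measurable D -> m D <= l D.
  by move=> mD; rewrite -(int_indic m mD) -(int_indic l mD); apply: mle; exact: nnm_indic.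
have mT : m setT = l (K k).
  rewrite (mE _ measurableT) -(int_indic l (mK k)); apply: eq_integral => z _.
  by rewrite [\1_setT z]indicE mem_setT mule1.
have mKC : m (~` (K k : set T)) = 0.
  have mC : measurable (~` (K k : set T)) by exact: measurableC.
  rewrite (mE _ mC) -(integral0 l setT); apply: eq_integral => z _.
  by rewrite !indicE in_setC; case: (z \in _); rewrite ?mule0 ?mul0e.
have M0 : (0 <= k%:R :> R)%R by [].
exists m, (3 `^ b * k%:R)%R; split.
- apply: (radonP (x := 0%R)) => q; apply: (@le_lt_trans _ _ (l (ceball 0 q))).
    by apply: mleD; exact: measurable_ceball.
  exact: rl _ (@compact_ceball R n 0 q).
- rewrite ge0_fin_numE; last exact: measure_ge0.
  by apply: le_lt_trans (mleD _ measurableT) _; rewrite l1 ltry.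
- by rewrite mT.
- have [N [mN N0 sN]] := cl; exists N; split => //.
  by apply/eqP; rewrite eq_le measure_ge0 andbT -N0; exact: mleD.
split; first by rewrite mulr_ge0// powR_ge0.
apply: (weak_maximum_principle n3 alpha0 alpha2 (mK k) (cK k) M0 mKC) => x Kx.
by apply: le_trans Kx; apply: mle; apply: nnm_edist; exact: nk.
Qed.

Variables (A : set (Rn R n)) (y : 'rV[R]_n) (nu : msr R n).
Hypothesis nuB : is_balayage alpha (dirac_at y) A nu.

Let nuM : Mplus alpha nu := nuB.1.

Lemma balayage_le_dirac x : pot ka nu x <= ka (edist x y).
Proof.
have := balayage_le n3 alpha0 alpha2 nuB x (dominates_dirac n3 alpha0 alpha2 A y).
by rewrite pot_dirac; last exact: nk.
Qed.

Lemma balayage_touches a q : (0 < q)%R -> nu (eball a q) = 0 ->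
  ~ cap_zero alpha (A `&` eball a (q / 8)%R) ->
  exists2 a', A a' /\ (edist a a' < q / 8)%R & pot ka nu a' = ka (edist a' y).
Proof.
move=> q0 nu0 capS.
have [nu_ [dnu dle ni cnu]] := balayage_sequence n3 alpha0 alpha2 nuB.
have [lam [M [rl lf l0 cl [M0 lM]]]] := bounded_potential_exists capS.
have sl := radon_sigma_finite rl.
have nl i : nnm (pot (kmix n alpha i) lam : T -> \bar R) := nnm_pot sl (nk i).
have lT : lam setT < +oo by rewrite -ge0_fin_numE.
have el : energy alpha lam < +oo.
  rewrite (energyE n3 alpha0 alpha2); apply: (@le_lt_trans _ _ (M%:E * lam setT)).
    rewrite -(int_indic lam measurableT) -integral_nnmZl; [|exact: (nnm_indic R measurableT)|by rewrite lee_fin].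
    apply: le_integral_nnm; [exact: nl| |by move=> w; rewrite indicE mem_setT mule1].
    by apply: nnmM; [apply: nnm_cst; rewrite lee_fin|exact: (nnm_indic R measurableT)].
  by apply: lte_mul_pinfty => //; rewrite lee_fin.
have clA : concentrated lam A by apply: negligibleS cl => z /= nz [].
have aeS0 : {ae lam, forall z : T, A z /\ (edist a (z : 'rV[R]_n) < q / 8)%R}.
  by apply: negligibleS cl => z /= nz [Az az]; apply: nz.
have Mk k : Mplus alpha (nu_ k) := (dnu k).1.
have nUk k i : nnm (pot (kmix n alpha i) (nu_ k) : T -> \bar R) := Mplus_pot_nnm n3 alpha0 alpha2 i (Mk k).
have nU i : nnm (pot (kmix n alpha i) nu : T -> \bar R) := Mplus_pot_nnm n3 alpha0 alpha2 i nuM.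
have nkap : nnm (fun z : T => ka (edist (z : 'rV[R]_n) y)) := nnm_edistr y (nk _).
have Ik : \int[lam]_z ka (edist (z : 'rV[R]_n) y) <= M%:E.
  by apply: le_trans (lM y); rewrite le_eqVlt; apply/orP; left; apply/eqP; apply: eq_integral => z _; rewrite edistC.
(* The exceptional set of [nu_ k] is [lam]-null, so all these integrals have the same value; the
   difficulty is to keep it in the limit. *)
have IU k : \int[lam]_z pot ka (nu_ k) z = \int[lam]_z ka (edist (z : 'rV[R]_n) y).
  apply: (eq_integral_nnm (nUk k _) nkap).
  have /(dominatesP n3 alpha0 alpha2)[_ c] := dnu k.
  have B0 := cap_zero_null n3 alpha0 alpha2 (measurable_sublevel n3 alpha0 alpha2 y (Mk k)) lT el clA c.
  exists [set z | pot ka (nu_ k) z < ka (edist z y)]; split => //; first exact: measurable_sublevel.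
  move=> z /= h; rewrite ltNge; apply/negP => h'; apply: h; apply/eqP.
  by rewrite eq_le h' andbT; exact: dle.
(* After the order of integration is exchanged, [nu_ k] within [q / 4] of [a] meets the bounded
   potential of [lam]; farther out it stays at distance [q / 8] from the mass of [lam], where the
   short kernel is a small fraction of the whole. *)
have tail s k : (0 < s)%R -> \int[lam]_z pot (ks s) (nu_ k) z <=
    M%:E * nu_ k (ceball a (q / 4)%R) + (gtail n s (q / 8))%:E * M%:E.
  move=> s0; have sk := radon_sigma_finite (Mk k).1.
  rewrite (pot_swap (nk _) sl sk).
  have mB := measurable_ceball a (q / 4)%R; have nB := nnm_indic R mB.
  have g0 : 0 <= (gtail n s (q / 8))%:E by rewrite lee_fin gtail_ge0.
  have M0e : 0 <= M%:E by rewrite lee_fin.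
  have nM : nnm (fun z : T => M%:E * (\1_(ceball a (q / 4)%R : set T) z)%:E) by exact: nnm_scale M0e nB.
  have ng : nnm (fun z : T => (gtail n s (q / 8))%:E * pot ka lam z) by exact: nnm_scale g0 (nl _).
  apply: (@le_trans _ _ (\int[nu_ k]_z (M%:E * (\1_(ceball a (q / 4)%R : set T) z)%:E + (gtail n s (q / 8))%:E * pot ka lam z))).
    apply: le_integral_nnm; [exact: nl|exact: nnmD|] => z.
    rewrite indicE; case: (boolP (z \in _)) => [_|].
      rewrite mule1; apply: (@le_trans _ _ (pot ka lam z)).
        by apply: le_pot; [exact: nk|exact: nk|move=> d _; exact: (kshort_le_kall n3 alpha0 alpha2)].
      apply: le_trans (lM z) _; rewrite leeDl//; apply: mule_ge0 => //; exact: nnm_ge0 (nl _) z.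
    rewrite notin_setE /ceball/= => /negP; rewrite -ltNge => az; rewrite mule0 add0e.
    have n1 := nnm_edist (z : 'rV[R]_n) (nk `]-oo, s]%R).
    have n2 := nnm_edist (z : 'rV[R]_n) (nk `]-oo, +oo[%R).
    have n3' := nnm_scale g0 n2.
    rewrite /pot -(integral_nnmZl _ n2 g0).
    rewrite (eq_integral_nnm n1 (nnm_min n1 n3')); last first.
      apply: (aeS aeS0) => w [_ aw]; apply/esym/min_idPl.
      apply: (ks_le n3 alpha0 alpha2 s0); apply/andP; split; first by rewrite divr_ge0// ltW.
      by have := edist_triangle a w z; rewrite (edistC w z); lra.
    by apply: le_integral_nnm; [exact: nnm_min|exact: n3'|move=> w; rewrite ge_min lexx orbT].
  rewrite (integral_nnmD _ nM ng) (integral_nnmZl _ nB M0e) (int_indic _ mB).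
  rewrite (integral_nnmZl _ (nl _) g0) -(pot_swap (nk _) sl sk).
  by apply: leeD => //; apply: lee_wpmul2l => //; rewrite IU.
have Ile : \int[lam]_z ka (edist (z : 'rV[R]_n) y) <= \int[lam]_z pot ka nu z.
  apply/lee_addgt0Pr => e e0.
  have e3 : (0 < e / 3)%R by rewrite divr_gt0.
  have M1 : (0 < M + 1)%R by rewrite ltr_wpDl.
  have q8 : (0 < q / 8)%R by rewrite divr_gt0.
  have eM : (0 < e / 3 / (M + 1))%R by rewrite divr_gt0.
  have [s s0 hs] := gtail_small n q8 eM.
  have gs : (gtail n s (q / 8) <= e / 3 / (M + 1))%R by apply: hs; rewrite s0 lexx.
  have nil z : nonincreasing_seq (fun k => pot (kl s) (nu_ k) z).
    by move=> i j ij; apply: le_kint_pot => // w; exact: ni.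
  have c : \int[lam]_z pot (kl s) (nu_ k) z @[k --> \oo] --> \int[lam]_z pot (kl s) nu z.
    apply: (@cvg_integral_ni _ _ _ lam (fun k (z : T) => pot (kl s) (nu_ k) z) (fun z : T => pot (kl s) nu z)).
    - by move=> k; exact: nUk.
    - exact: nU.
    - by move=> z; exact: nil.
    - by move=> z; exact: (@cnu s z s0).
    apply: (@le_lt_trans _ _ M%:E); last exact: ltry.
    apply: le_trans Ik; rewrite -(IU 0%N); apply: le_integral_nnm; [exact: nUk|exact: nUk|move=> z].
    by apply: le_pot; [exact: nk|exact: nk|move=> d _; exact: (klong_le_kall n3 alpha0 alpha2)].
  have If : \int[lam]_z pot (kl s) nu z \is a fin_num.
    rewrite ge0_fin_numE; last by apply: integral_nnm_ge0; exact: nU.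
    apply: (@le_lt_trans _ _ M%:E); last exact: ltry.
    apply: le_trans Ik; apply: le_integral_nnm; [exact: nU|exact: nkap|move=> z].
    apply: le_trans (balayage_le_dirac z).
    by apply: le_pot; [exact: nk|exact: nk|move=> d _; exact: (klong_le_kall n3 alpha0 alpha2)].
  have [N hN] : exists N, \int[lam]_z pot (kl s) (nu_ N) z <= \int[lam]_z pot (kl s) nu z + (e / 3)%:E.
    apply: contrapT => /forallNP h.
    have : \int[lam]_z pot (kl s) nu z + (e / 3)%:E <= \int[lam]_z pot (kl s) nu z.
      by apply: (cvge_lb c) => k; rewrite leNgt; apply/negP => /ltW; exact: h.
    have lt : \int[lam]_z pot (kl s) nu z < \int[lam]_z pot (kl s) nu z + (e / 3)%:E.
      by rewrite (lteDl _ If) lte_fin.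
    by rewrite leNgt lt.
  (* The sequence is shifted by [N], so that one index serves both for the small mass near [a] and
     for the convergence of the long potentials. *)
  have cN s' x : (0 < s')%R -> pot (kl s') (nu_ (k + N)%N) x @[k --> \oo] --> pot (kl s') nu x.
    by move=> s'0; rewrite (cvg_shiftn N (fun k => pot (kl s') (nu_ k) x)); exact: (@cnu s' x s'0).
  have geN k x : pot ka nu x <= pot ka (nu_ (k + N)%N) x by exact: (balayage_le n3 alpha0 alpha2 nuB x (dnu _)).
  have [k hk] := null_ball_seq n3 alpha0 alpha2 nuM (fun k => Mk (k + N)%N) geN cN q0 eM nu0.
  have nkN : \int[lam]_z pot (kl s) (nu_ (k + N)%N) z <= \int[lam]_z pot (kl s) nu z + (e / 3)%:E.
    apply: le_trans hN; apply: le_integral_nnm; [exact: nUk|exact: nUk|move=> z].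
    by apply: nil; exact: leq_addl.
  have Mr : (M * (e / 3 / (M + 1)) <= e / 3)%R.
    by rewrite mulrA ler_pdivrMr// mulrC ler_pM2l// lerDl.
  rewrite -(IU (k + N)%N).
  rewrite (_ : \int[lam]_z _ = \int[lam]_z (pot (ks s) (nu_ (k + N)%N) z + pot (kl s) (nu_ (k + N)%N) z)); last first.
    by apply: eq_integral => z _; exact: (pot_split n3 alpha0 alpha2).
  rewrite (integral_nnmD _ (nUk _ _) (nUk _ _)).
  apply: (@le_trans _ _ ((e / 3 + e / 3)%:E + (\int[lam]_z pot (kl s) nu z + (e / 3)%:E))).
    apply: leeD => //; apply: le_trans (tail s (k + N)%N s0) _; rewrite EFinD; apply: leeD.
      apply: (@le_trans _ _ (M%:E * (e / 3 / (M + 1))%:E)); first by apply: lee_wpmul2l; rewrite ?lee_fin.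
      by rewrite -EFinM lee_fin.
    by rewrite -EFinM lee_fin mulrC; apply: le_trans Mr; rewrite ler_wpM2l.
  rewrite addeCA -EFinD; apply: leeD.
    apply: le_integral_nnm; [exact: nU|exact: nU|move=> z].
    by apply: le_pot; [exact: nk|exact: nk|move=> d _; exact: (klong_le_kall n3 alpha0 alpha2)].
  by rewrite lee_fin; lra.
have Ifin : \int[lam]_z ka (edist (z : 'rV[R]_n) y) < +oo by apply: le_lt_trans Ik _; exact: ltry.
have ae := eq_ae_int_le (nU _) nkap balayage_le_dirac Ile Ifin.
have [a' [[Aa' aa'] E]] := ae_ex l0 (aeI aeS0 ae).
by exists a'.
Qed.

End touching.

(** * Regular points *)

Section masses.
Local Open Scope ereal_scope.
Context (R : realType) (n : nat) (alpha : R).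
Hypotheses (n3 : (3 <= n)%N) (alpha0 : (0 < alpha)%R) (alpha2 : (alpha <= 2)%R).
Local Notation L := (Leb R n).
Local Notation T := (RnB R n).
Local Notation kl := (klong n alpha).
Local Notation ks := (kshort n alpha).
Local Notation ka := (kall n alpha).
Local Notation km := (kmid n alpha).
Implicit Types (m : msr R n) (x z y : 'rV[R]_n) (s r q : R).

Let nk i : nnm (kmix n alpha i) := nnm_kmix n3 alpha0 alpha2 i.
Let nm s : (0 < s)%R -> nnm (km s) := @nnm_km R n alpha alpha0 alpha2 s.

Lemma null_of_short m x q (C s1 : R) : (0 <= C)%R -> (0 < q)%R -> (0 < s1)%R ->
  (forall s, (0 < s <= s1)%R -> pot (ks s) m x <= (C * gtail n s q)%:E) -> m (ceball x (q / 4)%R) = 0.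
Proof.
move=> C0 q0 s10 h.
apply/eqP; rewrite eq_le measure_ge0 andbT; apply/lee_addgt0Pr => e e0; rewrite add0e.
have [s /andP[s0 ss] hs] := gtail_vs_low n3 alpha0 alpha2 C0 q0 e0 s10.
have /andP[ss1 sle1] : (s <= s1)%R && (s <= 1)%R by move: ss; rewrite le_min.
pose c := (klow n alpha * expR (- (2 * (q / 4) ^+ 2 / s)))%R.
have c0 : (0 < c)%R by rewrite mulr_gt0 ?expR_gt0//; exact: klow_gt0 n3 alpha0 alpha2.
rewrite -(@lee_pmul2l _ c%:E)//.
apply: (@le_trans _ _ (pot (ks s) m x)).
  apply: pot_ball_ge; [exact: nk|by rewrite lee_fin ltW|].
  by move=> d dq; apply: (kshort_lower n3 alpha0 alpha2); rewrite ?s0.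
apply: le_trans (h s _) _; first by rewrite s0.
by rewrite -EFinM lee_fin mulrC [leRHS]mulrC; move: hs; rewrite [(C * _)%R]mulrC.
Qed.

(* [kl s 0] explodes as [s] decreases, so the mass near [z] must be at least [1]. *)
Lemma point_mass m z (K : R) : Mplus alpha m ->
  (forall s, (0 < s)%R -> (s <= 2^-1)%R -> kl s 0 <= pot (kl s) m z + K%:E) ->
  forall d, (0 < d)%R -> 1 <= m (ceball z d).
Proof.
move=> M h d d0; rewrite leNgt; apply/negP => m1.
pose B : set T := ceball z d.
have mB : measurable B by exact: measurable_ceball.
have mC : measurable (~` B) by exact: measurableC.
have nB := nnm_indic R mB; have nC := nnm_indic R mC.
have h2 : (0 < 2^-1 :> R)%R by rewrite invr_gt0.
have [s0 s00 hs0] := gtail_small n d0 h2.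
have Es : (gtail n s0 d <= 2^-1)%R by apply: hs0; rewrite s00 lexx.
have fF : pot (kl s0) m z \is a fin_num.
  by rewrite ge0_fin_numE; [exact: (Mplus_pot_kl_fin n3 alpha0 alpha2 z s00 M)|apply: pot_ge0; exact: nk].
pose F := fine (pot (kl s0) m z).
have F0 : (0 <= F)%R by apply: fine_ge0; apply: pot_ge0; exact: nk.
have mf : m B \is a fin_num by rewrite ge0_fin_numE ?measure_ge0//; apply: lt_trans m1 (ltry _).
pose t := fine (m B).
have t1 : (t < 1)%R by rewrite -lte_fin fineK.
have two0 : 0 <= 2%:E :> \bar R by rewrite lee_fin.
(* Inside the ball the kernel is at most [kl s 0]; outside it is at most [2 kl s0], uniformly in
   [s]. *)
have key s : (0 < s)%R -> pot (kl s) m z <= kl s 0 * t%:E + (2 * F)%:E.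
  move=> sp; have k0 := kmix_ge0 n3 alpha0 alpha2 `]s, +oo[%R 0.
  have n0 := nnm_edist z (nk `]s0, +oo[%R); have ns := nnm_edist z (nk `]s, +oo[%R).
  have n1 := nnm_scale k0 nB; have n2 := nnm_scale two0 n0.
  rewrite /t fineK// EFinM /F fineK// -(int_indic m mB) -(integral_nnmZl _ nB k0).
  rewrite /pot -(integral_nnmZl _ n0 two0) -(integral_nnmD _ n1 n2).
  apply: le_integral_nnm; [exact: ns|exact: nnmD|] => w.
  rewrite indicE; case: (boolP (w \in _)) => [_|].
    rewrite mule1; apply: (@le_trans _ _ (kl s 0)).
      by apply: (kmix_anti n3 alpha0 alpha2); rewrite lexx edist_ge0.
    by rewrite leeDl//; exact: nnm_ge0 n2 w.
  rewrite notin_setE /B/ceball/= => /negP; rewrite -ltNge => dw; rewrite mule0 add0e.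
  apply: le_trans (klong_le_kall n3 alpha0 alpha2 s _) _.
  apply: le_trans (ka_le_kl n3 alpha0 alpha2 (rho := d) s00 _ Es) _; first by rewrite d0 ltW.
  apply: lee_wpmul2r; first exact: kmix_ge0.
  by rewrite lee_fin; lra.
(* The index [k + 2] makes [s <= 1 / 2], as the hypothesis demands. *)
have big : exists k : nat, ((2 * F + `|K|) / (1 - t))%:E < kl k.+2%:R^-1 0.
  have := @klong_cvg R n alpha n3 alpha0 alpha2 0; rewrite (kall0 n3 alpha0 alpha2) => c.
  have [k hk] := cvge_gt_ex c (ltry ((2 * F + `|K|) / (1 - t))).
  exists k; apply: lt_le_trans hk _.
  by apply: (klong_anti n3 alpha0 alpha2); rewrite lef_pV2 ?posrE// ler_nat.
have [k hk] := big; pose s : R := (k.+2%:R^-1)%R.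
have sp : (0 < s)%R by rewrite invr_gt0.
have s2 : (s <= 2^-1)%R by rewrite lef_pV2 ?posrE// ler_nat.
have kf : kl s 0 \is a fin_num by exact: kl_fin.
have := le_trans (h s sp s2) (leeD2r K%:E (key s sp)).
rewrite -/s in hk; move: hk; rewrite -(fineK kf) -EFinM -!EFinD lee_fin lte_fin.
have u0 : (0 < 1 - t)%R by rewrite subr_gt0.
rewrite ltr_pdivrMr// => h1 h3.
have := ler_norm K; move: h1 h3; set Z := fine _; lra.
Qed.

(** Mass at least [1] within [t] of [y] contributes at least [kl s] at distance [d + t]; by
    [kl_modulus] this differs from [kl s d] by at most [t * c], and [t] is chosen accordingly. *)
Lemma potential_ge_of_mass m y : (forall d, (0 < d)%R -> 1 <= m (ceball y d)) ->
  forall x, ka (edist x y) <= pot ka m x.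
Proof.
move=> h x; have := @pot_kl_ext R n alpha n3 alpha0 alpha2 (dirac_at y) m x.
rewrite pot_dirac; last exact: nk.
apply=> s s0; rewrite pot_dirac; last exact: nk.
apply/lee_addgt0Pr => e e0; have dx := edist_ge0 x y; set d := edist x y in dx *.
have k0f := kl_fin n3 alpha0 alpha2 0 s0; pose k0 := fine (kl s 0).
have k00 : (0 <= k0)%R by apply: fine_ge0; exact: kmix_ge0.
pose c := ((2 * d + 1) * (k0 / s))%R.
have c0 : (0 <= c)%R by rewrite mulr_ge0 ?divr_ge0//; [lra|exact: ltW].
pose t := Num.min 1%R (e / (c + 1))%R.
have c1 : (0 < c + 1)%R by lra.
have t0 : (0 < t)%R by rewrite lt_min ltr01 divr_gt0.
have t1 : (t <= 1)%R by rewrite ge_min lexx.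
have te : (t * (c + 1) <= e)%R.
  by rewrite -ler_pdivlMr// ge_min lexx orbT.
have dt : (0 <= d + t)%R by lra.
have modu := kl_modulus n3 alpha0 alpha2 d (d + t)%R s0.
apply: (@le_trans _ _ (kl s (d + t)%R + e%:E)).
  apply: le_trans modu _; rewrite leeD2l// -(fineK k0f) -EFinM lee_fin -/k0.
  have -> : (d ^+ 2 - (d + t) ^+ 2 = - (t * (2 * d + t)))%R by ring.
  rewrite normrN ger0_norm; last by apply: mulr_ge0; lra.
  apply: (le_trans _ te); rewrite [leRHS]mulrDr mulr1.
  have : (t * (2 * d + t) / s * k0 <= t * c)%R.
    have -> : (t * (2 * d + t) / s * k0 = t * ((2 * d + t) * (k0 / s)))%R by ring.
    apply: ler_wpM2l; first exact: ltW.
    by apply: ler_wpM2r; [rewrite divr_ge0// ltW|lra].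
  by move: t0; lra.
rewrite leeD2r//; apply: (@le_trans _ _ (kl s (d + t)%R * m (ceball y t))).
  rewrite -[leLHS]mule1; apply: lee_wpmul2l; last exact: h.
  exact: kmix_ge0.
have mB := measurable_ceball y t; have nB := nnm_indic R mB.
have ns := nnm_edist x (nk `]s, +oo[%R).
have kk0 := kmix_ge0 n3 alpha0 alpha2 `]s, +oo[%R (d + t)%R.
rewrite -(int_indic m mB) -(integral_nnmZl _ nB kk0); apply: le_integral_nnm; [exact: nnm_scale|exact: ns|] => w.
rewrite indicE; case: (boolP (w \in _)) => [|_]; last by rewrite mule0; exact: nnm_ge0 ns w.
rewrite inE mule1 /ceball/= => yw; apply: (kmix_anti n3 alpha0 alpha2); rewrite edist_ge0/=.
by apply: le_trans (edist_triangle x y w) _; rewrite lerD2l.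
Qed.

(** Lebesgue measure on [B], weighted by the positive kernel [km 1], has finite mass, and its
    potential is at most [kl 1 0] because [kall] composed with [km 1] is [kl 1]. It thus has finite
    energy and must vanish. *)
Lemma cap_zero_Leb (B : set T) : measurable B -> cap_zero alpha (B : set (Rn R n)) -> L B = 0.
Proof.
move=> mB c; have nB := nnm_indic R mB.
have n1 := nnm_edistr (0 : 'rV[R]_n) (nm ltr01).
have ng := nnmM nB n1.
have gf (w : T) : (\1_B w)%:E * km 1 (edist (w : 'rV[R]_n) 0) \is a fin_num.
  by rewrite fin_numM// km_fin.
have [lam hlam] := dens_exists L ng gf.
have lamE (D : set T) : measurable D -> lam D = \int[L]_w ((\1_B w)%:E * km 1 (edist (w : 'rV[R]_n) 0) * (\1_D w)%:E).
  by move=> mD; rewrite -(int_indic lam mD) (hlam _ (nnm_indic R mD)).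
have le1 (w : T) (t : \bar R) : 0 <= t -> (\1_B w)%:E * t <= t.
  move=> t0; rewrite -[leRHS]mul1e; apply: lee_wpmul2r => //.
  by rewrite lee_fin indicE; case: (_ \in _).
have lT : lam setT <= 1.
  rewrite (lamE _ measurableT); apply: le_trans (kint_km1 alpha0 alpha2 (0 : 'rV[R]_n) ltr01).
  apply: le_integral_nnm; [by apply: nnmM => //; exact: (nnm_indic R measurableT)| |].
    by apply: nnm_kernel; [exact: nm|exact: nnm_cst].
  move=> w; rewrite [\1_setT w]indicE mem_setT !mule1 edistC; apply: le1.
  exact: nnm_ge0 (nm ltr01) _.
have lf : lam setT < +oo by apply: le_lt_trans lT (ltry _).
have sl : sigma_finite setT lam.
  by exists (fun=> setT); [rewrite bigcup_const|move=> _; split => //; exact: measurableT].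
have pl z : pot ka lam z <= kl 1 0.
  apply: (@le_trans _ _ (kl 1 (edist z 0))); last first.
    by apply: (kmix_anti n3 alpha0 alpha2); rewrite lexx edist_ge0.
  have nz := nnm_edist z (nk `]-oo, +oo[%R).
  rewrite -(comp_kaC n3 alpha0 alpha2 z 0 ltr01) /pot (hlam _ nz) /comp.
  apply: le_integral_nnm; [exact: nnmM|exact: nnmM|] => w.
  rewrite muleC; apply: lee_wpmul2l; first exact: nnm_ge0 nz w.
  by apply: le1; exact: nnm_ge0 n1 w.
have el : energy alpha lam < +oo.
  rewrite (energyE n3 alpha0 alpha2).
  have k0 := kmix_ge0 n3 alpha0 alpha2 `]1%R, +oo[%R 0.
  have nT := nnm_indic R (measurableT : measurable (setT : set T)).
  apply: (@le_lt_trans _ _ (kl 1 0 * lam setT)).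
    rewrite -(int_indic lam measurableT) -(integral_nnmZl _ nT k0).
    apply: le_integral_nnm; [exact: nnm_pot sl (nk _)|exact: nnm_scale|] => w.
    by rewrite indicE mem_setT mule1.
  apply: (@le_lt_trans _ _ (kl 1 0 * 1)); first by apply: lee_wpmul2l.
  by rewrite mule1; exact: klong_fin.
have cl : concentrated lam (B : set (Rn R n)).
  have mC : measurable (~` B) by exact: measurableC.
  exists (~` B); split => //.
  rewrite (lamE _ mC) -(integral0 L setT); apply: eq_integral => w _.
  by rewrite !indicE in_setC; case: (w \in B); rewrite ?mule0 ?mul0e.
have l0 : lam setT = 0.
  apply: (cap_zero_null n3 alpha0 alpha2 measurableT lf el cl).
  by rewrite setIT.
have nT := nnm_indic R (measurableT : measurable (setT : set T)).
have ae0 : {ae L, forall w, (\1_B w)%:E * km 1 (edist (w : 'rV[R]_n) 0) * (\1_(setT : set T) w)%:E = 0}.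
  by apply: nnm_int_eq0; [exact: nnmM|rewrite -(lamE _ measurableT) l0].
rewrite -(int_indic L mB) -(integral0 L setT); apply: (eq_integral_nnm nB (@nnm_cst _ T R 0 (lexx 0))).
apply: (aeS ae0) => w; rewrite [\1_setT w]indicE mem_setT mule1 => /eqP.
by rewrite mule_eq0 [X in _ || X]gt_eqF ?orbF; [move/eqP|exact: kmid_gt0].
Qed.

End masses.

(** * Dominating measures at regular points of the set *)

Section regular_points.
Local Open Scope ereal_scope.
Context (R : realType) (n : nat) (alpha : R).
Hypotheses (n3 : (3 <= n)%N) (alpha0 : (0 < alpha)%R) (alpha2 : (alpha <= 2)%R).
Local Notation L := (Leb R n).
Local Notation T := (RnB R n).
Local Notation kl := (klong n alpha).
Local Notation ks := (kshort n alpha).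
Local Notation ka := (kall n alpha).
Local Notation km := (kmid n alpha).
Local Notation b := (n%:R - alpha)%R.
Implicit Types (m : msr R n) (x z y : 'rV[R]_n) (s r q : R) (A : set (Rn R n)).

Let nk i : nnm (kmix n alpha i) := nnm_kmix n3 alpha0 alpha2 i.
Let nm s : (0 < s)%R -> nnm (km s) := @nnm_km R n alpha alpha0 alpha2 s.

Lemma regular_dominates A z m x : regular_pts alpha A z -> dominates alpha A z m ->
  ka (edist x z) <= pot ka m x.
Proof.
move=> reg dm; have := balayage_le n3 alpha0 alpha2 reg x dm.
by rewrite pot_dirac; last exact: nk.
Qed.

(** The kernel is infinite on the diagonal and lower semicontinuous, so it exceeds any [t] on a
    small ball, whose mass is then at most the potential over [t]. *)
Lemma measure_at_point m z (e : R) : pot ka m z < +oo -> (0 < e)%R ->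
  exists2 d, (0 < d)%R & m (ceball z d) <= e%:E.
Proof.
move=> fin e0.
have pf : pot ka m z \is a fin_num by rewrite ge0_fin_numE//; apply: pot_ge0; exact: nk.
pose P := fine (pot ka m z).
have [t [t0 ht]] : exists t : R, (0 < t)%R /\ (P <= e * t)%R.
  exists ((`|P| + 1) / e)%R; split; first by rewrite divr_gt0// ltr_wpDl.
  by rewrite mulrC divfK ?gt_eqF//; have := ler_norm P; lra.
have inf0 : t%:E < pot ka (dirac_at z) z.
  by rewrite pot_dirac; [rewrite edistxx (kall0 n3 alpha0 alpha2) ltry|exact: nk].
have [d d0 hd] := @lsc_kmix_pot R n alpha n3 alpha0 alpha2 (dirac_at z) `]-oo, +oo[%R z t%:E inf0.
exists (d / 2)%R; first by rewrite divr_gt0.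
rewrite -(@lee_pmul2l _ t%:E)//; apply: (@le_trans _ _ (pot ka m z)); last first.
    by rewrite -(fineK pf) -EFinM lee_fin mulrC.
have mB := measurable_ceball z (d / 2)%R; have nB := nnm_indic R mB.
have t0e : 0 <= t%:E by rewrite lee_fin ltW.
have nz := nnm_edist z (nk `]-oo, +oo[%R).
rewrite -(int_indic m mB) -(integral_nnmZl _ nB t0e); apply: le_integral_nnm; [exact: nnm_scale|exact: nz|] => w.
rewrite indicE; case: (boolP (w \in _)) => [|_]; last by rewrite mule0; exact: nnm_ge0 nz w.
rewrite inE mule1 /ceball/= => zw.
have := hd w; rewrite pot_dirac; last exact: nk.
by rewrite edistC => h; apply/ltW/h; rewrite edistC; apply: le_lt_trans zw _; lra.
Qed.


(* Otherwise [dens (ka (edist z _)) m], suitably scaled, has a potential exceeding that of the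
   unit mass at [z] near [z] on [A]; completed by a smeared unit mass it dominates on [A] but
   does not charge [z]. *)
Lemma dominates_regular A y z m : regular_pts alpha A z -> z != y -> dominates alpha A y m ->
  ka (edist z y) <= pot ka m z.
Proof.
move=> reg zy dm; rewrite leNgt; apply/negP => lt.
have M := dm.1; have sm := radon_sigma_finite M.1.
have na x := nnm_edist x (nk `]-oo, +oo[%R).
have kzE := kall_gt0E n3 alpha0 alpha2 (edist_gt0 zy).
have [kz kzR] : exists kz : R, ka (edist z y) = kz%:E by exists (edist z y `^ (alpha - n%:R))%R.
have pf : pot ka m z \is a fin_num.
  by rewrite ge0_fin_numE; [apply: lt_trans lt _; rewrite kzR ltry|apply: pot_ge0; exact: nk].
pose p := fine (pot ka m z).
have pE : pot ka m z = p%:E by rewrite fineK.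
have p0 : (0 <= p)%R by apply: fine_ge0; apply: pot_ge0; exact: nk.
have pkz : (p < kz)%R by rewrite -lte_fin -kzR -pE.
(* A third of the gap: one share lets the potential of [m] grow by the factor [lam], one absorbs the
   variation of [ka] near [z], and one remains. *)
pose eta := ((kz - p) / 3)%R.
have eta0 : (0 < eta)%R by rewrite /eta; lra.
have p10 : (0 < p + 1)%R by lra.
pose lam := (1 + eta / (p + 1))%R.
have el0 : (0 < eta / (p + 1))%R by rewrite divr_gt0.
have lam1 : (1 < lam)%R by rewrite /lam; lra.
have lamp : (lam * p + 2 * eta <= kz)%R.
  have h : (eta / (p + 1) * p <= eta)%R.
    by rewrite mulrAC ler_pdivrMr// ler_pM2l//; lra.
  have h3 : (eta * 3 = kz - p)%R by rewrite /eta divfK.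
  by rewrite /lam mulrDl mul1r; lra.
have b0 := codim_gt0 n3 alpha2.
(* A dilation of distances by [c] costs exactly the factor [lam] in the kernel. *)
pose c := (lam `^ (b^-1))%R.
have lam0 : (0 < lam)%R by lra.
have cb : (c `^ b = lam)%R by rewrite /c -powRrM mulVf ?gt_eqF// powRr1// ltW.
have c1 : (1 < c)%R.
  rewrite ltNge; apply/negP => c1.
  have : (c `^ b <= 1 `^ b)%R.
    by apply: ge0_ler_powR; rewrite ?nnegrE ?powR_ge0 ?ler01// ltW.
  by rewrite cb powR1; lra.
have c0 : (0 < c)%R by lra.
have cm1 : (0 < c - 1)%R by lra.
(* If [w] is at least [N d] away from [z] and [x] is at distance [d] from [z], then
   [edist z w <= c * edist x w]. *)
pose N := (c / (c - 1))%R.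
have N0 : (0 < N)%R by rewrite divr_gt0.
have Nb0 : (0 < N `^ b)%R by exact: powR_gt0.
(* Within [N d] of [z] the kernel seen from [z] is at least [N ^ (alpha - n)] times [ka d], and this
   part of [m] has potential at least [eta] at [x]. *)
pose C := (N `^ b / eta)%R.
have C0 : (0 <= C)%R by rewrite divr_ge0 ?ltW.
have [del del0 hdel] : exists2 del : R, (0 < del)%R & forall x : 'rV[R]_n, (edist z x < del)%R ->
    (kz - eta)%:E < ka (edist x y).
  have pd w : pot ka (dirac_at y) w = ka (edist w y) by apply: pot_dirac; exact: nk.
  have h0 : (kz - eta)%:E < pot ka (dirac_at y) z by rewrite pd kzR lte_fin; lra.
  have [del del0 h] := @lsc_kmix_pot R n alpha n3 alpha0 alpha2 (dirac_at y) `]-oo, +oo[%R z _ h0.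
  by exists del; [exact: del0|move=> x xd; rewrite -pd; exact: h].
(* [fine] sends the infinite value at [w = z] to [0]; the potential of [m] at [z] being finite, this
   alters [g] on an [m]-null set only. *)
pose g (w : T) : \bar R := (fine (ka (edist z (w : 'rV[R]_n))))%:E.
have ng : nnm g.
  apply: nnm_EFin; last by move=> w; apply: fine_ge0; exact: kmix_ge0.
  by apply: measurableT_comp => //; exact: nnm_m (na z).
have zfin : \int[m]_w ka (edist z (w : 'rV[R]_n)) < +oo by rewrite -[X in X < _]/(pot ka m z) pE ltry.
have gE : {ae m, forall w : T, g w = ka (edist z (w : 'rV[R]_n))}.
  by apply: (aeS (int_fin_ae (na z) zfin)) => w; exact: fineK.
have intg : \int[m]_w g w = p%:E by rewrite (eq_integral_nnm ng (na z) gE).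
have C0e : 0 <= C%:E by rewrite lee_fin.
have nCg : nnm (fun w => C%:E * g w) by exact: nnm_scale.
have fCg w : C%:E * g w \is a fin_num by rewrite /g -EFinM.
have [m1 hm1] := dens_exists m nCg fCg.
have h2 : (0 < 2^-1 :> R)%R by rewrite invr_gt0.
have [s s0 hs] := gtail_small n del0 h2.
have Es : (gtail n s del <= 2^-1)%R by apply: hs; rewrite s0 lexx.
have two0 : 0 <= 2%:E :> \bar R by rewrite lee_fin.
have nkmz := nnm_edistr z (nm s0).
have n2k := nnm_scale two0 nkmz.
have f2k (w : T) : 2%:E * km s (edist (w : 'rV[R]_n) z) \is a fin_num by rewrite fin_numM// km_fin.
(* Twice a unit mass at [z], smeared at scale [s]: it serves the points of [A] at distance at least
   [del] from [z]. *)
have [m2 hm2] := dens_exists L n2k f2k.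
have ka2 x : pot ka m2 x = 2%:E * kl s (edist x z).
  rewrite /pot (hm2 _ (na x)) -(comp_kaC n3 alpha0 alpha2 x z s0) /comp.
  rewrite -(integral_nnmZl _ (nnmM (na x) nkmz) two0).
  by apply: eq_integral => w _; rewrite -muleA [km s _ * _]muleC.
have [ze hze] := addm_exists m1 m2.
have pze k x : nnm k -> pot k ze x = pot k m1 x + pot k m2 x.
  by move=> hk; rewrite /pot (hze _ (nnm_edist x hk)).
have Mze : Mplus alpha ze.
  apply: (pot_kl_Mplus n3 alpha0 alpha2 (x := 0%R)); rewrite (pze _ _ (nk _)); apply: lte_add_pinfty.
    have n1 := nnm_edist (0 : 'rV[R]_n) (nk `]1%R, +oo[%R).
    have k0 := kmix_ge0 n3 alpha0 alpha2 `]1%R, +oo[%R 0.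
    rewrite /pot (hm1 _ n1); apply: (@le_lt_trans _ _ (kl 1 0 * (C%:E * p%:E))).
      rewrite -intg -(integral_nnmZl _ ng C0e) -(integral_nnmZl _ nCg k0).
      apply: le_integral_nnm; [exact: nnmM|exact: nnm_scale|] => w.
      rewrite muleC; apply: lee_wpmul2r; first exact: nnm_ge0 nCg w.
      by apply: (kmix_anti n3 alpha0 alpha2); rewrite lexx edist_ge0.
    by apply: lte_mul_pinfty => //; [exact: kl_fin|rewrite -EFinM ltry].
  apply: (@le_lt_trans _ _ (pot ka m2 0%R)).
    by apply: le_pot; [exact: nk|exact: nk|move=> d _; exact: (klong_le_kall n3 alpha0 alpha2)].
  by rewrite ka2; apply: lte_mul_pinfty => //; exact: klong_fin.
have dze : dominates alpha A z ze.
  apply: (dominates_ge n3 alpha0 alpha2 dm Mze) => x Ax hx; rewrite (pze _ _ (nk _)).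
  have P1 : 0 <= pot ka m1 x by apply: pot_ge0; exact: nk.
  have P2 : 0 <= pot ka m2 x by apply: pot_ge0; exact: nk.
  have [xz|zx] := leP del (edist x z).
    apply: (@le_trans _ _ (pot ka m2 x)); last by rewrite leeDr.
    rewrite ka2; apply: le_trans (ka_le_kl n3 alpha0 alpha2 (rho := del) s0 _ Es) _; first by rewrite del0.
    apply: lee_wpmul2r; first exact: kmix_ge0.
    by rewrite lee_fin; lra.
  apply: (@le_trans _ _ (pot ka m1 x)); last by rewrite leeDl.
  have dx0 := edist_ge0 x z; set d := edist x z in zx dx0 *.
  have kx := hdel x; rewrite (edistC z x) in kx; have {}kx := kx zx.
  have mB := measurable_eball z (N * d)%R; pose B : set T := eball z (N * d)%R.
  have nB : nnm (fun w : T => (\1_B w)%:E) := nnm_indic R mB.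
  have nBx := nnmM nB (na x).
  have lam0e : 0 <= lam%:E by rewrite lee_fin ltW.
  have nz := nnm_scale lam0e (na z).
  have split1 : pot ka m x <= \int[m]_w ((\1_B w)%:E * ka (edist x (w : 'rV[R]_n))) + (lam * p)%:E.
    rewrite EFinM -pE /pot -(integral_nnmZl _ (na z) lam0e) -(integral_nnmD _ nBx nz).
    apply: le_integral_nnm; [exact: na|exact: nnmD|] => w.
    rewrite indicE; case: (boolP (w \in _)) => [_|].
      by rewrite mul1e leeDl//; exact: nnm_ge0 nz w.
    rewrite notin_setE /B/eball/= => /negP; rewrite -leNgt => zw; rewrite mul0e add0e.
    rewrite -cb; apply: (ka_scale n3 alpha0 alpha2 c0); rewrite ?edist_ge0//.
    have t1 := edist_triangle z x w; rewrite (edistC z x) -/d in t1.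
    have h : (c * d <= (c - 1) * edist z w)%R.
      have := ler_wpM2l (ltW cm1) zw; rewrite /N.
      have -> : ((c - 1) * (c / (c - 1) * d) = c * d)%R by field; rewrite gt_eqF.
      by [].
    have h3 := ler_wpM2l (ltW c0) t1.
    by move: h h3; rewrite !mulrDr mulrBl; lra.
  have low : eta%:E <= \int[m]_w ((\1_B w)%:E * ka (edist x (w : 'rV[R]_n))).
    have := le_trans (ltW (lt_le_trans kx hx)) split1.
    rewrite -leeBlDr// -EFinB; apply: le_trans; rewrite lee_fin; lra.
  rewrite /pot (hm1 _ (na x)).
  have [CN [CN0 CN1 CNC]] : exists CN : R, [/\ (0 <= CN)%R, (CN * eta = 1)%R & (CN * N `^ b = C)%R].
    by exists eta^-1%R; rewrite invr_ge0 ltW//; split => //; [rewrite mulVf// gt_eqF|rewrite mulrC].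
  have i0 : 0 <= CN%:E * ka d by apply: mule_ge0; [rewrite lee_fin|exact: kmix_ge0].
  apply: (@le_trans _ _ (CN%:E * ka d * eta%:E)).
    have gen (t : \bar R) : t <= CN%:E * t * eta%:E by rewrite muleAC -EFinM CN1 mul1e.
    exact: gen.
  apply: (le_trans (lee_wpmul2l i0 low)); rewrite -(integral_nnmZl _ nBx i0).
  rewrite (eq_integral_nnm (nnmM nCg (na x)) (nnmM (nnm_scale C0e (na z)) (na x))); last first.
    by apply: (aeS gE) => w ->.
  apply: le_integral_nnm; [exact: nnm_scale|exact: nnmM (nnm_scale C0e (na z)) (na x)|] => w.
  have kw0 := nnm_ge0 (na x) w; have kz0 := nnm_ge0 (na z) w.
  have gen0 (t t' v : \bar R) : 0 <= v -> 0 <= t' -> t * (0%:E * v) <= t' * v.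
    by move=> v0 t0; rewrite mul0e mule0; exact: mule_ge0.
  have gen1 (t t' v : \bar R) : 0 <= v -> t <= t' -> t * (1%:E * v) <= t' * v.
    by move=> v0 tt; rewrite mul1e; exact: lee_wpmul2r.
  rewrite indicE; case: (boolP (w \in _)) => [|_]; last exact: gen0 kw0 (mule_ge0 C0e kz0).
  rewrite inE => zw; apply: (gen1 _ _ _ kw0).
  rewrite -CNC EFinM -muleA; apply: lee_wpmul2l; first by rewrite lee_fin.
  by apply: (ka_scale n3 alpha0 alpha2 N0); [exact: edist_ge0|exact: edist_ge0|exact: ltW zw].
(* Regularity of [z] puts the potential of [ze] above that of the unit mass at [z], so every ball
   about [z] has [ze]-mass at least [1]; yet [m1] and [m2] each give a small ball at most a
   quarter. *)
have one d : (0 < d)%R -> 1 <= ze (ceball z d).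
  apply: (point_mass n3 alpha0 alpha2 (K := 0%R) Mze) => s' s'0 _; rewrite adde0.
  have := le_kint_pot n3 alpha0 alpha2 z (Mplus_dirac n3 alpha0 alpha2 z) Mze s'0.
  rewrite pot_dirac; last exact: nk.
  rewrite edistxx; apply=> x; rewrite pot_dirac; last exact: nk.
  exact: (regular_dominates x reg dze).
have q4 : (0 < 4^-1 :> R)%R by rewrite invr_gt0.
have [d2 d20 hd2] : exists2 d, (0 < d)%R & m2 (ceball z d) <= (4^-1)%:E.
  by apply: measure_at_point => //; rewrite ka2; apply: lte_mul_pinfty => //; exact: klong_fin.
(* The density of [m1] on balls shrinking to [z]; since [g] is [0] at [z], the integrals tend to
   [0]. *)
pose f (k : nat) (w : T) : \bar R := (\1_(ceball z (k.+1%:R^-1)%R : set T) w)%:E * (C%:E * g w).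
have mB k : measurable (ceball z (k.+1%:R^-1)%R : set T) by exact: measurable_ceball.
have nf k : nnm (f k) by exact: nnmM (nnm_indic R (mB k)) nCg.
have nif w : nonincreasing_seq (f^~ w).
  move=> i j ij; apply: lee_wpmul2r; first exact: nnm_ge0 nCg w.
  rewrite !indicE lee_fin; case: (boolP (w \in (ceball z (j.+1%:R^-1)%R : set T))) => //.
  rewrite inE /ceball/= => h; rewrite mem_set//=; apply: le_trans h _.
  by rewrite lef_pV2 ?posrE// ler_nat.
have cf : \int[m]_w f k w @[k --> \oo] --> 0.
  rewrite -(integral0 m setT).
  apply: (@cvg_integral_ni _ _ _ m f (fun=> 0)) => //; first exact: nnm_cst.
    move=> w; apply: cvge_ni0; [exact: nif|by move=> k; exact: nnm_ge0 (nf k) w|].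
    move=> e e0; have [->|wz] := eqVneq w z.
      by exists 0%N; rewrite /f /g edistxx (kall0 n3 alpha0 alpha2) /= !mule0 lee_fin ltW.
    have zw0 : (0 < edist z w)%R by apply: edist_gt0; rewrite eq_sym.
    have [k hk] := nat_above (edist z w)^-1.
    exists k; rewrite /f indicE memNset ?mul0e ?lee_fin ?ltW//= /ceball/= => h.
    move: h; apply/negP; rewrite -ltNge -[ltRHS]invrK ltf_pV2 ?posrE ?invr_gt0//.
    by apply: lt_trans hk _; rewrite ltr_nat.
  apply: (@le_lt_trans _ _ (C%:E * p%:E)); last by rewrite -EFinM ltry.
  rewrite -intg -(integral_nnmZl _ ng C0e); apply: le_integral_nnm => // w.
  rewrite /f -[leRHS]mul1e; apply: lee_wpmul2r; first exact: nnm_ge0 nCg w.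
  by rewrite lee_fin indicE; case: (_ \in _).
have [k hk] := cvge0_ex q4 cf.
pose d := Num.min d2 (k.+1%:R^-1)%R.
have d0 : (0 < d)%R by rewrite lt_min d20 invr_gt0/=.
have := one d d0; have mD := measurable_ceball z d; have nD := nnm_indic R mD.
rewrite -(int_indic ze mD) (hze _ nD) (int_indic m2 mD).
have i2 : m2 (ceball z d) <= (4^-1)%:E.
  apply: le_trans hd2; apply: le_measure; rewrite ?inE; [exact: mD|exact: measurable_ceball|].
  by move=> w; rewrite /ceball/= => h; apply: le_trans h _; rewrite ge_min lexx.
have i1 : \int[m1]_w (\1_(ceball z d : set T) w)%:E <= (4^-1)%:E.
  rewrite (hm1 _ nD); apply: le_trans hk; apply: le_integral_nnm; [exact: nnmM|exact: nf|] => w.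
  rewrite muleC /f; apply: lee_wpmul2r; first exact: nnm_ge0 nCg w.
  rewrite !indicE lee_fin; case: (boolP (w \in (ceball z d : set T))) => //.
  rewrite inE /ceball/= => h; rewrite mem_set//=; apply: le_trans h _.
  by rewrite ge_min lexx orbT.
move=> /le_trans/(_ (leeD i1 i2)); rewrite -EFinD lee_fin; lra.
Qed.

End regular_points.

Lemma eqe_le (R : realType) (a b : \bar R) : a = b -> (a <= b)%E.
Proof. by move=> ->. Qed.

(** * The defect *)

Section levy_kernel.
Local Open Scope ereal_scope.
Context (R : realType) (n : nat) (alpha : R).
Local Notation leb := (@lebesgue_measure R).

Lemma nnm_klevy : nnm (klevy n alpha).
Proof.
pose f (d p : measurableTypeR R) : \bar R :=
  (((Beta (alpha / 2))^-1 * p `^ (alpha / 2 - 1))%:E * (gauss0 n (p `^ (-1))%R d)%:E) *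
  (\1_(`]1%R, 2%R[%classic : set (measurableTypeR R)) p)%:E.
have mp (c : R) : measurable_fun setT (fun q : measurableTypeR R * measurableTypeR R => (q.2 `^ c)%R).
  exact: (measurableT_comp (measurable_powR c) measurable_snd).
have f0 d p : 0 <= f d p.
  rewrite /f; case: (boolP (p \in (`]1%R, 2%R[%classic : set (measurableTypeR R)))) => hp; last first.
    by rewrite indicE (negbTE hp) mule0.
  rewrite indicE hp mule1 mule_ge0 ?lee_fin ?gauss0_ge0//.
  apply: mulr_ge0; last exact: powR_ge0.
  rewrite invr_ge0; apply: fine_ge0; apply: integral_ge0 => t _.
  by rewrite lee_fin /betad; case: ifP => // _; rewrite mulr_ge0 ?powR_ge0.
have E : klevy n alpha = (fun d => \int[leb]_p f d p).
  apply/funext => d; rewrite /klevy integral_mkcond; apply: eq_integral => p _.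
  by rewrite epatch_indic.
rewrite E; apply: nnmI; last by move=> d; apply: integral_ge0 => p _; exact: f0.
apply: (measurable_int2 (sigma_finiteT _) (f := f)) => //.
apply: emeasurable_funM; first apply: emeasurable_funM.
- by apply/measurable_EFinP; apply: measurable_funM => //; exact: mp.
- apply/measurable_EFinP.
  have mpair : measurable_fun setT (fun q : measurableTypeR R * measurableTypeR R =>
      (((q.2 `^ (-1))%R : measurableTypeR R), q.1)).
    by apply/measurable_fun_pairP; split; [exact: mp|exact: measurable_fst].
  exact: (measurableT_comp (@measurable_gauss0 R n) mpair).
- apply/measurable_EFinP; apply: (measurableT_comp _ measurable_snd).
  exact: measurable_indic.
Qed.

End levy_kernel.

Section gauss_tail.
Context (R : realType) (n : nat).

(** For [d >= r] and [s <= 1 / 2] the exponent [d ^ 2 / s] is at least [2 be / s + d ^ 2]: one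
    [be / s] is the asserted decay, the other absorbs the peak [s ^ (- n)], and [d ^ 2] is left for
    the Gaussian of time [1]. *)
Lemma gauss_far (r : R) : (0 < n)%N -> 0 < r -> exists2 C : R, 0 <= C & forall s d, 0 < s -> s <= 2^-1 -> r <= d ->
  gauss n s d <= C * expR (- (r ^+ 2 / (4 * s))) * gauss n 1 d.
Proof.
move=> n0 r0; pose be := r ^+ 2 / 4; have be0 : 0 < be by rewrite divr_gt0// exprn_gt0.
have nR : 0 < n%:R :> R by rewrite ltr0n.
have g1 : 0 < gpeak n (1 : R) by exact: gpeak_gt0.
exists ((n%:R / be) ^+ n / gpeak n 1); first by apply: divr_ge0; [apply: exprn_ge0; exact: divr_ge0 (ltW nR) (ltW be0)|exact: ltW].
move=> s d s0 s2 rd; have d0 : 0 <= d by apply: le_trans rd; exact: ltW.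
have s1 : s <= 1 by apply: le_trans s2 _; rewrite invf_le1// ler1n.
have gs : gpeak n s <= s^-1 ^+ n.
  rewrite /gpeak powRN exprVn lef_pV2; [|by rewrite posrE powR_gt0 ?mulr_gt0 ?pi_gt0|by rewrite posrE exprn_gt0].
  rewrite -powR_mulrn; last exact: ltW.
  have -> : (s `^ n%:R = (s ^+ 2) `^ (n%:R / 2)).
    by rewrite -powR_mulrn ?ltW// -powRrM mulrCA divff ?mulr1.
  apply: ge0_ler_powR; [exact: divr_ge0|by rewrite nnegrE exprn_ge0// ltW|by rewrite nnegrE (mulr_ge0 (pi_ge0 R) (ltW s0))|].
  rewrite expr2; apply: ler_wpM2r; first exact: ltW.
  by have := pi_ge2 R; lra.
have ex : expR (- (be / s)) <= (s * n%:R / be) ^+ n.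
  have -> : - (be / s) = - (be / (s * n%:R)) * n%:R by field; rewrite !gt_eqF.
  rewrite expRM_natr; apply: lerXn2r; [by rewrite nnegrE expR_ge0|by rewrite nnegrE divr_ge0 ?mulr_ge0// ltW|].
  apply: le_trans (expR_neg_le _) _; first by rewrite divr_gt0// mulr_gt0.
  by rewrite invf_div.
have peak : gpeak n s * expR (- (be / s)) <= (n%:R / be) ^+ n.
  apply: (@le_trans _ _ (s^-1 ^+ n * (s * n%:R / be) ^+ n)).
    by apply: (ler_pM _ _ gs ex); [exact: gpeak_ge0|exact: expR_ge0].
  rewrite -exprMn; have -> : s^-1 * (s * n%:R / be) = n%:R / be by field; rewrite !gt_eqF.
  by [].
have dd : - d ^+ 2 * s `^ (-1) <= - (be / s) + (- (be / s) + (- d ^+ 2 * 1 `^ (-1))).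
  rewrite powR1 mulr1 (powR_inv1 (ltW s0)) /be.
  have r2 : r ^+ 2 <= d ^+ 2 by apply: lerXn2r; rewrite ?nnegrE// ltW.
  have is2 : 2 <= s^-1 by rewrite -[leLHS]invrK lef_pV2 ?posrE ?invr_gt0.
  have is0 : 0 < s^-1 by rewrite invr_gt0.
  have h1 : r ^+ 2 * s^-1 <= d ^+ 2 * s^-1 by rewrite ler_wpM2r// ltW.
  have h2 : d ^+ 2 * 2 <= d ^+ 2 * s^-1 by rewrite ler_wpM2l// exprn_ge0.
  have -> : r ^+ 2 / 4 / s = (r ^+ 2 * s^-1) / 4 by field; rewrite gt_eqF.
  rewrite mulNr; move: h1 h2; set X := (d ^+ 2 * s^-1); set Y := (r ^+ 2 * s^-1); set Z := d ^+ 2.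
  by move=> h1 h2; lra.
have e4 : r ^+ 2 / (4 * s) = be / s by rewrite /be; field; rewrite gt_eqF.
rewrite e4 /gauss.
apply: (@le_trans _ _ (gpeak n s * expR (- (be / s) + (- (be / s) + (- d ^+ 2 * 1 `^ (-1)))))).
  by rewrite ler_wpM2l ?gpeak_ge0// ler_expR.
rewrite !expRD.
have -> : (n%:R / be) ^+ n / gpeak n 1 * expR (- (be / s)) * (gpeak n 1 * expR (- d ^+ 2 * 1 `^ (-1))) =
  (n%:R / be) ^+ n * (expR (- (be / s)) * expR (- d ^+ 2 * 1 `^ (-1))) by field; rewrite gt_eqF.
by rewrite mulrA ler_wpM2r// mulr_ge0 ?expR_ge0.
Qed.

Lemma gauss_near (s d r : R) : 0 < s -> s <= 1 -> 0 <= d <= r ->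
  gpeak n 1 * expR (- (r ^+ 2 / s)) <= gauss n s d.
Proof.
move=> s0 s1 /andP[d0 dr]; apply: ler_pM; [exact: gpeak_ge0|exact: expR_ge0| |].
  rewrite /gpeak !powRN lef_pV2 ?posrE ?powR_gt0 ?mulr_gt0 ?pi_gt0//.
  apply: ge0_ler_powR; [exact: divr_ge0|by rewrite nnegrE (mulr_ge0 (pi_ge0 R) (ltW s0))|by rewrite nnegrE mulr1 pi_ge0|].
  by apply: ler_wpM2l; first exact: pi_ge0.
rewrite ler_expR (powR_inv1 (ltW s0)) mulNr lerN2; apply: ler_wpM2r; first by rewrite invr_ge0 ltW.
by apply: lerXn2r; rewrite ?nnegrE// (le_trans d0).
Qed.

End gauss_tail.

Section defect.
Local Open Scope ereal_scope.
Context (R : realType) (n : nat) (alpha : R).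
Hypotheses (n3 : (3 <= n)%N) (alpha0 : (0 < alpha)%R) (alpha2 : (alpha <= 2)%R).
Local Notation L := (Leb R n).
Local Notation T := (RnB R n).
Local Notation kl := (klong n alpha).
Local Notation ks := (kshort n alpha).
Local Notation ka := (kall n alpha).
Local Notation km := (kmid n alpha).
Implicit Types (m : msr R n) (x z a : 'rV[R]_n) (s r q : R).

Let nk i : nnm (kmix n alpha i) := nnm_kmix n3 alpha0 alpha2 i.
Let nm s : (0 < s)%R -> nnm (km s) := @nnm_km R n alpha alpha0 alpha2 s.

Variables (A : set (Rn R n)) (y : 'rV[R]_n) (nu : msr R n).

Definition defect (z : T) : \bar R :=
  (ediff (pot ka nu : T -> \bar R) (fun w : T => ka (edist (w : 'rV[R]_n) y)) z)%:E.

Hypothesis nuB : is_balayage alpha (dirac_at y) A nu.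

Let nuM : Mplus alpha nu := nuB.1.
Let nU i : nnm (pot (kmix n alpha i) nu : T -> \bar R) := Mplus_pot_nnm n3 alpha0 alpha2 i nuM.
Let nkap : nnm (fun w : T => ka (edist (w : 'rV[R]_n) y)) := nnm_edistr y (nk _).
Let le_kap x : pot ka nu x <= ka (edist x y) := balayage_le_dirac n3 alpha0 alpha2 nuB x.

Lemma nnm_defect : nnm defect.
Proof. exact: nnm_ediff (nU _) nkap. Qed.

Let kl_nu_fin s x : (0 < s)%R -> pot (kl s) nu x \is a fin_num.
Proof.
by move=> s0; rewrite ge0_fin_numE; [exact: (Mplus_pot_kl_fin n3 alpha0 alpha2 x s0 nuM)|apply: pot_ge0; exact: nk].
Qed.

Let kapE : (fun w : T => ka (edist (w : 'rV[R]_n) y)) = pot ka (dirac_at y).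
Proof. by apply/funext => w; rewrite (pot_dirac y w (nk `]-oo, +oo[%R)). Qed.

Let kint_kap s x : (0 < s)%R -> kint L (km s) (fun w : T => ka (edist (w : 'rV[R]_n) y)) x = kl s (edist x y).
Proof.
move=> s0; rewrite kapE (kint_pot n3 alpha0 alpha2 x (dirac_sigma_finite y) s0).
by rewrite (pot_dirac y x (nk `]s, +oo[%R)).
Qed.

Let kap_fin : {ae L, forall z : T, ka (edist (z : 'rV[R]_n) y) \is a fin_num}.
Proof.
apply: (kint_km_ae_fin alpha0 alpha2 ltr01 nkap (x := 0%R)).
by rewrite kint_kap//; exact: klong_fin.
Qed.

(** Smoothing by [kmid s] turns both Riesz potentials into long ones, so the identity holds at every
    point with finite terms, although the defect is a true difference only almost everywhere. *)
Lemma kl_defect s x : (0 < s)%R -> kl s (edist x y) = pot (kl s) nu x + kint L (km s) defect x.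
Proof.
move=> s0; rewrite -(kint_kap x s0) -(kint_pot n3 alpha0 alpha2 x (radon_sigma_finite nuM.1) s0).
exact: (kint_ediff x (nm s0) (nU _) nkap le_kap kap_fin).
Qed.

Lemma kint_ae0 k x (f : T -> \bar R) : nnm k -> nnm f -> {ae L, forall z, f z = 0} -> kint L k f x = 0.
Proof.
move=> hk nf f0; rewrite -(integral0 L setT).
apply: (eq_integral_nnm (nnm_kernel x hk nf) (@nnm_cst _ T R 0 (lexx 0))).
by apply: (aeS f0) => z ->; rewrite mule0.
Qed.

Lemma regular_of_ge : (forall x, ka (edist x y) <= pot ka nu x) -> regular_pts alpha A y.
Proof.
move=> h; split; first exact: Mplus_dirac.
move=> x; rewrite -nuB.2 !(potentialE n3 alpha0 alpha2) (pot_dirac y x (nk `]-oo, +oo[%R)).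
by apply/eqP; rewrite eq_le h le_kap.
Qed.

Lemma regular_of_defect : {ae L, forall z, defect z = 0} -> regular_pts alpha A y.
Proof.
move=> d0; apply: regular_of_ge => x.
have := @pot_kl_ext R n alpha n3 alpha0 alpha2 (dirac_at y) nu x.
rewrite (pot_dirac y x (nk `]-oo, +oo[%R)); apply=> s s0.
have -> : pot (kl s) (dirac_at y) x = kl s (edist x y) by apply: pot_dirac; exact: nk.
rewrite (kl_defect x s0).
by rewrite (kint_ae0 x (nm s0) nnm_defect d0) adde0.
Qed.

(** At a point of contact the mean of the defect is at most the short part of the potential of [nu],
    which is small because [nu] vanishes near [x]. *)
Lemma defect_touch x q s : pot ka nu x = ka (edist x y) -> nu (eball x q) = 0 -> (0 < q)%R -> (0 < s)%R ->
  kint L (km s) defect x <= (gtail n s q)%:E * ka (edist x y).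
Proof.
move=> E nu0 q0 s0; rewrite -(@leeD2lE _ _ _ _ (kl_nu_fin x s0)) -(kl_defect x s0).
apply: le_trans (klong_le_kall n3 alpha0 alpha2 s _) _; rewrite -E.
apply: (le_trans (eqe_le (etrans (pot_split n3 alpha0 alpha2 s nu x) (addeC _ _)))).
apply: leeD; first exact: lexx.
exact: (pot_short_null n3 alpha0 alpha2 q0 s0 nu0).
Qed.

Lemma kap_fin_of_touch x q : pot ka nu x = ka (edist x y) -> nu (eball x q) = 0 -> (0 < q)%R ->
  exists2 k : R, (0 <= k)%R & ka (edist x y) = k%:E.
Proof.
move=> E nu0 q0; have f := pot_null_fin n3 alpha0 alpha2 nuM q0 nu0.
have f0 : 0 <= pot ka nu x by apply: pot_ge0; exact: nk.
exists (fine (pot ka nu x)); first exact: fine_ge0.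
by rewrite -E fineK// ge0_fin_numE.
Qed.

(* The mean [kint (km s)] of the defect is exponentially small in [1/s], but bounded below by
   [s ^ (alpha / 2)] times its mean against the jump kernel. *)
Lemma regular_of_touch a q : (alpha < 2)%R -> (0 < q)%R -> nu (eball a q) = 0 ->
  pot ka nu a = ka (edist a y) -> regular_pts alpha A y.
Proof.
move=> al2 q0 nu0 E; have [k k0 kE] := kap_fin_of_touch E nu0 q0.
have nl := @nnm_klevy R n alpha; have nd := nnm_defect.
pose Q := kint L (klevy n alpha) defect a.
have Q0 : 0 <= Q by exact: kint_ge0.
pose C := (2 ^+ n * 2 / q ^+ 2 * k)%R.
have C0 : (0 <= C)%R by rewrite !mulr_ge0 ?invr_ge0 ?exprn_ge0// ltW.
have key s : (0 < s)%R -> (s <= 2^-1)%R -> (s `^ (alpha / 2))%:E * Q <= (C * s)%:E.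
  move=> s0 s2; have p0 : 0 <= (s `^ (alpha / 2))%:E by rewrite lee_fin powR_ge0.
  have nsl : nnm (fun d => (s `^ (alpha / 2))%:E * klevy n alpha d).
    by apply: nnmM => //; exact: nnm_cst.
  apply: (@le_trans _ _ (kint L (km s) defect a)).
    rewrite /Q -(kintZk L a nl nd p0); apply: le_kintk; [exact: nsl|exact: nm|exact: nd|] => d _.
    exact: kmid_levy.
  apply: le_trans (defect_touch E nu0 q0 s0) _; rewrite kE -EFinM lee_fin.
  apply: (@le_trans _ _ (2 ^+ n * (2 * s) / q ^+ 2 * k)%R).
    by apply: ler_wpM2r => //; exact: gtail_le.
  by rewrite /C le_eqVlt; apply/orP; left; apply/eqP; ring.
have Qle0 : Q <= 0.
  apply/lee_addgt0Pr => e e0; rewrite add0e.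
  have be0 : (0 < 1 - alpha / 2)%R by move: al2; lra.
  have C1 : (0 < C + 1)%R by lra.
  (* Chosen so that [C * s <= e * s ^ (alpha / 2)] for [s <= t]; this is possible because
     [alpha / 2 < 1]. *)
  pose t := ((e / (C + 1)) `^ ((1 - alpha / 2)^-1))%R.
  have eC : (0 < e / (C + 1))%R by rewrite divr_gt0.
  have t0 : (0 < t)%R by exact: powR_gt0.
  pose s := Num.min t 2^-1%R.
  have s0 : (0 < s)%R by rewrite lt_min t0 invr_gt0/=.
  have s2 : (s <= 2^-1)%R by rewrite ge_min lexx orbT.
  have st : (s <= t)%R by rewrite ge_min lexx.
  have sp : (s `^ (1 - alpha / 2) <= e / (C + 1))%R.
    apply: (@le_trans _ _ (t `^ (1 - alpha / 2))%R).
      by apply: ge0_ler_powR; [exact: ltW|by rewrite nnegrE ltW|by rewrite nnegrE ltW|].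
    by rewrite /t -powRrM mulVf ?gt_eqF// powRr1// ltW.
  have sa0 : (0 < s `^ (alpha / 2))%R by exact: powR_gt0.
  rewrite -(@lee_pmul2l _ (s `^ (alpha / 2))%:E)//.
  apply: le_trans (key s s0 s2) _; rewrite -EFinM lee_fin.
  have -> : (C * s = s `^ (alpha / 2) * (C * s `^ (1 - alpha / 2)))%R.
    rewrite mulrCA -powRD; last by apply/implyP => _; exact: lt0r_neq0.
    by rewrite [(alpha / 2 + _)%R]addrC subrK powRr1// ltW.
  rewrite ler_pM2l//; apply: (@le_trans _ _ (C * (e / (C + 1)))%R); first by rewrite ler_wpM2l.
  by rewrite mulrA ler_pdivrMr// mulrC ler_pM2l//; lra.
apply: regular_of_defect; apply: (aeS (nnm_int_eq0 (nnm_kernel a nl nd) Qle0)) => z /eqP.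
by rewrite mule_eq0 gt_eqF/= ?klevy_gt0// => /eqP.
Qed.

(** * Local propagation of the defect for [alpha = 2] *)

Section newtonian.
Hypothesis alphaE : alpha = 2%R.

Let kmE s d : (0 < s)%R -> km s d = (gauss n s d)%:E.
Proof. by move=> s0; exact: kmid_two. Qed.

Let n0 : (0 < n)%N. Proof. by apply: leq_trans n3. Qed.

(** Beyond [r] the Gaussian of time [s] is a tiny multiple of the one of time [1], and the mean of
    the defect at time [1] is at most [kl 1]. *)
Lemma defect_far x r : (0 < r)%R ->
  {ae L, forall z : T, (edist x (z : 'rV[R]_n) < r)%R -> defect z = 0} ->
  exists2 C : R, (0 <= C)%R & forall s, (0 < s)%R -> (s <= 2^-1)%R ->
    kint L (km s) defect x <= (C * expR (- (r ^+ 2 / (4 * s))))%:E.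
Proof.
move=> r0 loc; have [C C0 hC] := gauss_far n0 r0; have nd := nnm_defect.
have k1f : kl 1 (edist x y) \is a fin_num by exact: kl_fin.
have k10 : (0 <= fine (kl 1 (edist x y)))%R by apply: fine_ge0; exact: kmix_ge0.
exists (C * fine (kl 1 (edist x y)))%R; first exact: mulr_ge0.
move=> s s0 s2; pose c := (C * expR (- (r ^+ 2 / (4 * s))))%R.
have c0 : 0 <= c%:E by rewrite lee_fin mulr_ge0 ?expR_ge0.
have nc : nnm (fun d => c%:E * km 1 d) by apply: nnmM; [exact: nnm_cst|exact: nm].
have n1 := nnm_kernel x (nm s0) nd; have n2 := nnm_kernel x nc nd.
apply: (@le_trans _ _ (c%:E * kint L (km 1) defect x)); last first.
  have i1 : kint L (km 1) defect x <= kl 1 (edist x y).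
    by rewrite (kl_defect x ltr01) leeDr//; apply: pot_ge0; exact: nk.
  apply: le_trans (lee_wpmul2l c0 i1) _; rewrite -(fineK k1f) -EFinM lee_fin /c.
  by rewrite le_eqVlt; apply/orP; left; apply/eqP; ring.
rewrite -(kintZk L x (nm ltr01) nd c0) /kint (eq_integral_nnm n1 (nnm_min n1 n2)); last first.
  apply: (aeS loc) => z hz; apply/esym/min_idPl.
  have [/hz->|rz] := ltP (edist x z) r; first by rewrite !mule0.
  apply: lee_wpmul2r; first exact: nnm_ge0 nd z.
  by rewrite !kmE// -EFinM lee_fin; exact: hC.
by apply: le_integral_nnm; [exact: nnm_min|exact: n2|move=> z; rewrite ge_min lexx orbT].
Qed.

(** In [kl_defect] the mean of the defect vanishes with [s]; this upgrades equality almost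
    everywhere to equality at the point [x] itself. *)
Lemma defect_local x r : (0 < r)%R ->
  {ae L, forall z : T, (edist x (z : 'rV[R]_n) < r)%R -> defect z = 0} ->
  pot ka nu x = ka (edist x y).
Proof.
move=> r0 loc; have [C C0 hC] := defect_far r0 loc.
apply/eqP; rewrite eq_le le_kap/=; apply/lee_addgt0Pr => e e0.
apply: (cvge_ub (@klong_cvg R n alpha n3 alpha0 alpha2 (edist x y))) => k.
have C1 : (0 < C + 1)%R by lra.
have r2 : (0 < r ^+ 2)%R by exact: exprn_gt0.
pose t := (e * r ^+ 2 / (4 * (C + 1)))%R.
have t0 : (0 < t)%R by rewrite divr_gt0 ?mulr_gt0.
have h0 := harm_gt0 R k.
pose s := Num.min t (Num.min (k.+1%:R^-1) 2^-1)%R.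
have s0 : (0 < s)%R by rewrite !lt_min t0 h0 invr_gt0/=.
have s2 : (s <= 2^-1)%R by rewrite !ge_min lexx !orbT.
have sk : (s <= k.+1%:R^-1)%R by rewrite !ge_min lexx !orbT.
have st : (s <= t)%R by rewrite ge_min lexx.
apply: le_trans (klong_anti n3 alpha0 alpha2 _ sk) _; rewrite (kl_defect x s0); apply: leeD.
  by apply: le_pot; [exact: nk|exact: nk|move=> d _; exact: (klong_le_kall n3 alpha0 alpha2)].
apply: le_trans (hC s s0 s2) _; rewrite lee_fin.
have h4 : (0 < r ^+ 2 / (4 * s))%R by rewrite divr_gt0// mulr_gt0.
apply: (@le_trans _ _ (C * (4 * s / r ^+ 2))%R).
  by apply: ler_wpM2l => //; apply: le_trans (expR_neg_le h4) _; rewrite invf_div.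
rewrite mulrA ler_pdivrMr// mulrA.
have h5 : (s * (4 * (C + 1)) <= e * r ^+ 2)%R by rewrite -ler_pdivlMr// mulr_gt0.
by apply: le_trans h5; move: s0 C0; nra.
Qed.

(** The mean of the defect at [x] is of order [exp (- q ^ 2 / (2 s))], while the Gaussian is at
    least of order [exp (- q ^ 2 / (4 s))] within [q / 2]: the defect vanishes almost everywhere
    there. A point within [q / 8] of [x] has its ball of radius [q / 4] inside. *)
Lemma touch_spreads x q : (0 < q)%R -> nu (eball x q) = 0 -> pot ka nu x = ka (edist x y) ->
  forall x', (edist x x' < q / 8)%R -> pot ka nu x' = ka (edist x' y).
Proof.
move=> q0 nu0 E; have [k k0 kE] := kap_fin_of_touch E nu0 q0; have nd := nnm_defect.
have mB := measurable_ceball x (q / 2)%R; have nB := nnm_indic R mB.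
pose J := \int[L]_z ((\1_(ceball x (q / 2)%R : set T) z)%:E * defect z).
have g1 : (0 < gpeak n (1 : R))%R by exact: gpeak_gt0.
have J0 : J <= 0.
  apply/lee_addgt0Pr => e e0; rewrite add0e.
  pose C := (2 ^+ n * k / gpeak n 1)%R.
  have C0 : (0 <= C)%R by rewrite divr_ge0 ?mulr_ge0 ?exprn_ge0// ltW.
  have C1 : (0 < C + 1)%R by lra.
  have q2 : (0 < q ^+ 2)%R by exact: exprn_gt0.
  pose t := (e * q ^+ 2 / (4 * (C + 1)))%R.
  have t0 : (0 < t)%R by rewrite divr_gt0 ?mulr_gt0.
  pose s := Num.min t 1%R.
  have s0 : (0 < s)%R by rewrite lt_min t0 ltr01.
  have s1 : (s <= 1)%R by rewrite ge_min lexx orbT.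
  have st : (s <= t)%R by rewrite ge_min lexx.
  pose c := (gpeak n 1 * expR (- ((q / 2) ^+ 2 / s)))%R.
  have c0 : (0 < c)%R by rewrite mulr_gt0 ?expR_gt0.
  have c0e : 0 <= c%:E by rewrite lee_fin ltW.
  rewrite -(@lee_pmul2l _ c%:E)//; apply: (@le_trans _ _ (kint L (km s) defect x)).
    have nBd := nnmM nB nd; have nkd := nnm_kernel x (nm s0) nd.
    rewrite /J -(integral_nnmZl _ nBd c0e); apply: le_integral_nnm; [exact: nnm_scale|exact: nkd|] => z.
    rewrite indicE; case: (boolP (z \in _)) => [|_]; last first.
      by rewrite mul0e mule0; exact: nnm_ge0 nkd z.
    rewrite inE mul1e /ceball/= => xz; apply: lee_wpmul2r; first exact: nnm_ge0 nd z.
    by rewrite kmE// lee_fin; apply: gauss_near => //; rewrite edist_ge0.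
  apply: le_trans (defect_touch E nu0 q0 s0) _; rewrite kE -!EFinM lee_fin.
  have h4 : (0 < q ^+ 2 / (4 * s))%R by rewrite divr_gt0// mulr_gt0.
  have -> : (gtail n s q * k = c * (C * expR (- (q ^+ 2 / (4 * s)))))%R.
    have -> : (c * (C * expR (- (q ^+ 2 / (4 * s)))) =
        2 ^+ n * k * (expR (- ((q / 2) ^+ 2 / s)) * expR (- (q ^+ 2 / (4 * s)))))%R.
      by rewrite /c /C; field; rewrite gt_eqF.
    rewrite -expRD /gtail -mulrA [(expR _ * k)%R]mulrC mulrA; congr (_ * expR _)%R.
    by field; rewrite gt_eqF.
  rewrite ler_pM2l//; apply: (@le_trans _ _ (C * (4 * s / q ^+ 2))%R).
    by apply: ler_wpM2l => //; apply: le_trans (expR_neg_le h4) _; rewrite invf_div.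
  rewrite mulrA ler_pdivrMr// mulrA.
  have h5 : (s * (4 * (C + 1)) <= e * q ^+ 2)%R by rewrite -ler_pdivlMr// mulr_gt0.
  by apply: le_trans h5; move: s0 C0; nra.
have ae0 := nnm_int_eq0 (nnmM nB nd) J0.
move=> x' xx'; have r4 : (0 < q / 4)%R by rewrite divr_gt0.
apply: (defect_local r4); apply: (aeS ae0) => z + x'z.
rewrite indicE mem_set ?mul1e//= /ceball/=.
apply: le_trans (edist_triangle x x' z) _; lra.
Qed.

(** Contact at [x] and [kl_defect] express the short potential of [nu] as [ks s] at distance
    [edist x y] plus the mean of the defect. Both are exponentially small since [x != y]. *)
Lemma null_of_defect x r : (0 < r)%R -> x != y ->
  {ae L, forall z : T, (edist x (z : 'rV[R]_n) < r)%R -> defect z = 0} ->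
  exists2 d, (0 < d)%R & nu (ceball x d) = 0.
Proof.
move=> r0 xy loc; have E := defect_local r0 loc; have [C C0 hC] := defect_far r0 loc.
have d0 := edist_gt0 xy; set d := edist x y in E d0.
have [k k0 kE] : exists2 k : R, (0 <= k)%R & ka d = k%:E.
  by exists (d `^ (alpha - n%:R))%R; [exact: powR_ge0|exact: kall_gt0E].
pose q := Num.min d (r / 2)%R.
have q0 : (0 < q)%R by rewrite lt_min d0 divr_gt0.
have qd : (q <= d)%R by rewrite ge_min lexx.
have qr : (q <= r / 2)%R by rewrite ge_min lexx orbT.
exists (q / 4)%R; first by rewrite divr_gt0.
have h2 : (0 < 2^-1 :> R)%R by rewrite invr_gt0.
apply: (null_of_short n3 alpha0 alpha2 (addr_ge0 k0 C0) q0 h2) => s /andP[s0 s2].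
have e1 : pot (ks s) nu x = ks s d + kint L (km s) defect x.
  have h : pot (kl s) nu x + pot (ks s) nu x = pot (kl s) nu x + (ks s d + kint L (km s) defect x).
    have := etrans (etrans (esym (pot_split n3 alpha0 alpha2 s nu x)) E) (kall_split n3 alpha0 alpha2 s d).
    move=> E2; rewrite addeC; apply: (etrans E2); rewrite (kl_defect x s0).
    exact: addeCA.
  exact: adde_cancell (kl_nu_fin x s0) h.
rewrite e1 mulrDl EFinD; apply: leeD.
  have qd0 : (0 <= q <= d)%R by rewrite qd ltW.
  by apply: le_trans (ks_le n3 alpha0 alpha2 s0 qd0) _; rewrite kE -EFinM mulrC.
apply: le_trans (hC s s0 s2) _; rewrite lee_fin; apply: ler_wpM2l => //.
rewrite /gtail -[leLHS]mul1r; apply: ler_pM; [exact: ler01|exact: expR_ge0| |].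
  by rewrite exprn_ege1// ler1n.
rewrite ler_expR mulNr lerN2.
have q2 : (q ^+ 2 <= (r / 2) ^+ 2)%R by apply: lerXn2r; [by rewrite nnegrE ltW|by rewrite nnegrE divr_ge0// ltW|exact: qr].
have is0 : (0 < s^-1)%R by rewrite invr_gt0.
have -> : (q ^+ 2 / (2 * s) = q ^+ 2 * s^-1 / 2)%R by field; rewrite gt_eqF.
have -> : (r ^+ 2 / (4 * s) = (r / 2) ^+ 2 * s^-1)%R by field; rewrite gt_eqF.
have h3 : (q ^+ 2 * s^-1 <= (r / 2) ^+ 2 * s^-1)%R by rewrite ler_wpM2r// ltW.
have h4 : (0 <= q ^+ 2 * s^-1)%R by rewrite mulr_ge0 ?exprn_ge0// ltW.
by move: h3 h4; lra.
Qed.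

(** At [y] itself [kl_defect] bounds [kl s 0] by the [kl s]-potential of [nu] plus a constant, so
    [nu] carries a unit mass at [y]. *)
Lemma regular_of_local_defect r : (0 < r)%R ->
  {ae L, forall z : T, (edist y (z : 'rV[R]_n) < r)%R -> defect z = 0} -> regular_pts alpha A y.
Proof.
move=> r0 loc; have [C C0 hC] := defect_far r0 loc.
apply: regular_of_ge; apply: (potential_ge_of_mass n3 alpha0 alpha2).
apply: (point_mass n3 alpha0 alpha2 (K := C) nuM) => s s0 s2.
rewrite -{1}(edistxx y) (kl_defect y s0) leeD2l//; apply: le_trans (hC s s0 s2) _.
rewrite lee_fin -[leRHS]mulr1; apply: ler_wpM2l => //.
by rewrite -expR0 ler_expR oppr_le0 divr_ge0 ?exprn_ge0 ?mulr_ge0// ltW.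
Qed.

End newtonian.

End defect.

(** * The support of the balayage *)

Section support.
Local Open Scope ereal_scope.
Context (R : realType) (n : nat).
Local Notation T := (RnB R n).
Implicit Types (m : msr R n) (x z : 'rV[R]_n) (q d r : R).

Lemma not_msupport m x d : (0 < d)%R -> m (ceball x d) = 0 -> ~ msupport m x.
Proof.
move=> d0 m0 sx; have xx : eball x d x by rewrite /eball/= edistxx.
have := sx _ (open_eball (x := x) (r := d)) xx; rewrite ltNge => /negP; apply.
rewrite -m0; apply: le_measure; rewrite ?inE; [exact: measurable_eball|exact: measurable_ceball|].
by move=> z; rewrite /eball/ceball/= => /ltW.
Qed.

Lemma not_msupport_null m x : ~ msupport m x -> exists2 q, (0 < q)%R & m (eball x q) = 0.
Proof.
move=> /existsNP[U /not_implyP[oU /not_implyP[Ux /negP]]]; rewrite -leNgt => mU.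
have [q q0 qU] := open_eballP oU Ux; exists q => //.
apply/eqP; rewrite eq_le measure_ge0 andbT; apply: le_trans mU.
by apply: le_measure; rewrite ?inE; [exact: measurable_eball|exact: open_mRn|exact: qU].
Qed.

Lemma null_eball_sub m x x' q q' : (edist x x' + q' <= q)%R -> m (eball x q) = 0 -> m (eball x' q') = 0.
Proof.
move=> h m0; apply/eqP; rewrite eq_le measure_ge0 andbT -m0.
apply: le_measure; rewrite ?inE; [exact: measurable_eball|exact: measurable_eball|].
move=> z; rewrite /eball/= => hz; apply: le_lt_trans (edist_triangle x x' z) _; lra.
Qed.

End support.

(** * Both cases of the theorem *)

Section support_of_balayage.
Local Open Scope ereal_scope.
Context (R : realType) (n : nat) (alpha : R).
Hypotheses (n3 : (3 <= n)%N) (alpha0 : (0 < alpha)%R) (alpha2 : (alpha <= 2)%R).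
Local Notation L := (Leb R n).
Local Notation T := (RnB R n).
Local Notation ka := (kall n alpha).
Implicit Types (x z a : 'rV[R]_n) (q r : R).

Variables (A : set (Rn R n)) (y : 'rV[R]_n) (nu : msr R n).
Hypotheses (hA : A = reduced_kernel alpha A) (yreg : ~ regular_pts alpha A y).
Hypothesis nuB : is_balayage alpha (dirac_at y) A nu.

Let nuM : Mplus alpha nu := nuB.1.
Let le_kap x : pot ka nu x <= ka (edist x y) := balayage_le_dirac n3 alpha0 alpha2 nuB x.

Lemma msupport_sub_closure : msupport nu `<=` closure A.
Proof.
move=> x sx; apply: contrapT => ncl; move: ncl; rewrite closure_eballP.
move=> /existsNP[r /not_implyP[r0 h]].
have r2 : (0 < r / 2)%R by rewrite divr_gt0.
have far a : A a -> (2 * (r / 2) <= edist x a)%R.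
  move=> Aa; rewrite mulrC divfK//; rewrite leNgt; apply/negP => ar; apply: h.
  by exists a.
have := balayage_null_far n3 alpha0 alpha2 nuB r2 far.
by move=> n0; apply: not_msupport n0 sx; rewrite divr_gt0.
Qed.

(** This is where the reduced kernel enters: around each of its points [A] has pieces of positive
    capacity at every scale. *)
Lemma touch_near x q r : closure A x -> (0 < q)%R -> nu (eball x q) = 0 -> (0 < r)%R ->
  exists2 a, (edist x a < r)%R & pot ka nu a = ka (edist a y).
Proof.
move=> cx q0 nu0 r0; pose q' := Num.min (q / 2)%R (r / 2)%R.
have q'0 : (0 < q')%R by rewrite lt_min !divr_gt0.
have q'q : (q' <= q / 2)%R by rewrite ge_min lexx.
have q'r : (q' <= r / 2)%R by rewrite ge_min lexx orbT.
have [a Aa xa] := (closure_eballP A x).1 cx _ q'0.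
have nua : nu (eball a q') = 0 by apply: null_eball_sub nu0; lra.
have q8 : (0 < q' / 8)%R by rewrite divr_gt0.
have cap : ~ cap_zero alpha (A `&` eball a (q' / 8)%R).
  by move: Aa; rewrite [X in X a -> _]hA => -[_]; exact.
have [a' [_ aa'] E] := balayage_touches n3 alpha0 alpha2 nuB q'0 nua cap.
exists a' => //; apply: le_lt_trans (edist_triangle x a a') _; lra.
Qed.

Lemma msupport_closure : (alpha < 2)%R -> msupport nu = closure A.
Proof.
move=> al2; apply/seteqP; split; first exact: msupport_sub_closure.
move=> x cx; apply: contrapT => /not_msupport_null[q q0 nu0].
have q2 : (0 < q / 2)%R by rewrite divr_gt0.
have [a xa E] := touch_near cx q0 nu0 q2.
apply: yreg; apply: (regular_of_touch n3 alpha0 alpha2 nuB al2 q2 _ E).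
by apply: null_eball_sub nu0; lra.
Qed.

Hypothesis alphaE : alpha = 2%R.
Hypothesis irr0 : cap_zero alpha (irregular_pts alpha A).
Hypothesis conD : connected (~` closure A).

(** A point of [W] without contact lies in the closure of [A] and is irregular, for at a regular
    [z != y] every dominating potential reaches the kernel. The points without contact form a Borel
    set, hence a Lebesgue null one. *)
Lemma ae_defect (W : set T) : measurable W ->
  (forall z, W z -> closure A z \/ pot ka nu z = ka (edist z y)) ->
  {ae L, forall z : T, W z -> defect alpha y nu z = 0}.
Proof.
move=> mW h; pose B : set T := W `&` [set z | pot ka nu z < ka (edist z y)].
have mB : measurable B by apply: measurableI => //; exact: measurable_sublevel.
have cB : cap_zero alpha (B : set (Rn R n)).
  apply: cap_zero_sub irr0 => z [Wz /= lz]; split.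
    by case: (h z Wz) => // E; move: lz; rewrite E ltxx.
  move=> zreg; have zy : z != y by apply/eqP => zy; apply: yreg; rewrite -zy.
  have : ka (edist z y) <= pot ka nu z.
    apply: (balayage_ge n3 alpha0 alpha2 nuB) => m dm.
    exact: (dominates_regular n3 alpha0 alpha2 zreg zy dm).
  by rewrite leNgt lz.
exists B; split => //; first exact: (cap_zero_Leb n3 alpha0 alpha2 mB cB).
move=> z /= /not_implyP[Wz nz]; split => //=; rewrite ltNge; apply/negP => ge; apply: nz.
have E : pot ka nu z = ka (edist z y) by apply/eqP; rewrite eq_le le_kap ge.
by rewrite /defect /ediff E subrr maxxx.
Qed.

Let null_off z : (~` closure A) z -> exists2 q, (0 < q)%R & nu (eball z q) = 0.
Proof. by move=> Dz; apply: not_msupport_null => /msupport_sub_closure. Qed.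

(** The contact set is relatively open and closed in the connected complement: contact spreads over
    a fraction of any radius within which [nu] vanishes. *)
Lemma touch_complement z0 : (~` closure A) z0 -> pot ka nu z0 = ka (edist z0 y) ->
  forall z, (~` closure A) z -> pot ka nu z = ka (edist z y).
Proof.
move=> Dz0 E0; pose B : set (Rn R n) := (~` closure A) `&` [set z | pot ka nu z = ka (edist z y)].
(* The radius over which contact spreads varies with the point, so the open set is a union of balls
   around points of contact. *)
pose C : set (Rn R n) := [set x' | exists z q, [/\ B z, (0 < q)%R, nu (eball z q) = 0 & (edist z x' < q / 8)%R]].
have spreads := touch_spreads n3 alpha0 alpha2 nuB alphaE.
suff <- : B = ~` closure A by move=> z [].
apply: conD; first by exists z0.
- exists C.
    rewrite openE => x' [z [q [Bz q0 nu0 zx']]].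
    have e0 : (0 < q / 8 - edist z x')%R by lra.
    have nb : nbhs (x' : Rn R n) (eball x' (q / 8 - edist z x')%R : set (Rn R n)).
      by apply: open_nbhs_nbhs; split; [exact: open_eball|rewrite /eball/= edistxx].
    apply: filterS nb => w; rewrite /eball/= => hw; exists z, q; split => //.
    by apply: le_lt_trans (edist_triangle z x' w) _; lra.
  apply/seteqP; split => [z Bz|z [Dz [x [q [[_ E] q0 nu0 xz]]]]].
    split; first exact: Bz.1.
    have [q q0 nu0] := null_off Bz.1; exists z, q; split => //.
    by rewrite edistxx divr_gt0.
  by split; [exact: Dz|exact: (spreads x q q0 nu0 E z xz)].
- exists (closure B); first exact: closed_closure.
  apply/seteqP; split => [z Bz|z [Dz cz]].
    by split; [exact: Bz.1|exact: subset_closure].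
  split; first exact: Dz.
  have [q q0 nu0] := null_off Dz.
  have q2 : (0 < q / 2)%R by rewrite divr_gt0.
  have q16 : (0 < q / 2 / 8)%R by rewrite !divr_gt0.
  (* [z'] is close enough to [z] for its ball of radius [q / 2] to be null and for [z] to lie within
     an eighth of that radius. *)
  have [z' [_ E] zz'] := (closure_eballP B z).1 cz _ q16.
  apply: (spreads z' _ q2 _ E); last by rewrite edistC.
  by apply: null_eball_sub nu0; lra.
Qed.

Lemma msupport_boundary : msupport nu = boundary (~` closure A).
Proof.
have clA : closure (closure A) `<=` closure A by have := @closed_closure _ A; rewrite closure_id => <-.
apply/seteqP; split => x.
  move=> sx; have cx := msupport_sub_closure sx; split; last first.
    by rewrite setCK; exact: subset_closure.
  (* Otherwise a ball about [x] lies in the closure of [A], and the defect vanishes almost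
     everywhere in it; then [nu] is null near [x], or [y] is regular in case [x = y]. *)
  apply: contrapT; rewrite closure_eballP => /existsNP[r /not_implyP[r0 h]].
  have sub z : (edist x z < r)%R -> closure A z.
    by move=> xz; apply: contrapT => nz; apply: h; exists z.
  have loc : {ae L, forall z : T, (edist x (z : 'rV[R]_n) < r)%R -> defect alpha y nu z = 0}.
    by apply: (ae_defect (measurable_eball x r)) => z xz; left; exact: sub.
  have [xy|xy] := eqVneq x y.
    by rewrite xy in loc; apply: yreg; exact: (regular_of_local_defect n3 alpha0 alpha2 nuB alphaE r0 loc).
  have [d d0 nd] := null_of_defect n3 alpha0 alpha2 nuB alphaE r0 xy loc.
  exact: not_msupport nd sx.
move=> [cD]; rewrite setCK => /clA cx.
apply: contrapT => /not_msupport_null[q q0 nu0].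
have q2 : (0 < q / 2)%R by rewrite divr_gt0.
(* [a] and [z] are both taken within [q / 32] of [x], so [z] is within [q / 16] of [a], an eighth of
   the radius [q / 2]; contact thus crosses from the set into the complement. *)
have q32 : (0 < q / 32)%R by rewrite divr_gt0.
have [a xa E] := touch_near cx q0 nu0 q32.
have [z Dz xz] := (closure_eballP _ x).1 cD _ q32.
have nua : nu (eball a (q / 2)%R) = 0 by apply: null_eball_sub nu0; lra.
have Ez : pot ka nu z = ka (edist z y).
  apply: (touch_spreads n3 alpha0 alpha2 nuB alphaE q2 nua E).
  by apply: le_lt_trans (edist_triangle a x z) _; rewrite (edistC a x); lra.
apply: yreg; apply: (regular_of_defect n3 alpha0 alpha2 nuB).
have tot z' : closure A z' \/ pot ka nu z' = ka (edist z' y).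
  have [cz'|nz'] := pselect (closure A z'); [by left|right].
  exact: (touch_complement Dz Ez nz').
by apply: (aeS (ae_defect measurableT (fun z' _ => tot z'))) => z'; exact.
Qed.

End support_of_balayage.

Theorem mainTheorem11 (R : realType) (n : nat) (alpha : R) (A : set (Rn R n)) :
  (3 <= n)%N -> 0 < alpha -> alpha <= 2 ->
  A = reduced_kernel alpha A ->
  (alpha = 2 ->
     cap_zero alpha (irregular_pts alpha A) /\
     (~` closure A) !=set0 /\ connected (~` closure A)) ->
  forall y : Rn R n, ~ regular_pts alpha A y ->
  forall nu : msr R n, is_balayage alpha (dirac_at y) A nu ->
    (alpha < 2 -> msupport nu = closure A) /\
    (alpha = 2 -> msupport nu = boundary (~` closure A)).
Proof.
move=> n3 alpha0 alpha2 hA h2 y yreg nu nuB; split => [al|al].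
  exact: (msupport_closure n3 alpha0 alpha2 hA yreg nuB al).
have [irr0 [_ con]] := h2 al.
exact: (msupport_boundary n3 alpha0 alpha2 hA yreg nuB al irr0 con).
Qed.
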